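(* There exists a positive constant $\Lambda$, independent of the discretisation parameters $h_T$, $k_n$, $p$ and $q$ (but depending on $\|x\|_{L_\infty(\Omega)}$), such that $$\inf_{U\in\mathcal{V}_{h,k}\setminus\{0\}}\ \sup_{V\in\mathcal{V}_{h,k}\setminus\{0\}}\ \frac{B_{\rm st}(U,V)}{|||U|||_{\rm st}\,|||V|||_{\rm st}}\ge\Lambda .$$
   Context: Domain. $\Omega\subset\mathbb{R}^2$ is a bounded Lipschitz polygonal domain with points $(x,y)$ and unit outward normal $n=(n_1,n_2)$ on $\partial\Omega$; $\Gamma_0:=\{(x,y)\in\partial\Omega:n_1\neq0\}$, $\Gamma_-:=\{(x,y)\in\partial\Omega\setminus\Gamma_0:xn_2<0\}$, $\Gamma_+:=\{(x,y)\in\partial\Omega\setminus\Gamma_0:xn_2\ge0\}$; $\Gamma_-$ has positive one-dimensional Hausdorff measure. $I=(0,t_f]$ with $t_f>0$. $(\cdot,\cdot)_\omega$, $\|\cdot\|_\omega$ are the $L_2(\omega)$ inner product and norm, with the subscript dropped for $\omega=\Omega$. Subscripts $x,y,t$ denote partial derivatives. Mesh. $\mathcal{T}_h$ belongs to a family of subdivisions of $\Omega$ into mutually disjoint open triangular or box-type elements $T$ whose closures cover $\bar\Omega$; the family is shape-regular and locally quasi-uniform, with $C_\rho>0$ a uniform constant such that $h_T/h_{T'}\le C_\rho$ for all $T,T'\in\mathcal{T}_h$ sharing a face. $h|_T:=h_T:={\rm diam}(T)$. $\Gamma_{\rm int}:=\big(\bigcup_{T}\partial T\big)\setminus\partial\Omega$.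 On $\partial T$, in terms attached to $T$, $n$ is the unit outward normal of $T$, and $\partial_-T:=\{(x,y)\in\partial T:xn_2<0\}$, $\partial_+T:=\{(x,y)\in\partial T:xn_2\ge0\}$. For each $T$, (almost) every point of $\partial_-T\setminus\Gamma_-$ lies on $\partial_+T'$ for a unique $T'\in\mathcal{T}_h$ (in particular $\partial_-T\cap\partial\Omega\subset\Gamma_-$ up to a null set). On $\partial_-T$, $w^+$ is the trace of $w|_T$, and on $\partial_-T\setminus\Gamma_-$, $w^-$ is the trace of $w|_{T'}$; the upwind jump is $\lfloor w\rfloor:=w^+-w^-$. On an interior face $e=\partial T^i\cap\partial T^j$, $i>j$, $[\![w]\!]:=w|_{T^i}-w|_{T^j}$, $\{\!\{w\}\!\}:=(w|_{T^i}+w|_{T^j})/2$, and in integrals over $\Gamma_{\rm int}$ $n$ is the unit normal outward to $T^i$. Discrete spaces. For $p\ge1$, $\mathcal{V}_h:=\{V\in L_2(\Omega):V|_T\in\mathbb{P}_p(T),\ T\in\mathcal{T}_h\}$ ($\mathbb{P}_p$: total degree at most $p$). $0=t_0<t_1<\dots<t_N=t_f$, $I_n:=(t_{n-1},t_n]$, $k_n:=t_n-t_{n-1}$; for $q\ge0$, $\mathcal{V}_{h,k}:=\{V\in L_2(I;\mathcal{V}_h):V|_{I_n}\text{ is polynomial in }t\text{ of degree at most }q,\ n=1,\dots,N\}$. $V(t_n^\pm)$ are one-sided limits in time, $\lfloor V\rfloor_n:=V(t_n^+)-V(t_n^-)$ denotes the time-jump. Constants. $C_\partial,C_\nabla>0$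 are fixed constants, depending only on the space dimension and on mesh shape-regularity, such that $\|V\|_{\partial T}\le C_\partial p\,h_T^{-1/2}\|V\|_T$, $\|\nabla V\|_T\le C_\nabla p^2h_T^{-1}\|V\|_T$ for all $V\in\mathbb{P}_p(T)$. $N_\partial$ is the number of faces per element, $n_1^F:=\|n_1\|_{L_\infty(F)}$, $\sigma|_F:=64N_\partial(C_\partial n_1^Fp)^2\max_{i=1,2}h_{T_i}^{-1}$ for $F=\partial T_1\cap\partial T_2\subset\Gamma_{\rm int}$. Bilinear forms. $$a_{\rm dG}(U,V):=\sum_T\big((U_x,V_x)_T+(xU_y,V)_T\big)-(\{\!\{n_1U_x\}\!\},[\![V]\!])_{\Gamma_{\rm int}}-(\{\!\{n_1V_x\}\!\},[\![U]\!])_{\Gamma_{\rm int}}+(\sigma[\![U]\!],[\![V]\!])_{\Gamma_{\rm int}}-\sum_T\big((xn_2\lfloor U\rfloor,V^+)_{\partial_-T\cap\Gamma_{\rm int}}+(xn_2U^+,V^+)_{\partial_-T\cap\Gamma_-}\big),$$ $$B_{\rm st}(U,V):=\sum_{n=1}^N\int_{I_n}\big((U_t,V)+a_{\rm dG}(U,V)\big)dt+\sum_{n=2}^N(\lfloor U\rfloor_{n-1},V(t_{n-1}^+))+(U(t_0^+),V(t_0^+)).$$ Parameters. With $\sigma_T:=\max_{F\subset\partial T}\sigma|_F$, $x_{n_2}^T:=\|xn_2\|_{L_\infty(\partial_-T)}$, $$\tau_T:=\frac{h_T^2}{p^4}\Big(\frac{65C_\nabla^2}{6}+\frac{3\sigma_T^2h_T^2}{64p^4}+\frac{(8x_{n_2}^TC_\partial)^2h_T}{3p^2}\Big)^{-1},\qquad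 \tau|_{I_n\times T}=\tau_{T,n}:=\min\Big\{\tau_T,\frac{k_n}{64(q+1)^2}\Big\},$$ $$\delta_{T,n}:=\max\Big\{1,\frac{C_\partial^2p^4}{h_T^2}\max\Big\{4+\frac{C_\nabla^2}{8C_\partial^2},\frac{(x_{n_2}^T)^2h_T}{p^2},\sqrt{\mathcal{R}_{T,n}}\Big\}\Big\},$$ $$\mathcal{R}_{T,n}:=2h_T^2p^{-4}\tau_{T,n}^{-1}+1040N_\partial\big(\max_{F\subset\partial T}n_1^F\,C_\rho C_\partial^{-1}\big)^2+8(C_\nabla C_\partial^{-1}x_{n_2}^T)^2p^{-2}h_T+2h_T^2(q+1)^2p^{-4}k_n^{-1}.$$ $A$ is the matrix, constant on each $I_n\times T$, $A=\begin{pmatrix}\alpha&\beta\\ \beta&\gamma\end{pmatrix}$ with $\alpha=\frac1{8\delta_{T,n}}$, $\beta=\frac1{48\delta_{T,n}^2}$, $\gamma=\frac{10}{48^2\delta_{T,n}^3}$ (positive definite). Norms. $\|w\|_{A,h}^2:=\|w\|^2+(A\nabla_hw,\nabla_hw)$, $\nabla_h$ the element-wise gradient; $$\|w\|_{\rm uw}^2:=\sum_T\Big(\big\|\sqrt{|xn_2|}\,w\big\|^2_{(\partial_-T\cap\Gamma_-)\cup(\partial_+T\cap\partial\Omega)}+\big\|\sqrt{|xn_2|}\lfloor w\rfloor\big\|^2_{\partial_-T\cap\Gamma_{\rm int}}\Big),$$ $$|||w|||^2:=\sum_T\Big(\|\sqrt A\nabla w_x\|_T^2+\tfrac12\|\alpha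 w_y\|_T^2+\tfrac12\|w_x\|_T^2+\tfrac12\|\sqrt\tau(w_t+xw_y)\|_T^2+\|\sqrt{xn_2A}\,\nabla w\|_{\partial_+T}^2\Big)+\|\sqrt\sigma[\![w]\!]\|_{\Gamma_{\rm int}}^2+2\|w\|_{\rm uw}^2$$ (at each fixed $t$), and $$|||w|||_{\rm st}^2:=\tfrac12\Big(\|w(t_N^-)\|_{A,h}^2+\|w(t_0^+)\|_{A,h}^2+\sum_{n=2}^N\|\lfloor w\rfloor_{n-1}\|_{A,h}^2\Big)+\tfrac14\sum_{n=1}^N\int_{I_n}|||w|||^2dt,$$ where $A$ is taken on $I_N$ in the first term, on $I_1$ in the second, and on $I_n$ in the term with $\lfloor w\rfloor_{n-1}$. *)

(* Defs.v *)
From mathcomp Require Import all_boot all_order all_algebra.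
From mathcomp Require Import all_classical all_reals all_analysis.

Set Implicit Arguments.
Unset Strict Implicit.
Unset Printing Implicit Defensive.

Import Order.TTheory GRing.Theory Num.Theory numFieldNormedType.Exports.
Local Open Scope classical_set_scope.
Local Open Scope ring_scope.

(* Plane geometry. A point is z = (x, y) with x = z.1 and y = z.2. The library *)
(* norm on R * R is the max norm, so Euclidean quantities are defined here.    *)
Section Plane.
Context {R : realType}.
Local Notation pt := (R * R)%type.

Definition dot (u v : pt) : R := u.1 * v.1 + u.2 * v.2.
Definition cross (u v : pt) : R := u.1 * v.2 - u.2 * v.1.
Definition enorm (u : pt) : R := Num.sqrt (dot u u).
Definition eball (z : pt) (r : R) : set pt := [set w | enorm (w - z) < r].

(* The added 0 only makes the diameter of the empty set 0. *)
Definition ediam (S : set pt) : \bar R :=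
  ereal_sup ([set 0%E] `|`
             [set e | exists2 z, S z & exists2 w, S w & e = (enorm (z - w))%:E]).

(* One-dimensional Hausdorff (outer) measure. *)
Definition hausdorff1 (S : set pt) : \bar R :=
  ereal_sup [set ereal_inf [set (\sum_(0 <= k <oo) ediam (C k))%E | C in
                             [set C : nat -> set pt |
                               S `<=` \bigcup_k C k /\
                               forall k, (ediam (C k) <= d%:E)%E]]
            | d in [set d : R | 0 < d]].

Definition bd (S : set pt) : set pt := closure S `\` interior S.

Definition point_on (e : pt * pt) (s : R) : pt :=
  (e.1.1 + s * (e.2.1 - e.1.1), e.1.2 + s * (e.2.2 - e.1.2)).
Definition segment (e : pt * pt) : set pt := point_on e @` `[0, 1]%classic.
Definition has_segment (S : set pt) : Prop :=
  exists e : pt * pt, e.1 <> e.2 /\ segment e `<=` S.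

(* Near a boundary point, Omega is one side of a Lipschitz graph over the line *)
(* orthogonal to u.                                                            *)
Definition lipschitz_boundary (Omega : set pt) : Prop :=
  forall z, bd Omega z ->
  exists (u : pt) (L r : R) (g : R -> R),
    [/\ enorm u = 1, 0 < r, forall a b, `|g a - g b| <= L * `|a - b| &
        forall w, eball z r w ->
          (Omega w <-> dot (w - z) u < g (cross u (w - z)))].

Definition polygonal (Omega : set pt) : Prop :=
  exists s : seq (pt * pt),
    bd Omega = [set z | exists2 e, e \in s & segment e z].

Definition polygonal_lipschitz_domain (Omega : set pt) : Prop :=
  [/\ open Omega, connected Omega, (exists r, Omega `<=` eball 0 r),
      polygonal Omega & lipschitz_boundary Omega].

(* Defined at every boundary point that is not a vertex. *)
Definition outward_normal (Omega : set pt) (z n : pt) : Prop :=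
  enorm n = 1 /\
  exists2 r, 0 < r &
    forall w, eball z r w -> (Omega w <-> dot (w - z) n < 0).

Definition Gamma0 (Omega : set pt) : set pt :=
  [set z | bd Omega z /\ exists2 n, outward_normal Omega z n & n.1 != 0].

Definition Gamma_minus (Omega : set pt) : set pt :=
  [set z | (bd Omega `\` Gamma0 Omega) z /\
           exists2 n, outward_normal Omega z n & z.1 * n.2 < 0].

Definition leb2 : set pt -> \bar R :=
  (@lebesgue_measure R \x @lebesgue_measure R)%E.

(* Elements are given by their vertices in counterclockwise order. *)
Definition polygon := seq pt.

Definition edges (c : polygon) : seq (pt * pt) := zip c (rot 1 c).

(* Clockwise quarter turn of the unit tangent: outward for a counterclockwise  *)
(* polygon.                                                                    *)
Definition normal (e : pt * pt) : pt :=
  ((e.2.2 - e.1.2) / enorm (e.2 - e.1), - (e.2.1 - e.1.1) / enorm (e.2 - e.1)).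

Definition is_triangle (c : polygon) : Prop :=
  exists a b d : pt, c = [:: a; b; d] /\ 0 < cross (b - a) (d - a).

(* Affine images of the unit square. *)
Definition is_box (c : polygon) : Prop :=
  exists a u v : pt, c = [:: a; a + u; a + u + v; a + v] /\ 0 < cross u v.

(* The open convex polygon with vertices c. *)
Definition cell (c : polygon) : set pt :=
  [set z | forall e, e \in edges c -> 0 < cross (e.2 - e.1) (z - e.1)].

Definition hdiam (c : polygon) : R := fine (ediam (cell c)).

Definition bd_minus (c : polygon) : set pt :=
  [set z | exists e, [/\ e \in edges c, segment e z & z.1 * (normal e).2 < 0]].
Definition bd_plus (c : polygon) : set pt :=
  [set z | exists e, [/\ e \in edges c, segment e z & 0 <= z.1 * (normal e).2]].

(* Arc-length integral over S `&` bd (cell c); f receives the outward normal   *)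
(* of the cell and the point.                                                  *)
Definition bd_int (c : polygon) (S : set pt) (f : pt -> pt -> R) : R :=
  \sum_(e <- edges c) enorm (e.2 - e.1) *
    (\int[@lebesgue_measure R]_(s in `[0, 1]%classic `&` point_on e @^-1` S)
       f (normal e) (point_on e s)).

(* Essential supremum of |f| over S `&` bd (cell c), 0 on null sets. *)
Definition bd_Linf (c : polygon) (S : set pt) (f : pt -> pt -> R) : R :=
  inf [set K : R | 0 <= K /\
    forall e, e \in edges c ->
      {ae @lebesgue_measure R, forall s, 0 <= s <= 1 -> S (point_on e s) ->
         `|f (normal e) (point_on e s)| <= K}].

Definition d_x (w : pt -> R) (z : pt) : R := derive1 (fun s : R => w (s, z.2)) z.1.
Definition d_y (w : pt -> R) (z : pt) : R := derive1 (fun s : R => w (z.1, s)) z.2.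
Definition grad (w : pt -> R) (z : pt) : pt := (d_x w z, d_y w z).

Definition is_Pp (p : nat) (w : pt -> R) : Prop :=
  exists c : nat -> nat -> R, forall z,
    w z = \sum_(i < p.+1) \sum_(j < p.+1 | (i + j <= p)%N)
            c i j * z.1 ^+ i * z.2 ^+ j.

End Plane.

Section Mesh.
Context {R : realType}.
Local Notation pt := (R * R)%type.

Definition mesh := seq (@polygon R).

Variables (Omega : set pt) (M : mesh).

Definition vert (i : 'I_(size M)) : polygon := nth [::] M i.
Definition elt (i : 'I_(size M)) : set pt := cell (vert i).
Definition h (i : 'I_(size M)) : R := hdiam (vert i).

(* The faces of elt i are the bd (elt i) `&` bd (elt j) with shares_face i j   *)
(* and the segment e `&` bd Omega with bd_face e, for e an edge of elt i;      *)
(* hanging nodes are allowed.                                                  *)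
Definition face (i j : 'I_(size M)) : set pt := bd (elt i) `&` bd (elt j).
Definition shares_face (i j : 'I_(size M)) : Prop :=
  i != j /\ has_segment (face i j).
Definition bd_face (e : pt * pt) : Prop :=
  has_segment (segment e `&` bd Omega).

Definition num_faces (i : 'I_(size M)) : nat :=
  (#|[pred j | `[< shares_face i j >]]| +
   count (fun e => `[< bd_face e >]) (edges (vert i)))%N.
Definition N_bd : nat := \max_(i < size M) num_faces i.

Definition Gamma_int : set pt :=
  (\bigcup_(i in [set: 'I_(size M)]) bd (elt i)) `\` bd Omega.

Definition subdivision : Prop :=
  [/\ forall i, is_triangle (vert i) \/ is_box (vert i),
      forall i j, i != j -> elt i `&` elt j = set0,
      forall i, elt i `<=` Omega &
      closure Omega `<=` \bigcup_(i in [set: 'I_(size M)]) closure (elt i)].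

Definition shape_regular (Csr : R) : Prop :=
  forall i, exists z r, [/\ 0 < r, eball z r `<=` elt i & h i <= Csr * r].

Definition locally_quasi_uniform (Crho : R) : Prop :=
  forall i j, shares_face i j -> h i / h j <= Crho.

Definition upwind_neighbours : Prop :=
  forall i e, e \in edges (vert i) ->
    {ae @lebesgue_measure R, forall s, 0 <= s <= 1 ->
       bd_minus (vert i) (point_on e s) ->
       (~ Gamma_minus Omega (point_on e s) ->
          exists! j, bd_plus (vert j) (point_on e s)) /\
       (bd Omega (point_on e s) -> Gamma_minus Omega (point_on e s))}.

Definition inverse_estimates (Cd Cn : R) : Prop :=
  forall i (p : nat) (w : pt -> R), (0 < p)%N -> is_Pp p w ->
    Num.sqrt (bd_int (vert i) setT (fun _ z => w z ^+ 2)) <=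
      Cd * p%:R * (Num.sqrt (h i))^-1 *
      Num.sqrt (\int[leb2]_(z in elt i) (w z ^+ 2)) /\
    Num.sqrt (\int[leb2]_(z in elt i) (dot (grad w z) (grad w z))) <=
      Cn * p%:R ^+ 2 * (h i)^-1 *
      Num.sqrt (\int[leb2]_(z in elt i) (w z ^+ 2)).

Definition admissible_mesh (Csr Crho Cd Cn : R) : Prop :=
  [/\ subdivision, shape_regular Csr, locally_quasi_uniform Crho,
      upwind_neighbours & inverse_estimates Cd Cn].

(* A function with w|_T in P_p(T) for each T is given by the polynomials       *)
(* w i : R^2 -> R, i.e. by its restrictions to the elements, extended to the   *)
(* plane; the trace from elt i is then the value of w i.                       *)
Definition broken := 'I_(size M) -> pt -> R.

(* Almost everywhere on bd_minus (vert i) `\` Gamma_minus, the sum has exactly *)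
(* one term, namely the trace w^- from the upwind neighbour.                   *)
Definition upwind_trace (w : broken) (z : pt) : R :=
  \sum_(j < size M | `[< bd_plus (vert j) z >]) w j z.
Definition upwind_jump (w : broken) (i : 'I_(size M)) (z : pt) : R :=
  w i z - upwind_trace w z.

Definition jump (w : broken) (i j : 'I_(size M)) (z : pt) : R := w i z - w j z.
Definition avg (w : broken) (i j : 'I_(size M)) (z : pt) : R :=
  (w i z + w j z) / 2.
Definition b_x (w : broken) : broken := fun i => d_x (w i).

(* f i j n z is the integrand on the face between elt i and elt j, j < i, with *)
(* n outward to elt i.                                                         *)
Definition Gamma_int_integral
    (f : 'I_(size M) -> 'I_(size M) -> pt -> pt -> R) : R :=
  \sum_(i < size M) \sum_(j < size M | (j < i)%N)
    bd_int (vert i) (face i j `&` Gamma_int) (f i j).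

Definition ip (v w : broken) : R :=
  \sum_(i < size M) \int[leb2]_(z in elt i) (v i z * w i z).

End Mesh.

Section Method.
Context {R : realType}.
Local Notation pt := (R * R)%type.

Variables (Omega : set pt) (M : @mesh R) (Crho Cd Cn : R).
Variables (p q N : nat) (t : nat -> R).

Local Notation I := 'I_(size M).
Local Notation pR := (p%:R : R).

Definition time_partition (tf : R) : Prop :=
  [/\ (0 < N)%N, t 0%N = 0, t N = tf & forall n, (n < N)%N -> t n < t n.+1].

(* Slabs are numbered 1, ..., N. *)
Definition I_ (n : nat) : set R := `]t n.-1, t n]%classic.
Definition k_ (n : nat) : R := t n - t n.-1.

Definition n1F (i : I) (F : set pt) : R :=
  bd_Linf (vert i) F (fun n _ => n.1).

Definition max_n1F (i : I) : R :=
  Num.max (\big[Num.max/0]_(j < size M | `[< shares_face i j >])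
             n1F i (face i j))
          (\big[Num.max/0]_(e <- edges (vert i) | `[< bd_face Omega e >])
             n1F i (segment e `&` bd Omega)).

Definition sigma (i j : I) : R :=
  64 * (N_bd Omega M)%:R * (Cd * n1F i (face i j) * pR) ^+ 2 *
  Num.max (h i)^-1 (h j)^-1.

Definition sigma_T (i : I) : R :=
  \big[Num.max/0]_(j < size M | `[< shares_face i j >]) sigma i j.

Definition xn2_T (i : I) : R :=
  bd_Linf (vert i) (bd_minus (vert i)) (fun n z => z.1 * n.2).

Definition tau_T (i : I) : R :=
  h i ^+ 2 / pR ^+ 4 *
  (65 * Cn ^+ 2 / 6 + 3 * sigma_T i ^+ 2 * h i ^+ 2 / (64 * pR ^+ 4)
   + (8 * xn2_T i * Cd) ^+ 2 * h i / (3 * pR ^+ 2))^-1.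

Definition tau (n : nat) (i : I) : R :=
  Num.min (tau_T i) (k_ n / (64 * (q.+1)%:R ^+ 2)).

Definition calR (n : nat) (i : I) : R :=
  2 * h i ^+ 2 / pR ^+ 4 / tau n i
  + 1040 * (N_bd Omega M)%:R * (max_n1F i * Crho / Cd) ^+ 2
  + 8 * (Cn / Cd * xn2_T i) ^+ 2 / pR ^+ 2 * h i
  + 2 * h i ^+ 2 * (q.+1)%:R ^+ 2 / pR ^+ 4 / k_ n.

Definition delta (n : nat) (i : I) : R :=
  Num.max 1
    (Cd ^+ 2 * pR ^+ 4 / h i ^+ 2 *
     Num.max (4 + Cn ^+ 2 / (8 * Cd ^+ 2))
       (Num.max (xn2_T i ^+ 2 * h i / pR ^+ 2) (Num.sqrt (calR n i)))).

Definition alpha (n : nat) (i : I) : R := 1 / (8 * delta n i).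
Definition beta (n : nat) (i : I) : R := 1 / (48 * delta n i ^+ 2).
Definition gamma (n : nat) (i : I) : R := 10 / (48 ^+ 2 * delta n i ^+ 3).

Definition A_mul (n : nat) (i : I) (v : pt) : pt :=
  (alpha n i * v.1 + beta n i * v.2, beta n i * v.1 + gamma n i * v.2).

(* (A v) . v = |sqrt(A) v|^2 *)
Definition A_sq (n : nat) (i : I) (v : pt) : R := dot (A_mul n i v) v.

Definition a_dG (U V : broken M) : R :=
  \sum_(i < size M)
    ((\int[leb2]_(z in elt i) (d_x (U i) z * d_x (V i) z))
     + \int[leb2]_(z in elt i) (z.1 * d_y (U i) z * V i z))
  - Gamma_int_integral Omega
      (fun i j n z => n.1 * avg (b_x U) i j z * jump V i j z)
  - Gamma_int_integral Omega
      (fun i j n z => n.1 * avg (b_x V) i j z * jump U i j z)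
  + Gamma_int_integral Omega
      (fun i j n z => sigma i j * jump U i j z * jump V i j z)
  - \sum_(i < size M)
      (bd_int (vert i) (bd_minus (vert i) `&` Gamma_int Omega M)
         (fun n z => z.1 * n.2 * upwind_jump U i z * V i z)
       + bd_int (vert i) (bd_minus (vert i) `&` Gamma_minus Omega)
           (fun n z => z.1 * n.2 * U i z * V i z)).

Definition norm_Ah_sq (n : nat) (w : broken M) : R :=
  \sum_(i < size M)
    ((\int[leb2]_(z in elt i) (w i z ^+ 2))
     + \int[leb2]_(z in elt i) (A_sq n i (grad (w i) z))).

Definition norm_uw_sq (w : broken M) : R :=
  \sum_(i < size M)
    (bd_int (vert i)
       ((bd_minus (vert i) `&` Gamma_minus Omega) `|`
        (bd_plus (vert i) `&` bd Omega))
       (fun n z => `|z.1 * n.2| * w i z ^+ 2)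
     + bd_int (vert i) (bd_minus (vert i) `&` Gamma_int Omega M)
         (fun n z => `|z.1 * n.2| * upwind_jump w i z ^+ 2)).

(* Space-time functions: U n i s z is the polynomial on slab n and element i   *)
(* at time s; the one-sided limits at t_(n-1)^+ and t_n^- are its values at    *)
(* t n.-1 and t n. Only the slabs 1 <= n <= N are meaningful.                  *)
Definition st_fun := nat -> I -> R -> pt -> R.

Definition slice (U : st_fun) (n : nat) (s : R) : broken M :=
  fun i z => U n i s z.
Definition slice_t (U : st_fun) (n : nat) (s : R) : broken M :=
  fun i z => derive1 (fun r : R => U n i r z) s.
Definition time_jump (U : st_fun) (n : nat) : broken M :=
  fun i z => U n.+1 i (t n) z - U n i (t n) z.

Definition V_hk : set st_fun :=
  [set U | forall n i, (1 <= n <= N)%N ->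
     exists2 phi : nat -> pt -> R, (forall l, is_Pp p (phi l)) &
       forall s z, U n i s z = \sum_(l < q.+1) s ^+ l * phi l z].

Definition st_zero : set st_fun :=
  [set U | forall n i s z, (1 <= n <= N)%N -> U n i s z = 0].

Definition B_st (U V : st_fun) : R :=
  \sum_(1 <= n < N.+1)
    (\int[@lebesgue_measure R]_(s in I_ n)
       (ip (slice_t U n s) (slice V n s) + a_dG (slice U n s) (slice V n s)))
  + \sum_(2 <= n < N.+1) ip (time_jump U n.-1) (slice V n (t n.-1))
  + ip (slice U 1%N (t 0%N)) (slice V 1%N (t 0%N)).

(* |||w(s)|||^2 at a time s of slab n. *)
Definition norm_sq (U : st_fun) (n : nat) (s : R) : R :=
  let w := slice U n s in
  let w_t := slice_t U n s in
  \sum_(i < size M)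
    ((\int[leb2]_(z in elt i) (A_sq n i (grad (d_x (w i)) z)))
     + 1 / 2 * (\int[leb2]_(z in elt i) ((alpha n i * d_y (w i) z) ^+ 2))
     + 1 / 2 * (\int[leb2]_(z in elt i) (d_x (w i) z ^+ 2))
     + 1 / 2 * (\int[leb2]_(z in elt i)
                  (tau n i * (w_t i z + z.1 * d_y (w i) z) ^+ 2))
     + bd_int (vert i) (bd_plus (vert i))
         (fun nu z => z.1 * nu.2 * A_sq n i (grad (w i) z)))
  + Gamma_int_integral Omega (fun i j _ z => sigma i j * jump w i j z ^+ 2)
  + 2 * norm_uw_sq w.

Definition norm_st (U : st_fun) : R :=
  Num.sqrt
    (1 / 2 * (norm_Ah_sq N (slice U N (t N)) + norm_Ah_sq 1%N (slice U 1%N (t 0%N))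
              + \sum_(2 <= n < N.+1) norm_Ah_sq n (time_jump U n.-1))
     + 1 / 4 * \sum_(1 <= n < N.+1)
                 \int[@lebesgue_measure R]_(s in I_ n) norm_sq U n s).

Definition inf_sup : \bar R :=
  ereal_inf [set ereal_sup [set (B_st U V / (norm_st U * norm_st V))%:E
                           | V in V_hk `\` st_zero]
            | U in V_hk `\` st_zero].

End Method.

(* Main.v *)
(** Test with V = K c_n U + tau (U_t + x U_y), where the weight c_n is constant on each slab and decreases with n.
The part a_dG(U, U) controls U_x, the penalty and the upwind jumps; the tau-part controls W = U_t + x U_y; the
decrease of c_n lets summation by parts control the end-of-slab energies. The term with A in the norm, in which U_y
is the only part not yet controlled, is recovered from the hypocoercive identity
  U_y^2 = W_x U_y + W_y U_x - (U_x U_y)_t - x (U_x U_y)_y,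
integrated over each element and slab, together with inverse estimates in space and time. On discrete functions all
forms are built from positive linear functionals of polynomials in (x, y), and are polynomial in t, so that the
estimates reduce to pointwise polynomial inequalities; the time inverse estimates come from the Legendre operator. *)

Require Import Defs.
From HB Require Import structures.
From mathcomp Require Import all_boot all_order all_algebra.
From mathcomp Require Import all_classical all_reals all_analysis measurable_realfun.
From mathcomp Require Import ring lra.

Import Order.TTheory GRing.Theory Num.Theory numFieldNormedType.Exports.
Local Open Scope classical_set_scope.
Local Open Scope ring_scope.

Set Implicit Arguments.
Unset Strict Implicit.
Unset Printing Implicit Defensive.

(** No term with A is put into the test function. The A-part of the norm is bounded afterwards by
    energies that the test has already produced. The price is paid in time: the identity for U_y^2
    leaves U_x U_y at both ends of every slab, whereas testing with U alone controls only the first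
    and last values and the jumps. This is what forces the weight to decrease. The losses close
    because all parameters live on the scale p^2/h: tau p^4/h^2 is bounded, beta p^4/h^2 is at most
    a multiple of tau, and tau is at most k_n. The end terms therefore carry a factor k_n, and their
    sum over the slabs costs only a multiple of t_f. Everything is compared with one energy e of the
    trial function: the form is at least e/4 and both squared norms are at most C e, which gives the
    bound 1/(4C). As a quotient by zero is 0, both norms have to be shown positive. *)

(** * Univariate polynomials: formal antiderivatives and their integrals *)

Section FormalIntegral.
Context {R : realType}.
Implicit Types (p u v : {poly R}) (a b c : R).

Definition poly_evalE := (hornerD, hornerN, hornerZ, hornerM, horner_exp, hornerC, hornerX).

(** At index 0 the quotient is by zero, hence 0 by convention: the antiderivative has no constant
    term. *)
Definition antid p : {poly R} := \poly_(i < (size p).+1) (p`_i.-1 / i%:R).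

Lemma coef_antid p i : (antid p)`_i = p`_i.-1 / i%:R.
Proof.
rewrite coef_poly; case: ltnP => // hi.
by rewrite nth_default ?mul0r//; case: i hi.
Qed.

Lemma deriv_antid p : (antid p)^`() = p.
Proof.
apply/polyP => i; rewrite coef_deriv coef_antid -[RHS](@divfK _ i.+1%:R) ?pnatr_eq0//.
by rewrite mulr_natr.
Qed.

Lemma antid_deriv p : antid p^`() = p - (p`_0)%:P.
Proof.
apply/polyP => i; rewrite coef_antid coef_deriv coefB coefC.
case: i => [|i]; first by rewrite invr0 mulr0 subrr.
by rewrite /= subr0 -(mulr_natr p`_i.+1) mulfK// pnatr_eq0.
Qed.

Lemma antid_is_linear : linear antid.
Proof.
move=> c p v; apply/polyP => i.
by rewrite coefD coefZ !coef_antid coefD coefZ mulrDl mulrA.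
Qed.

(** The definite integral taken formally, so that linearity and the fundamental theorem are algebra
    without integrability conditions; [TI_horner] links it to the Lebesgue integral. *)
Definition pint a b p := (antid p).[b] - (antid p).[a].

Lemma pint_linear a b c p v : pint a b (c *: p + v) = c * pint a b p + pint a b v.
Proof. rewrite /pint antid_is_linear !poly_evalE; ring. Qed.

Lemma pint0 a b : pint a b 0 = 0.
Proof.
have := pint_linear a b 1 0 0; rewrite scaler0 addr0 mul1r; lra.
Qed.

Lemma pintD a b p v : pint a b (p + v) = pint a b p + pint a b v.
Proof. by have := pint_linear a b 1 p v; rewrite scale1r mul1r. Qed.

Lemma pintZ a b c p : pint a b (c *: p) = c * pint a b p.
Proof. by rewrite -[c *: p]addr0 pint_linear pint0 addr0. Qed.

Lemma pintN a b p : pint a b (- p) = - pint a b p.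
Proof. by rewrite -scaleN1r pintZ mulN1r. Qed.

Lemma pintB a b p v : pint a b (p - v) = pint a b p - pint a b v.
Proof. by rewrite pintD pintN. Qed.

Lemma pint_deriv a b p : pint a b p^`() = p.[b] - p.[a].
Proof. rewrite /pint antid_deriv !hornerE; ring. Qed.

Lemma derive1_horner p : derive1 (horner p) = horner p^`().
Proof.
apply/funext => x; rewrite derive1E.
exact: (@derive_val _ _ _ x 1 (horner p) _ (is_derive_poly p x)).
Qed.

Lemma continuous_hornerR p : continuous (horner p).
Proof.
move=> x; apply/differentiable_continuous/derivable1_diffP.
exact: (@ex_derive _ _ _ x 1 (horner p) _ (is_derive_poly p x)).
Qed.

Definition TI a b (f : R -> R) : R :=
  \int[@lebesgue_measure R]_(s in `]a, b]%classic) f s.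

Lemma TI_horner a b p : a < b -> TI a b (horner p) = pint a b p.
Proof.
move=> ab; rewrite /TI Rintegral_itv_obnd_cbnd; last first.
  apply: (@integrableS _ _ _ (@lebesgue_measure R) `[a, b]%classic) => //.
    by apply: subset_itvr; rewrite bnd_simp.
  apply: continuous_compact_integrable; first exact: segment_compact.
  by apply: continuous_subspaceT; exact: continuous_hornerR.
rewrite /Rintegral (@continuous_FTC2 _ _ (horner (antid p)))//.
- by apply: continuous_subspaceT; exact: continuous_hornerR.
- split.
  + move=> x _; apply: (@ex_derive _ _ _ x 1 (horner _)).
  + by apply: cvg_at_right_filter; exact: continuous_hornerR.
  + by apply: cvg_at_left_filter; exact: continuous_hornerR.
- by move=> x _; rewrite derive1_horner deriv_antid.
Qed.

Lemma pint_ge0 a b p : a <= b -> (forall x, a <= x <= b -> 0 <= p.[x]) ->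
  0 <= pint a b p.
Proof.
rewrite le_eqVlt => /predU1P[->|ab] hp; first by rewrite /pint subrr.
rewrite -TI_horner//; apply: Rintegral_ge0 => x /=; rewrite in_itv /= => /andP[ax xb].
by apply: hp; rewrite (ltW ax).
Qed.

Lemma pint_le a b p v : a <= b -> (forall x, a <= x <= b -> p.[x] <= v.[x]) ->
  pint a b p <= pint a b v.
Proof.
move=> ab h; rewrite -subr_ge0 -pintB; apply: pint_ge0 => // x /h.
by rewrite !poly_evalE subr_ge0.
Qed.

Lemma pint_sqr_ge0 a b p : a <= b -> 0 <= pint a b (p ^+ 2).
Proof. by move=> ab; apply: pint_ge0 => // x _; rewrite horner_exp sqr_ge0. Qed.

Lemma poly_eq0_itv a b p : a < b -> (forall x, a < x < b -> p.[x] = 0) -> p = 0.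
Proof.
move=> ab h; apply/eqP/negPn/negP => p0.
(* These [size p] distinct interior points would be one root more than a nonzero polynomial can
   have. *)
pose s := [seq a + (b - a) * (i.+1%:R / (size p).+1%:R) | i <- iota 0 (size p)].
suff [h1 h2] : all (root p) s /\ uniq s.
  by have := max_poly_roots p0 h1 h2; rewrite size_map size_iota ltnn.
split.
- apply/allP => _ /mapP[i + ->]; rewrite mem_iota add0n /= => hi.
  apply/eqP/h; have hn : (0 : R) < (size p).+1%:R by rewrite ltr0n.
  have h1 : 0 < (i.+1%:R / (size p).+1%:R : R) by rewrite divr_gt0// ltr0n.
  have h2 : (i.+1%:R / (size p).+1%:R : R) < 1 by rewrite ltr_pdivrMr// mul1r ltr_nat.
  rewrite ltrDl mulr_gt0 ?subr_gt0//=.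
  by rewrite -ltrBrDl gtr_pMr ?subr_gt0.
- rewrite map_inj_uniq ?iota_uniq// => i j /addrI /(mulfI _) h1.
  have /h1 /mulIf h2 : b - a != 0 by rewrite subr_eq0 gt_eqF.
  have /eqP : (i.+1%:R : R) = j.+1%:R by apply: h2; rewrite invr_eq0 pnatr_eq0.
  by rewrite eqr_nat => /eqP[].
Qed.

(** The primitive that vanishes at [a] is nondecreasing and returns to 0 at [b]. It is therefore the
    zero polynomial, and so is its derivative [p ^+ 2]. *)
Lemma pint_sqr_eq0 a b p : a < b -> pint a b (p ^+ 2) = 0 -> p = 0.
Proof.
move=> ab h0; apply/eqP; rewrite -sqrf_eq0 -(deriv_antid (p ^+ 2)).
suff : antid (p ^+ 2) - (antid (p ^+ 2)).[a]%:P = 0.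
  by move/eqP; rewrite subr_eq0 => /eqP ->; rewrite derivC.
apply: (poly_eq0_itv ab) => x /andP[ax xb]; rewrite !poly_evalE.
have h1 := pint_sqr_ge0 p (ltW ax); have h2 := pint_sqr_ge0 p (ltW xb).
by move: h0 h1 h2; rewrite /pint; lra.
Qed.

End FormalIntegral.

(** * Inverse estimates in time from the Legendre operator *)

Section TimeInverse.
Context {R : realType}.
Variables (a b : R).
Hypothesis ab : a < b.
Local Notation "<< p , v >>" := (pint a b (p * v)).
Implicit Types (e p u v : {poly R}).

Lemma size_le_split m p : (size p <= m.+1)%N ->
  exists c u, (size u <= m)%N /\ p = c *: 'X^m + u.
Proof.
move=> hp; exists p`_m, (p - p`_m *: 'X^m); split; last by rewrite addrC subrK.
apply/leq_sizeP => j; rewrite leq_eqVlt => /predU1P[<-|hj].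
  by rewrite coefB coefZ coefXn eqxx mulr1 subrr.
by rewrite coefB coefZ coefXn gtn_eqF// mulr0 subr0 nth_default// (leq_trans hp).
Qed.

(** Gram-Schmidt on the degree. In the inductive step [e] is, up to scale, the Legendre polynomial
    of degree [m] on the interval; its existence suffices and no formula for it is needed. *)
Lemma orthogonal_projection m p : exists2 v : {poly R}, (size v <= m)%N &
  forall u : {poly R}, (size u <= m)%N -> <<p - v, u>> = 0.
Proof.
elim: m p => [|m IH] p.
  exists 0; first by rewrite size_poly0.
  by move=> u; rewrite leqn0 size_poly_eq0 => /eqP ->; rewrite mulr0 pint0.
have [v hv vP] := IH p; have [w hw wP] := IH 'X^m.
pose e := 'X^m - w.
have se : (size e <= m.+1)%N.
  by rewrite (leq_trans (size_polyD _ _))// geq_max size_polyXn leqnn size_polyN ltnW.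
have e2 : pint a b (e ^+ 2) != 0.
  apply/eqP => /(pint_sqr_eq0 ab) /eqP; rewrite subr_eq0 => /eqP h.
  by move: hw; rewrite -h size_polyXn ltnn.
pose c := <<p - v, e>> / pint a b (e ^+ 2).
exists (v + c *: e).
  rewrite (leq_trans (size_polyD _ _))// geq_max (leq_trans hv)//=.
  exact: leq_trans (size_scale_leq _ _) se.
move=> u /size_le_split[d [u' [hu' ->]]].
have -> : d *: 'X^m + u' = d *: e + (u' + d *: w) by rewrite scalerBr; ring.
have hz : (size (u' + d *: w)%R <= m)%N.
  by rewrite (leq_trans (size_polyD _ _))// geq_max hu'/= (leq_trans (size_scale_leq _ _)).
have -> : (p - (v + c *: e)) * (d *: e + (u' + d *: w)) =
   d *: ((p - v) * e - c *: e ^+ 2) + (p - v) * (u' + d *: w) - c *: (e * (u' + d *: w)).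
  rewrite -!mul_polyC; ring.
have eP (z : {poly R}) : (size z <= m)%N -> << e, z >> = 0 by exact: wP.
rewrite pintB pintD !pintZ pintB pintZ (vP _ hz) (eP _ hz) /c divfK//; ring.
Qed.

Let rho : {poly R} := ('X - a%:P) * (b%:P - 'X).
(** The Sturm-Liouville operator of the Legendre polynomials, moved to [[a, b]]. Its weight [rho]
    vanishes at both ends, so integration by parts leaves no boundary terms. *)
Definition legendre_op v := (rho * v^`())^`().

Let dE := (derivM, derivD, derivN, derivZ, derivC, derivX).

Lemma legendre_op_sym p v : <<legendre_op p, v>> = <<p, legendre_op v>>.
Proof.
apply/eqP; rewrite -subr_eq0 -pintB.
have -> : legendre_op p * v - p * legendre_op v = (rho * (p^`() * v - p * v^`()))^`().
  rewrite /legendre_op !dE; ring.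
by rewrite pint_deriv /rho !poly_evalE; apply/eqP; ring.
Qed.

Lemma legendre_opD c p v : legendre_op (c *: p + v) = c *: legendre_op p + legendre_op v.
Proof.
rewrite /legendre_op /rho !dE -!mul_polyC; ring.
Qed.

Lemma coef_legendre_op v m : (size v <= m.+1)%N ->
  (size (legendre_op v) <= m.+1)%N /\ (legendre_op v)`_m = - (m * m.+1)%:R * v`_m.
Proof.
move=> hv.
have E : legendre_op v = (a + b)%:P * v^`() - 2 *: ('X * v^`())
    - (a * b)%:P * v^`()^`() + (a + b)%:P * ('X * v^`()^`()) - 'X * ('X * v^`()^`()).
  rewrite /legendre_op /rho !dE polyCM !polyCD -!mul_polyC polyC_natr; ring.
have C j : (m <= j)%N -> (legendre_op v)`_j = - (j * j.+1)%:R * v`_j.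
  move=> hj.
  have z i : (j < i)%N -> v`_i = 0.
    by move=> ji; rewrite nth_default// (leq_trans hv)// (leq_ltn_trans hj).
  rewrite E natrM !(coefB, coefD) coefZ !coefCM !coefXM.
  case: j hj z => [|j] hj z /=.
  rewrite !coef_deriv (z 1%N)// (z 2%N)//; ring.
rewrite !coef_deriv (z j.+2)// (z j.+3)//; case: j hj z => [|j] hj z /=; first ring.
ring.
split; last exact: C.
apply/leq_sizeP => j hj; rewrite C ?(ltnW hj)//.
by rewrite nth_default ?mulr0// (leq_trans hv).
Qed.

Lemma size_legendre_op_le v m : (size v <= m)%N -> (size (legendre_op v) <= m)%N.
Proof.
case: m => [|m]; last by move=> /coef_legendre_op[].
rewrite !leqn0 !size_poly_eq0 => /eqP ->.
by rewrite /legendre_op deriv0 mulr0 deriv0.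
Qed.

(** A spectral bound: the operator is symmetric and preserves the degree, so its eigenvectors are
    the Legendre polynomials, with eigenvalues [- (k * k.+1)]. For size at most [m] the largest
    modulus is at [k = m.-1]. The induction splits off one eigenvector at a time. *)
Lemma legendre_op_bound m v : (size v <= m)%N ->
  pint a b (legendre_op v ^+ 2) <= (m.-1 * m)%:R ^+ 2 * pint a b (v ^+ 2).
Proof.
elim: m v => [|m IH] v.
  rewrite leqn0 size_poly_eq0 => /eqP ->.
  by rewrite /legendre_op deriv0 mulr0 deriv0 expr0n /= pint0 mulr0.
move=> /size_le_split[c [u0 [hu0 ->]]].
have [w hw wP] := orthogonal_projection m 'X^m.
pose e := 'X^m - w; pose u := u0 + c *: w.
have -> : c *: 'X^m + u0 = c *: e + u by rewrite /e /u scalerBr; ring.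
have hu : (size u <= m)%N.
  by rewrite (leq_trans (size_polyD _ _))// geq_max hu0 (leq_trans (size_scale_leq _ _)).
have se : (size e <= m.+1)%N.
  by rewrite (leq_trans (size_polyD _ _))// geq_max size_polyXn leqnn size_polyN ltnW.
pose l : R := - (m * m.+1)%:R.
have [sDe De] := coef_legendre_op se.
have DeE : legendre_op e = l *: e.
  have hr : (size (legendre_op e - l *: e)%R <= m)%N.
    apply/leq_sizeP => j; rewrite leq_eqVlt => /predU1P[<-|hj].
      by rewrite coefB coefZ De subrr.
    rewrite coefB coefZ !nth_default ?mulr0 ?subrr//.
      exact: leq_trans se _.
    exact: leq_trans sDe _.
  (* The residual has degree below [m] and is orthogonal to all such polynomials: [e] is by
     construction, [legendre_op e] by symmetry. Hence it is orthogonal to itself. *)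
  apply/eqP; rewrite -subr_eq0; apply/eqP; apply: (pint_sqr_eq0 ab).
  rewrite expr2 {1}mulrBl pintB -scalerAl pintZ wP// mulr0 subr0 legendre_op_sym wP//.
  exact: size_legendre_op_le.
have D0 : pint a b (e * u) = 0 by exact: wP.
have hDu := size_legendre_op_le hu.
have D1 : pint a b (e * legendre_op u) = 0 by exact: wP.
have -> : (legendre_op (c *: e + u)) ^+ 2 = (c * l) ^+ 2 *: e ^+ 2
    + (2 * c * l) *: (e * legendre_op u) + (legendre_op u) ^+ 2.
  rewrite legendre_opD DeE !expr2 -!mul_polyC !polyCM; ring.
have -> : (c *: e + u) ^+ 2 = c ^+ 2 *: e ^+ 2 + (2 * c) *: (e * u) + u ^+ 2.
  rewrite !expr2 -!mul_polyC !polyCM; ring.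
rewrite !pintD !pintZ D0 D1 !mulr0 !addr0 /=.
have u0' := pint_sqr_ge0 u (ltW ab).
have hz : pint a b (legendre_op u ^+ 2) <= l ^+ 2 * pint a b (u ^+ 2).
  apply: le_trans (IH _ hu) _; rewrite /l sqrrN ler_wpM2r//.
  rewrite ler_sqr ?nnegrE// ler_nat.
  by case: (m) => // k; rewrite leq_mul.
have -> : ((m * m.+1)%:R : R) = - l by rewrite /l opprK.
have -> : (- l) ^+ 2 * (c ^+ 2 * pint a b (e ^+ 2) + pint a b (u ^+ 2)) =
   (c * l) ^+ 2 * pint a b (e ^+ 2) + l ^+ 2 * pint a b (u ^+ 2) by ring.
by rewrite lerD2l.
Qed.

(** A Hardy-type inequality. Since [rho'^2 + 4 rho = (b - a)^2], the difference of the two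
    integrands is a square plus the derivative of a polynomial that vanishes at both ends. *)
Lemma hardy_legendre v :
  (b - a) ^+ 2 * pint a b (v^`() ^+ 2) <= 4 * pint a b (legendre_op v ^+ 2).
Proof.
set w := v^`().
have key : 4 *: legendre_op v ^+ 2 - (b - a) ^+ 2 *: w ^+ 2 =
   (2 *: (rho * w^`()) + rho^`() * w) ^+ 2 + (2 *: (rho * rho^`() * w ^+ 2))^`().
  rewrite /legendre_op -/w /rho !expr2 !dE -!mul_polyC !(polyC_natr, polyCD, polyCM, polyCN); ring.
rewrite -subr_ge0 -!pintZ -pintB key pintD pint_deriv addr_ge0//.
  exact/pint_sqr_ge0/ltW.
by rewrite /rho !poly_evalE le_eqVlt; apply/orP; left; apply/eqP; ring.
Qed.

Lemma time_inverse q v : (size v <= q.+1)%N ->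
  (b - a) ^+ 2 * pint a b (v^`() ^+ 2) <= 4 * q.+1%:R ^+ 4 * pint a b (v ^+ 2).
Proof.
move=> /legendre_op_bound h; have v0 := pint_sqr_ge0 v (ltW ab).
apply: (le_trans (hardy_legendre v)); rewrite -mulrA ler_wpM2l//.
apply: (le_trans h); rewrite ler_wpM2r// -natrX -[_ ^+ 4]natrX ler_nat.
by rewrite -[4%N]/(2 * 2)%N expnM leq_exp2r// expnS expn1 leq_mul.
Qed.

(** The end value is the integral of the derivative of [v^2] times the linear function that vanishes
    at the other end. The product [v v'] that arises is split by Young's inequality with weights
    balanced for [time_inverse]. *)
Lemma endpoint_inverse q v c : (size v <= q.+1)%N -> c = a \/ c = b ->
  (b - a) * v.[c] ^+ 2 <= 6 * q.+1%:R ^+ 2 * pint a b (v ^+ 2).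
Proof.
move=> hv hc; pose n : R := q.+1%:R; rewrite -/n.
have n1 : 1 <= n by rewrite ler1n.
have n0 : 0 < n by rewrite ltr0n.
have ti := time_inverse hv; rewrite -/n in ti.
(* The three summands integrate to at most [1], [n ^+ 2] and [4 * n ^+ 2] times the squared norm of
   [v]; with [1 <= n] this is the constant 6. *)
pose F : {poly R} := v ^+ 2 + n ^+ 2 *: v ^+ 2 + ((b - a) / n) ^+ 2 *: v^`() ^+ 2.
have hF : (b - a) * v.[c] ^+ 2 <= pint a b F.
  have yg (s y z : R) : s ^+ 2 <= (b - a) ^+ 2 ->
      2 * (s * y * z) <= n ^+ 2 * y ^+ 2 + ((b - a) / n) ^+ 2 * z ^+ 2.
    move=> hs; apply: (@le_trans _ _ (n ^+ 2 * y ^+ 2 + (s / n) ^+ 2 * z ^+ 2)).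
      rewrite -subr_ge0.
      have -> : n ^+ 2 * y ^+ 2 + (s / n) ^+ 2 * z ^+ 2 - 2 * (s * y * z) =
        (n * y - s / n * z) ^+ 2 by field; rewrite gt_eqF.
      exact: sqr_ge0.
    by rewrite lerD2l ler_wpM2r ?sqr_ge0// !exprMn ler_wpM2r// sqr_ge0.
  case: hc => ->.
    have -> : (b - a) * v.[a] ^+ 2 = pint a b (- ((b%:P - 'X) * v ^+ 2)^`()).
      by rewrite pintN pint_deriv !poly_evalE; ring.
    apply: pint_le => [|x /andP[ax xb]]; first exact: ltW.
    rewrite expr2 !dE !poly_evalE.
    have hs : (x - b) ^+ 2 <= (b - a) ^+ 2.
      by rewrite -sqrrN opprB ler_sqr ?nnegrE; lra.
    have := yg (x - b) v.[x] (v^`()).[x] hs; set r := (_ / n) ^+ 2; set y := v.[x].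
    set z := (v^`()).[x]; rewrite !expr2; lra.
  have -> : (b - a) * v.[b] ^+ 2 = pint a b (('X - a%:P) * v ^+ 2)^`().
    by rewrite pint_deriv !poly_evalE; ring.
  apply: pint_le => [|x /andP[ax xb]]; first exact: ltW.
  rewrite expr2 !dE !poly_evalE.
  have hs : (x - a) ^+ 2 <= (b - a) ^+ 2 by rewrite ler_sqr ?nnegrE; lra.
  have := yg (x - a) v.[x] (v^`()).[x] hs; set r := (_ / n) ^+ 2; set y := v.[x].
  set z := (v^`()).[x]; rewrite !expr2; lra.
apply: (le_trans hF); rewrite /F !pintD !pintZ.
have v0 := pint_sqr_ge0 v (ltW ab).
have h1 : ((b - a) / n) ^+ 2 * pint a b (v^`() ^+ 2) <= 4 * n ^+ 2 * pint a b (v ^+ 2).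
  rewrite exprMn exprVn mulrAC ler_pdivrMr ?exprn_gt0//.
  by apply: (le_trans ti); rewrite le_eqVlt; apply/orP; left; apply/eqP; ring.
have h2 : pint a b (v ^+ 2) <= n ^+ 2 * pint a b (v ^+ 2).
  by rewrite ler_peMl// exprn_ege1.
move: h1 h2; move: (_ * pint a b (v^`() ^+ 2)) (pint a b (v ^+ 2)) (n ^+ 2) => d y m.
lra.
Qed.

End TimeInverse.

(** * Integrals of functions that agree almost everywhere *)

Section IntegralAe.
Local Open Scope ereal_scope.
Context d (T : measurableType d) (R : realType).
Variable mu : {measure set T -> \bar R}.
Implicit Types f g : T -> \bar R.

Import HBNNSimple.

(* No measurability is assumed: the integral of a nonnegative function is a supremum over simple functions. *)
Lemma ae_le_ge0_integralT f g : (forall x, 0 <= f x) -> (forall x, 0 <= g x) ->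
  {ae mu, forall x, f x <= g x} ->
  \int[mu]_x f x <= \int[mu]_x g x.
Proof.
move=> f0 g0 [N [mN muN sN]].
rewrite !ge0_integralTE//; apply: ge_ereal_sup => _ [h /= hf <-].
pose h1 := proj_nnsfun h (measurableC mN).
apply: (@le_trans _ _ (sintegral mu h1)); last first.
  apply: ereal_sup_ubound; exists h1 => //= x.
  rewrite /h1 /proj_nnsfun /= mindicE in_setC.
  have [xN|xN] := boolP (x \in N); first by rewrite mulr0.
  rewrite mulr1; apply: le_trans (hf x) _; apply: contrapT => h2.
  by move: xN; rewrite notin_setE; apply; exact: sN.
rewrite -!integralT_nnsfun; apply: ae_ge0_le_integral => //.
- by move=> x _; rewrite lee_fin.
- by apply/measurable_EFinP.
- by move=> x _; rewrite lee_fin.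
- by apply/measurable_EFinP.
exists N; split => // x /= /not_implyP[_ hx]; apply: contrapT => xN; apply: hx.
by rewrite mindicE in_setC memNset//= mulr1.
Qed.

Lemma ae_eq_integralT f g : {ae mu, forall x, f x = g x} ->
  \int[mu]_x f x = \int[mu]_x g x.
Proof.
move=> fg; rewrite integralE [RHS]integralE; congr (_ - _).
  apply/eqP; rewrite eq_le; apply/andP; split; apply: ae_le_ge0_integralT => //;
    by apply: filterS fg => x; rewrite !funeposE => ->.
apply/eqP; rewrite eq_le; apply/andP; split; apply: ae_le_ge0_integralT => //;
  by apply: filterS fg => x; rewrite !funenegE => ->.
Qed.

End IntegralAe.

(** * Affine change of variable on the line *)

Section AffineChange.
Context {R : realType}.
Local Notation mu := (@lebesgue_measure R).

Lemma affine_measurable (a b : R) :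
  measurable_fun setT (fun s : measurableTypeR R => a * s + b : measurableTypeR R).
Proof. by apply: measurable_funD => //; apply: measurable_funM. Qed.

(** Uniqueness of Lebesgue measure: the scaled image measure has the right value on half-open
    intervals. For negative [a] the preimage is half-open on the other side, with the same
    length. *)
Lemma lebesgue_measure_affine (a b : R) (A : set R) : a != 0 -> measurable A ->
  mu A = (`|a|%:E * mu ((fun s : R => (a * s + b)%R) @^-1` A))%E.
Proof.
move=> a0 mA.
have a0' : 0 < `|a| by rewrite normr_gt0.
have mphi := affine_measurable a b.
pose mpack : {mfun measurableTypeR R >-> measurableTypeR R} := HB.pack (fun s : R => a * s + b)
   (isMeasurableFun.Build _ _ (measurableTypeR R) (measurableTypeR R) _ mphi).
pose nu0 : {measure set (measurableTypeR R) -> \bar R} :=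
  mscale (NngNum (ltW a0')) (pushforward mu mpack).
pose nu := nu0 mphi.
have nuE B : nu B = (`|a|%:E * mu ((fun s : R => (a * s + b)%R) @^-1` B))%E by [].
rewrite -nuE; apply: lebesgue_measure_unique => // _ [[x y] _ <-].
rewrite nuE /=.
have [a_gt0|a_lt0|a_eq0] := ltrgtP 0 a; last by rewrite a_eq0 eqxx in a0.
  have -> : (fun s => a * s + b) @^-1` `]x, y]%classic =
      `](x - b) / a, (y - b) / a]%classic.
    apply/seteqP; split => s /=; rewrite !in_itv /= ltr_pdivrMr// ler_pdivlMr//
      ltrBlDr lerBrDr [s * a]mulrC//.
  rewrite !lebesgue_measure_itv /= !lte_fin ltr_pM2r ?invr_gt0// ltrD2r.
  case: ifP => _; last by rewrite mule0.
  rewrite -!EFinB -EFinM gtr0_norm//; congr (_%:E); field.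
  by rewrite gt_eqF.
have -> : (fun s => a * s + b) @^-1` `]x, y]%classic =
    `[(y - b) / a, (x - b) / a[%classic.
  apply/seteqP; split => s /=; rewrite !in_itv /= ltr_ndivlMr// ler_ndivrMr//
    ltrBlDr lerBrDr [s * a]mulrC andbC//.
rewrite !lebesgue_measure_itv /= !lte_fin ltr_nM2r ?invr_lt0// ltrD2r.
case: ifP => _; last by rewrite mule0.
rewrite -!EFinB -EFinM ltr0_norm//; congr (_%:E); field.
by rewrite lt_eqF.
Qed.

Lemma ge0_integral_affine (a b : R) (f : measurableTypeR R -> \bar R) : a != 0 ->
  measurable_fun setT f -> (forall x : R, (0 <= f x)%E) ->
  (\int[mu]_(x in setT) f x = `|a|%:E * \int[mu]_(x in setT) f (a * x + b)%R)%E.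
Proof.
move=> a0 mf f0.
have a0' : 0 < `|a| by rewrite normr_gt0.
have mphi := affine_measurable a b.
pose mpack : {mfun measurableTypeR R >-> measurableTypeR R} := HB.pack (fun s : R => a * s + b)
   (isMeasurableFun.Build _ _ (measurableTypeR R) (measurableTypeR R) _ mphi).
rewrite -[X in (_ * X)%E](@ge0_integral_pushforward _ _ _ _ _ _ mphi mu setT f)//.
rewrite -(@ge0_integral_mscale _ _ _ (pushforward mu mpack) setT measurableT (NngNum (ltW a0')))//.
apply: eq_measure_integral => A mA _.
exact: lebesgue_measure_affine.
Qed.

Lemma Rintegral_affine (a b : R) (f : R -> R) : a != 0 ->
  mu.-integrable setT (EFin \o f) ->
  \int[mu]_x f x = `|a| * \int[mu]_x f (a * x + b).
Proof.
move=> a0 fi; have mf := measurable_int mu fi.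
have a0' : (0 < `|a|%:E)%E by rewrite lte_fin normr_gt0.
rewrite /Rintegral integralE [X in _ = _ * fine X]integralE.
rewrite (@ge0_integral_affine a b (EFin \o f)^\+)%E//; last exact: measurable_funepos.
rewrite (@ge0_integral_affine a b (EFin \o f)^\-)%E//; last exact: measurable_funeneg.
have fp := integrable_pos_fin_num measurableT fi.
have fn := integrable_neg_fin_num measurableT fi.
have fin (g : R -> \bar R) : measurable_fun setT g -> (forall x, (0 <= g x)%E) ->
    (\int[mu]_x g x \is a fin_num)%E -> (\int[mu]_x g (a * x + b)%R \is a fin_num)%E.
  move=> mg g0; rewrite (@ge0_integral_affine a b g)//.
  have := @integral_ge0 _ _ _ mu setT (fun x => g (a * x + b)) (fun x _ => g0 _).
  case: (\int[mu]_x _)%E => //= _; first by rewrite gt0_muley.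
have F1 := fin _ (measurable_funepos mf) (fun x => funepos_ge0 _ _) fp.
have F2 := fin _ (measurable_funeneg mf) (fun x => funeneg_ge0 _ _) fn.
have E1 : (\int[mu]_(x in setT) (fun x : R => (f (a * x + b))%:E)^\+ x =
    \int[mu]_(x in setT) (EFin \o f)^\+ (a * x + b)%R)%E.
  by apply: eq_integral => x _; rewrite !funeposE.
have E2 : (\int[mu]_(x in setT) (fun x : R => (f (a * x + b))%:E)^\- x =
    \int[mu]_(x in setT) (EFin \o f)^\- (a * x + b)%R)%E.
  by apply: eq_integral => x _; rewrite !funenegE.
rewrite E1 E2 -(fineK F1) -(fineK F2) -!EFinM -!EFinB /=; ring.
Qed.

End AffineChange.

(** * Integration over the edge parameter in [0, 1] *)

Section UnitInterval.
Context {R : realType}.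
Local Notation mu := (@lebesgue_measure R).
Implicit Types (f g : R -> R) (A : set R).

#[local] Instance ae_lebesgue_filter : Filter (nbhs (almost_everywhere mu)).
Proof. exact: ae_filter_ringOfSetsType. Qed.

(** Upwind neighbours and uniqueness of the edge through a point are available only off null sets,
    so integrands on edges are compared in this sense. *)
Definition ae01 (P : R -> Prop) := {ae mu, forall s : R, 0 <= s <= 1 -> P s}.

Lemma ae01T (P : R -> Prop) : (forall s, 0 <= s <= 1 -> P s) -> ae01 P.
Proof. by move=> h; apply: aeW => s; exact: h. Qed.

Lemma ae01_and (P Q : R -> Prop) : ae01 P -> ae01 Q -> ae01 (fun s => P s /\ Q s).
Proof. by rewrite /ae01; apply: filterS2 => s hP hQ h; split; [exact: hP|exact: hQ]. Qed.

Lemma ae01_imp (P Q : R -> Prop) : (forall s, 0 <= s <= 1 -> P s -> Q s) -> ae01 P -> ae01 Q.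
Proof. by rewrite /ae01 => h; apply: filterS => s hP h1; apply: h => //; exact: hP. Qed.

Lemma ae01_imp2 (P Q S : R -> Prop) : (forall s, 0 <= s <= 1 -> P s -> Q s -> S s) ->
  ae01 P -> ae01 Q -> ae01 S.
Proof. by rewrite /ae01 => h; apply: filterS2 => s hP hQ h1; apply: h => //; [exact: hP|exact: hQ]. Qed.

Lemma ae01_seq (I : eqType) (r : seq I) (P : I -> R -> Prop) :
  (forall i, i \in r -> ae01 (P i)) -> ae01 (fun s => forall i, i \in r -> P i s).
Proof.
elim: r => [|i r IH] h; first exact: ae01T.
have h1 : ae01 (P i) by apply: h; rewrite mem_head.
have h2 : ae01 (fun s => forall j, j \in r -> P j s).
  by apply: IH => j jr; apply: h; rewrite in_cons jr orbT.
apply: ae01_imp2 h1 h2 => s _ p1 p2 j; rewrite in_cons => /predU1P[->//|]; exact: p2.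
Qed.

Lemma ae01_fin (I : finType) (P : I -> R -> Prop) :
  (forall i, ae01 (P i)) -> ae01 (fun s => forall i, P i s).
Proof.
move=> h; have := @ae01_seq I (enum I) P (fun i _ => h i).
by apply: ae01_imp => s _ hs i; apply: hs; rewrite mem_enum.
Qed.

Lemma ae01_neq (c : R) : ae01 (fun s => s <> c).
Proof.
exists [set c]; split => //; first exact: lebesgue_measure_set1.
by move=> s /= /not_implyP[_ /contrapT].
Qed.

Lemma ae01_subset1 (P : R -> Prop) :
  (forall s r, 0 <= s <= 1 -> 0 <= r <= 1 -> P s -> P r -> s = r) -> ae01 (fun s => ~ P s).
Proof.
move=> h; have [[c [hc Pc]]|n] := pselect (exists c, 0 <= c <= 1 /\ P c).
  by apply: ae01_imp (ae01_neq c) => s hs sc Ps; apply: sc; exact: h.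
by apply: ae01T => s hs Ps; apply: n; exists s.
Qed.

(** The bound is asked on [[0, 1]] only, because a polynomial along a line is unbounded further
    out. *)
Definition bmf f := measurable_fun setT f /\ exists C, forall s, 0 <= s <= 1 -> `|f s| <= C.
Definition E01 f := \int[mu]_(s in `[0, 1]%classic) f s.

Lemma bmf_cst c : bmf (fun=> c).
Proof. by split => //; exists `|c|. Qed.

Lemma bmfD f g : bmf f -> bmf g -> bmf (fun s => f s + g s).
Proof.
move=> [mf [C hC]] [mg [D hD]]; split; first exact: measurable_funD.
exists (C + D) => s hs; apply: le_trans (ler_normD _ _) _.
by rewrite lerD ?hC ?hD.
Qed.

Lemma bmfM f g : bmf f -> bmf g -> bmf (fun s => f s * g s).
Proof.
move=> [mf [C hC]] [mg [D hD]]; split; first exact: measurable_funM.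
exists (C * D) => s hs; rewrite normrM ler_pM//; [exact: hC|exact: hD].
Qed.

Lemma bmfZ c f : bmf f -> bmf (fun s => c * f s).
Proof. by apply: bmfM; exact: bmf_cst. Qed.

Lemma bmf_sum (I : Type) (r : seq I) (P : pred I) (F : I -> R -> R) :
  (forall i, P i -> bmf (F i)) -> bmf (fun s => \sum_(i <- r | P i) F i s).
Proof.
move=> h; elim: r => [|i r IH].
  by under eq_fun do rewrite big_nil; exact: bmf_cst.
under eq_fun do rewrite big_cons.
case: (boolP (P i)) => Pi //; exact: bmfD (h _ Pi) IH.
Qed.

Lemma bmf_indic A : measurable A -> bmf (\1_A).
Proof.
move=> mA; split; first exact: measurable_indic.
by exists 1 => s _; rewrite indicE ger0_norm ?ler0n// lern1 leq_b1.
Qed.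

Lemma bmf_norm f : bmf f -> bmf (fun s => `|f s|).
Proof.
move=> [mf [C hC]]; split; first exact: measurableT_comp.
by exists C => s /hC; rewrite normr_id.
Qed.

Lemma bmf_integrable f : bmf f -> mu.-integrable `[0, 1]%classic (EFin \o f).
Proof.
move=> [mf [C hC]]; apply: measurable_bounded_integrable => //.
- by rewrite /= lebesgue_measure_itv /= lte_fin ltr01 oppr0 adde0 ltry.
- exact: measurable_funTS.
- exists C; split; first by rewrite num_real.
  by move=> x Cx s /=; rewrite in_itv /= => /hC h; apply: le_trans h (ltW Cx).
Qed.

Lemma E01D f g : bmf f -> bmf g -> E01 (fun s => f s + g s) = E01 f + E01 g.
Proof. by move=> hf hg; rewrite /E01 RintegralD//; exact: bmf_integrable. Qed.

Lemma E01Z c f : bmf f -> E01 (fun s => c * f s) = c * E01 f.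
Proof. by move=> hf; rewrite /E01 RintegralZl//; exact: bmf_integrable. Qed.

Lemma E01_sum (I : Type) (r : seq I) (P : pred I) (F : I -> R -> R) :
  (forall i, P i -> bmf (F i)) ->
  E01 (fun s => \sum_(i <- r | P i) F i s) = \sum_(i <- r | P i) E01 (F i).
Proof.
move=> h; elim: r => [|i r IH].
  rewrite big_nil /E01; under eq_Rintegral do rewrite big_nil.
  by have := E01Z 0 (bmf_cst 0); rewrite !mul0r.
have -> : (fun s => \sum_(j <- i :: r | P j) F j s) =
   fun s => (if P i then F i s else 0) + \sum_(j <- r | P j) F j s.
  by apply/funext => s; rewrite big_cons; case: ifP; rewrite ?add0r.
rewrite big_cons; case: (boolP (P i)) => Pi.
  by rewrite E01D ?IH//; [exact: h|exact: bmf_sum].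
by rewrite -IH; congr E01; apply/funext => s; rewrite add0r.
Qed.

Lemma E01_eq_ae f g : ae01 (fun s => f s = g s) -> E01 f = E01 g.
Proof.
rewrite /ae01 => fg; rewrite /E01 Rintegral_mkcond [RHS]Rintegral_mkcond /Rintegral.
congr fine; apply: ae_eq_integralT; apply: filterS fg => s h.
rewrite !patchE; case: ifPn => //; rewrite inE /= in_itv /= => hs.
by rewrite h.
Qed.

Lemma E01_ge0 f : ae01 (fun s => 0 <= f s) -> 0 <= E01 f.
Proof.
move=> f0; rewrite (@E01_eq_ae f (fun s => `|f s|)).
  by apply: Rintegral_ge0 => s _.
by apply: ae01_imp f0 => s _ h; rewrite ger0_norm.
Qed.

Lemma E01_le f g : bmf f -> bmf g -> ae01 (fun s => f s <= g s) -> E01 f <= E01 g.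
Proof.
move=> hf hg h; rewrite -subr_ge0 -mulN1r -E01Z// -E01D//; last exact: bmfZ.
by apply: E01_ge0; apply: ae01_imp h => s _; rewrite mulN1r subr_ge0.
Qed.

Lemma E01_cond A f :
  \int[mu]_(s in `[0, 1]%classic `&` A) f s = E01 (fun s => \1_A s * f s).
Proof.
rewrite Rintegral_mkcondr; apply: eq_Rintegral => s _.
by rewrite patchE indicE; case: ifP; rewrite ?mul1r ?mul0r.
Qed.

Lemma E01_eq0_ae A : measurable A -> E01 (\1_A) = 0 -> ae01 (fun s => ~ A s).
Proof.
move=> mA; rewrite /E01 /Rintegral.
rewrite integral_indic//.
move=> h; exists (A `&` `[0, 1]%classic); split; first exact: measurableI.
  have mI : measurable (`[0%R, 1%R]%classic : set (measurableTypeR R)) by exact: measurable_itv.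
  have fin : (mu (A `&` `[0%R, 1%R]%classic) \is a fin_num)%E.
    rewrite ge0_fin_numE//; apply: (@le_lt_trans _ _ (mu `[0%R, 1%R]%classic)).
      by apply: le_measure; rewrite ?inE; [exact: measurableI|exact: mI|exact: subIsetr].
    by rewrite lebesgue_measure_itv /= lte_fin ltr01 oppr0 adde0 ltry.
  by rewrite -(fineK fin); congr (_%:E).
by move=> s /= /not_implyP[hs /contrapT As]; split => //=; rewrite in_itv.
Qed.

Lemma E01_mkT f : E01 f = \int[mu]_s (\1_(`[0, 1]%classic) s * f s).
Proof.
rewrite /E01 Rintegral_mkcond; apply: eq_Rintegral => s _.
by rewrite patchE indicE; case: ifP; rewrite ?mul1r ?mul0r.
Qed.

Lemma bmf_integrableT f : bmf f ->
  mu.-integrable setT (EFin \o (fun s => \1_(`[0, 1]%classic) s * f s)).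
Proof.
move=> hf; have := bmf_integrable hf.
rewrite integrable_mkcond//; congr (_.-integrable _ _); apply/funext => s /=.
by rewrite patchE indicE; case: ifP; rewrite ?mul1r ?mul0r.
Qed.

End UnitInterval.

(** * Polynomials in (x, y) and their partial derivatives *)

Section Bivariate.
Context {R : realType}.
Implicit Types (P Q : {poly {poly R}}) (z : R * R).

(* The outer variable is y, the inner one is x. *)
Definition ev2 Q z : R := Q.[z.2%:P].[z.1].
Definition cst2 (c : R) : {poly {poly R}} := c%:P%:P.
Definition Xx : {poly {poly R}} := 'X%:P.
Definition dy Q := Q^`().
Definition dx Q : {poly {poly R}} := map_poly (@deriv R) Q.

Lemma ev2D P Q z : ev2 (P + Q) z = ev2 P z + ev2 Q z.
Proof. by rewrite /ev2 !hornerD. Qed.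
Lemma ev2N Q z : ev2 (- Q) z = - ev2 Q z.
Proof. by rewrite /ev2 !hornerN. Qed.
Lemma ev2M P Q z : ev2 (P * Q) z = ev2 P z * ev2 Q z.
Proof. by rewrite /ev2 !hornerM. Qed.
Lemma ev2X Q n z : ev2 (Q ^+ n) z = ev2 Q z ^+ n.
Proof. by rewrite /ev2 !horner_exp. Qed.
Lemma ev2_cst c z : ev2 (cst2 c) z = c.
Proof. by rewrite /ev2 !hornerC. Qed.
Lemma ev2_Xx z : ev2 Xx z = z.1.
Proof. by rewrite /ev2 hornerC hornerX. Qed.
Lemma ev2_0 z : ev2 0 z = 0.
Proof. by rewrite /ev2 !horner0. Qed.
Lemma ev2_1 z : ev2 1 z = 1.
Proof. by rewrite /ev2 !hornerC. Qed.
Definition ev2E := (ev2D, ev2N, ev2M, ev2X, ev2_cst, ev2_Xx, ev2_0, ev2_1).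

Lemma ev2_sum (I : Type) (r : seq I) (C : pred I) (F : I -> {poly {poly R}}) z :
  ev2 (\sum_(i <- r | C i) F i) z = \sum_(i <- r | C i) ev2 (F i) z.
Proof. by elim/big_rec2 : _ => [|i y1 y2 _ <-]; rewrite ?ev2_0// ev2D. Qed.

Lemma cst2M a b : cst2 (a * b) = cst2 a * cst2 b. Proof. by rewrite /cst2 !polyCM. Qed.
Lemma cst2D a b : cst2 (a + b) = cst2 a + cst2 b. Proof. by rewrite /cst2 !polyCD. Qed.
Lemma cst2N a : cst2 (- a) = - cst2 a. Proof. by rewrite /cst2 !polyCN. Qed.
Lemma cst2X a n : cst2 (a ^+ n) = cst2 a ^+ n. Proof. by rewrite /cst2 !polyC_exp. Qed.
Lemma cst2_0 : cst2 0 = 0. Proof. by rewrite /cst2 !polyC0. Qed.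
Lemma cst2_1 : cst2 1 = 1. Proof. by rewrite /cst2 !polyC1. Qed.

Lemma coef_dx Q i : (dx Q)`_i = (Q`_i)^`().
Proof. by rewrite coef_map_id0// deriv0. Qed.

Lemma dxD P Q : dx (P + Q) = dx P + dx Q.
Proof. by apply/polyP => i; rewrite coefD !coef_dx coefD derivD. Qed.
Lemma dxN Q : dx (- Q) = - dx Q.
Proof. by apply/polyP => i; rewrite coefN !coef_dx coefN derivN. Qed.
Lemma dxM P Q : dx (P * Q) = dx P * Q + P * dx Q.
Proof.
apply/polyP => i; rewrite coefD coef_dx !coefM raddf_sum -big_split /=.
by apply: eq_bigr => j _; rewrite derivM !coef_dx.
Qed.
Lemma dx_cst c : dx (cst2 c) = 0.
Proof. by apply/polyP => i; rewrite coef_dx coefC coef0; case: eqP; rewrite ?derivC ?deriv0. Qed.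
Lemma dx_Xx : dx Xx = 1.
Proof.
by apply/polyP => i; rewrite coef_dx coefC coef1; case: i => [|i] /=; rewrite ?derivX ?deriv0.
Qed.
Lemma dy_cst c : dy (cst2 c) = 0. Proof. exact: derivC. Qed.
Lemma dy_Xx : dy Xx = 0. Proof. exact: derivC. Qed.
Lemma dyD P Q : dy (P + Q) = dy P + dy Q. Proof. exact: derivD. Qed.
Lemma dyN Q : dy (- Q) = - dy Q. Proof. exact: derivN. Qed.
Lemma dyM P Q : dy (P * Q) = dy P * Q + P * dy Q. Proof. exact: derivM. Qed.
Lemma dxdy Q : dx (dy Q) = dy (dx Q).
Proof. by apply/polyP => i; rewrite coef_dx !coef_deriv coef_dx derivMn. Qed.
Definition dxyE := (dxD, dxN, dxM, dx_cst, dx_Xx, dyD, dyN, dyM, dy_cst, dy_Xx, dxdy).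

Definition slice_y Q x : {poly R} := map_poly (horner_eval x) Q.

Lemma slice_yE Q x s : (slice_y Q x).[s] = ev2 Q (x, s).
Proof.
transitivity (horner_eval x Q.[s%:P]); last by [].
by rewrite -horner_map /= /horner_eval hornerC.
Qed.

Lemma slice_y_deriv Q x : (slice_y Q x)^`() = slice_y (dy Q) x.
Proof. exact: deriv_map. Qed.

Lemma horner_dx Q (c : R) : (dx Q).[c%:P] = (Q.[c%:P])^`().
Proof.
elim/poly_ind: Q => [|Q p IH]; first by rewrite /dx map_poly0 !horner0 deriv0.
have -> : dx (Q * 'X + p%:P) = dx Q * 'X + (p^`())%:P.
  apply/polyP => i; rewrite coef_dx !coefD !coefMX !coefC.
  by case: i => [|i] /=; rewrite ?add0r// !addr0 coef_dx.
by rewrite !hornerE IH derivD derivM derivC mulr0 addr0.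
Qed.

Lemma d_y_ev2 Q z : d_y (ev2 Q) z = ev2 (dy Q) z.
Proof.
rewrite /d_y; have -> : (fun s => ev2 Q (z.1, s)) = horner (slice_y Q z.1).
  by apply/funext => s; rewrite slice_yE.
by rewrite derive1_horner slice_y_deriv slice_yE; case: z.
Qed.

Lemma d_x_ev2 Q z : d_x (ev2 Q) z = ev2 (dx Q) z.
Proof.
rewrite /d_x -[LHS]/(derive1 (horner Q.[z.2%:P]) z.1).
by rewrite derive1_horner -horner_dx.
Qed.

Definition deg2 p Q := forall i j, (p < i + j)%N -> Q`_j`_i = 0.

Lemma deg2D p P Q : deg2 p P -> deg2 p Q -> deg2 p (P + Q).
Proof. by move=> hP hQ i j h; rewrite !coefD hP ?hQ ?addr0. Qed.
Lemma deg2Z p c Q : deg2 p Q -> deg2 p (cst2 c * Q).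
Proof. by move=> hQ i j h; rewrite coefCM coefCM hQ ?mulr0. Qed.
Lemma deg2N p Q : deg2 p Q -> deg2 p (- Q).
Proof. by move=> hQ i j h; rewrite !coefN hQ ?oppr0. Qed.
Lemma deg2_0 p : deg2 p 0.
Proof. by move=> i j _; rewrite !coef0. Qed.
Lemma deg2_dx p Q : deg2 p Q -> deg2 p (dx Q).
Proof. by move=> hQ i j h; rewrite coef_dx coef_deriv hQ ?mul0rn// ltnW// addSn ltnS ltnW. Qed.
Lemma deg2_dy p Q : deg2 p Q -> deg2 p (dy Q).
Proof.
by move=> hQ i j h; rewrite coef_deriv coefMn hQ ?mul0rn// addnS ltnS ltnW.
Qed.
(** The factor [x] gives back the degree that the derivative in [y] takes away. This is what keeps
    [U_t + x U_y], and so the test function, in the discrete space. *)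
Lemma deg2_Xx_dy p Q : deg2 p Q -> deg2 p (Xx * dy Q).
Proof.
move=> hQ i j h; rewrite coefCM coefXM; case: i h => [|i] h //=.
by rewrite coef_deriv coefMn hQ ?mul0rn// addnS -addSn.
Qed.
Lemma deg2_sum p (I : Type) (r : seq I) (C : pred I) (F : I -> {poly {poly R}}) :
  (forall i, C i -> deg2 p (F i)) -> deg2 p (\sum_(i <- r | C i) F i).
Proof. by move=> h; elim/big_rec : _ => [|i x Ci hx]; [exact: deg2_0|exact/deg2D/hx/h]. Qed.

Lemma is_PpP p (w : R * R -> R) : is_Pp p w <-> exists2 Q, deg2 p Q & w = ev2 Q.
Proof.
split=> [[c hw]|[Q hQ ->]].
  exists (\poly_(j < p.+1) \poly_(i < p.+1) (if (i + j <= p)%N then c i j else 0)).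
    move=> i j h; rewrite coef_poly; case: ifP => _; last by rewrite coef0.
    by rewrite coef_poly; case: ifP => // _; rewrite leqNgt h.
  apply/funext => z; rewrite hw /ev2 horner_poly horner_sum.
  under eq_bigr do rewrite big_mkcond /=.
  rewrite exchange_big /=.
  apply: eq_bigr => j _; rewrite hornerM -polyC_exp hornerC horner_poly mulr_suml.
  by apply: eq_bigr => i _; case: ifP => _; rewrite ?mul0r// !mul0r.
exists (fun i j => Q`_j`_i) => z.
have sQ : (size Q <= p.+1)%N.
  apply/leq_sizeP => j hj; apply/polyP => i; rewrite coef0 hQ//.
  by rewrite (leq_trans hj)// leq_addl.
have sQj (j : nat) : (size (Q`_j)%R <= p.+1)%N.
  by apply/leq_sizeP => i hi; rewrite hQ// (leq_trans hi)// leq_addr.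
under [RHS]eq_bigr do rewrite big_mkcond /=.
rewrite [RHS]exchange_big /= /ev2 (horner_coef_wide _ sQ) horner_sum.
apply: eq_bigr => j _; rewrite hornerM -polyC_exp hornerC (horner_coef_wide _ (sQj j)).
rewrite mulr_suml; apply: eq_bigr => i _; case: ifPn => //.
by rewrite -ltnNge => /hQ ->; rewrite !mul0r.
Qed.

End Bivariate.

(** * Positive linear functionals on bivariate polynomials *)

Section LinearFunctional.
Context {R : realType}.
Local Notation bp := {poly {poly R}}.
Implicit Types (P Q : bp) (z : R * R).

Definition lin2 (L : bp -> R) :=
  (forall P Q, L (P + Q) = L P + L Q) /\ (forall c Q, L (cst2 c * Q) = c * L Q).

Lemma lin2_0 L : lin2 L -> L 0 = 0.
Proof. by move=> [_ h]; have := h 0 0; rewrite mulr0 mul0r. Qed.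
Lemma lin2_N L Q : lin2 L -> L (- Q) = - L Q.
Proof. by move=> [_ h]; have := h (-1) Q; rewrite cst2N cst2_1 !mulN1r. Qed.
Lemma lin2_sum L (I : Type) (r : seq I) (C : pred I) (F : I -> bp) : lin2 L ->
  L (\sum_(i <- r | C i) F i) = \sum_(i <- r | C i) L (F i).
Proof.
by move=> hL; elim/big_rec2 : _ => [|i y1 y2 _ <-]; rewrite ?lin2_0//; case: hL => ->.
Qed.
Lemma lin2_Mn L Q n : lin2 L -> L (Q *+ n) = L Q *+ n.
Proof. by move=> hL; elim: n => [|n IH]; rewrite ?mulr0n ?lin2_0// !mulrS hL.1 IH. Qed.
Lemma lin2_ev2 z : lin2 (ev2^~ z).
Proof. by split=> *; rewrite !ev2E. Qed.

(* The bound xm confines the support of the functional to a strip containing the domain. *)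
Record plf (xm : R) := Plf {
  plf_fun :> bp -> R;
  plf_lin : lin2 plf_fun;
  plf_ge0 : forall Q, (forall z, `|z.1| <= xm -> 0 <= ev2 Q z) -> 0 <= plf_fun Q }.

Variable xm : R.
Implicit Types L : plf xm.

Lemma plfD L P Q : L (P + Q) = L P + L Q. Proof. exact: (plf_lin L).1. Qed.
Lemma plfZ L c Q : L (cst2 c * Q) = c * L Q. Proof. exact: (plf_lin L).2. Qed.
Lemma plfN L Q : L (- Q) = - L Q. Proof. exact: lin2_N (plf_lin L). Qed.
Lemma plf0 L : L 0 = 0. Proof. exact: lin2_0 (plf_lin L). Qed.

Lemma plf_le L P Q : (forall z, `|z.1| <= xm -> ev2 P z <= ev2 Q z) -> L P <= L Q.
Proof.
by move=> h; rewrite -subr_ge0 -plfN -plfD; apply: plf_ge0 => z /h; rewrite !ev2E subr_ge0.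
Qed.

Lemma plf_sqr_ge0 L Q : 0 <= L (Q ^+ 2).
Proof. by apply: plf_ge0 => z _; rewrite ev2X sqr_ge0. Qed.

(* A pointwise inequality [a u v <= b u^2 + c v^2] is what Young's inequality needs. *)
Lemma plf_young L (P Q : bp) t : 0 < t ->
  2 * L (P * Q) <= t * L (P ^+ 2) + t^-1 * L (Q ^+ 2).
Proof.
move=> t0; rewrite -!plfZ -plfD; apply: plf_le => z _; rewrite !ev2E -subr_ge0.
have -> : t * ev2 P z ^+ 2 + t^-1 * ev2 Q z ^+ 2 - 2 * (ev2 P z * ev2 Q z) =
   t^-1 * (t * ev2 P z - ev2 Q z) ^+ 2 by field; rewrite gt_eqF.
by rewrite mulr_ge0 ?sqr_ge0// invr_ge0 ltW.
Qed.

Lemma plf_sqrD L (P Q : bp) : L ((P + Q) ^+ 2) <= 2 * L (P ^+ 2) + 2 * L (Q ^+ 2).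
Proof.
rewrite -!plfZ -plfD; apply: plf_le => z _; rewrite !ev2E -subr_ge0.
have -> : 2 * ev2 P z ^+ 2 + 2 * ev2 Q z ^+ 2 - (ev2 P z + ev2 Q z) ^+ 2 =
  (ev2 P z - ev2 Q z) ^+ 2 by ring.
exact: sqr_ge0.
Qed.

Lemma plf_sqrZ L c Q : L ((cst2 c * Q) ^+ 2) = c ^+ 2 * L (Q ^+ 2).
Proof. by rewrite exprMn -cst2X plfZ. Qed.

Lemma plf_Xx_sqr L Q : L ((Xx * Q) ^+ 2) <= xm ^+ 2 * L (Q ^+ 2).
Proof.
rewrite -plfZ; apply: plf_le => z hz; rewrite !ev2E exprMn ler_wpM2r ?sqr_ge0//.
by rewrite -real_normK ?num_real// ler_sqr ?nnegrE// (le_trans _ hz).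
Qed.

End LinearFunctional.

(** * Polynomials in time with bivariate coefficients *)

Section TimePolynomial.
Context {R : realType}.
Local Notation bp := {poly {poly R}}.
Implicit Types (P : {poly bp}) (L : bp -> R).

Definition tpoly L P : {poly R} := \poly_(i < size P) L P`_i.
(** The time integral taken coefficient by coefficient. It commutes with every linear functional
    ([pint_tpoly]), which takes the place of Fubini's theorem. *)
Definition tint (a b : R) P : bp := \sum_(i < size P) cst2 (pint a b 'X^i) * P`_i.

Lemma lin2_horner L P s : lin2 L -> L P.[cst2 s] = (tpoly L P).[s].
Proof.
move=> hL; rewrite horner_coef lin2_sum// horner_poly.
by apply: eq_bigr => i _; rewrite -cst2X mulrC hL.2 mulrC.
Qed.

Lemma pint_tpoly L a b P : lin2 L -> pint a b (tpoly L P) = L (tint a b P).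
Proof.
move=> hL; rewrite /tpoly poly_def /tint lin2_sum//.
elim/big_rec2 : _ => [|i y1 y2 _ <-]; first by rewrite pint0.
by rewrite pintD pintZ hL.2 mulrC.
Qed.

Lemma coef_tpoly L P i : lin2 L -> (tpoly L P)`_i = L P`_i.
Proof.
by move=> hL; rewrite coef_poly; case: ltnP => // h; rewrite nth_default// lin2_0.
Qed.

Lemma tpoly_deriv L P : lin2 L -> tpoly L P^`() = (tpoly L P)^`().
Proof.
by move=> hL; apply/polyP => i; rewrite coef_tpoly// !coef_deriv coef_tpoly// lin2_Mn.
Qed.

Lemma tpoly_sqr z P : tpoly (ev2^~ z) (P ^+ 2) = tpoly (ev2^~ z) P ^+ 2.
Proof.
apply/eqP; rewrite -subr_eq0; apply/eqP; apply: (@poly_eq0_itv _ 0 1) => // x _.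
rewrite !poly_evalE -!lin2_horner; try exact: lin2_ev2.
by rewrite horner_exp ev2X subrr.
Qed.

(** The class of integrands in time on which [TI] is linear and monotone with no integrability side
    condition. *)
Definition polyfun (f : R -> R) := exists r : {poly R}, forall s, f s = r.[s].

Lemma polyfun_lin L P : lin2 L -> polyfun (fun s => L P.[cst2 s]).
Proof. by move=> hL; exists (tpoly L P) => s; exact: lin2_horner. Qed.
Lemma polyfunD f g : polyfun f -> polyfun g -> polyfun (fun s => f s + g s).
Proof. by move=> [p hp] [r hr]; exists (p + r) => s; rewrite hornerD hp hr. Qed.
Lemma polyfunZ c f : polyfun f -> polyfun (fun s => c * f s).
Proof. by move=> [p hp]; exists (c *: p) => s; rewrite hornerZ hp. Qed.
Lemma polyfunN f : polyfun f -> polyfun (fun s => - f s).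
Proof. by move=> [p hp]; exists (- p) => s; rewrite hornerN hp. Qed.
Lemma polyfun_cst c : polyfun (fun=> c).
Proof. by exists c%:P => s; rewrite hornerC. Qed.
Lemma polyfun_sum (I : Type) (r : seq I) (C : pred I) (F : I -> R -> R) :
  (forall i, polyfun (F i)) -> polyfun (fun s => \sum_(i <- r | C i) F i s).
Proof.
move=> h; elim: r => [|i r IH].
  by under eq_fun do rewrite big_nil; exact: polyfun_cst.
under eq_fun do rewrite big_cons.
by case: (C i) => //; exact: polyfunD.
Qed.

Definition tpath (F : R -> bp) := exists P, forall s, F s = P.[cst2 s].

Lemma tpath_horner P : tpath (fun s => P.[cst2 s]). Proof. by exists P. Qed.
Lemma tpath_cst Q : tpath (fun=> Q). Proof. by exists Q%:P => s; rewrite hornerC. Qed.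
Lemma tpathD F G : tpath F -> tpath G -> tpath (fun s => F s + G s).
Proof. by move=> [p hp] [r hr]; exists (p + r) => s; rewrite hornerD hp hr. Qed.
Lemma tpathM F G : tpath F -> tpath G -> tpath (fun s => F s * G s).
Proof. by move=> [p hp] [r hr]; exists (p * r) => s; rewrite hornerM hp hr. Qed.
Lemma tpathN F : tpath F -> tpath (fun s => - F s).
Proof. by move=> [p hp]; exists (- p) => s; rewrite hornerN hp. Qed.
Lemma tpathX F n : tpath F -> tpath (fun s => F s ^+ n).
Proof. by move=> [p hp]; exists (p ^+ n) => s; rewrite horner_exp hp. Qed.

Lemma horner_map_add (d : bp -> bp) P s : d 0 = 0 -> (forall P0 Q : bp, d (P0 + Q) = d P0 + d Q) ->
  (forall Q, d (cst2 s * Q) = cst2 s * d Q) -> d P.[cst2 s] = (map_poly d P).[cst2 s].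
Proof.
move=> d0 dD dZ; elim/poly_ind: P => [|P Q IH]; first by rewrite map_poly0 !horner0.
have -> : map_poly d (P * 'X + Q%:P) = map_poly d P * 'X + (d Q)%:P.
  apply/polyP => i; rewrite coefD coef_map_id0// coefD !coefMX !coefC.
  by case: i => [|i] /=; rewrite ?add0r ?addr0 ?coef_map_id0.
by rewrite !hornerE dD mulrC dZ IH mulrC.
Qed.

Lemma dx_horner P s : dx P.[cst2 s] = (map_poly dx P).[cst2 s].
Proof.
apply: horner_map_add => [|P0 Q|Q]; rewrite ?dxD//.
  by rewrite /dx map_poly0.
by rewrite dxM dx_cst mul0r add0r.
Qed.

Lemma dy_horner P s : dy P.[cst2 s] = (map_poly dy P).[cst2 s].
Proof.
apply: horner_map_add => [|P0 Q|Q]; rewrite ?dyD//.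
  by rewrite /dy deriv0.
by rewrite dyM dy_cst mul0r add0r.
Qed.

Lemma tpath_dx F : tpath F -> tpath (fun s => dx (F s)).
Proof. by move=> [p hp]; exists (map_poly dx p) => s; rewrite hp dx_horner. Qed.
Lemma tpath_dy F : tpath F -> tpath (fun s => dy (F s)).
Proof. by move=> [p hp]; exists (map_poly dy p) => s; rewrite hp dy_horner. Qed.
Lemma polyfun_tpath L F : lin2 L -> tpath F -> polyfun (fun s => L (F s)).
Proof.
by move=> hL [P hP]; under eq_fun do rewrite hP; exact: polyfun_lin.
Qed.

Variables (a b : R).
Hypothesis ab : a < b.

Lemma TI_pint f r : (forall s, f s = r.[s]) -> TI a b f = pint a b r.
Proof. by move=> h; rewrite -TI_horner//; congr TI; apply/funext. Qed.
Lemma TI_D f g : polyfun f -> polyfun g -> TI a b (fun s => f s + g s) = TI a b f + TI a b g.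
Proof.
move=> [p hp] [r hr]; rewrite (TI_pint hp) (TI_pint hr) -pintD; apply: TI_pint => s.
by rewrite hornerD hp hr.
Qed.
Lemma TI_Z c f : polyfun f -> TI a b (fun s => c * f s) = c * TI a b f.
Proof.
move=> [p hp]; rewrite (TI_pint hp) -pintZ; apply: TI_pint => s.
by rewrite hornerZ hp.
Qed.
Lemma TI_le f g : polyfun f -> polyfun g -> (forall s, a <= s <= b -> f s <= g s) ->
  TI a b f <= TI a b g.
Proof.
move=> [p hp] [r hr] h; rewrite (TI_pint hp) (TI_pint hr); apply: pint_le; first exact: ltW.
by move=> s /h; rewrite hp hr.
Qed.
Lemma TI_ge0 f : (forall s, a <= s <= b -> 0 <= f s) -> 0 <= TI a b f.
Proof.
move=> h; apply: Rintegral_ge0 => x /=; rewrite in_itv /= => /andP[ax xb].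
by apply: h; rewrite (ltW ax).
Qed.
Lemma TI_sum (I : Type) (r : seq I) (C : pred I) (F : I -> R -> R) :
  (forall i, polyfun (F i)) ->
  TI a b (fun s => \sum_(i <- r | C i) F i s) = \sum_(i <- r | C i) TI a b (F i).
Proof.
move=> h; elim: r => [|i r IH].
  rewrite big_nil -[RHS](pint0 a b); apply: TI_pint => s.
  by rewrite big_nil horner0.
have -> : (fun s => \sum_(j <- i :: r | C j) F j s) =
   fun s => (if C i then F i s else 0) + \sum_(j <- r | C j) F j s.
  by apply/funext => s; rewrite big_cons; case: ifP; rewrite ?add0r.
rewrite big_cons; case: (C i).
  by rewrite TI_D ?IH//; exact: polyfun_sum.
by rewrite -IH; congr TI; apply/funext => s; rewrite add0r.
Qed.

Lemma TI_eq f g : (forall s, f s = g s) -> TI a b f = TI a b g.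
Proof. by move=> h; congr TI; apply/funext. Qed.

Lemma TI_FTC L P : lin2 L ->
  TI a b (fun s => L P^`().[cst2 s]) = L P.[cst2 b] - L P.[cst2 a].
Proof.
move=> hL; rewrite (TI_pint (fun s => lin2_horner P^`() s hL)) tpoly_deriv//.
by rewrite pint_deriv !lin2_horner.
Qed.

Lemma size_tpoly L P : (size (tpoly L P) <= size P)%N.
Proof. exact: size_poly. Qed.

(** At a fixed point [z] this is the scalar estimate for the polynomial [s -> P(s)(z)]. As the time
    integral is a bivariate polynomial evaluated at [z], the pointwise inequality passes through the
    positive functional. *)
Lemma TI_endpoint xm (L : plf xm) q P c : (size P <= q.+1)%N -> c = a \/ c = b ->
  (b - a) * L (P.[cst2 c] ^+ 2) <=
  6 * q.+1%:R ^+ 2 * TI a b (fun s => L (P.[cst2 s] ^+ 2)).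
Proof.
move=> sP hc; have hL := plf_lin L.
have E s : L (P.[cst2 s] ^+ 2) = (tpoly L (P ^+ 2)).[s].
  by rewrite -lin2_horner// horner_exp.
rewrite (TI_pint E) pint_tpoly// -!plfZ; apply: plf_le => z _; rewrite !ev2E.
rewrite -(pint_tpoly _ _ _ (lin2_ev2 z)) tpoly_sqr -!expr2 (lin2_horner _ _ (lin2_ev2 z)).
by apply: endpoint_inverse => //; apply: leq_trans (size_tpoly _ _) sP.
Qed.

Lemma TI_inverse xm (L : plf xm) q P : (size P <= q.+1)%N ->
  (b - a) ^+ 2 * TI a b (fun s => L (P^`().[cst2 s] ^+ 2)) <=
  4 * q.+1%:R ^+ 4 * TI a b (fun s => L (P.[cst2 s] ^+ 2)).
Proof.
move=> sP; have hL := plf_lin L.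
have E (r : {poly bp}) s : L (r.[cst2 s] ^+ 2) = (tpoly L (r ^+ 2)).[s].
  by rewrite -lin2_horner// horner_exp.
rewrite (TI_pint (E P)) (TI_pint (E P^`())) !pint_tpoly// -!plfZ.
apply: plf_le => z _; rewrite !ev2E.
rewrite -!(pint_tpoly _ _ _ (lin2_ev2 z)) !tpoly_sqr (tpoly_deriv _ (lin2_ev2 z)).
by apply: time_inverse => //; apply: leq_trans (size_tpoly _ _) sP.
Qed.

End TimePolynomial.

(** * Geometry of triangles and parallelograms *)

Section CellGeometry.
Context {R : realType}.
Local Notation pt := (R * R)%type.
Implicit Types (e : pt * pt) (z w d : pt) (c : @polygon R).

(** Twice a signed area: positive on the left of the directed edge, which is the inner side for a
    counterclockwise cell. *)
Definition lf e z : R := cross (e.2 - e.1) (z - e.1).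

Lemma lfE e z :
  lf e z = (e.2.1 - e.1.1) * (z.2 - e.1.2) - (e.2.2 - e.1.2) * (z.1 - e.1.1).
Proof. by []. Qed.

Lemma lf_point_on e e' s : lf e' (point_on e s) = (1 - s) * lf e' e.1 + s * lf e' e.2.
Proof. by rewrite !lfE /point_on /=; ring. Qed.

Lemma lf_point_on_self e s : lf e (point_on e s) = 0.
Proof. by rewrite !lfE /point_on /=; ring. Qed.

(** The interface through which cells are used from here on; triangles and parallelograms are told
    apart only where it is established. [gc_cycle] expresses that the edges close up, and [gc_cross]
    that a vertical line through the cell that misses the vertices crosses an edge. *)
Record good_cell c : Prop := GoodCell {
  gc_uniq : uniq (edges c);
  gc_ndeg : forall e, e \in edges c -> e.1 != e.2;
  gc_strict : forall e e', e \in edges c -> e' \in edges c -> e != e' ->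
    forall s, 0 < s < 1 -> 0 < lf e' (point_on e s);
  gc_bd : bd (cell c) = [set z | exists2 e, e \in edges c & segment e z];
  gc_cycle : forall f : pt -> R, \sum_(e <- edges c) (f e.2 - f e.1) = 0;
  gc_cross : forall z, cell c z -> (forall e, e \in edges c -> e.1.1 != z.1) ->
    exists2 e, e \in edges c & (e.1.1 < z.1 < e.2.1) || (e.2.1 < z.1 < e.1.1);
  gc_vertex : forall e, e \in edges c -> exists2 e', e' \in edges c & e'.1 = e.2;
  gc_bounded : exists B, forall z, cell c z -> `|z.1| <= B /\ `|z.2| <= B }.

Lemma continuous_fst_pt : continuous (fun z : pt => z.1).
Proof. by move=> z; exact: cvg_fst. Qed.
Lemma continuous_snd_pt : continuous (fun z : pt => z.2).
Proof. by move=> z; exact: cvg_snd. Qed.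

Lemma continuous_lf e : continuous (lf e).
Proof.
move=> z; apply: cvgB; apply: cvgM; try exact: cvg_cst.
  by apply: cvgB; [exact: continuous_snd_pt|exact: cvg_cst].
by apply: cvgB; [exact: continuous_fst_pt|exact: cvg_cst].
Qed.

Lemma continuous_line z d : continuous (fun r : R => (z.1 + r * d.1, z.2 + r * d.2) : pt).
Proof.
move=> r.
have c1 : (fun t : R => z.1 + t * d.1) @ r --> z.1 + r * d.1.
  by apply: cvgD; [exact: cvg_cst|apply: cvgM; [exact: cvg_id|exact: cvg_cst]].
have c2 : (fun t : R => z.2 + t * d.2) @ r --> z.2 + r * d.2.
  by apply: cvgD; [exact: cvg_cst|apply: cvgM; [exact: cvg_id|exact: cvg_cst]].
exact: cvg_pair c1 c2.
Qed.

Lemma open_cell c : open (cell c).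
Proof.
rewrite /cell; elim: (edges c) => [|e r IH].
  by rewrite [X in open X](_ : _ = setT) ?seteqP; [exact: openT|].
have -> : [set z | forall e0, e0 \in e :: r -> 0 < cross (e0.2 - e0.1) (z - e0.1)] =
    [set z | 0 < lf e z] `&` [set z | forall e0, e0 \in r -> 0 < cross (e0.2 - e0.1) (z - e0.1)].
  apply/seteqP; split=> z /=.
    by move=> h; split=> [|e0 h0]; apply: h; rewrite in_cons ?eqxx ?h0 ?orbT.
  by move=> [h1 h2] e0; rewrite in_cons => /predU1P[->//|]; exact: h2.
apply: openI IH; apply: (@open_comp _ _ (lf e) [set r | 0 < r]); last exact: open_gt.
by move=> z _; exact: continuous_lf.
Qed.

Lemma closure_cell_le c z : closure (cell c) z -> forall e, e \in edges c -> 0 <= lf e z.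
Proof.
move=> hz e he; have : closure [set w | 0 <= lf e w] z.
  by apply: closure_subset hz => w hw; exact/ltW/hw.
have cl : closed [set w | 0 <= lf e w].
  apply: (@closed_comp _ _ (lf e) [set r | 0 <= r]); last exact: closed_ge.
  by move=> w _; exact: continuous_lf.
by rewrite -(closure_id _).1.
Qed.

(** A point of an edge is a limit of the cell, since a small move towards the interior point [m]
    makes all edge functions positive. Conversely, a limit point at which no edge function vanishes
    belongs to the open cell. *)
Lemma bd_cell_of c m : cell c m ->
  (forall e e', e \in edges c -> e' \in edges c -> 0 <= lf e' e.1 /\ 0 <= lf e' e.2) ->
  (forall z e, (forall e', e' \in edges c -> 0 <= lf e' z) -> e \in edges c -> lf e z = 0 ->
     exists2 e', e' \in edges c & segment e' z) ->
  bd (cell c) = [set z | exists2 e, e \in edges c & segment e z].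
Proof.
move=> cm hv hs; have oc : open (cell c) by exact: open_cell.
apply/seteqP; split=> z.
  move=> [cz nz]; have h0 := closure_cell_le cz.
  have [[e [he ez]]|n] := pselect (exists e, e \in edges c /\ lf e z = 0).
    exact: hs ez.
  exfalso; apply: nz; rewrite (interior_id _).1// => e he.
  rewrite lt_neqAle (h0 _ he) andbT eq_sym; apply/eqP => h; apply: n.
  by exists e; split.
move=> [e he [s]]; rewrite /= in_itv /= => /andP[s0 s1] zE; split; last first.
  by move=> /interior_subset /(_ e he); rewrite -/(lf _ _) -zE lf_point_on_self ltxx.
move=> B hB.
have h0 e' : e' \in edges c -> 0 <= lf e' z.
  move=> he'; have [h1 h2] := hv _ _ he he'; rewrite -zE lf_point_on addr_ge0 ?mulr_ge0//.
  by rewrite subr_ge0.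
pose d : pt := (m.1 - z.1, m.2 - z.2).
have /= := @continuous_line z d 0 B; rewrite !mul0r !addr0.
have -> : (z.1, z.2) = z by case: (z).
move=> /(_ hB) /nbhs_ballP[r /= r0 hr].
pose t := Num.min (r / 2) 1.
have t0 : 0 < t by rewrite lt_min ltr01 divr_gt0.
have t1 : t <= 1 by rewrite ge_min lexx orbT.
exists (z.1 + t * d.1, z.2 + t * d.2); split.
  move=> e' he'; rewrite -/(lf _ _).
  have -> : lf e' (z.1 + t * d.1, z.2 + t * d.2) = (1 - t) * lf e' z + t * lf e' m.
    by rewrite !lfE /d /=; ring.
  have cm' : 0 < lf e' m := cm _ he'.
  have h1 := h0 _ he'; have t2 : 0 <= 1 - t by rewrite subr_ge0.
  by apply: ltr_wpDl; [exact: mulr_ge0|exact: mulr_gt0].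
apply: hr; rewrite /ball /= sub0r normrN gtr0_norm//.
by rewrite gt_min ltr_pdivrMr// ltr_pMr// ltr1n.
Qed.

Lemma segmentP e z s : 0 <= s <= 1 -> z.1 = e.1.1 + s * (e.2.1 - e.1.1) ->
  z.2 = e.1.2 + s * (e.2.2 - e.1.2) -> segment e z.
Proof.
by move=> hs h1 h2; exists s; rewrite /= ?in_itv//= /point_on -h1 -h2; case: (z).
Qed.

Lemma good_triangle c : is_triangle c -> good_cell c.
Proof.
move=> [[a1 a2] [[b1 b2] [[d1 d2] [-> D0]]]].
have E : edges [:: (a1, a2); (b1, b2); (d1, d2)] =
  [:: ((a1, a2), (b1, b2)); ((b1, b2), (d1, d2)); ((d1, d2), (a1, a2))] by [].
have {}D0 : 0 < (b1 - a1) * (d2 - a2) - (b2 - a2) * (d1 - a1) := D0.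
set D := _ - _ in D0.
have cellE z : cell [:: (a1, a2); (b1, b2); (d1, d2)] z <->
   [/\ 0 < lf ((a1, a2), (b1, b2)) z, 0 < lf ((b1, b2), (d1, d2)) z &
     0 < lf ((d1, d2), (a1, a2)) z].
  rewrite /cell E; split=> [h|[h1 h2 h3] e].
    by split; apply: h; rewrite !inE eqxx ?orbT.
  by rewrite !inE => /or3P[] /eqP ->.
(* Divided by [D], the three edge functions are the barycentric coordinates. *)
have bary z : D * z.1 = lf ((b1, b2), (d1, d2)) z * a1 + lf ((d1, d2), (a1, a2)) z * b1 +
    lf ((a1, a2), (b1, b2)) z * d1 /\ D * z.2 = lf ((b1, b2), (d1, d2)) z * a2 +
    lf ((d1, d2), (a1, a2)) z * b2 + lf ((a1, a2), (b1, b2)) z * d2.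
  by rewrite !lfE /D /=; split; ring.
have sumD z : lf ((b1, b2), (d1, d2)) z + lf ((d1, d2), (a1, a2)) z +
    lf ((a1, a2), (b1, b2)) z = D by rewrite !lfE /D /=; ring.
split.
- rewrite E /= !inE !andbT !negb_or -!andbA /=.
  apply/and3P; split; apply/eqP => -[]; move=> *; subst; move: D0; rewrite /D; lra.
- move=> e; rewrite E !inE => /or3P[] /eqP -> /=; apply/eqP => -[]; move=> *; subst;
    move: D0; rewrite /D; lra.
- move=> e e'; rewrite E !inE => /or3P[] /eqP -> /or3P[] /eqP -> //= h s /andP[s0 s1];
    rewrite ?eqxx// in h; rewrite lfE /point_on /=; move: D0; rewrite /D; nra.
- apply: (@bd_cell_of _ ((a1 + b1 + d1) / 3, (a2 + b2 + d2) / 3)).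
  + by apply/cellE; rewrite !lfE /=; move: D0; rewrite /D; split; lra.
  + move=> e e'; rewrite E !inE => /or3P[] /eqP -> /or3P[] /eqP ->;
      rewrite !lfE /=; move: D0; rewrite /D; split; lra.
  move=> z e h0; have h1 : 0 <= lf ((a1, a2), (b1, b2)) z by apply: h0; rewrite E !inE eqxx.
  have h2 : 0 <= lf ((b1, b2), (d1, d2)) z by apply: h0; rewrite E !inE eqxx orbT.
  have h3 : 0 <= lf ((d1, d2), (a1, a2)) z by apply: h0; rewrite E !inE eqxx !orbT.
  have [B1 B2] := bary z; have S := sumD z.
  have Dn : D != 0 by rewrite gt_eqF.
  have bd01 r : 0 <= r -> r <= D -> 0 <= r / D <= 1.
    by move=> r0 r1; rewrite divr_ge0 ?(ltW D0)//= ler_pdivrMr// mul1r.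
  rewrite E !inE => /or3P[] /eqP -> hz.
  + exists ((a1, a2), (b1, b2)); first by rewrite !inE eqxx.
    apply: (@segmentP _ _ (lf ((d1, d2), (a1, a2)) z / D)) => /=; first by apply: bd01; lra.
      by apply: (mulfI Dn); rewrite B1 -S hz; field; rewrite -?S hz in Dn *; rewrite ?addr0 in Dn *.
    by apply: (mulfI Dn); rewrite B2 -S hz; field; rewrite -?S hz in Dn *; rewrite ?addr0 in Dn *.
  + exists ((b1, b2), (d1, d2)); first by rewrite !inE eqxx orbT.
    apply: (@segmentP _ _ (lf ((a1, a2), (b1, b2)) z / D)) => /=; first by apply: bd01; lra.
      by apply: (mulfI Dn); rewrite B1 -S hz; field; rewrite -?S hz in Dn *; rewrite ?add0r in Dn *.
    by apply: (mulfI Dn); rewrite B2 -S hz; field; rewrite -?S hz in Dn *; rewrite ?add0r in Dn *.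
  + exists ((d1, d2), (a1, a2)); first by rewrite !inE eqxx !orbT.
    apply: (@segmentP _ _ (lf ((b1, b2), (d1, d2)) z / D)) => /=; first by apply: bd01; lra.
      by apply: (mulfI Dn); rewrite B1 -S hz; field; rewrite -?S hz in Dn *; rewrite ?addr0 in Dn *.
    by apply: (mulfI Dn); rewrite B2 -S hz; field; rewrite -?S hz in Dn *; rewrite ?addr0 in Dn *.
- by move=> f; rewrite E !big_cons big_nil /=; ring.
- move=> z /cellE[h1 h2 h3] hx; have [B1 _] := bary z; have S := sumD z.
  have na : a1 != z.1 by apply: (hx ((a1, a2), (b1, b2))); rewrite E !inE eqxx.
  have nb : b1 != z.1 by apply: (hx ((b1, b2), (d1, d2))); rewrite E !inE eqxx orbT.
  have nd : d1 != z.1 by apply: (hx ((d1, d2), (a1, a2))); rewrite E !inE eqxx !orbT.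
  have i1 : ((a1, a2), (b1, b2)) \in edges [:: (a1, a2); (b1, b2); (d1, d2)] by rewrite E !inE eqxx.
  have i2 : ((b1, b2), (d1, d2)) \in edges [:: (a1, a2); (b1, b2); (d1, d2)].
    by rewrite E !inE eqxx orbT.
  (* A convex combination of the vertices cannot have all of them strictly on one side of its
     vertical line; [y = 1] and [y = -1] give the two sides. *)
  have out (y : R) : a1 * y < z.1 * y -> b1 * y < z.1 * y -> d1 * y < z.1 * y -> False.
    by move=> y1 y2 y3; move: h1 h2 h3 S B1; move: (lf _ _) (lf _ _) (lf _ _) => k1 k2 k3; nra.
  move: na nb nd; rewrite !neq_lt => /orP[] na /orP[] nb /orP[] nd.
  + by exfalso; apply: (out 1); rewrite !mulr1.
  + by exists ((b1, b2), (d1, d2)) => //=; rewrite nb nd.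
  + by exists ((a1, a2), (b1, b2)) => //=; rewrite na nb.
  + by exists ((a1, a2), (b1, b2)) => //=; rewrite na nb.
  + by exists ((a1, a2), (b1, b2)) => //=; rewrite na nb orbT.
  + by exists ((a1, a2), (b1, b2)) => //=; rewrite na nb orbT.
  + by exists ((b1, b2), (d1, d2)) => //=; rewrite nb nd orbT.
  + by exfalso; apply: (out (-1)); rewrite !mulrN1 ltrN2.
- move=> e; rewrite E !inE => /or3P[] /eqP ->.
  + by exists ((b1, b2), (d1, d2)); rewrite ?inE ?eqxx ?orbT.
  + by exists ((d1, d2), (a1, a2)); rewrite ?inE ?eqxx ?orbT.
  + by exists ((a1, a2), (b1, b2)); rewrite ?inE ?eqxx ?orbT.
- exists (`|a1| + `|b1| + `|d1| + (`|a2| + `|b2| + `|d2|)) => z /cellE[h1 h2 h3].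
  have [B1 B2] := bary z; have S := sumD z.
  have bnd (k1 k2 k3 u v w y B : R) : 0 < k1 -> 0 < k2 -> 0 < k3 ->
    k1 + k2 + k3 = D -> D * y = k1 * u + k2 * v + k3 * w -> `|u| <= B -> `|v| <= B ->
    `|w| <= B -> `|y| <= B.
    rewrite !ler_norml => p1 p2 p3 s1 s2 /andP[u1 u2] /andP[v1 v2] /andP[w1 w2].
    by apply/andP; split; rewrite -(ler_pM2l D0) s2 -s1; nra.
  have n1 := normr_ge0 a1; have n2 := normr_ge0 b1; have n3 := normr_ge0 d1.
  have m1 := normr_ge0 a2; have m2 := normr_ge0 b2; have m3 := normr_ge0 d2.
  by split; [apply: (bnd _ _ _ _ _ _ _ _ h2 h3 h1 S B1)|apply: (bnd _ _ _ _ _ _ _ _ h2 h3 h1 S B2)]; lra.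
Qed.

Lemma good_box c : is_box c -> good_cell c.
Proof.
move=> [[a1 a2] [[u1 u2] [[v1 v2] [cE D0]]]].
pose P0 : pt := (a1, a2); pose P1 : pt := (a1 + u1, a2 + u2).
pose P2 : pt := (a1 + u1 + v1, a2 + u2 + v2); pose P3 : pt := (a1 + v1, a2 + v2).
have {cE} -> : c = [:: P0; P1; P2; P3] := cE.
pose e1 : pt * pt := (P0, P1); pose e2 : pt * pt := (P1, P2).
pose e3 : pt * pt := (P2, P3); pose e4 : pt * pt := (P3, P0).
have E : edges [:: P0; P1; P2; P3] = [:: e1; e2; e3; e4] by [].
have {}D0 : 0 < u1 * v2 - u2 * v1 := D0.
set D := _ - _ in D0.
(* The affine coordinates with respect to [u] and [v], scaled by [D]: the cell is where both lie
   between 0 and [D]. *)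
pose p z := u1 * (z.2 - a2) - u2 * (z.1 - a1).
pose q z := (z.1 - a1) * v2 - (z.2 - a2) * v1.
have l1 z : lf e1 z = p z by rewrite lfE /p /=; ring.
have l2 z : lf e2 z = D - q z by rewrite lfE /q /D /=; ring.
have l3 z : lf e3 z = D - p z by rewrite lfE /p /D /=; ring.
have l4 z : lf e4 z = q z by rewrite lfE /q /=; ring.
have i1 : e1 \in edges [:: P0; P1; P2; P3] by rewrite E !inE eqxx.
have i2 : e2 \in edges [:: P0; P1; P2; P3] by rewrite E !inE eqxx orbT.
have i3 : e3 \in edges [:: P0; P1; P2; P3] by rewrite E !inE eqxx !orbT.
have i4 : e4 \in edges [:: P0; P1; P2; P3] by rewrite E !inE eqxx !orbT.
have cellE z : cell [:: P0; P1; P2; P3] z -> [/\ 0 < p z, p z < D, 0 < q z & q z < D].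
  move=> h; have := h _ i1; have := h _ i2; have := h _ i3; have := h _ i4.
  by rewrite -!/(lf _ _) l1 l2 l3 l4; split; lra.
have B1 z : D * z.1 = D * a1 + q z * u1 + p z * v1 by rewrite /D /p /q; ring.
have B2 z : D * z.2 = D * a2 + q z * u2 + p z * v2 by rewrite /D /p /q; ring.
have Dn : D != 0 by rewrite gt_eqF.
have allE (Q : pt * pt -> Prop) : Q e1 -> Q e2 -> Q e3 -> Q e4 ->
    forall e, e \in edges [:: P0; P1; P2; P3] -> Q e.
  by move=> h1 h2 h3 h4 e; rewrite E !inE => /or4P[] /eqP ->.
split.
- rewrite E /= !inE !andbT !negb_or -!andbA /=.
  repeat (apply/andP; split); apply/eqP => -[]; move=> *; move: D0; rewrite /D; nra.
- by apply: (allE); apply/eqP => -[] => *; move: D0; rewrite /D; nra.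
- move=> e e' he he'; move: e he; apply: (allE); move: e' he'; apply: (allE) => h s /andP[s0 s1]; rewrite ?eqxx// in h;
    rewrite lfE /point_on /=; move: D0; rewrite /D; nra.
- apply: (@bd_cell_of _ (a1 + (u1 + v1) / 2, a2 + (u2 + v2) / 2)).
  + by apply: (allE); rewrite -/(lf _ _) ?l1 ?l2 ?l3 ?l4 /p /q /=; move: D0; rewrite /D; lra.
  + move=> e e' he he'; move: e he; apply: (allE); move: e' he'; apply: (allE);
      rewrite !lfE /=; move: D0; rewrite /D; split; lra.
  move=> z e h0; have h1 := h0 _ i1; have h2 := h0 _ i2; have h3 := h0 _ i3.
  have h4 := h0 _ i4; rewrite l1 in h1; rewrite l2 in h2; rewrite l3 in h3; rewrite l4 in h4.
  have C1 := B1 z; have C2 := B2 z.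
  have bd01 r : 0 <= r -> r <= D -> 0 <= r / D <= 1.
    by move=> r0 r1; rewrite divr_ge0 ?(ltW D0)//= ler_pdivrMr// mul1r.
  move: e; apply: (allE); rewrite ?l1 ?l2 ?l3 ?l4 => hz.
  + exists e1 => //; apply: (@segmentP _ _ (q z / D)) => /=; first by apply: bd01; lra.
      by apply: (mulfI Dn); rewrite C1 hz; field.
    by apply: (mulfI Dn); rewrite C2 hz; field.
  + have {}hz : q z = D by lra.
    exists e2 => //; apply: (@segmentP _ _ (p z / D)) => /=; first by apply: bd01; lra.
      by apply: (mulfI Dn); rewrite C1 hz; field.
    by apply: (mulfI Dn); rewrite C2 hz; field.
  + have {}hz : p z = D by lra.
    exists e3 => //; apply: (@segmentP _ _ ((D - q z) / D)) => /=; first by apply: bd01; lra.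
      by apply: (mulfI Dn); rewrite C1 hz; field.
    by apply: (mulfI Dn); rewrite C2 hz; field.
  + exists e4 => //; apply: (@segmentP _ _ ((D - p z) / D)) => /=; first by apply: bd01; lra.
      by apply: (mulfI Dn); rewrite C1 hz; field.
    by apply: (mulfI Dn); rewrite C2 hz; field.
- by move=> f; rewrite E !big_cons big_nil /=; ring.
- move=> z /cellE[p0 pD q0 qD] hx; have C1 := B1 z.
  have na : a1 != z.1 := hx _ i1.
  have nb : a1 + u1 != z.1 := hx _ i2.
  have nc : a1 + u1 + v1 != z.1 := hx _ i3.
  have nd : a1 + v1 != z.1 := hx _ i4.
  (* All vertices cannot lie strictly on one side of the vertical line through [z]. The point is
     written as a combination of two points on opposite sides of the parallelogram, each a
     combination of two vertices. *)
  have out (y : R) : a1 * y < z.1 * y -> (a1 + u1) * y < z.1 * y ->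
      (a1 + u1 + v1) * y < z.1 * y -> (a1 + v1) * y < z.1 * y -> False.
    move=> y0 y1 y2 y3; move: p0 pD q0 qD C1; move: (p z) (q z) => k l p0 pD q0 qD C1.
    have r1 : (D * a1 + l * u1) * y < D * (z.1 * y) by nra.
    have r2 : (D * a1 + l * u1 + D * v1) * y < D * (z.1 * y) by nra.
    have r3 : (D - k) * ((D * a1 + l * u1) * y) < (D - k) * (D * (z.1 * y)).
      by rewrite ltr_pM2l ?subr_gt0.
    have r4 : k * ((D * a1 + l * u1 + D * v1) * y) < k * (D * (z.1 * y)).
      by rewrite ltr_pM2l.
    have r5 : (D - k) * ((D * a1 + l * u1) * y) + k * ((D * a1 + l * u1 + D * v1) * y) =
      D * ((D * a1 + l * u1 + k * v1) * y) by ring.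
    by move: r5; rewrite -C1; lra.
  have [ha|ha] : a1 < z.1 \/ z.1 < a1 by apply/orP; rewrite -neq_lt.
    have [hb|hb] : a1 + u1 < z.1 \/ z.1 < a1 + u1 by apply/orP; rewrite -neq_lt.
      have [hd|hd] : a1 + v1 < z.1 \/ z.1 < a1 + v1 by apply/orP; rewrite -neq_lt.
        have [hc|hc] : a1 + u1 + v1 < z.1 \/ z.1 < a1 + u1 + v1 by apply/orP; rewrite -neq_lt.
          by exfalso; apply: (out 1); rewrite !mulr1.
        by exists e2 => //=; rewrite hb hc.
      by exists e4 => //=; rewrite ha hd orbT.
    by exists e1 => //=; rewrite ha hb.
  have [hb|hb] : a1 + u1 < z.1 \/ z.1 < a1 + u1 by apply/orP; rewrite -neq_lt.
    by exists e1 => //=; rewrite ha hb orbT.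
  have [hd|hd] : a1 + v1 < z.1 \/ z.1 < a1 + v1 by apply/orP; rewrite -neq_lt.
    by exists e4 => //=; rewrite ha hd.
  have [hc|hc] : a1 + u1 + v1 < z.1 \/ z.1 < a1 + u1 + v1 by apply/orP; rewrite -neq_lt.
    by exists e2 => //=; rewrite hb hc orbT.
  by exfalso; apply: (out (-1)); rewrite !mulrN1 ltrN2.
- by apply: (allE); [exists e2|exists e3|exists e4|exists e1].
- exists (`|a1| + `|u1| + `|v1| + (`|a2| + `|u2| + `|v2|)) => z /cellE[p0 pD q0 qD].
  have bnd (k l u v a y B : R) : 0 < k -> k < D -> 0 < l -> l < D ->
      D * y = D * a + k * u + l * v -> `|a| + `|u| + `|v| <= B -> `|y| <= B.
    move=> k0 k1 l0 l1' s h; rewrite -(ler_pM2l D0) -{1}(gtr0_norm D0) -normrM s.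
    apply: le_trans (ler_normD _ _) _; apply: le_trans (lerD (ler_normD _ _) (lexx _)) _.
    rewrite !normrM (gtr0_norm D0) (gtr0_norm k0) (gtr0_norm l0).
    have n1 := normr_ge0 u; have n2 := normr_ge0 v; have n3 := normr_ge0 a.
    by apply: (@le_trans _ _ (D * (`|a| + `|u| + `|v|))); [nra|rewrite ler_pM2l].
  have n1 := normr_ge0 a1; have n2 := normr_ge0 u1; have n3 := normr_ge0 v1.
  have m1 := normr_ge0 a2; have m2 := normr_ge0 u2; have m3 := normr_ge0 v2.
  by split; [apply: (bnd _ _ _ _ _ _ _ q0 qD p0 pD (B1 z))|
    apply: (bnd _ _ _ _ _ _ _ q0 qD p0 pD (B2 z))]; lra.
Qed.

End CellGeometry.

(** * Integration of polynomials over a cell *)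

Section CellIntegral.
Context {R : realType}.
Local Notation pt := (R * R)%type.
Local Notation mu := (@lebesgue_measure R).
Local Notation mT := (measurableTypeR R).
Implicit Types (Q : {poly {poly R}}) (c : @polygon R).

Definition mu2 : {measure set (mT * mT)%type -> \bar R} := (mu \x mu)%E.

Lemma leb2E : @leb2 R = mu2. Proof. by []. Qed.

Lemma measurable_lf e : measurable_fun setT (lf e : mT * mT -> mT).
Proof.
rewrite (_ : lf e = fun z => (e.2.1 - e.1.1) * (z.2 - e.1.2) - (e.2.2 - e.1.2) * (z.1 - e.1.1))//.
apply: measurable_funB; apply: measurable_funM => //; apply: measurable_funB => //.
Qed.

Lemma measurable_cell c : measurable (cell c : set (mT * mT)).
Proof.
rewrite /cell; elim: (edges c) => [|e r IH].
  by rewrite [X in measurable X](_ : _ = setT)//; apply/seteqP; split.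
have -> : [set z | forall e0, e0 \in e :: r -> 0 < cross (e0.2 - e0.1) (z - e0.1)] =
    (lf e @^-1` `]0, +oo[%classic) `&` [set z | forall e0, e0 \in r -> 0 < cross (e0.2 - e0.1) (z - e0.1)].
  apply/seteqP; split=> z /=.
    by move=> h; split=> [|e0 h0]; [rewrite in_itv /= andbT|]; apply: h; rewrite in_cons ?eqxx ?h0 ?orbT.
  by rewrite in_itv /= andbT => -[h1 h2] e0; rewrite in_cons => /predU1P[->//|]; exact: h2.
apply: measurableI IH; rewrite -[X in measurable X]setTI.
exact: measurable_lf.
Qed.

Lemma ev2_coef Q (z : pt) : ev2 Q z = \sum_(j < size Q) (Q`_j).[z.1] * z.2 ^+ j.
Proof.
rewrite /ev2 (horner_coef Q) horner_sum; apply: eq_bigr => j _.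
by rewrite hornerM -polyC_exp hornerC.
Qed.

Lemma measurable_ev2 Q : measurable_fun setT (ev2 Q : mT * mT -> mT).
Proof.
rewrite (_ : ev2 Q = fun z => \sum_(j < size Q) (Q`_j).[z.1] * z.2 ^+ j); last first.
  by apply/funext => z; exact: ev2_coef.
apply: measurable_sum => j; apply: measurable_funM.
  apply: (@measurableT_comp _ _ _ _ _ _ (horner Q`_j : mT -> mT)) => //.
  by apply: continuous_measurable_fun => x; exact: continuous_hornerR.
exact/measurable_funX.
Qed.

Lemma bounded_ev2 Q (B : R) :
  exists C, forall z : pt, `|z.1| <= B -> `|z.2| <= B -> `|ev2 Q z| <= C.
Proof.
exists (\sum_(j < size Q) (\sum_(i < size Q`_j) `|Q`_j`_i| * B ^+ i) * B ^+ j) => z h1 h2.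
have hp (a : R) n : `|a| <= B -> `|a ^+ n| <= B ^+ n.
  by move=> h; rewrite normrX lerXn2r// nnegrE// (le_trans _ h).
rewrite ev2_coef; apply: le_trans (ler_norm_sum _ _ _) _.
apply: ler_sum => j _; rewrite normrM ler_pM ?hp//.
rewrite horner_coef; apply: le_trans (ler_norm_sum _ _ _) _.
by apply: ler_sum => i _; rewrite normrM ler_pM ?hp.
Qed.

Variable c : @polygon R.
Hypothesis gc : good_cell c.

Lemma mu2_cell_fin : (mu2 (cell c) < +oo)%E.
Proof.
have [B hB] := gc_bounded gc.
apply: (@le_lt_trans _ _ (mu2 ([set` `[- B, B]] `*` [set` `[- B, B]]))).
  apply: le_measure; rewrite ?inE; [exact: measurable_cell|exact: measurableX|].
  by move=> z /hB[]; rewrite !ler_norml /= !in_itv /= => ->.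
rewrite /mu2 /= product_measure1E//.
have fin : (mu `[(- B)%R, B]%classic < +oo)%E.
  by rewrite lebesgue_measure_itv /=; case: ifP => _; rewrite ?ltry// -EFinB ltry.
by rewrite lte_mul_pinfty// ge0_fin_numE.
Qed.

Lemma integrable_ev2 Q : mu2.-integrable (cell c) (EFin \o ev2 Q).
Proof.
have [B hB] := gc_bounded gc; have [C hC] := bounded_ev2 Q B.
apply: measurable_bounded_integrable.
- exact: measurable_cell.
- exact: mu2_cell_fin.
- by apply: measurable_funTS; exact: measurable_ev2.
- exists C; split; first by rewrite num_real.
  by move=> x Cx z /hB[h1 h2] /=; apply: le_trans (hC _ h1 h2) (ltW Cx).
Qed.

Definition cint Q : R := \int[@leb2 R]_(z in cell c) ev2 Q z.

Lemma cint_lin : lin2 cint.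
Proof.
rewrite /cint leb2E; split=> [P Q|a Q].
  rewrite -RintegralD; [|exact: measurable_cell|exact: integrable_ev2..].
  by apply: eq_Rintegral => z _; rewrite ev2D.
rewrite -RintegralZl; [|exact: measurable_cell|exact: integrable_ev2].
by apply: eq_Rintegral => z _; rewrite ev2M ev2_cst.
Qed.

Lemma cint_ge0 Q : (forall z, cell c z -> 0 <= ev2 Q z) -> 0 <= cint Q.
Proof. by move=> h; apply: Rintegral_ge0. Qed.

(** If [Q] did not vanish at some point of the cell, its square would exceed half of its value there
    on a small square of positive measure. So [Q] vanishes on an open set, and then coefficientwise,
    first in [y] and then in [x]. *)
Lemma cint_sqr_eq0 Q z0 : cell c z0 -> cint (Q ^+ 2) = 0 -> Q = 0.
Proof.
move=> cz0 h0.
have Qcell z : cell c z -> ev2 Q z = 0.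
  move=> cz; apply/eqP/negPn/negP => Qz.
  pose F (w : pt) := ev2 Q w ^+ 2; pose m := F z / 2.
  have m0 : 0 < m by rewrite divr_gt0// exprn_even_gt0.
  have cF : continuous F.
    have -> : F = fun w => (\sum_(j < size Q) (Q`_j).[w.1] * w.2 ^+ j) ^+ 2.
      by apply/funext => w; rewrite /F ev2_coef.
    move=> w; rewrite /continuous_at; under eq_fun do rewrite expr2; rewrite expr2.
    have cS : (fun w : pt => \sum_(j < size Q) (Q`_j).[w.1] * w.2 ^+ j) @ w -->
       \sum_(j < size Q) (Q`_j).[w.1] * w.2 ^+ j.
      elim: (index_enum _) => [|j s IH].
        by under eq_fun do rewrite big_nil; rewrite big_nil; exact: cvg_cst.
      under eq_fun do rewrite big_cons; rewrite big_cons; apply: cvgD IH; apply: cvgM.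
        apply: (@cvg_comp _ _ _ (fun w : pt => w.1) (horner Q`_j)); first exact: continuous_fst_pt.
        exact: continuous_hornerR.
      elim: (nat_of_ord j) => [|n IH].
        by under eq_fun do rewrite expr0; rewrite expr0; exact: cvg_cst.
      under eq_fun do rewrite exprS; rewrite exprS.
      by apply: cvgM => //; exact: continuous_snd_pt.
    exact: cvgM.
  have n1 : nbhs z (cell c) by apply: open_nbhs_nbhs; split => //; exact: open_cell.
  have n2 : nbhs z [set w | m < F w].
    have := cF z [set y | m < y]; apply; apply: open_nbhs_nbhs; split; first exact: open_gt.
    rewrite /m /=; have : 0 < F z by rewrite exprn_even_gt0.
    by lra.
  have [r /= r0 hr] := (@nbhs_ballP R (R * R)%type z _).1 (filterI n1 n2).
  pose Bx : set (mT * mT) := `](z.1 - r), (z.1 + r)[%classic `*` `](z.2 - r), (z.2 + r)[%classic.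
  have mB : measurable Bx by apply: measurableX.
  have BxP w : Bx w -> cell c w /\ m < F w.
    rewrite /Bx /= !in_itv /= => -[/andP[w1 w2] /andP[w3 w4]]; apply: hr.
    by split; rewrite /ball /= ltr_norml; apply/andP; split; lra.
  have : (m%:E * mu2 Bx <= \int[mu2]_(w in cell c) (F w)%:E)%E.
    rewrite -integral_cst//; apply: (@le_trans _ _ (\int[mu2]_(w in Bx) (F w)%:E)%E).
      apply: ge0_le_integral => //.
      - by move=> w _; rewrite lee_fin ltW.
      - by apply/measurable_EFinP; apply: measurable_funTS; apply: measurable_funX; exact: measurable_ev2.
      - by move=> w /BxP[_ /ltW]; rewrite lee_fin.
    apply: ge0_subset_integral => //.
    - exact: measurable_cell.
    - by apply/measurable_EFinP; apply: measurable_funTS; apply: measurable_funX; exact: measurable_ev2.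
    - by move=> w _; rewrite lee_fin sqr_ge0.
    - by move=> w /BxP[].
  have -> : (\int[mu2]_(w in cell c) (F w)%:E = 0)%E.
    have fin : (\int[mu2]_(w in cell c) (ev2 (Q ^+ 2) w)%:E \is a fin_num)%E.
      by apply: integrable_fin_num; [exact: measurable_cell|exact: integrable_ev2].
    have -> : (\int[mu2]_(w in cell c) (F w)%:E = \int[mu2]_(w in cell c) (ev2 (Q ^+ 2) w)%:E)%E.
      by apply: eq_integral => w _; rewrite ev2X.
    by rewrite -(fineK fin); congr (_%:E).
  apply/negP; rewrite -ltNge /mu2 /= product_measure1E//.
  have muI (a : R) : mu `](a - r)%R, (a + r)%R[%classic = (2 * r)%:E.
    rewrite lebesgue_measure_itv /= lte_fin ifT; last lra.
    by rewrite -EFinB; congr (_%:E); ring.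
  apply: (@lt_le_trans _ _ (m%:E * ((2 * r)%:E * (2 * r)%:E))%E).
    have r2 : 0 < 2 * r by rewrite mulr_gt0.
    by rewrite -!EFinM lte_fin mulr_gt0// mulr_gt0.
  by rewrite -{1}(muI z.1) -(muI z.2); exact: lexx.
have n1 : nbhs z0 (cell c) by apply: open_nbhs_nbhs; split => //; exact: open_cell.
have [r /= r0 hr] := (@nbhs_ballP R (R * R)%type z0 _).1 n1.
have h1 x : z0.1 - r < x < z0.1 + r -> slice_y Q x = 0.
  move=> /andP[x1 x2]; apply: (@poly_eq0_itv _ (z0.2 - r) (z0.2 + r)); first lra.
  move=> y /andP[y1 y2]; rewrite slice_yE; apply/Qcell/hr.
  by split; rewrite /ball /= ltr_norml; apply/andP; split; lra.
apply/polyP => j; rewrite coef0; apply: (@poly_eq0_itv _ (z0.1 - r) (z0.1 + r)); first lra.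
move=> x /h1 hx; have := congr1 (fun p : {poly R} => p`_j) hx.
by rewrite coef0 /slice_y coef_map.
Qed.

End CellIntegral.

(** * The divergence theorem in the direction y *)

Section Divergence.
Context {R : realType}.
Local Notation pt := (R * R)%type.
Local Notation mu := (@lebesgue_measure R).
Implicit Types (Q : {poly {poly R}}) (e : pt * pt).

#[local] Existing Instance ae_lebesgue_filter.

Lemma integrable_affine (a b : R) (f : R -> R) : a != 0 ->
  mu.-integrable setT (EFin \o f) -> mu.-integrable setT (EFin \o (fun x => f (a * x + b))).
Proof.
move=> a0 /integrableP[mf fi].
have maf := affine_measurable a b.
apply/integrableP; split.
  by apply: (@measurableT_comp _ _ _ _ _ _ (EFin \o f) _ (fun s => a * s + b)).
move: fi; rewrite (@ge0_integral_affine _ a b (fun x => `|(f x)%:E|%E))//; last exact: measurableT_comp.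
apply: contraTT; rewrite -!leNgt !leye_eq => /eqP ->.
by rewrite gt0_muley// lte_fin normr_gt0.
Qed.

Lemma integral_open_poly (a b : R) (p : {poly R}) : a < b ->
  (\int[mu]_(y in `]a, b[%classic) (p^`().[y])%:E = (p.[b] - p.[a])%:E)%E.
Proof.
move=> ab; have ms : measurable_fun setT (fun y : measurableTypeR R => (p^`().[y])%:E).
  apply/measurable_EFinP.
  by apply: continuous_measurable_fun => x; exact: continuous_hornerR.
rewrite integral_itv_bndo_bndc//; last exact: measurable_funTS ms.
rewrite integral_itv_obnd_cbnd//; last exact: measurable_funTS ms.
rewrite (@continuous_FTC2 _ _ (horner p))//.
- by apply: continuous_subspaceT; exact: continuous_hornerR.
- split.
  + move=> x _; apply: (@ex_derive _ _ _ x 1 (horner _)).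
  + by apply: cvg_at_right_filter; exact: continuous_hornerR.
  + by apply: cvg_at_left_filter; exact: continuous_hornerR.
- by move=> x _; rewrite derive1_horner.
Qed.

Variable c : @polygon R.
Hypothesis gc : good_cell c.
Variable Q : {poly {poly R}}.

(** [s e x] is the parameter of the point of [e] with abscissa [x], and [g e x] is the value of [Q]
    there, signed by the vertical component of the outward normal. Abscissas of vertices are
    excluded by [generic]. *)
Let w e := e.2.1 - e.1.1.
Let s e (x : R) := (x - e.1.1) / w e.
Let over e (x : R) := (e.1.1 < x < e.2.1) || (e.2.1 < x < e.1.1).
Let g e (x : R) := - Num.sg (w e) *
  (\1_(`[0, 1]%classic) (s e x) * ev2 Q (point_on e (s e x))).
Let generic (x : R) := forall e, e \in edges c -> e.1.1 != x.

Let generic2 x : generic x -> forall e, e \in edges c -> e.2.1 != x.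
Proof. by move=> gx e /(gc_vertex gc)[e' he' <-]; exact: gx. Qed.

Let sE x e : generic x -> e \in edges c -> w e != 0 ->
  [/\ (point_on e (s e x)).1 = x, over e x = (0 < s e x < 1) &
      over e x = (0 <= s e x <= 1)].
Proof.
move=> gx he w0; have n1 := gx _ he; have n2 := generic2 gx he.
have p1 : (point_on e (s e x)).1 = x.
  by rewrite /point_on /= -/(w e) /s divfK// addrC subrK.
have xE : x = e.1.1 + s e x * w e by rewrite -{1}p1.
have s0 : s e x != 0 by apply: contra_neq n1 => h; rewrite xE h mul0r addr0.
have s1 : s e x != 1 by apply: contra_neq n2 => h; rewrite xE h mul1r /w addrC subrK.
split=> //; last first.
  suff -> : (0 <= s e x <= 1) = (0 < s e x < 1).
    rewrite /over /s; case: (ltgtP (w e) 0) w0 => // hw _; rewrite /w in hw *.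
      rewrite ltr_ndivrMr ?ltr_ndivlMr// mul0r mul1r.
      rewrite (_ : (e.1.1 < x < e.2.1) = false) /=; last by apply/negP => /andP[]; lra.
      by apply/andP/andP => -[]; split; lra.
    rewrite ltr_pdivrMr ?ltr_pdivlMr// mul0r mul1r orbC.
    rewrite (_ : (e.2.1 < x < e.1.1) = false) /=; last by apply/negP => /andP[]; lra.
    by apply/andP/andP => -[]; split; lra.
  by rewrite !le_eqVlt (eq_sym 0) (negPf s0) (negPf s1).
rewrite /over /s; case: (ltgtP (w e) 0) w0 => // hw _; rewrite /w in hw *.
  rewrite ltr_ndivrMr ?ltr_ndivlMr// mul0r mul1r.
  rewrite (_ : (e.1.1 < x < e.2.1) = false) /=; last by apply/negP => /andP[]; lra.
  by apply/andP/andP => -[]; split; lra.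
rewrite ltr_pdivrMr ?ltr_pdivlMr// mul0r mul1r orbC.
rewrite (_ : (e.2.1 < x < e.1.1) = false) /=; last by apply/negP => /andP[]; lra.
by apply/andP/andP => -[]; split; lra.
Qed.

Let over_w e x : over e x -> w e != 0.
Proof. by rewrite /over /w => /orP[] /andP[h1 h2]; [rewrite gt_eqF|rewrite lt_eqF]; lra. Qed.

Let lfx e (x y : R) : (point_on e (s e x)).1 = x ->
  lf e (x, y) = w e * (y - (point_on e (s e x)).2).
Proof.
move=> h; have : lf e (point_on e (s e x)) = 0 by exact: lf_point_on_self.
by rewrite !lfE h /= /w => h2; rewrite -[LHS]subr0 -h2; ring.
Qed.

Let g_over e x : generic x -> e \in edges c -> over e x ->
  g e x = - Num.sg (w e) * ev2 Q (x, (point_on e (s e x)).2).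
Proof.
move=> gx he ov; have [p1 _ o2] := sE gx he (over_w ov).
rewrite /g indicE mem_set ?mul1r; last by rewrite /= in_itv /= -o2.
by congr (_ * ev2 _ _); rewrite -[X in (X, _)]p1; case: (point_on _ _).
Qed.

Let g_nover e x : generic x -> e \in edges c -> ~~ over e x -> g e x = 0.
Proof.
move=> gx he ov; have [w0|w0] := eqVneq (w e) 0; first by rewrite /g w0 sgr0 oppr0 mul0r.
have [_ _ o2] := sE gx he w0.
rewrite /g indicE memNset ?mul0r ?mulr0//= in_itv /= -o2; exact/negP.
Qed.

(** By convexity the vertical line crosses exactly one edge that runs to the right, at the bottom,
    and one that runs to the left, at the top. The fundamental theorem between the two crossing
    points is the claim. *)
Let slice_integral x : generic x ->
  (\int[mu]_(y in setT) ((\1_(cell c) (x, y)) * ev2 (dy Q) (x, y))%:E =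
   (\sum_(e <- edges c) g e x)%:E)%E.
Proof.
move=> gx.
have [[e0 [he0 ov0]]|none] := pselect (exists e, e \in edges c /\ over e x); last first.
  rewrite big_seq big1 => [|e he]; last first.
    by apply: g_nover => //; apply/negP => ov; apply: none; exists e.
  rewrite integral0_eq// => y _; rewrite indicE memNset ?mul0r// => /(gc_cross gc)[//|e he ov].
  by apply: none; exists e.
(* This is the direction in which [e] crosses the abscissa [x], or 0. It sums to zero around the
   closed polygon, so one crossing edge forces crossings in both directions. *)
pose sg e : R := (x < e.2.1)%R%:R - (x < e.1.1)%R%:R.
have sgE e : e \in edges c -> sg e = (if over e x then Num.sg (w e) else 0).
  move=> he; have n1 := gx _ he; have n2 := generic2 gx he; rewrite /sg /over /w.
  case: (ltgtP x e.1.1) n1 => // h1 _; case: (ltgtP x e.2.1) n2 => // h2 _ /=.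
  - by rewrite subrr.
  - by rewrite ltr0_sg ?sub0r//; lra.
  - by rewrite gtr0_sg ?subr0//; lra.
  - by rewrite subrr.
have cyc : \sum_(e <- edges c) sg e = 0 := gc_cycle gc (fun v => (x < v.1)%R%:R).
have ex_pm (b : R) : b = 1 \/ b = -1 -> exists e, [/\ e \in edges c, over e x & 0 < b * w e].
  move=> hb; apply: contrapT => no.
  have h1 e : e \in edges c -> 0 <= - b * sg e.
    move=> he; rewrite sgE//; case: ifP => ov; last by rewrite mulr0.
    have w0 := over_w ov; rewrite leNgt; apply/negP => lt0; apply: no; exists e; split=> //.
    case: (ltgtP (w e) 0) w0 lt0 => // hw _; [rewrite ltr0_sg//|rewrite gtr0_sg//];
      by case: hb => ->; nra.
  have h2 : \sum_(e <- edges c) - b * sg e = 0 by rewrite -mulr_sumr cyc mulr0.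
  have h3 : - b * sg e0 = 0.
    have := h2; rewrite (bigD1_seq e0) ?(gc_uniq gc)//= => h3.
    have : 0 <= \sum_(i <- edges c | i != e0) - b * sg i.
      by rewrite big_seq_cond sumr_ge0// => e /andP[he _]; exact: h1.
    by move: (h1 _ he0) h3; lra.
  move: h3; rewrite sgE// ov0; have w0 := over_w ov0; move/eqP; rewrite mulf_eq0 sgr_eq0 (negPf w0).
  by rewrite orbF oppr_eq0; case: hb => ->; rewrite ?oppr_eq0 oner_eq0.
have [ep [hep ovp wp]] := ex_pm 1 (or_introl erefl).
have [em [hem ovm wm]] := ex_pm (-1) (or_intror erefl).
rewrite mul1r in wp; rewrite mulN1r oppr_gt0 in wm.
pose yp := (point_on ep (s ep x)).2; pose ym := (point_on em (s em x)).2.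
have [pp op1 _] := sE gx hep (over_w ovp); have [pm om1 _] := sE gx hem (over_w ovm).
have zp : point_on ep (s ep x) = (x, yp) by rewrite -[X in (X, _)]pp /yp; case: (point_on _ _).
have zm : point_on em (s em x) = (x, ym) by rewrite -[X in (X, _)]pm /ym; case: (point_on _ _).
have neq : ep != em by apply/eqP => h; move: wp wm; rewrite h; lra.
have stp e : e \in edges c -> e != ep -> 0 < lf e (x, yp).
  by move=> he ne; rewrite -zp; apply: (gc_strict gc) => //; [rewrite eq_sym|rewrite -op1].
have stm e : e \in edges c -> e != em -> 0 < lf e (x, ym).
  by move=> he ne; rewrite -zm; apply: (gc_strict gc) => //; [rewrite eq_sym|rewrite -om1].
have ypm : yp < ym.
  have := stp _ hem; rewrite eq_sym neq => /(_ isT); rewrite (lfx _ pm) -/ym; nra.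
(* A third crossing point would lie strictly between the other two, while both of those lie on the
   inner side of its edge, that is, both above or both below it. *)
have only e : e \in edges c -> e != ep -> e != em -> ~~ over e x.
  move=> he n1 n2; apply/negP => ov; have [p o1 _] := sE gx he (over_w ov).
  pose y := (point_on e (s e x)).2.
  have z : point_on e (s e x) = (x, y) by rewrite -[X in (X, _)]p /y; case: (point_on _ _).
  have st e' : e' \in edges c -> e' != e -> 0 < lf e' (x, y).
    by move=> he' ne; rewrite -z; apply: (gc_strict gc) => //; [rewrite eq_sym|rewrite -o1].
  have := stp _ he n1; have := stm _ he n2.
  have := st _ hep; rewrite eq_sym n1 => /(_ isT).
  have := st _ hem; rewrite eq_sym n2 => /(_ isT).
  rewrite (lfx _ pm) (lfx _ pp) !(lfx _ p) -/y -/yp -/ym; have := over_w ov; rewrite neq_lt.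
  by move=> /orP[]; nra.
have sum1 a k : a \in edges c -> \sum_(e <- edges c) (e == a)%:R * k = k :> R.
  move=> ha; rewrite (bigD1_seq a) ?(gc_uniq gc)//= eqxx mul1r big1 ?addr0// => e /negPf ->.
  by rewrite mul0r.
have -> : \sum_(e <- edges c) g e x = g ep x + g em x.
  rewrite -(sum1 ep (g ep x))// -(sum1 em (g em x))// -big_split /=.
  apply: eq_big_seq => e he; have [->|n1] := eqVneq e ep.
    by rewrite (negPf neq) mul1r mul0r addr0.
  have [->|n2] := eqVneq e em; first by rewrite mul0r mul1r add0r.
  by rewrite !mul0r addr0; apply: g_nover => //; exact: only.
have sliceE y : cell c (x, y) <-> yp < y < ym.
  split=> [cy|/andP[y1 y2] e he].
    have := cy _ hep; have := cy _ hem; rewrite -!/(lf _ _) (lfx _ pm) (lfx _ pp) -/yp -/ym.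
    by move=> h1 h2; apply/andP; split; nra.
  pose th := (y - yp) / (ym - yp).
  have th01 : 0 < th < 1.
    by rewrite divr_gt0 ?subr_gt0//= ltr_pdivrMr ?subr_gt0// mul1r; lra.
  have yE : y = yp + th * (ym - yp) by rewrite divfK ?subr_eq0 ?gt_eqF// addrC subrK.
  rewrite -/(lf _ _); have -> : lf e (x, y) = (1 - th) * lf e (x, yp) + th * lf e (x, ym).
    by rewrite yE !lfE /=; ring.
  case/andP: th01 => th0 th1.
  have [eE|n1] := eqVneq e ep.
    have : 0 < lf e (x, ym) by apply: stm => //; rewrite eE.
    have -> : lf e (x, yp) = 0 by rewrite eE -zp lf_point_on_self.
    by move=> h; rewrite mulr0 add0r mulr_gt0.
  have := stp _ he n1; have [eE|n2] := eqVneq e em.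
    have -> : lf e (x, ym) = 0 by rewrite eE -zm lf_point_on_self.
    by move=> h; rewrite mulr0 addr0 mulr_gt0// subr_gt0.
  by have := stm _ he n2 => h1 h2; rewrite addr_gt0// mulr_gt0// subr_gt0.
rewrite !g_over// -/yp -/ym (gtr0_sg wp) (ltr0_sg wm) opprK mul1r mulN1r addrC.
rewrite -!slice_yE -(integral_open_poly _ ypm) [RHS]integral_mkcond.
apply: eq_integral => y _; rewrite patchE indicE slice_y_deriv slice_yE.
case: ifPn => [|/negP]; rewrite inE /= in_itv /= => hy.
  by rewrite mem_set ?mul1r//; exact/sliceE.
by rewrite memNset ?mul0r// => /sliceE h; apply: hy.
Qed.

Let h01 e (r : R) := \1_(`[0, 1]%classic) r * ev2 Q (point_on e r).

Lemma bmf_ev2_point_on e : bmf (fun r => ev2 Q (point_on e r)).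
Proof.
split.
  apply: (@measurableT_comp _ _ _ _ _ _ (ev2 Q : measurableTypeR R * measurableTypeR R -> measurableTypeR R)).
    exact: measurable_ev2.
  apply/measurable_fun_pairP; split => /=.
    rewrite (_ : _ \o _ = fun r => (e.2.1 - e.1.1) * r + e.1.1); first exact: affine_measurable.
    by apply/funext => r /=; rewrite addrC mulrC.
  rewrite (_ : _ \o _ = fun r => (e.2.2 - e.1.2) * r + e.1.2); first exact: affine_measurable.
  by apply/funext => r /=; rewrite addrC mulrC.
pose B : R := `|e.1.1| + `|e.2.1 - e.1.1| + (`|e.1.2| + `|e.2.2 - e.1.2|).
have [C hC] := bounded_ev2 Q B; exists C => r /andP[r0 r1].
have hb (a b : R) : `|a + r * b| <= `|a| + `|b|.
  apply: le_trans (ler_normD _ _) _; rewrite lerD2l normrM ler_piMl//.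
  by rewrite ger0_norm.
apply: hC; apply: (le_trans (hb _ _)); rewrite /B.
  by rewrite lerDl addr_ge0.
by rewrite lerDr addr_ge0.
Qed.

Let g_integral e : mu.-integrable setT (EFin \o g e) /\
  \int[mu]_x g e x = - w e * E01 (fun r => ev2 Q (point_on e r)).
Proof.
have hi := bmf_integrableT (bmf_ev2_point_on e).
have [w0|w0] := eqVneq (w e) 0.
  have g0 : g e = fun=> 0 by apply/funext => x; rewrite /g w0 sgr0 oppr0 mul0r.
  rewrite g0 w0 oppr0 mul0r; split; last by rewrite Rintegral_cst//= mul0r.
  exact: integrable0.
have iw : (w e)^-1 != 0 by rewrite invr_eq0.
have gE : g e = fun x => - Num.sg (w e) * h01 e ((w e)^-1 * x + - e.1.1 / w e).
  apply/funext => x; rewrite /g /h01 /s.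
  by have -> : (w e)^-1 * x + - e.1.1 / w e = (x - e.1.1) / w e by ring.
have ii := integrable_affine (- e.1.1 / w e) iw hi.
split.
  rewrite gE; apply: eq_integrable (integrableZl measurableT (- Num.sg (w e)) ii) => //.
rewrite gE RintegralZl// E01_mkT (Rintegral_affine (- e.1.1 / w e) iw hi).
rewrite -/(h01 e) mulrA; congr (_ * _).
rewrite normfV mulNr; congr (- _).
by rewrite {2}[w e]numEsg mulfK// normr_eq0.
Qed.

(** Fubini reduces the claim to vertical slices, valid for all abscissas except those of vertices.
    Each edge term is then brought from the abscissa back to the edge parameter by an affine change
    of variable; vertical edges contribute zero. *)
Lemma divergence_y :
  cint c (dy Q) = - \sum_(e <- edges c) (e.2.1 - e.1.1) * E01 (fun r => ev2 Q (point_on e r)).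
Proof.
pose f (z : measurableTypeR R * measurableTypeR R) : \bar R := ((\1_(cell c) z) * ev2 (dy Q) z)%:E.
have fi : (@mu2 R).-integrable setT f.
  have := integrable_ev2 gc (dy Q); rewrite integrable_mkcond; last exact: measurable_cell.
  apply: eq_integrable => // z _; rewrite /f patchE indicE /=.
  by case: ifP; rewrite ?mul1r ?mul0r.
have -> : cint c (dy Q) = fine (\int[@mu2 R]_z f z)%E.
  rewrite /cint leb2E Rintegral_mkcond /Rintegral; congr fine; apply: eq_integral => z _.
  by rewrite /f patchE indicE; case: ifP; rewrite ?mul1r ?mul0r.
rewrite -integral12_prod_meas1//.
have -> : (\int[mu]_x \int[mu]_y f (x, y) =
    \int[mu]_x (\sum_(e <- edges c) g e x)%:E)%E.
  apply: ae_eq_integralT.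
  have : {ae mu, forall x, generic x}.
    rewrite /generic; elim: (edges c) => [|e r IH]; first exact: aeW.
    have : {ae mu, forall x, x <> e.1.1}.
      exists [set e.1.1]; split => //; first exact: lebesgue_measure_set1.
      by move=> x /= /contrapT.
    apply: filterS2 IH => x h1 h2 a; rewrite in_cons => /predU1P[->|]; last exact: h1.
    by apply/eqP => h3; apply: h2.
  by apply: filterS => x gx; exact: slice_integral.
transitivity (\sum_(e <- edges c) \int[mu]_x g e x); last first.
  rewrite -sumrN; apply: eq_bigr => e _; rewrite (g_integral e).2 mulNr//.
transitivity (\int[mu]_x (\sum_(e <- edges c) g e x)); first by [].
elim: (edges c) => [|e r IH].
  by rewrite big_nil; under eq_Rintegral do rewrite big_nil; rewrite Rintegral_cst//= mul0r.
under eq_Rintegral do rewrite big_cons; rewrite big_cons -IH RintegralD//.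
  exact: (g_integral e).1.
elim: r {IH} => [|a r IH].
  by under eq_fun do rewrite big_nil; exact: integrable0.
rewrite (_ : _ \o _ = (fun x => (g a x)%:E + (\sum_(e <- r) g e x)%:E)%E).
  by apply: integrableD => //; exact: (g_integral a).1.
by apply/funext => x /=; rewrite big_cons EFinD.
Qed.

End Divergence.

(** * Integrals over edges and their change of parametrisation *)

Section BoundaryIntegral.
Context {R : realType}.
Local Notation pt := (R * R)%type.
Implicit Types (e : pt * pt) (z w : pt) (S : set pt) (c : @polygon R).

(** [bd_int] integrates edge by edge, so measurability of the traces on lines is the notion that
    fits it. *)
Definition measurable_on_lines S := forall e, measurable (point_on e @^-1` S).
Definition bmf_on_lines (f : pt -> R) := forall e, bmf (fun s => f (point_on e s)).

Lemma continuous_point_on e : continuous (point_on e).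
Proof. exact: (@continuous_line R e.1 (e.2 - e.1)). Qed.

Lemma closed_measurable_on_lines S : closed S -> measurable_on_lines S.
Proof.
move=> cS e; apply: closed_measurable; apply: closed_comp => // s _.
exact: continuous_point_on.
Qed.

Lemma measurable_on_linesI S S' : measurable_on_lines S -> measurable_on_lines S' ->
  measurable_on_lines (S `&` S').
Proof. by move=> h h' e; rewrite preimage_setI; exact: measurableI. Qed.
Lemma measurable_on_linesU S S' : measurable_on_lines S -> measurable_on_lines S' ->
  measurable_on_lines (S `|` S').
Proof. by move=> h h' e; rewrite preimage_setU; exact: measurableU. Qed.
Lemma measurable_on_linesC S : measurable_on_lines S -> measurable_on_lines (~` S).
Proof. by move=> h e; rewrite -preimage_setC; exact: measurableC. Qed.
Lemma measurable_on_linesD S S' : measurable_on_lines S -> measurable_on_lines S' ->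
  measurable_on_lines (S `\` S').
Proof. by move=> h h'; rewrite setDE; apply: measurable_on_linesI => //; exact: measurable_on_linesC. Qed.
Lemma measurable_on_linesT : measurable_on_lines setT.
Proof. by move=> e; rewrite preimage_setT. Qed.
Lemma measurable_on_lines_seq (I : eqType) (r : seq I) (F : I -> set pt) :
  (forall i, measurable_on_lines (F i)) ->
  measurable_on_lines [set z | exists2 i, i \in r & F i z].
Proof.
move=> h; elim: r => [|i r IH].
  rewrite [X in measurable_on_lines X](_ : _ = set0); last by apply/seteqP; split => z // [].
  by move=> e; rewrite preimage_set0.
rewrite [X in measurable_on_lines X](_ : _ = F i `|` [set z | exists2 j, j \in r & F j z]).
  exact: measurable_on_linesU.
apply/seteqP; split => z.
  by move=> [j]; rewrite in_cons => /predU1P[->|jr] Fz; [left|right; exists j].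
by move=> [Fz|[j jr Fz]]; [exists i; rewrite ?mem_head|exists j; rewrite // in_cons jr orbT].
Qed.

Lemma closed_bd S : closed (bd S).
Proof.
rewrite /bd setDE; apply: closedI; first exact: closed_closure.
by apply: open_closedC; exact: open_interior.
Qed.

Lemma closed_segment e : closed (segment e).
Proof.
apply: compact_closed; first exact: norm_hausdorff.
apply: continuous_compact; last exact: segment_compact.
by apply: continuous_subspaceT; exact: continuous_point_on.
Qed.

Lemma measurable_bd_minus c : measurable_on_lines (bd_minus c).
Proof.
have -> : bd_minus c = [set z | exists2 e, e \in edges c &
    (segment e `&` [set z : pt | z.1 * (normal e).2 < 0]) z].
  by apply/seteqP; split => z [e]; [move=> [h1 h2 h3]|move=> h1 [h2 h3]]; exists e.
apply: measurable_on_lines_seq => e; apply: measurable_on_linesI.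
  apply: closed_measurable_on_lines; exact: closed_segment.
rewrite (_ : [set z : pt | _] = ~` [set z : pt | 0 <= z.1 * (normal e).2]); last first.
  by apply/seteqP; split => z /=; [move=> h; apply/negP; rewrite -ltNge|move/negP; rewrite -ltNge].
apply: measurable_on_linesC; apply: closed_measurable_on_lines.
apply: (@closed_comp _ _ (fun z : pt => z.1 * (normal e).2) [set r | 0 <= r]); last exact: closed_ge.
by move=> z _; apply: cvgM; [exact: continuous_fst_pt|exact: cvg_cst].
Qed.

Lemma measurable_bd_plus c : measurable_on_lines (bd_plus c).
Proof.
have -> : bd_plus c = [set z | exists2 e, e \in edges c &
    (segment e `&` [set z : pt | 0 <= z.1 * (normal e).2]) z].
  by apply/seteqP; split => z [e]; [move=> [h1 h2 h3]|move=> h1 [h2 h3]]; exists e.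
apply: measurable_on_lines_seq => e; apply: measurable_on_linesI.
  apply: closed_measurable_on_lines; exact: closed_segment.
apply: closed_measurable_on_lines.
apply: (@closed_comp _ _ (fun z : pt => z.1 * (normal e).2) [set r | 0 <= r]); last exact: closed_ge.
by move=> z _; apply: cvgM; [exact: continuous_fst_pt|exact: cvg_cst].
Qed.

Lemma bmf_indic_lines S e : measurable_on_lines S -> bmf (fun s => \1_S (point_on e s)).
Proof.
move=> mS; rewrite (_ : (fun s => _) = \1_(point_on e @^-1` S)).
  exact: bmf_indic.
by apply/funext => s; rewrite !indicE; congr (_%:R); apply/idP/idP; rewrite !inE.
Qed.

Lemma bd_intE c S f : bd_int c S f = \sum_(e <- edges c) enorm (e.2 - e.1) *
  E01 (fun s => \1_S (point_on e s) * f (normal e) (point_on e s)).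
Proof.
apply: eq_bigr => e _; congr (_ * _); rewrite E01_cond; congr E01; apply/funext => s.
Qed.

Lemma bd_int_eq_ae c S S' f f' : (forall e, e \in edges c -> ae01 (fun s =>
    \1_S (point_on e s) * f (normal e) (point_on e s) =
    \1_S' (point_on e s) * f' (normal e) (point_on e s))) ->
  bd_int c S f = bd_int c S' f'.
Proof.
move=> h; rewrite !bd_intE; apply: eq_big_seq => e he; congr (_ * _).
exact/E01_eq_ae/h.
Qed.

Definition wbmf c S (f : pt -> pt -> R) := forall e, e \in edges c ->
  bmf (fun s => \1_S (point_on e s) * f (normal e) (point_on e s)).

Lemma bd_intD c S f g : wbmf c S f -> wbmf c S g ->
  bd_int c S (fun n z => f n z + g n z) = bd_int c S f + bd_int c S g.
Proof.
move=> hf hg; rewrite !bd_intE -big_split /=; apply: eq_big_seq => e he.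
rewrite -mulrDr -E01D; [|exact: hf|exact: hg].
by congr (_ * E01 _); apply/funext => s; rewrite mulrDr.
Qed.

Lemma bd_intZ c S a f : wbmf c S f -> bd_int c S (fun n z => a * f n z) = a * bd_int c S f.
Proof.
move=> hf; rewrite !bd_intE mulr_sumr; apply: eq_big_seq => e he.
rewrite mulrCA -(E01Z a (hf _ he)).
by congr (_ * E01 _); apply/funext => s; rewrite mulrCA.
Qed.

Lemma enorm_ge0 z : 0 <= enorm z. Proof. exact: sqrtr_ge0. Qed.

Lemma bd_int_le_ae c S S' f f' : wbmf c S f -> wbmf c S' f' ->
  (forall e, e \in edges c -> ae01 (fun s =>
    \1_S (point_on e s) * f (normal e) (point_on e s) <=
    \1_S' (point_on e s) * f' (normal e) (point_on e s))) ->
  bd_int c S f <= bd_int c S' f'.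
Proof.
move=> hf hf' h; rewrite !bd_intE [leLHS]big_seq [leRHS]big_seq; apply: ler_sum => e he.
rewrite ler_wpM2l ?enorm_ge0//; apply: E01_le; [exact: hf|exact: hf'|exact: h].
Qed.

Lemma bd_int_ge0 c S f : (forall e, e \in edges c -> ae01 (fun s =>
    0 <= \1_S (point_on e s) * f (normal e) (point_on e s))) -> 0 <= bd_int c S f.
Proof.
move=> h; rewrite bd_intE big_seq; apply: sumr_ge0 => e he.
by rewrite mulr_ge0 ?enorm_ge0//; apply/E01_ge0/h.
Qed.

Lemma bd_int_sum_ae (I : Type) (r : seq I) (P : pred I) c S f (S' : I -> set pt)
    (f' : I -> pt -> pt -> R) : (forall i, wbmf c (S' i) (f' i)) ->
  (forall e, e \in edges c -> ae01 (fun s =>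
    \1_S (point_on e s) * f (normal e) (point_on e s) =
    \sum_(i <- r | P i) \1_(S' i) (point_on e s) * f' i (normal e) (point_on e s))) ->
  bd_int c S f = \sum_(i <- r | P i) bd_int c (S' i) (f' i).
Proof.
move=> hf h; under [RHS]eq_bigr do rewrite bd_intE; rewrite bd_intE exchange_big /=.
apply: eq_big_seq => e he; rewrite -mulr_sumr -E01_sum; last by move=> i _; exact: hf.
by congr (_ * _); apply/E01_eq_ae/h.
Qed.

Lemma bd_int_sum_le_ae (I : Type) (r : seq I) (P : pred I) c S f (S' : I -> set pt)
    (f' : I -> pt -> pt -> R) : wbmf c S f -> (forall i, wbmf c (S' i) (f' i)) ->
  (forall e, e \in edges c -> ae01 (fun s =>
    \sum_(i <- r | P i) \1_(S' i) (point_on e s) * f' i (normal e) (point_on e s) <=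
    \1_S (point_on e s) * f (normal e) (point_on e s))) ->
  \sum_(i <- r | P i) bd_int c (S' i) (f' i) <= bd_int c S f.
Proof.
move=> hS hf h; under eq_bigr do rewrite bd_intE; rewrite bd_intE exchange_big /=.
rewrite big_seq [leRHS]big_seq; apply: ler_sum => e he; rewrite -mulr_sumr.
rewrite ler_wpM2l ?enorm_ge0// -E01_sum; last by move=> i _; exact: hf.
apply: E01_le; [by apply: bmf_sum => i _; exact: hf|exact: hS|exact: h].
Qed.

Lemma point_on_inj e s r : e.1 != e.2 -> point_on e s = point_on e r -> s = r.
Proof.
move=> ne [h1 h2]; apply/eqP/negPn/negP => sr; move/eqP: ne; apply.
have h (a b : R) : a + s * (b - a) = a + r * (b - a) -> a = b.
  move=> h; have : (s - r) * (b - a) = 0 by rewrite mulrBl; lra.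
  by move/eqP; rewrite mulf_eq0 subr_eq0 (negPf sr) /= subr_eq0 => /eqP.
by case: e h1 h2 => -[a b] [a' b'] /= /h -> /h ->.
Qed.

Lemma segment_point_on e s : e.1 != e.2 -> segment e (point_on e s) <-> 0 <= s <= 1.
Proof.
move=> ne; split => [[r]|hs]; last by exists s => //=; rewrite in_itv.
by rewrite /= in_itv /= => hr /(point_on_inj ne) <-.
Qed.

Lemma segment_lf0 e z : segment e z -> lf e z = 0.
Proof. by move=> [s _ <-]; exact: lf_point_on_self. Qed.

Lemma dot_gt0 z : z != 0 -> 0 < dot z z.
Proof.
case: z => a b; rewrite /dot /= => h; have := sqr_ge0 a; have := sqr_ge0 b.
rewrite -!expr2 => b0 a0; rewrite lt_neqAle addr_ge0// andbT eq_sym.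
apply: contra h; rewrite paddr_eq0// !sqrf_eq0 => /andP[/eqP -> /eqP ->].
exact: eqxx.
Qed.

Lemma edge_ne0 e : e.1 != e.2 -> e.2 - e.1 != 0.
Proof. by rewrite subr_eq0 eq_sym. Qed.

Lemma lf_line e e' s : lf e' (point_on e s) = lf e' e.1 + s * cross (e'.2 - e'.1) (e.2 - e.1).
Proof. by rewrite !lfE /point_on /cross /=; ring. Qed.

Lemma collinear_param e e' : e'.1 != e'.2 -> cross (e'.2 - e'.1) (e.2 - e.1) = 0 ->
  lf e' e.1 = 0 -> exists a b, [/\ e.2.1 - e.1.1 = a * (e'.2.1 - e'.1.1),
    e.2.2 - e.1.2 = a * (e'.2.2 - e'.1.2) &
    forall s, point_on e s = point_on e' (a * s + b)].
Proof.
move=> ne c0 l0; have d0 := dot_gt0 (edge_ne0 ne).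
set D := dot _ _ in d0; have D0 : D != 0 by rewrite gt_eqF.
pose a := dot (e.2 - e.1) (e'.2 - e'.1) / D; pose b := dot (e.1 - e'.1) (e'.2 - e'.1) / D.
move: c0 l0; rewrite lfE /cross /= => c0 l0.
have a1 : e.2.1 - e.1.1 = a * (e'.2.1 - e'.1.1).
  apply: (mulIf D0); rewrite /a mulrAC divfK// /D /dot /=.
  have := congr1 ( *%R (e'.2.2 - e'.1.2)) c0; rewrite mulr0 => h; apply/eqP; rewrite eq_sym -subr_eq0 -h; apply/eqP; ring.
have a2 : e.2.2 - e.1.2 = a * (e'.2.2 - e'.1.2).
  apply: (mulIf D0); rewrite /a mulrAC divfK// /D /dot /=.
  have := congr1 ( *%R (e'.2.1 - e'.1.1)) c0; rewrite mulr0 => h; apply/eqP; rewrite -subr_eq0 -h; apply/eqP; ring.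
have b1 : e.1.1 - e'.1.1 = b * (e'.2.1 - e'.1.1).
  apply: (mulIf D0); rewrite /b mulrAC divfK// /D /dot /=.
  have := congr1 ( *%R (e'.2.2 - e'.1.2)) l0; rewrite mulr0 => h; apply/eqP; rewrite eq_sym -subr_eq0 -h; apply/eqP; ring.
have b2 : e.1.2 - e'.1.2 = b * (e'.2.2 - e'.1.2).
  apply: (mulIf D0); rewrite /b mulrAC divfK// /D /dot /=.
  have := congr1 ( *%R (e'.2.1 - e'.1.1)) l0; rewrite mulr0 => h; apply/eqP; rewrite -subr_eq0 -h; apply/eqP; ring.
exists a, b; split => // s; rewrite /point_on a1 a2; congr (_, _).
  by rewrite -[e.1.1](subrK e'.1.1) b1; ring.
by rewrite -[e.1.2](subrK e'.1.2) b2; ring.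
Qed.

Lemma enormZ (a : R) z : enorm (a * z.1, a * z.2) = `|a| * enorm z.
Proof.
rewrite /enorm -sqrtr_sqr -sqrtrM ?sqr_ge0//; congr Num.sqrt; rewrite /dot /=; ring.
Qed.

Lemma enorm_gt0 e : e.1 != e.2 -> 0 < enorm (e.2 - e.1).
Proof. by move=> ne; rewrite sqrtr_gt0 dot_gt0// edge_ne0. Qed.

Lemma normal_collinear e e' : e.1 != e.2 -> e'.1 != e'.2 ->
  cross (e'.2 - e'.1) (e.2 - e.1) = 0 ->
  `|(normal e).1| = `|(normal e').1| /\ `|(normal e).2| = `|(normal e').2|.
Proof.
move=> ne ne' c0; pose e1 : pt * pt := (e'.1, (e'.1.1 + (e.2.1 - e.1.1), e'.1.2 + (e.2.2 - e.1.2))).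
have [||a [b [a1 a2 _]]] := @collinear_param e1 e' ne'.
- by move: c0; rewrite /cross /= => <-; ring.
- by rewrite lfE /=; ring.
have {}a1 : e.2.1 - e.1.1 = a * (e'.2.1 - e'.1.1) by rewrite -a1 /=; ring.
have {}a2 : e.2.2 - e.1.2 = a * (e'.2.2 - e'.1.2) by rewrite -a2 /=; ring.
have E : enorm (e.2 - e.1) = `|a| * enorm (e'.2 - e'.1).
  by rewrite -enormZ; congr enorm; rewrite /= -a1 -a2; case: (e) => -[? ?] [? ?].
have p := enorm_gt0 ne; have p' := enorm_gt0 ne'.
have ap : `|a| != 0.
  by apply/eqP => a0; move: p; rewrite E a0 mul0r ltxx.
have q : enorm (e'.2 - e'.1) != 0 by rewrite gt_eqF.
rewrite /normal /= E a1 a2 !normrM !normrN !normrM !normfV !normrM normr_id.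
by split; field; rewrite normr_eq0 q ap.
Qed.

(** On a common line the parameters of the two edges differ by an affine map whose factor has
    modulus the ratio of the lengths. On distinct parallel lines both sides vanish. *)
Lemma edge_transport e e' (g : pt -> R) : e.1 != e.2 -> e'.1 != e'.2 -> bmf_on_lines g ->
  cross (e'.2 - e'.1) (e.2 - e.1) = 0 ->
  enorm (e.2 - e.1) * E01 (fun s => \1_(segment e') (point_on e s) * g (point_on e s)) =
  enorm (e'.2 - e'.1) * E01 (fun s => \1_(segment e) (point_on e' s) * g (point_on e' s)).
Proof.
move=> ne ne' hg c0.
have E0 f : (forall s : R, f s = 0) -> E01 f = 0.
  move=> f0; rewrite (_ : f = fun=> 0 * 0); last by apply/funext => s; rewrite f0 mul0r.
  by rewrite E01Z ?mul0r//; exact: bmf_cst.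
have [l0|l0] := eqVneq (lf e' e.1) 0; last first.
  have h1 s : ~ segment e' (point_on e s).
    by move=> /segment_lf0; rewrite lf_line c0 mulr0 addr0; apply/eqP.
  have h2 s : ~ segment e (point_on e' s).
    have c1 : cross (e.2 - e.1) (e'.2 - e'.1) = 0 by move: c0; rewrite /cross; lra.
    move=> /segment_lf0; rewrite lf_line c1 mulr0 addr0 => hl.
    have [a [b [_ _ h]]] := collinear_param ne c1 hl.
    have d0 := dot_gt0 (edge_ne0 ne').
    have a0 : a != 0.
      apply/eqP => a0; have := h 0; have := h 1; rewrite a0 !mul0r => <- /(point_on_inj ne') /eqP.
      by rewrite eq_sym oner_eq0.
    apply: (h1 0); have := h (- b / a); have -> : a * (- b / a) + b = 0 by field.
    have -> : point_on e 0 = e.1 by rewrite /point_on !mul0r !addr0; case: (e.1).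
    move=> he; move: l0; rewrite -(lf_point_on_self e' (- b / a)) he.
    by rewrite eqxx.
  by rewrite !E0 ?mulr0// => s; rewrite indicE memNset ?mul0r.
have [a [b [a1 a2 hs]]] := collinear_param ne' c0 l0.
have E : enorm (e.2 - e.1) = `|a| * enorm (e'.2 - e'.1).
  by rewrite -enormZ; congr enorm; rewrite /= -a1 -a2; case: (e) => -[? ?] [? ?].
have a0 : a != 0.
  by apply/eqP => a0; have := enorm_gt0 ne; rewrite E a0 normr0 mul0r ltxx.
have mseg f : measurable_on_lines (segment f) by apply: closed_measurable_on_lines; exact: closed_segment.
pose F r := \1_(segment e) (point_on e' r) * g (point_on e' r).
have bF : bmf F by apply: bmfM; [exact: bmf_indic_lines|exact: hg].
rewrite [in RHS]E01_mkT (Rintegral_affine b a0 (bmf_integrableT bF)) E01_mkT E.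
rewrite mulrA [_ * `|a|]mulrC; congr (_ * _); apply: eq_Rintegral => s _.
rewrite /F -hs !indicE.
have i1 : (point_on e s \in segment e') = (a * s + b \in `[0, 1]%classic).
  by apply/idP/idP; rewrite !inE /= in_itv /= hs => /(segment_point_on _ ne').
have i2 : (point_on e s \in segment e) = (s \in `[0, 1]%classic).
  by apply/idP/idP; rewrite !inE /= in_itv /= => /(segment_point_on _ ne).
by rewrite i1 i2; ring.
Qed.

Lemma edge_cross_null e e' : e.1 != e.2 -> cross (e'.2 - e'.1) (e.2 - e.1) != 0 ->
  ae01 (fun s => ~ segment e' (point_on e s)).
Proof.
move=> ne c0; apply: ae01_subset1 => s r _ _ /segment_lf0 h1 /segment_lf0 h2.
move: h1 h2; rewrite !lf_line => h1 h2.
have /eqP : (s - r) * cross (e'.2 - e'.1) (e.2 - e.1) = 0 by rewrite mulrBl; lra.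
by rewrite mulf_eq0 subr_eq0 (negPf c0) orbF => /eqP.
Qed.

(** Parallel edges have normals equal up to sign, so moduli of the components can be carried across.
    Edges that are not parallel meet in at most one point, a null set. *)
Lemma edge_transport_normal e e' (f : R -> R -> pt -> R) : e.1 != e.2 -> e'.1 != e'.2 ->
  (forall a b, bmf_on_lines (f a b)) ->
  enorm (e.2 - e.1) * E01 (fun s => \1_(segment e') (point_on e s) *
     f `|(normal e).1| `|(normal e).2| (point_on e s)) =
  enorm (e'.2 - e'.1) * E01 (fun s => \1_(segment e) (point_on e' s) *
     f `|(normal e').1| `|(normal e').2| (point_on e' s)).
Proof.
move=> ne ne' hf; have [c0|c0] := eqVneq (cross (e'.2 - e'.1) (e.2 - e.1)) 0.
  have [-> ->] := normal_collinear ne ne' c0; exact: edge_transport.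
have c1 : cross (e.2 - e.1) (e'.2 - e'.1) != 0.
  by apply: contra_neq c0; rewrite /cross; lra.
have z (f1 : R -> R) : ae01 (fun s => f1 s = 0) -> E01 f1 = 0.
  move=> h; rewrite (@E01_eq_ae _ f1 (fun=> 0 * 0)); first by rewrite E01Z ?mul0r//; exact: bmf_cst.
  by apply: ae01_imp h => s _ ->; rewrite mul0r.
rewrite !z ?mulr0//.
  by apply: ae01_imp (edge_cross_null ne' c1) => s _ h; rewrite indicE memNset ?mul0r.
by apply: ae01_imp (edge_cross_null ne c0) => s _ h; rewrite indicE memNset ?mul0r.
Qed.

End BoundaryIntegral.

(** * How the cells of a mesh meet *)

Section MeshGeometry.
Context {R : realType}.
Local Notation pt := (R * R)%type.
Variables (M : @mesh R).
Local Notation I := 'I_(size M).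
Hypothesis good : forall i : I, good_cell (vert i).
Hypothesis disj : forall i j : I, i != j -> elt i `&` elt j = set0.
Implicit Types (e : pt * pt) (z w : pt) (S : set pt) (i j k : I).

(** Away from all vertices of the mesh, a boundary point of a cell lies on exactly one of its
    edges. *)
Definition generic_pt z := forall i e, e \in edges (vert i) -> z <> e.1 /\ z <> e.2.

Lemma generic_ae e : e.1 != e.2 -> ae01 (fun s => generic_pt (point_on e s)).
Proof.
move=> ne; apply: ae01_fin => i; apply: ae01_seq => e' _; apply: ae01_and;
  by apply: ae01_subset1 => s r _ _ h1 h2; apply: (point_on_inj ne); rewrite h1 h2.
Qed.

Lemma edge_neq i e : e \in edges (vert i) -> e.1 != e.2.
Proof. exact: gc_ndeg. Qed.

Lemma generic_segment i e z : generic_pt z -> e \in edges (vert i) -> segment e z ->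
  exists2 s, 0 < s < 1 & z = point_on e s.
Proof.
move=> gz he [s]; rewrite /= in_itv /= => /andP[s0 s1] zE; have [n1 n2] := gz _ _ he.
exists s => //; rewrite !lt_neqAle s0 s1 !andbT; apply/andP; split.
  apply/eqP => h; apply: n1; rewrite -zE -h /point_on !mul0r !addr0; by case: (e.1).
apply/eqP => h; apply: n2; rewrite -zE h /point_on !mul1r.
by rewrite [_ + _]addrC subrK [X in (_, X)]addrC subrK; case: (e.2).
Qed.

Lemma generic_edge_unique i e e' z : generic_pt z -> e \in edges (vert i) ->
  e' \in edges (vert i) -> segment e z -> segment e' z -> e = e'.
Proof.
move=> gz he he' sz sz'; apply/eqP/negPn/negP => ne.
have [s hs zE] := generic_segment gz he sz.
have := gc_strict (good i) he he' ne hs.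
by rewrite -zE (segment_lf0 sz') ltxx.
Qed.

Lemma bdP i z : bd (elt i) z <-> exists2 e, e \in edges (vert i) & segment e z.
Proof. by rewrite /elt (gc_bd (good i)). Qed.

Lemma sum_indic_edges i z : generic_pt z ->
  \sum_(e <- edges (vert i)) \1_(segment e) z = \1_(bd (elt i)) z :> R.
Proof.
move=> gz; rewrite [RHS]indicE.
have [/bdP[e he sz]|nb] := pselect (bd (elt i) z); last first.
  rewrite memNset// big_seq big1// => e he; rewrite indicE memNset// => sz.
  by apply: nb; apply/bdP; exists e.
rewrite mem_set; last by apply/bdP; exists e.
rewrite (bigD1_seq e) ?(gc_uniq (good i))//= indicE mem_set// big_seq_cond big1 ?addr0//.
move=> e' /andP[he' ne]; rewrite indicE memNset// => sz'.
by move: ne; rewrite (generic_edge_unique gz he' he sz' sz) eqxx.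
Qed.

Lemma measurable_bd S : measurable_on_lines (bd S).
Proof. by apply: closed_measurable_on_lines; exact: closed_bd. Qed.

(** Only the moduli of the normal components enter, since the normals on the two sides of a face are
    opposite. Such integrals may be computed from either side. *)
Definition even_int i S (f : R -> R -> pt -> R) : R :=
  bd_int (vert i) S (fun n z => f `|n.1| `|n.2| z).

Lemma bd_transport i j S f : measurable_on_lines S -> (forall a b, bmf_on_lines (f a b)) ->
  even_int i (bd (elt j) `&` S) f = even_int j (bd (elt i) `&` S) f.
Proof.
move=> mS hf.
have key i0 j0 : even_int i0 (bd (elt j0) `&` S) f =
    \sum_(e <- edges (vert i0)) \sum_(e' <- edges (vert j0)) enorm (e.2 - e.1) *
     E01 (fun s => \1_(segment e') (point_on e s) *
       (\1_S (point_on e s) * f `|(normal e).1| `|(normal e).2| (point_on e s))).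
  rewrite /even_int bd_intE; apply: eq_big_seq => e he; rewrite -mulr_sumr -E01_sum; last first.
    move=> e' _; apply: bmfM.
      by apply: bmf_indic_lines; apply: closed_measurable_on_lines; exact: closed_segment.
    by apply: bmfM; [exact: bmf_indic_lines|exact: hf].
  congr (_ * _); apply: E01_eq_ae; apply: ae01_imp (generic_ae (edge_neq he)) => s _ gz.
  by rewrite -mulr_suml sum_indic_edges// indicI mulrA.
rewrite !key exchange_big /=; apply: eq_big_seq => e' he'; apply: eq_big_seq => e he.
rewrite (@edge_transport_normal _ e e' (fun a b z => \1_S z * f a b z))//.
- exact: edge_neq he.
- exact: edge_neq he'.
- by move=> a b d; apply: bmfM; [exact: bmf_indic_lines|exact: hf].
Qed.

Lemma inward i e z w : e \in edges (vert i) -> generic_pt z -> segment e z ->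
  0 < cross (e.2 - e.1) w ->
  exists2 r, 0 < r & forall t, 0 < t < r -> elt i (z.1 + t * w.1, z.2 + t * w.2).
Proof.
move=> he gz sz hw; have [s hs zE] := generic_segment gz he sz.
have lfw e' t : lf e' (z.1 + t * w.1, z.2 + t * w.2) = lf e' z + t * cross (e'.2 - e'.1) w.
  by rewrite !lfE /cross /=; ring.
suff gen (r : seq (pt * pt)) : {subset r <= edges (vert i)} -> exists2 m, 0 < m &
    forall t, 0 < t < m -> forall a, a \in r -> 0 < lf a (z.1 + t * w.1, z.2 + t * w.2).
  by have [m m0 hm] := gen (edges (vert i)) (fun _ h => h); exists m.
elim: r => [|e' r IH] sub; first by exists 1.
have [r1 r1_gt0 hr1] : exists2 m, 0 < m & forall t, 0 < t < m ->
    0 < lf e' (z.1 + t * w.1, z.2 + t * w.2).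
  have he' : e' \in edges (vert i) by apply: sub; rewrite mem_head.
  have [ee|ne] := eqVneq e e'.
    exists 1 => // t /andP[t0 _]; rewrite -ee lfw segment_lf0// add0r.
    by rewrite mulr_gt0.
  have l0 : 0 < lf e' z by rewrite zE; exact: (gc_strict (good i) he he' ne hs).
  exists (lf e' z / (`|cross (e'.2 - e'.1) w| + 1)); first by rewrite divr_gt0// ltr_wpDl.
  have p1 : 0 < `|cross (e'.2 - e'.1) w| + 1 by rewrite ltr_wpDl.
  move=> t /andP[t0]; rewrite ltr_pdivlMr// => ht; rewrite lfw.
  have := ler_norm (- cross (e'.2 - e'.1) w); rewrite normrN.
  have := normr_ge0 (cross (e'.2 - e'.1) w).
  nra.
have [|r2 r2_gt0 hr2] := IH; first by move=> a ar; apply: sub; rewrite in_cons ar orbT.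
exists (Num.min r1 r2); first by rewrite lt_min r1_gt0.
move=> t /andP[t0]; rewrite lt_min => /andP[t1 t2] a; rewrite in_cons => /predU1P[->|ar].
  by apply: hr1; rewrite t0.
by apply: hr2 => //; rewrite t0.
Qed.

(** Unless the two edges have opposite directions, some vector [w] points into both cells at [z],
    and a small step along it reaches a common point of two disjoint cells. If the edges are not
    parallel, [w] has both cross products equal to 1; if they have the same direction, it is the
    inner normal. *)
Lemma opposite_edges i j e e' z : i != j -> generic_pt z -> e \in edges (vert i) ->
  e' \in edges (vert j) -> segment e z -> segment e' z ->
  exists2 a, a < 0 & e'.2.1 - e'.1.1 = a * (e.2.1 - e.1.1) /\
     e'.2.2 - e'.1.2 = a * (e.2.2 - e.1.2).
Proof.
move=> ij gz he he' sz sz'; apply: contrapT => no.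
have [w w1 w2] : exists2 w, 0 < cross (e.2 - e.1) w & 0 < cross (e'.2 - e'.1) w.
  have [c0|c0] := eqVneq (cross (e.2 - e.1) (e'.2 - e'.1)) 0; last first.
    set k := cross _ _ in c0.
    exists (((e'.2.1 - e'.1.1) - (e.2.1 - e.1.1)) / k, ((e'.2.2 - e'.1.2) - (e.2.2 - e.1.2)) / k).
      have -> : cross (e.2 - e.1) (((e'.2.1 - e'.1.1) - (e.2.1 - e.1.1)) / k,
         ((e'.2.2 - e'.1.2) - (e.2.2 - e.1.2)) / k) = k / k by rewrite /k /cross /=; ring.
      by rewrite divff.
    have -> : cross (e'.2 - e'.1) (((e'.2.1 - e'.1.1) - (e.2.1 - e.1.1)) / k,
       ((e'.2.2 - e'.1.2) - (e.2.2 - e.1.2)) / k) = k / k by rewrite /k /cross /=; ring.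
    by rewrite divff.
  have hl : lf e e'.1 = 0.
    have l1 : lf e z = 0 := segment_lf0 sz.
    have [s hs zE] := generic_segment gz he' sz'.
    by have := lf_line e' e s; rewrite -zE l1 c0 mulr0 addr0.
  have [a [b [a1 a2 _]]] := collinear_param (edge_neq he) c0 hl.
  have d0 := dot_gt0 (edge_ne0 (edge_neq he)).
  have d0' := dot_gt0 (edge_ne0 (edge_neq he')).
  have a_gt0 : 0 < a.
    rewrite ltNge; apply/negP; rewrite le_eqVlt => /predU1P[a0|a0].
      by move: d0'; rewrite /dot /= a1 a2 a0 !mul0r addr0 ltxx.
    by apply: no; exists a.
  exists (- (e.2.2 - e.1.2), e.2.1 - e.1.1).
    by move: d0; rewrite /dot /cross /= ; nra.
  rewrite /cross /= a1 a2; move: d0; rewrite /dot /= => d0.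
  have -> : a * (e.2.1 - e.1.1) * (e.2.1 - e.1.1) - a * (e.2.2 - e.1.2) * - (e.2.2 - e.1.2) =
    a * ((e.2.1 - e.1.1) * (e.2.1 - e.1.1) + (e.2.2 - e.1.2) * (e.2.2 - e.1.2)) by ring.
  exact: mulr_gt0.
have [r1 r10 h1] := inward he gz sz w1; have [r2 r20 h2] := inward he' gz sz' w2.
pose t := Num.min r1 r2 / 2.
have m0 : 0 < Num.min r1 r2 by rewrite lt_min r10.
have t0 : 0 < t by rewrite divr_gt0.
have tm : t < Num.min r1 r2 by rewrite /t; lra.
move: tm; rewrite lt_min => /andP[t1 t2].
have : (elt i `&` elt j) (z.1 + t * w.1, z.2 + t * w.2).
  by split; [apply: h1; rewrite t0|apply: h2; rewrite t0].
by rewrite disj.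
Qed.

(** Three directions cannot be pairwise opposite: the factors would satisfy [b = c * a] with all
    three negative. *)
Lemma three_cells i j k z : generic_pt z -> i != j -> i != k -> j != k ->
  bd (elt i) z -> bd (elt j) z -> bd (elt k) z -> False.
Proof.
move=> gz ij ik jk /bdP[e1 h1 s1] /bdP[e2 h2 s2] /bdP[e3 h3 s3].
have [a a0 [a1 a2]] := opposite_edges ij gz h1 h2 s1 s2.
have [b b0 [b1 b2]] := opposite_edges ik gz h1 h3 s1 s3.
have [c c0 [c1 c2]] := opposite_edges jk gz h2 h3 s2 s3.
have d0 := dot_gt0 (edge_ne0 (edge_neq h1)); rewrite /dot /= in d0.
have : b * ((e1.2.1 - e1.1.1) * (e1.2.1 - e1.1.1) + (e1.2.2 - e1.1.2) * (e1.2.2 - e1.1.2)) =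
   c * a * ((e1.2.1 - e1.1.1) * (e1.2.1 - e1.1.1) + (e1.2.2 - e1.1.2) * (e1.2.2 - e1.1.2)).
  rewrite mulrDr !mulrA -b1 -b2 c1 c2 a1 a2; ring.
by move/(mulIf (lt0r_neq0 d0)); nra.
Qed.

Lemma segment_convex e z w : segment e z -> segment e w -> segment (z, w) `<=` segment e.
Proof.
move=> [s /= hs <-] [r /= hr <-] v [t /=]; rewrite !in_itv /= in hs hr *.
move=> /andP[t0 t1] <-; move/andP: hs => [s0 s1]; move/andP: hr => [r0 r1].
exists (s + t * (r - s)) => /=; first by rewrite in_itv /=; apply/andP; split; nra.
by rewrite /point_on /=; congr (_, _); ring.
Qed.

(** Segments are convex, so two distinct common points would give a common segment. The penalty and
    the number of faces count only [shares_face], and this makes the remaining pairs of cells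
    negligible. *)
Lemma face_null i j e : i != j -> ~ shares_face i j -> e \in edges (vert i) ->
  ae01 (fun s => ~ bd (elt j) (point_on e s)).
Proof.
move=> ij nf he.
have h : forall e', e' \in edges (vert j) -> ae01 (fun s => ~ segment e' (point_on e s)).
  move=> e' he'; apply: ae01_subset1 => s r hs hr h1 h2.
  apply/eqP/negPn/negP => sr; apply: nf; split=> //.
  exists (point_on e s, point_on e r); split=> /=.
    by move/(point_on_inj (edge_neq he)) => h; move: sr; rewrite h eqxx.
  have ne := edge_neq he.
  move=> v hv; split; apply/bdP.
    exists e => //; apply: segment_convex hv; exact/segment_point_on.
  by exists e' => //; apply: segment_convex hv.
by apply: ae01_imp (ae01_seq h) => s _ hs /bdP[e' he' sz]; exact: hs sz.
Qed.

Lemma faceC i j : face i j = face j i. Proof. exact: setIC. Qed.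

Lemma enorm_normal e : e.1 != e.2 -> (normal e).1 ^+ 2 + (normal e).2 ^+ 2 = 1.
Proof.
move=> ne; have p := enorm_gt0 ne; rewrite /normal /= !exprMn -mulrDl.
have -> : (e.2.2 - e.1.2) ^+ 2 + (- (e.2.1 - e.1.1)) ^+ 2 = enorm (e.2 - e.1) ^+ 2.
  rewrite /enorm sqr_sqrtr; last by rewrite ltW// dot_gt0// edge_ne0.
  by rewrite /dot /=; ring.
by rewrite exprVn divff// sqrf_eq0 gt_eqF.
Qed.

Lemma normal_le1 e : e.1 != e.2 -> `|(normal e).1| <= 1 /\ `|(normal e).2| <= 1.
Proof.
move=> /enorm_normal h; have := sqr_ge0 (normal e).1; have := sqr_ge0 (normal e).2.
by split; rewrite -[leRHS]normr1 -ler_sqr ?nnegrE// !real_normK ?num_real// expr1n; lra.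
Qed.

Definition n1_bound i S K := 0 <= K /\ forall e, e \in edges (vert i) ->
  ae01 (fun s => S (point_on e s) -> `|(normal e).1| <= K).

Lemma n1_bound_edge i S K e : n1_bound i S K -> e \in edges (vert i) ->
  ae01 (fun s => ~ S (point_on e s)) \/ `|(normal e).1| <= K.
Proof.
move=> [_ h] he; have [hle|hle] := pselect (`|(normal e).1| <= K); first by right.
by left; apply: ae01_imp (h _ he) => s _ hs /hs.
Qed.

(** The infimum in [bd_Linf] is attained: the normal is constant on an edge, so a bound either holds
    on it outright or the edge meets [S] in a null set. *)
Lemma n1FP i S : n1_bound i S (n1F i S).
Proof.
pose A := [set K : R | n1_bound i S K].
have An0 : A !=set0.
  by exists 1; split => // e he; apply: ae01T => s _ _; exact: (normal_le1 (edge_neq he)).1.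
have E : n1F i S = inf A by [].
split; first by rewrite E; apply: lb_le_inf => // K [].
move=> e he; have [h|h] := pselect (ae01 (fun s => ~ S (point_on e s))).
  by apply: ae01_imp h => s _ n /n.
apply: ae01T => s _ _; rewrite E; apply: lb_le_inf => // K hK.
by have [/h|] := n1_bound_edge hK he.
Qed.

Lemma n1F_ge0 i S : 0 <= n1F i S. Proof. by have [] := n1FP i S. Qed.

Lemma n1F_le_ae i j e : e \in edges (vert i) ->
  ae01 (fun s => face i j (point_on e s) -> (normal e).1 ^+ 2 <= n1F i (face i j) ^+ 2).
Proof.
move=> he; apply: ae01_imp ((n1FP i (face i j)).2 _ he) => s _ h /h hs.
by rewrite -real_normK ?num_real// ler_sqr ?nnegrE// n1F_ge0.
Qed.

(** Overlapping edges of the two cells have the same modulus of the first normal component, and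
    [edge_transport] shows that an overlap which is null for one cell is null for the other.
    Symmetry of the penalty parameter depends on this. *)
Lemma n1_bound_sym i j K : n1_bound i (face i j) K -> n1_bound j (face j i) K.
Proof.
move=> hK; split; first exact: hK.1.
move=> e' he'.
have h : forall e, e \in edges (vert i) ->
    ae01 (fun s => segment e (point_on e' s) -> `|(normal e').1| <= K).
  move=> e he; have ne := edge_neq he; have ne' := edge_neq he'.
  have [c0|c0] := eqVneq (cross (e'.2 - e'.1) (e.2 - e.1)) 0; last first.
    have c1 : cross (e.2 - e.1) (e'.2 - e'.1) != 0 by apply: contra_neq c0; rewrite /cross; lra.
    by apply: ae01_imp (edge_cross_null ne' c1) => s _ n /n.
  have [h|h] := n1_bound_edge hK he; last first.
    by apply: ae01T => s _ _; have [<- _] := normal_collinear ne ne' c0.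
  suff : ae01 (fun s => ~ segment e (point_on e' s)) by apply: ae01_imp => s _ n /n.
  have mseg d : measurable_on_lines (segment d).
    by apply: closed_measurable_on_lines; exact: closed_segment.
  apply: (@E01_eq0_ae R (point_on e' @^-1` segment e)); first exact: mseg.
  have bm1 : bmf_on_lines (fun=> 1 : R) by move=> d; exact: bmf_cst.
  have := edge_transport ne ne' bm1 c0.
  rewrite (_ : E01 (fun s => \1_(segment e') (point_on e s) * 1) = 0); last first.
    rewrite (@E01_eq_ae _ _ (fun=> 0 * 0)); first by rewrite E01Z ?mul0r//; exact: bmf_cst.
    apply: ae01_imp h => s hs n; rewrite mulr1 mul0r indicE memNset// => sz; apply: n.
    by split; apply/bdP; [exists e => //; exact/segment_point_on|exists e'].
  rewrite mulr0 => /esym /eqP; rewrite mulf_eq0 gt_eqF ?enorm_gt0//= => /eqP E.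
  by rewrite -[RHS]E; congr E01; apply/funext => s; rewrite mulr1 !indicE.
apply: ae01_imp (ae01_seq h) => s _ hs [_ /bdP[e he sz]]; exact: hs sz.
Qed.

Lemma n1F_sym i j : n1F i (face i j) = n1F j (face j i).
Proof.
rewrite /n1F /bd_Linf; congr inf; apply/seteqP; split => K /= hK; exact: n1_bound_sym.
Qed.

End MeshGeometry.

(** * Cell, face and inflow integrals as positive functionals *)

Section MeshFunctionals.
Context {R : realType}.
Local Notation pt := (R * R)%type.
Local Notation bp2 := {poly {poly R}}.
Variables (Omega : set pt) (M : @mesh R) (xm : R).
Local Notation I := 'I_(size M).
Hypothesis good : forall i : I, good_cell (vert i).
Hypothesis disj : forall i j : I, i != j -> elt i `&` elt j = set0.
Hypothesis hxm : forall (i : I) z, bd (elt i) z -> `|z.1| <= xm.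
Hypothesis hxm_elt : forall (i : I) z, elt i z -> `|z.1| <= xm.
Hypothesis hup : upwind_neighbours Omega M.
Implicit Types (e : pt * pt) (z w : pt) (S : set pt) (i j k : I) (Q : bp2).

Let Gi := Gamma_int Omega M.
Let bm i := bd_minus (vert i).
Let bp i := bd_plus (vert i).

Lemma measurable_Gamma_int : measurable_on_lines Gi.
Proof.
have -> : Gi = [set z | exists2 i : I, i \in enum 'I_(size M) & bd (elt i) z] `\` bd Omega.
  rewrite /Gi /Gamma_int; congr (_ `\` _); apply/seteqP; split=> z.
    by move=> [i _ h]; exists i; rewrite ?mem_enum.
  by move=> [i _ h]; exists i.
by apply: measurable_on_linesD; [apply: measurable_on_lines_seq => i|]; exact: measurable_bd.
Qed.

Definition uI i S Q := bd_int (vert i) S (fun _ z => ev2 Q z).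
Definition wI i S Q := bd_int (vert i) S (fun n z => `|z.1 * n.2| * ev2 Q z).

Lemma bmf_ev2_lines Q : bmf_on_lines (ev2 Q). Proof. by move=> e; exact: bmf_ev2_point_on. Qed.

Lemma bmf_x_lines (a : R) : bmf_on_lines (fun z => z.1 * a).
Proof.
move=> e; have := @bmf_ev2_point_on R (Xx * cst2 a) e; congr bmf; apply/funext => s.
by rewrite !ev2E.
Qed.

Lemma wbmf_u i S Q : measurable_on_lines S -> wbmf (vert i) S (fun _ z => ev2 Q z).
Proof. by move=> mS e _; apply: bmfM; [exact: bmf_indic_lines|exact: bmf_ev2_lines]. Qed.

Lemma wbmf_w i S Q : measurable_on_lines S ->
  wbmf (vert i) S (fun n z => `|z.1 * n.2| * ev2 Q z).
Proof.
move=> mS e _; apply: bmfM; first exact: bmf_indic_lines.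
by apply: bmfM; [apply: bmf_norm; exact: bmf_x_lines|exact: bmf_ev2_lines].
Qed.

Lemma uI_lin i S : measurable_on_lines S -> lin2 (uI i S).
Proof.
move=> mS; split=> [P Q|c Q]; rewrite /uI.
  rewrite -bd_intD; [|exact: wbmf_u..].
  by apply: bd_int_eq_ae => e _; apply: ae01T => s _; rewrite ev2D.
rewrite -bd_intZ; last exact: wbmf_u.
by apply: bd_int_eq_ae => e _; apply: ae01T => s _; rewrite ev2M ev2_cst.
Qed.

Lemma wI_lin i S : measurable_on_lines S -> lin2 (wI i S).
Proof.
move=> mS; split=> [P Q|c Q]; rewrite /wI.
  rewrite -bd_intD; [|exact: wbmf_w..].
  by apply: bd_int_eq_ae => e _; apply: ae01T => s _; rewrite ev2D; ring.
rewrite -bd_intZ; last exact: wbmf_w.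
by apply: bd_int_eq_ae => e _; apply: ae01T => s _; rewrite ev2M ev2_cst; ring.
Qed.

Lemma edge_x_le i e s : e \in edges (vert i) -> 0 <= s <= 1 -> `|(point_on e s).1| <= xm.
Proof.
move=> he hs; apply: (hxm (i := i)); apply/(bdP good); exists e => //.
by apply/segment_point_on => //; exact: (edge_neq good he).
Qed.

Lemma uI_ge0 i S Q : (forall z, `|z.1| <= xm -> 0 <= ev2 Q z) -> 0 <= uI i S Q.
Proof.
move=> h; apply: bd_int_ge0 => e he; apply: ae01T => s hs.
by rewrite mulr_ge0 ?indicE ?ler0n// h// (edge_x_le he).
Qed.

Lemma wI_ge0 i S Q : (forall z, `|z.1| <= xm -> 0 <= ev2 Q z) -> 0 <= wI i S Q.
Proof.
move=> h; apply: bd_int_ge0 => e he; apply: ae01T => s hs.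
by rewrite !mulr_ge0 ?indicE ?ler0n// h// (edge_x_le he).
Qed.

Definition uP i S (mS : measurable_on_lines S) : plf xm := Plf (uI_lin i mS) (@uI_ge0 i S).
Definition wP i S (mS : measurable_on_lines S) : plf xm := Plf (wI_lin i mS) (@wI_ge0 i S).

Lemma cint_plf_ge0 i Q : (forall z, `|z.1| <= xm -> 0 <= ev2 Q z) -> 0 <= cint (vert i) Q.
Proof. by move=> h; apply: cint_ge0 => z hz; apply/h/hxm_elt/hz. Qed.
Definition jP i : plf xm := Plf (cint_lin (good i)) (@cint_plf_ge0 i).

Lemma xm_ge0 i : 0 <= xm.
Proof.
have [e he] : exists e, e \in edges (vert i).
  (* Without edges the cell would be the whole plane, against its boundedness. *)
  case E : (edges (vert i)) => [|e r]; last by exists e; rewrite mem_head.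
  have B z : cell (vert i) z by move=> e; rewrite E.
  have [b hb] := gc_bounded (good i).
  have [] := hb (`|b| + 1, 0) (B _); rewrite /= ger0_norm ?addr_ge0//.
  by have := ler_norm b; lra.
by apply: le_trans (edge_x_le he (_ : 0 <= 0 <= 1)); rewrite ?lexx ?ler01.
Qed.

Lemma wI_le i S Q : measurable_on_lines S -> (forall z, `|z.1| <= xm -> 0 <= ev2 Q z) ->
  wI i S Q <= xm * uI i setT Q.
Proof.
move=> mS h; have mT : measurable_on_lines [set: pt] by exact: measurable_on_linesT.
rewrite -(uI_lin i mT).2; apply: bd_int_le_ae; [exact: wbmf_w|exact: wbmf_u|].
move=> e he; apply: ae01T => s hs; have x1 := edge_x_le he hs.
have n1 := (normal_le1 (edge_neq good he)).2.
rewrite [in leRHS]indicE mem_set// mul1r ev2M ev2_cst normrM.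
have Q0 := h _ x1; rewrite indicE.
apply: (@le_trans _ _ (`|(point_on e s).1| * `|(normal e).2| * ev2 Q (point_on e s))).
  by rewrite ler_piMl ?mulr_ge0// lern1 leq_b1.
rewrite ler_wpM2r// -[leRHS]mulr1 ler_pM//.
Qed.

Lemma bmP i e z : generic_pt M z -> e \in edges (vert i) -> segment e z ->
  bm i z <-> z.1 * (normal e).2 < 0.
Proof.
move=> gz he sz; split=> [[e' [he' sz' h]]|h]; last by exists e.
by rewrite (generic_edge_unique good gz he he' sz sz').
Qed.

Lemma bpP i e z : generic_pt M z -> e \in edges (vert i) -> segment e z ->
  bp i z <-> 0 <= z.1 * (normal e).2.
Proof.
move=> gz he sz; split=> [[e' [he' sz' h]]|h]; last by exists e.
by rewrite (generic_edge_unique good gz he he' sz sz').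
Qed.

Lemma bp_bd i z : bp i z -> bd (elt i) z.
Proof. by move=> [e [he sz _]]; apply/(bdP good); exists e. Qed.

Lemma bmp_generic i z : generic_pt M z -> bm i z -> bp i z -> False.
Proof.
move=> gz [e [he sz h]] /(bpP gz he sz); lra.
Qed.

Lemma edge_ae i e (P : pt -> Prop) : e \in edges (vert i) ->
  (forall z, generic_pt M z -> segment e z -> P z) -> ae01 (fun s => P (point_on e s)).
Proof.
move=> he h; have ne := edge_neq good he.
apply: ae01_imp (generic_ae M ne) => s hs gz; apply: h => //; exact/segment_point_on.
Qed.

Lemma upwind_ae i e : e \in edges (vert i) -> ae01 (fun s => bm i (point_on e s) ->
  Gi (point_on e s) -> exists j, forall k, bp k (point_on e s) <-> k = j).
Proof.
move=> he; have := hup he; apply: ae01_imp => s _ h hm [_ nO].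
have [h1 _] := h hm.
have nG : ~ Gamma_minus Omega (point_on e s) by move=> [[]].
have [j [hj uj]] := h1 nG; exists j => k; split=> [/uj//|-> //].
Qed.

Lemma Gamma_minus_ae i e : e \in edges (vert i) -> ae01 (fun s => bm i (point_on e s) ->
  (bd Omega (point_on e s) <-> Gamma_minus Omega (point_on e s))).
Proof.
move=> he; have := hup he; apply: ae01_imp => s _ h hm.
by have [_ h1] := h hm; split=> // -[[]].
Qed.

Let mGi := measurable_Gamma_int.
Let mbm i : measurable_on_lines (bm i). Proof. exact: measurable_bd_minus. Qed.
Let mbp i : measurable_on_lines (bp i). Proof. exact: measurable_bd_plus. Qed.
Let mbO : measurable_on_lines (bd Omega). Proof. exact: measurable_bd. Qed.

Lemma mX i j : measurable_on_lines (bm i `&` bp j `&` Gi).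
Proof. by apply: measurable_on_linesI => //; exact: measurable_on_linesI. Qed.
Lemma mY i : measurable_on_lines (bm i `&` bd Omega). Proof. exact: measurable_on_linesI. Qed.
Lemma mZ i : measurable_on_lines (bp i `&` bd Omega). Proof. exact: measurable_on_linesI. Qed.
Lemma mPp i : measurable_on_lines (bp i `&` Gi). Proof. exact: measurable_on_linesI. Qed.
Lemma mFc i j : measurable_on_lines (face i j `&` Gi).
Proof. by apply: measurable_on_linesI => //; apply: measurable_on_linesI; exact: measurable_bd. Qed.

(** In turn: the inflow part of [i] with upwind neighbour [j], the inflow and the outflow part on
    the domain boundary, and the interior outflow part, all weighted by [|x n_2|]; then the face
    with [j] and the whole boundary, unweighted. *)
Definition fX i j := wP i (mX i j).
Definition fY i := wP i (mY i).
Definition fZ i := wP i (mZ i).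
Definition fP i := wP i (mPp i).
Definition fF i j := uP i (mFc i j).
Definition fT i := uP i measurable_on_linesT.

(** Almost every interior inflow point has exactly one upwind neighbour. Splitting by that neighbour
    makes the upwind trace a polynomial on each piece. *)
Lemma upwind_sum i (G : pt -> pt -> R) (F : I -> bp2) :
  (forall n z j, z.1 * n.2 < 0 -> (forall k, bp k z <-> k = j) ->
     G n z = `|z.1 * n.2| * ev2 (F j) z) ->
  bd_int (vert i) (bm i `&` Gi) G = \sum_j fX i j (F j).
Proof.
move=> h; apply: bd_int_sum_ae => [j|e he]; first by apply: wbmf_w; exact: mX.
have g0 := edge_ae he (fun z gz sz => conj gz sz).
apply: ae01_imp2 (upwind_ae he) g0 => s _ hu [gz sz].
set z := point_on e s in hu gz sz *.
have [[zm zG]|nz] := pselect ((bm i `&` Gi) z); last first.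
  rewrite indicE memNset// mul0r big1// => j _; rewrite indicE memNset ?mul0r//.
  by move=> [[zm _] zG]; apply: nz.
have [j hj] := hu zm zG; rewrite indicE mem_set// mul1r (bigD1 j)//=.
rewrite big1 ?addr0 => [|k kj]; last first.
  by rewrite indicE memNset ?mul0r// => -[[_ /hj kj'] _]; move: kj; rewrite kj' eqxx.
rewrite indicE mem_set; last by split => //; split => //; exact/hj.
by rewrite mul1r; apply: h => //; apply/(bmP gz he sz).
Qed.

Lemma upwind_traceE (w : broken M) z j : (forall k, bp k z <-> k = j) -> upwind_trace w z = w j z.
Proof.
move=> h; rewrite /upwind_trace (big_pred1 j)// => k /=.
by apply/asboolP/eqP => /h.
Qed.

(** On the inflow part of a cell [Gamma_minus] agrees almost everywhere with the closed set
    [bd Omega], whose measurability on lines is clear. *)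
Lemma Gamma_minus_int i (f : pt -> pt -> R) Q :
  (forall n z, z.1 * n.2 < 0 -> f n z = `|z.1 * n.2| * ev2 Q z) ->
  bd_int (vert i) (bm i `&` Gamma_minus Omega) f = fY i Q.
Proof.
move=> h; apply: bd_int_eq_ae => e he.
have g0 := edge_ae he (fun z gz sz => conj gz sz).
apply: ae01_imp2 (Gamma_minus_ae he) g0 => s _ hG [gz sz]; rewrite !indicE.
set z := point_on e s in hG gz sz *.
have [zm|nz] := pselect (bm i z); last by rewrite !memNset ?mul0r// => -[].
have [zO|nO] := pselect (bd Omega z); last first.
  by rewrite !memNset ?mul0r// => -[_] // /(hG zm).
rewrite !mem_set//; last by split=> //; exact/(hG zm).
by rewrite !mul1r; apply: h; exact/(bmP gz he sz).
Qed.

Lemma outflow_int i Q :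
  bd_int (vert i) ((bm i `&` Gamma_minus Omega) `|` (bp i `&` bd Omega))
    (fun n z => `|z.1 * n.2| * ev2 Q z) = fY i Q + fZ i Q.
Proof.
have -> : fY i Q + fZ i Q = \sum_(b <- [:: true; false])
    wI i (if b then bm i `&` bd Omega else bp i `&` bd Omega) Q.
  by rewrite !big_cons big_nil addr0.
apply: bd_int_sum_ae => [[]|e he]; try (apply: wbmf_w; exact: measurable_on_linesI).
have g0 := edge_ae he (fun z gz sz => conj gz sz).
apply: ae01_imp2 (Gamma_minus_ae he) g0 => s _ hG [gz sz].
rewrite !big_cons big_nil addr0 !indicE.
set z := point_on e s in hG gz sz *.
have [zm|nz] := pselect (bm i z).
  rewrite (_ : z \in bp i `&` bd Omega = false); last first.
    by apply: memNset => -[zp _]; exact: bmp_generic gz zm zp.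
  rewrite mul0r addr0; congr (_%:R * _); congr nat_of_bool; apply/idP/idP; rewrite !inE.
    by move=> [[_ /(hG zm)]|[zp]] //; exfalso; exact: bmp_generic gz zm zp.
  by move=> [_ zO]; left; split => //; exact/(hG zm).
rewrite (_ : z \in bm i `&` bd Omega = false); last by apply: memNset => -[].
rewrite mul0r add0r; congr (_%:R * _); congr nat_of_bool; apply/idP/idP; rewrite !inE.
  by move=> [[]|] //.
by right.
Qed.

Lemma Gi_bd i z : bd (elt i) z -> Gi z <-> ~ bd Omega z.
Proof. by move=> h; split=> [[]//|n]; split=> //; exists i. Qed.

Lemma wI_bmGi i Q : wI i (bm i `&` Gi) Q = \sum_j fX i j Q.
Proof. exact: upwind_sum. Qed.

(** As [x] does not depend on [y], the integrand is the [y]-derivative of [Xx * Q], and the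
    divergence theorem gives the boundary weight [x n_2]. The boundary is split by the sign of this
    weight and by membership in [bd Omega]. *)
Lemma transport_term i Q :
  jP i (Xx * dy Q) = fZ i Q + fP i Q - fY i Q - \sum_j fX i j Q.
Proof.
rewrite -wI_bmGi /jP /=.
have -> : Xx * dy Q = dy (Xx * Q) by rewrite !dxyE; ring.
rewrite (divergence_y (good i)).
have -> : - (\sum_(e <- edges (vert i)) (e.2.1 - e.1.1) *
     E01 (fun r => ev2 (Xx * Q) (point_on e r))) =
     bd_int (vert i) setT (fun n z => z.1 * n.2 * ev2 Q z).
  rewrite bd_intE -sumrN; apply: eq_big_seq => e he.
  have p := enorm_gt0 (edge_neq good he).
  have -> : - ((e.2.1 - e.1.1) * E01 (fun r => ev2 (Xx * Q) (point_on e r))) =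
     enorm (e.2 - e.1) * ((normal e).2 * E01 (fun r => ev2 (Xx * Q) (point_on e r))).
    by rewrite /normal /=; field; rewrite gt_eqF.
  congr (_ * _); rewrite -E01Z; last exact: bmf_ev2_point_on.
  by congr E01; apply/funext => s; rewrite indicE in_setT mul1r !ev2E; ring.
pose S' (b : bool * bool) := (if b.1 then bp i else bm i) `&` (if b.2 then bd Omega else Gi).
pose Q' (b : bool * bool) := if b.1 then Q else - Q.
have -> : fZ i Q + fP i Q - fY i Q - wI i (bm i `&` Gi) Q = \sum_(b <- [:: (true, true);
    (true, false); (false, true); (false, false)]) wI i (S' b) (Q' b).
  rewrite !big_cons big_nil addr0 /S' /Q' /= -(lin2_N _ (wI_lin i (mY i))).
  by rewrite -(lin2_N _ (wI_lin i (measurable_on_linesI (mbm i) mGi))) !addrA.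
apply: bd_int_sum_ae => [[b1 b2]|e he].
  apply: wbmf_w; apply: measurable_on_linesI => /=.
    by case: b1; [exact: mbp|exact: mbm].
  by case: b2; [exact: mbO|exact: mGi].
have g0 := edge_ae he (fun z gz sz => conj gz sz).
apply: ae01_imp g0 => s _; move: (point_on e s) => z [gz sz].
have bz : bd (elt i) z by apply/(bdP good); exists e.
have hm : (z \in bm i) = (z.1 * (normal e).2 < 0).
  by apply/idP/idP; rewrite inE => /(bmP gz he sz).
have hp : (z \in bp i) = (0 <= z.1 * (normal e).2).
  by apply/idP/idP; rewrite inE => /(bpP gz he sz).
have hG : (z \in Gi) = ~~ (z \in bd Omega).
  by apply/idP/idP; rewrite ?notin_setE inE => /(Gi_bd bz).
have indI A B : \1_(A `&` B) z = (z \in A)%:R * (z \in B)%:R :> R.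
  by rewrite indicE in_setI; case: (z \in A); rewrite ?mul1r ?mul0r.
rewrite indicE in_setT mul1r.
move: hm hp; move: ((normal e).2) => n2 hm hp.
rewrite !big_cons big_nil addr0 /S' /Q' /= !indI.
rewrite hm hp hG !ev2N leNgt; case: ltP => h; case: (z \in bd Omega); rewrite /=.
- by rewrite ltr0_norm//; ring.
- by rewrite ltr0_norm//; ring.
- by rewrite ger0_norm//; ring.
- by rewrite ger0_norm//; ring.
Qed.

Lemma sum_indic_le1 (A : I -> set pt) (B : set pt) z (c : R) (P : pred I) : 0 <= c ->
  (forall i, P i -> A i z -> B z) ->
  (forall i j, P i -> P j -> A i z -> A j z -> i = j) ->
  \sum_(i | P i) \1_(A i) z * c <= \1_B z * c.
Proof.
move=> c0 AB uA; rewrite -mulr_suml ler_wpM2r//.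
have [[i [Pi Ai]]|n] := pselect (exists i, P i /\ A i z); last first.
  rewrite big1 ?indicE ?ler0n// => i Pi; rewrite indicE memNset// => Ai.
  by apply: n; exists i.
rewrite (bigD1 i)//= big1 ?addr0 => [|j /andP[Pj ji]]; last first.
  rewrite indicE memNset// => Aj; move: ji; by rewrite (uA _ _ Pj Pi Aj Ai) eqxx.
by rewrite !indicE !mem_set//; exact: AB Ai.
Qed.

(** Seen from [j], the inflow parts that have [j] as upwind neighbour lie in its interior outflow
    part. They overlap only in null sets, as three cells cannot meet at a generic point. *)
Lemma inflow_le_outflow j Q : (forall z, `|z.1| <= xm -> 0 <= ev2 Q z) ->
  \sum_i fX i j Q <= fP j Q.
Proof.
move=> Q0; pose f (a b : R) z := `|z.1| * b * ev2 Q z.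
have hf a b : bmf_on_lines (f a b).
  move=> e; apply: bmfM; last exact: bmf_ev2_lines.
  apply: bmfM; last exact: bmf_cst.
  have := @bmf_norm R _ (bmf_x_lines 1 e); congr bmf; apply/funext => s; by rewrite mulr1.
have E i : fX i j Q = wI j (bd (elt i) `&` (bm i `&` bp j `&` Gi)) Q.
  have := bd_transport good i j (mX i j) hf; rewrite /even_int /= => H.
  transitivity (bd_int (vert i) (bd (elt j) `&` (bm i `&` bp j `&` Gi))
      (fun n z => f `|n.1| `|n.2| z)).
    rewrite /= /wI (_ : bd (elt j) `&` _ = bm i `&` bp j `&` Gi); last first.
      by apply/seteqP; split=> z [] // h1 h2; split=> //; case: h1 => _ /bp_bd.
    by apply: bd_int_eq_ae => e _; apply: ae01T => s _; rewrite /f normrM.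
  by rewrite H /wI; apply: bd_int_eq_ae => e _; apply: ae01T => s _; rewrite /f (normrM (_.1)).
rewrite (eq_bigr _ (fun i _ => E i)); apply: bd_int_sum_le_ae.
- by apply: wbmf_w; exact: mPp.
- by move=> i; apply: wbmf_w; apply: measurable_on_linesI; [exact: measurable_bd|exact: mX].
move=> e he.
have g0 := edge_ae he (fun z gz sz => conj gz sz).
apply: ae01_imp g0 => s hs [gz sz]; apply: sum_indic_le1.
- by rewrite mulr_ge0// Q0// (edge_x_le he).
- by move=> i _ [_ [[]]].
move=> i k _ _ [bi [[mi pi] _]] [bk [[mk _] _]].
apply/eqP/negPn/negP => ik; have bj := bp_bd pi.
have [ij|ij] := eqVneq i j; first by apply: bmp_generic gz mi _; rewrite ij.
have [kj|kj] := eqVneq k j; first by apply: bmp_generic gz mk _; rewrite kj.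
exact: (three_cells good disj gz ik ij kj bi bk bj).
Qed.

Lemma fF_sym i j Q : fF i j Q = fF j i Q.
Proof.
have hf (a b : R) : bmf_on_lines (ev2 Q) by exact: bmf_ev2_lines.
have := @bd_transport _ _ good i j (face i j `&` Gi) (fun _ _ => ev2 Q) (mFc i j) hf.
rewrite /even_int /= /uI => H.
rewrite -[in LHS](_ : bd (elt j) `&` (face i j `&` Gi) = face i j `&` Gi); last first.
  by apply/seteqP; split=> z [] // h1 h2; split=> //; case: h1.
rewrite H faceC; congr bd_int.
by apply/seteqP; split=> z [] // h1 h2; split=> //; case: h1.
Qed.

Lemma sum_fF_le i Q : (forall z, `|z.1| <= xm -> 0 <= ev2 Q z) ->
  \sum_(j | j != i) fF i j Q <= fT i Q.
Proof.
move=> Q0; apply: bd_int_sum_le_ae.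
- by apply: wbmf_u; exact: measurable_on_linesT.
- by move=> j; apply: wbmf_u; exact: mFc.
move=> e he.
have g0 := edge_ae he (fun z gz sz => conj gz sz).
apply: ae01_imp g0 => s hs [gz sz]; apply: sum_indic_le1 => //.
  by rewrite Q0// (edge_x_le he).
move=> j k ji ki [[bi bj] _] [[_ bk] _]; apply/eqP/negPn/negP => jk.
by apply: (three_cells good disj gz _ _ jk bi bj bk); rewrite eq_sym.
Qed.

Lemma fF_null i j Q : i != j -> ~ shares_face i j -> fF i j Q = 0.
Proof.
move=> ij nf; rewrite /= /uI -[RHS](mul0r (uI i setT Q)) -(uI_lin i measurable_on_linesT).2.
rewrite /uI; apply: bd_int_eq_ae => e he; apply: ae01_imp (face_null good ij nf he) => s _ h.
by rewrite !ev2E mul0r mulr0 indicE memNset ?mul0r// => -[[]].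
Qed.

(** Weighted by the signed first normal component, this functional is linear but not positive. It is
    reached only through the Young inequality [nI_young]. *)
Definition nI i j Q := bd_int (vert i) (face i j `&` Gi) (fun n z => n.1 * ev2 Q z).

Lemma wbmf_n i j Q : wbmf (vert i) (face i j `&` Gi) (fun n z => n.1 * ev2 Q z).
Proof.
move=> e _; apply: bmfM; first by apply: bmf_indic_lines; exact: mFc.
by apply: bmfZ; exact: bmf_ev2_lines.
Qed.

Lemma nI_lin i j : lin2 (nI i j).
Proof.
split=> [P Q|c Q]; rewrite /nI.
  rewrite -bd_intD; [|exact: wbmf_n..].
  by apply: bd_int_eq_ae => e _; apply: ae01T => s _; rewrite ev2D; ring.
rewrite -bd_intZ; last exact: wbmf_n.
by apply: bd_int_eq_ae => e _; apply: ae01T => s _; rewrite ev2M ev2_cst; ring.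
Qed.

Lemma nI_young i j (f g : bp2) t : 0 < t ->
  2 * nI i j (f * g) <= t * n1F i (face i j) ^+ 2 * fF i j (f ^+ 2) + t^-1 * fF i j (g ^+ 2).
Proof.
move=> t0; rewrite -(nI_lin i j).2 -!plfZ -plfD; apply: bd_int_le_ae.
- exact: wbmf_n.
- by apply: wbmf_u; exact: mFc.
move=> e he; apply: ae01_imp (n1F_le_ae good j he) => s _ hn; rewrite indicE.
set z := point_on e s in hn *.
have [zF|nz] := pselect ((face i j `&` Gi) z); last by rewrite memNset// !mul0r.
rewrite mem_set// !mul1r !ev2E.
have := hn zF.1; set m := (normal e).1; set N := n1F i _ => hN.
set a := ev2 f z; set b := ev2 g z.
apply: (@le_trans _ _ (t * m ^+ 2 * a ^+ 2 + t^-1 * b ^+ 2)).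
  rewrite -subr_ge0.
  have -> : t * m ^+ 2 * a ^+ 2 + t^-1 * b ^+ 2 - m * (2 * (a * b)) = t^-1 * (t * m * a - b) ^+ 2.
    by field; rewrite gt_eqF.
  by rewrite mulr_ge0 ?sqr_ge0// invr_ge0 ltW.
by rewrite lerD2r ler_wpM2r ?sqr_ge0// ler_wpM2l// ltW.
Qed.

Lemma outflow_term i Q (f : pt -> pt -> R) :
  (forall n z, 0 <= z.1 * n.2 -> f n z = `|z.1 * n.2| * ev2 Q z) ->
  bd_int (vert i) (bp i) f = wI i (bp i) Q.
Proof.
move=> h; apply: bd_int_eq_ae => e he.
apply: (edge_ae he (P := fun z => \1_(bp i) z * f _ z = \1_(bp i) z * (`|z.1 * _| * ev2 Q z))).
move=> z gz sz; rewrite indicE; have [zp|nz] := pselect (bp i z); last by rewrite memNset ?mul0r.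
by rewrite mem_set// !mul1r h//; exact/(bpP gz he sz).
Qed.

End MeshFunctionals.

(** * Sums over unordered pairs of cells *)

Section PairSums.
Context {R : realType} (m : nat).
Implicit Types G : 'I_m -> 'I_m -> R.

Lemma sum_pairs G :
  \sum_(i < m) \sum_(j < m | (j < i)%N) (G i j + G j i) = \sum_(i < m) \sum_(j < m | j != i) G i j.
Proof.
under eq_bigr do rewrite big_split /=; rewrite big_split /=.
rewrite [X in _ + X](exchange_big_dep xpredT)//= -big_split /=.
apply: eq_bigr => i _; rewrite [RHS](bigID (fun j : 'I_m => (j < i)%N)) /=; congr (_ + _).
  by apply: eq_bigl => j; rewrite neq_ltn; case: ltnP => //; rewrite andbF.
by apply: eq_bigl => j; rewrite neq_ltn; case: ltngtP.
Qed.

End PairSums.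

Arguments plf_fun : simpl never.

(** * Coercivity and bounds of the discrete form at a fixed time *)

Section FixedTime.
Context {R : realType}.
Local Notation pt := (R * R)%type.
Local Notation bp2 := {poly {poly R}}.
Variables (Omega : set pt) (M : @mesh R) (xm Cd Cn : R) (p : nat).
Local Notation I := 'I_(size M).
Hypothesis good : forall i : I, good_cell (vert i).
Hypothesis disj : forall i j : I, i != j -> elt i `&` elt j = set0.
Hypothesis hxm : forall (i : I) z, bd (elt i) z -> `|z.1| <= xm.
Hypothesis hxm_elt : forall (i : I) z, elt i z -> `|z.1| <= xm.
Hypothesis hup : upwind_neighbours Omega M.
Hypothesis hinv : inverse_estimates M Cd Cn.
Hypothesis hpos : forall i : I, 0 < h i.
Hypothesis Cd0 : 0 < Cd.
Hypothesis Cn0 : 0 < Cn.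
Hypothesis p0 : (0 < p)%N.
Implicit Types (i j k : I) (Q : bp2) (u v w : I -> bp2).

Definition cell_form i : plf xm := jP good hxm_elt i.
Definition bd_form i : plf xm := fT good hxm i.
Definition face_form i j : plf xm := fF Omega good hxm i j.
Definition upwind_form i j : plf xm := fX Omega good hxm i j.
Definition inflow_form i : plf xm := fY Omega good hxm i.
Definition outflow_form i : plf xm := fZ Omega good hxm i.
Definition interior_outflow_form i : plf xm := fP Omega good hxm i.
(** The common scale of the inverse estimates on squares: the trace estimate costs this factor, the
    gradient estimate its square. *)
Definition inv_scale i : R := p%:R ^+ 2 / h i.

Lemma pR_gt0 : 0 < p%:R :> R. Proof. by rewrite ltr0n. Qed.
Lemma eta_gt0 i : 0 < inv_scale i. Proof. by rewrite divr_gt0// exprn_gt0// pR_gt0. Qed.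

Lemma sqrt_le_sqr (a b c : R) : 0 <= a -> 0 <= b -> 0 <= c ->
  Num.sqrt a <= c * Num.sqrt b -> a <= c ^+ 2 * b.
Proof.
move=> a0 b0 c0 h; rewrite -[leLHS](sqr_sqrtr a0) -(sqr_sqrtr b0) -exprMn.
by rewrite ler_sqr ?nnegrE ?mulr_ge0 ?sqrtr_ge0.
Qed.

Lemma is_Pp_ev2 Q : deg2 p Q -> is_Pp p (ev2 Q).
Proof. by move=> dQ; apply/is_PpP; exists Q. Qed.

Lemma trace_inverse i Q : deg2 p Q -> bd_form i (Q ^+ 2) <= Cd ^+ 2 * inv_scale i * cell_form i (Q ^+ 2).
Proof.
move=> dQ; have [h1 _] := hinv i p0 (is_Pp_ev2 dQ); have hi := hpos i.
have E1 : bd_int (vert i) setT (fun _ z => ev2 Q z ^+ 2) = bd_form i (Q ^+ 2).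
  by apply: bd_int_eq_ae => e _; apply: ae01T => s _; rewrite ev2X.
have E2 : \int[leb2]_(z in elt i) (ev2 Q z ^+ 2) = cell_form i (Q ^+ 2).
  by apply: eq_Rintegral => z _; rewrite ev2X.
rewrite E1 E2 in h1.
have -> : Cd ^+ 2 * inv_scale i = (Cd * p%:R / Num.sqrt (h i)) ^+ 2.
  by rewrite !exprMn exprVn sqr_sqrtr ?(ltW hi)// mulrA.
apply: sqrt_le_sqr => //; rewrite ?plf_sqr_ge0//.
by rewrite !mulr_ge0 ?invr_ge0 ?sqrtr_ge0 ?ler0n// ltW.
Qed.

Lemma grad_inverse i Q : deg2 p Q ->
  cell_form i (dx Q ^+ 2) + cell_form i (dy Q ^+ 2) <= Cn ^+ 2 * inv_scale i ^+ 2 * cell_form i (Q ^+ 2).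
Proof.
move=> dQ; have [_ h1] := hinv i p0 (is_Pp_ev2 dQ); have hi := hpos i.
have E1 : \int[leb2]_(z in elt i) (dot (grad (ev2 Q) z) (grad (ev2 Q) z)) =
    cell_form i (dx Q ^+ 2) + cell_form i (dy Q ^+ 2).
  rewrite -plfD; apply: eq_Rintegral => z _.
  by rewrite /dot /grad /= d_x_ev2 d_y_ev2 !ev2E !expr2.
have E2 : \int[leb2]_(z in elt i) (ev2 Q z ^+ 2) = cell_form i (Q ^+ 2).
  by apply: eq_Rintegral => z _; rewrite ev2X.
rewrite E1 E2 in h1.
have -> : Cn ^+ 2 * inv_scale i ^+ 2 = (Cn * p%:R ^+ 2 / h i) ^+ 2.
  by rewrite /inv_scale -exprMn mulrA.
apply: sqrt_le_sqr => //; rewrite ?addr_ge0 ?plf_sqr_ge0//.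
by rewrite !mulr_ge0 ?invr_ge0 ?exprn_ge0 ?ler0n// ltW.
Qed.

Lemma dx_inverse i Q : deg2 p Q -> cell_form i (dx Q ^+ 2) <= Cn ^+ 2 * inv_scale i ^+ 2 * cell_form i (Q ^+ 2).
Proof. by move=> dQ; apply: le_trans (grad_inverse i dQ); rewrite lerDl plf_sqr_ge0. Qed.
Lemma dy_inverse i Q : deg2 p Q -> cell_form i (dy Q ^+ 2) <= Cn ^+ 2 * inv_scale i ^+ 2 * cell_form i (Q ^+ 2).
Proof. by move=> dQ; apply: le_trans (grad_inverse i dQ); rewrite lerDr plf_sqr_ge0. Qed.

Local Notation sg := (sigma Omega Cd p).
Local Notation Nb := (N_bd Omega M).

Lemma sqr_ge0_ev2 Q (z : pt) : `|z.1| <= xm -> 0 <= ev2 (Q ^+ 2) z.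
Proof. by rewrite ev2X sqr_ge0. Qed.

Lemma max_hV_gt0 i j : 0 < Num.max (h i)^-1 (h j)^-1.
Proof. by rewrite lt_max invr_gt0 hpos. Qed.

Lemma sigma_ge0 i j : 0 <= sg i j.
Proof.
apply: mulr_ge0; last by apply: ltW; exact: max_hV_gt0.
by rewrite mulr_ge0 ?sqr_ge0// mulr_ge0 ?ler0n.
Qed.

Lemma sigma_sym i j : sg i j = sg j i.
Proof. by rewrite /sigma (n1F_sym good) maxC. Qed.

Lemma N_bd_gt0 i j : shares_face i j -> 1 <= Nb%:R :> R.
Proof.
move=> sf; rewrite ler1n /N_bd; apply: (@leq_trans (num_faces Omega i)); last exact: leq_bigmax.
rewrite /num_faces addn_gt0; apply/orP; left; apply/card_gt0P; exists j.
by rewrite unfold_in /=; exact/asboolP.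
Qed.

(** Chosen so that the trace estimate weighted by [kap] leaves the factor 1/64, while
    [n1F^2 / sigma] on a face is at most the [kap] of either neighbour. This is the origin of the
    factor 64 in [sigma]. *)
Definition kap i : R := h i / (64 * (Cd * p%:R) ^+ 2).
Lemma Cdp_gt0 : 0 < (Cd * p%:R) ^+ 2.
Proof. by rewrite exprn_gt0// mulr_gt0// pR_gt0. Qed.
Lemma kap_ge0 i : 0 <= kap i.
Proof. by rewrite divr_ge0 ?mulr_ge0 ?(ltW (hpos _))// ltW// Cdp_gt0. Qed.

Lemma kap_trace i Q : deg2 p Q -> kap i * bd_form i (Q ^+ 2) <= 64^-1 * cell_form i (Q ^+ 2).
Proof.
move=> dQ; apply: le_trans (ler_wpM2l (kap_ge0 i) (trace_inverse i dQ)) _.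
rewrite mulrA le_eqVlt; apply/orP; left; apply/eqP; congr (_ * _).
have := hpos i; have := Cd0; have := pR_gt0 => a b c.
rewrite /kap /inv_scale; field; rewrite !gt_eqF//.
Qed.

(* The penalty parameter is chosen so that the consistency terms on a face are *)
(* controlled by the penalty and a small multiple of the adjacent energies.    *)
Lemma face_young i j (f g : bp2) th : i != j -> 0 < th ->
  2 * nI Omega i j (f * g) <=
    th * sg i j * face_form i j (g ^+ 2) + th^-1 * Num.min (kap i) (kap j) * face_form i j (f ^+ 2).
Proof.
move=> ij th0; have lin := nI_lin Omega i j.
have F0 Q : 0 <= face_form i j (Q ^+ 2) by exact: plf_sqr_ge0.
have yg f0 g0 t := @nI_young _ Omega M xm good hxm i j f0 g0 t.
have [sf|nsf] := pselect (shares_face i j); last first.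
  have z Q : face_form i j Q = 0 by exact: fF_null.
  rewrite !z !mulr0 addr0; apply: le_trans (yg f g 1 ltr01) _.
  by have := z (f ^+ 2); have := z (g ^+ 2); rewrite /face_form => -> ->; rewrite !mulr0 addr0.
have consistency_form := N_bd_gt0 sf; have nF := n1F_ge0 good i (face i j).
have m0 := max_hV_gt0 i j; have c0 := Cdp_gt0.
have k0 : 0 <= Num.min (kap i) (kap j) by rewrite le_min !kap_ge0.
(* Here the penalty parameter is zero as well. Young's inequality no longer sees [f], and rescaling
   [f] shows that the left side cannot be positive. *)
have [n0|n0] := eqVneq (n1F i (face i j)) 0.
  apply: (@le_trans _ _ 0); last first.
    have tg := ltW th0; have sg0 := sigma_ge0 i j.
    by apply: addr_ge0; (apply: mulr_ge0; last exact: F0); apply: mulr_ge0; rewrite ?invr_ge0.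
  rewrite leNgt; apply/negP => pos.
  have := yg (cst2 ((face_form i j (g ^+ 2) + 1) / (2 * nI Omega i j (f * g))) * f) g 1 ltr01.
  rewrite n0 expr0n /= mulr0 mul0r add0r -mulrA lin.2 mulrCA divfK ?gt_eqF// invr1 mul1r.
  by rewrite -/(face_form i j) => H; move: (F0 g); lra.
have n_gt0 : 0 < n1F i (face i j) by rewrite lt_neqAle eq_sym n0.
have s0 : 0 < sg i j.
  apply: mulr_gt0 => //; apply: mulr_gt0; first by apply: mulr_gt0; lra.
  by rewrite exprn_gt0// mulr_gt0 ?pR_gt0// mulr_gt0.
have t0 : 0 < (th * sg i j)^-1 by rewrite invr_gt0 mulr_gt0.
apply: le_trans (yg f g _ t0) _; rewrite invrK addrC lerD2l ler_wpM2r//.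
rewrite invfM -mulrA ler_wpM2l ?invr_ge0 ?(ltW th0)//.
have E : (sg i j)^-1 * n1F i (face i j) ^+ 2 =
   (64 * Nb%:R * (Cd * p%:R) ^+ 2 * Num.max (h i)^-1 (h j)^-1)^-1.
  rewrite /sigma; field.
  have := hpos i; have := hpos j; have pp := pR_gt0.
  by rewrite !gt_eqF//; lra.
have kk (a : I) : (h a)^-1 <= Num.max (h i)^-1 (h j)^-1 ->
    (64 * Nb%:R * (Cd * p%:R) ^+ 2 * Num.max (h i)^-1 (h j)^-1)^-1 <= kap a.
  move=> hm; have ha := hpos a.
  have -> : kap a = (64 * (Cd * p%:R) ^+ 2 * (h a)^-1)^-1.
    by rewrite /kap invf_div.
  rewrite lef_pV2 ?posrE; last 2 first.
  - by apply: mulr_gt0 => //; apply: mulr_gt0 => //; apply: mulr_gt0; lra.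
  - by apply: mulr_gt0; rewrite ?invr_gt0//; apply: mulr_gt0 => //; lra.
  rewrite ler_pM//; first by rewrite mulr_ge0// ltW.
    by rewrite invr_ge0 ltW.
  by rewrite ler_wpM2r ?(ltW c0)//; lra.
by rewrite E le_min !kk// le_max lexx ?orbT.
Qed.

Definition dx_energy u : R := \sum_i cell_form i (dx (u i) ^+ 2).
Definition penalty_form u v : R :=
  \sum_(i < size M) \sum_(j < size M | (j < i)%N) sg i j * face_form i j ((u i - u j) * (v i - v j)).
Definition consistency_form u v : R :=
  \sum_(i < size M) \sum_(j < size M | (j < i)%N)
    nI Omega i j (cst2 2^-1 * (dx (u i) + dx (u j)) * (v i - v j)).
Definition upwind_energy u : R :=
  \sum_i \sum_j upwind_form i j ((u i - u j) ^+ 2) + \sum_i (inflow_form i (u i ^+ 2) + outflow_form i (u i ^+ 2)).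
Definition trace_energy u : R := \sum_i \sum_j upwind_form i j (u i ^+ 2) + \sum_i inflow_form i (u i ^+ 2).
Definition l2_sqr u : R := \sum_i cell_form i (u i ^+ 2).
(** The volume transport term is kept apart because it joins [u'] to form [W = u' + x u_y]. *)
Definition dG_rest u v : R :=
  \sum_i cell_form i (dx (u i) * dx (v i)) - consistency_form u v - consistency_form v u + penalty_form u v
  + (\sum_i \sum_j upwind_form i j ((u i - u j) * v i) + \sum_i inflow_form i (u i * v i)).
Definition dG_form u v : R := \sum_i cell_form i (Xx * dy (u i) * v i) + dG_rest u v.
Definition degp u := forall i, deg2 p (u i).

Lemma face_sum_le (k : I -> R) (c : I -> I -> R) u : (forall i, 0 <= k i) ->
  (forall i j, i != j -> c i j * face_form i j (u i ^+ 2) <= k i * face_form i j (u i ^+ 2)) ->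
  (forall i j, c i j = c j i) ->
  \sum_(i < size M) \sum_(j < size M | (j < i)%N)
     c i j * (face_form i j (u i ^+ 2) + face_form i j (u j ^+ 2)) <= \sum_i k i * bd_form i (u i ^+ 2).
Proof.
move=> k0 ck csym.
have E : \sum_(i < size M) \sum_(j < size M | (j < i)%N)
    c i j * (face_form i j (u i ^+ 2) + face_form i j (u j ^+ 2)) =
    \sum_(i < size M) \sum_(j < size M | (j < i)%N)
     (c i j * face_form i j (u i ^+ 2) + c j i * face_form j i (u j ^+ 2)).
  apply: eq_bigr => i _; apply: eq_bigr => j _; rewrite mulrDr (csym j i); congr (_ + _ * _).
  exact: fF_sym.
rewrite E (sum_pairs (fun i j => c i j * face_form i j (u i ^+ 2))); apply: ler_sum => i _.
apply: (@le_trans _ _ (\sum_(j | j != i) k i * face_form i j (u i ^+ 2))).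
  by apply: ler_sum => j ji; apply: ck; rewrite eq_sym.
rewrite -mulr_sumr ler_wpM2l ?k0//.
by apply: (sum_fF_le Omega good disj hxm) => z; exact: sqr_ge0_ev2.
Qed.

Lemma plf_avg_sqr (L : plf xm) (P Q : bp2) :
  L ((cst2 2^-1 * (P + Q)) ^+ 2) <= 2^-1 * (L (P ^+ 2) + L (Q ^+ 2)).
Proof.
by rewrite plf_sqrZ; have := plf_sqrD L P Q; lra.
Qed.

(** The constant is the 1/64 of [kap_trace] times the 1/2 lost in [plf_avg_sqr]. *)
Lemma N1_young u v th : degp u -> 0 < th -> 2 * consistency_form u v <= th * penalty_form v v + 128^-1 * th^-1 * dx_energy u.
Proof.
move=> du th0; have ti : 0 < th^-1 by rewrite invr_gt0.
pose km i j := Num.min (kap i) (kap j).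
have km0 i j : 0 <= km i j by rewrite le_min !kap_ge0.
apply: (@le_trans _ _ (\sum_(i < size M) \sum_(j < size M | (j < i)%N)
   (th * (sg i j * face_form i j ((v i - v j) * (v i - v j))) + (2^-1 * th^-1) *
     (km i j * (face_form i j (dx (u i) ^+ 2) + face_form i j (dx (u j) ^+ 2)))))).
  rewrite /consistency_form mulr_sumr; apply: ler_sum => i _; rewrite mulr_sumr; apply: ler_sum => j ji.
  have ij : i != j by rewrite neq_ltn ji orbT.
  apply: le_trans (face_young _ _ ij th0) _; rewrite -!expr2 -mulrA lerD2l.
  have := plf_avg_sqr (face_form i j) (dx (u i)) (dx (u j)) => H.
  have := ler_wpM2l (mulr_ge0 (ltW ti) (km0 i j)) H; rewrite -/(km i j).
  by rewrite mulrA [_ * (km i j * _)]mulrA [2^-1 * _ * km i j]mulrAC -mulrA => H1; lra.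
under eq_bigr do rewrite big_split /= -!mulr_sumr; rewrite big_split /= -!mulr_sumr lerD2l.
have H : \sum_(i < size M) \sum_(j < size M | (j < i)%N)
     km i j * (face_form i j (dx (u i) ^+ 2) + face_form i j (dx (u j) ^+ 2)) <= 64^-1 * dx_energy u.
  apply: (@le_trans _ _ (\sum_i kap i * bd_form i (dx (u i) ^+ 2))).
    apply: (face_sum_le (u := fun i => dx (u i))).
    - exact: kap_ge0.
    - by move=> i j _; rewrite ler_wpM2r ?plf_sqr_ge0// /km ge_min lexx.
    - by move=> i j; rewrite /km minC.
  rewrite /dx_energy mulr_sumr; apply: ler_sum => i _; apply: kap_trace; exact: deg2_dx.
have := ler_wpM2l (ltW ti) H; lra.
Qed.

Lemma Sg_ge0 u : 0 <= penalty_form u u.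
Proof.
apply: sumr_ge0 => i _; apply: sumr_ge0 => j _; rewrite mulr_ge0 ?sigma_ge0//.
by rewrite -expr2 plf_sqr_ge0.
Qed.
Lemma Dx_ge0 u : 0 <= dx_energy u. Proof. by apply: sumr_ge0 => i _; exact: plf_sqr_ge0. Qed.
Lemma nrm_ge0 u : 0 <= l2_sqr u. Proof. by apply: sumr_ge0 => i _; exact: plf_sqr_ge0. Qed.
Lemma Uw_ge0 u : 0 <= upwind_energy u.
Proof.
rewrite /upwind_energy addr_ge0//; apply: sumr_ge0 => i _; last by rewrite addr_ge0 ?plf_sqr_ge0.
by apply: sumr_ge0 => j _; exact: plf_sqr_ge0.
Qed.
Lemma Uv_ge0 u : 0 <= trace_energy u.
Proof.
rewrite /trace_energy addr_ge0//; apply: sumr_ge0 => i _; last exact: plf_sqr_ge0.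
by apply: sumr_ge0 => j _; exact: plf_sqr_ge0.
Qed.

(** Writing [(a - b) a] as half of [a^2 + (a - b)^2 - b^2] on inflow parts and using
    [transport_term], the traces cancel up to [inflow_le_outflow], and half of the upwind energy
    remains. The consistency terms, taken with [th = 1/2], use half of the penalty and 1/64 of the
    energy of [w_x]. *)
Lemma aF_coercive w : degp w -> 2^-1 * (dx_energy w + penalty_form w w + upwind_energy w) <= dG_form w w.
Proof.
move=> dw.
have tr i : cell_form i (Xx * dy (w i) * w i) = 2^-1 * (outflow_form i (w i ^+ 2) + interior_outflow_form i (w i ^+ 2)
     - inflow_form i (w i ^+ 2) - \sum_j upwind_form i j (w i ^+ 2)).
  have := transport_term good hxm hxm_elt hup i (w i ^+ 2).
  rewrite -/(cell_form i) -/(outflow_form i) -/(interior_outflow_form i) -/(inflow_form i).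
  have -> : Xx * dy (w i ^+ 2) = cst2 2 * (Xx * dy (w i) * w i).
    rewrite !expr2 !dxyE /cst2 !polyC_natr; ring.
  by rewrite plfZ => h1; rewrite -h1; field.
have xj i j : upwind_form i j ((w i - w j) * w i) = 2^-1 * (upwind_form i j (w i ^+ 2) +
    upwind_form i j ((w i - w j) ^+ 2) - upwind_form i j (w j ^+ 2)).
  rewrite -plfN -!plfD -plfZ; congr (upwind_form i j _).
  have -> : w i ^+ 2 + (w i - w j) ^+ 2 - w j ^+ 2 = cst2 2 * ((w i - w j) * w i).
    rewrite /cst2 !polyC_natr; ring.
  by rewrite mulrA -cst2M mulVf ?pnatr_eq0// cst2_1 mul1r.
have inf : \sum_i \sum_j upwind_form i j (w j ^+ 2) <= \sum_j interior_outflow_form j (w j ^+ 2).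
  rewrite exchange_big /=; apply: ler_sum => j _.
  by apply: (inflow_le_outflow Omega good disj hxm) => z; exact: sqr_ge0_ev2.
have T1 : \sum_i cell_form i (Xx * dy (w i) * w i) = 2^-1 * (\sum_i outflow_form i (w i ^+ 2) +
    \sum_i interior_outflow_form i (w i ^+ 2) - \sum_i inflow_form i (w i ^+ 2) - \sum_i \sum_j upwind_form i j (w i ^+ 2)).
  by rewrite (eq_bigr _ (fun i _ => tr i)) -mulr_sumr !sumrB big_split.
have T2 : \sum_i \sum_j upwind_form i j ((w i - w j) * w i) = 2^-1 * (\sum_i \sum_j upwind_form i j (w i ^+ 2) +
    \sum_i \sum_j upwind_form i j ((w i - w j) ^+ 2) - \sum_i \sum_j upwind_form i j (w j ^+ 2)).
  rewrite (eq_bigr (fun i => 2^-1 * (\sum_j upwind_form i j (w i ^+ 2) +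
    \sum_j upwind_form i j ((w i - w j) ^+ 2) - \sum_j upwind_form i j (w j ^+ 2)))); last first.
    by move=> i _; rewrite (eq_bigr _ (fun j _ => xj i j)) -mulr_sumr sumrB big_split.
  by rewrite -mulr_sumr sumrB big_split.
have T3 : \sum_i inflow_form i (w i * w i) = \sum_i inflow_form i (w i ^+ 2) by [].
have T4 : \sum_i cell_form i (dx (w i) * dx (w i)) = dx_energy w by [].
have Y := @N1_young w w 2^-1 dw (ltac:(lra)); rewrite invrK in Y.
rewrite /dG_form /dG_rest T1 T2 T3 T4 /upwind_energy big_split /=.
have := Sg_ge0 w; have := Dx_ge0 w; lra.
Qed.

Lemma J_young_sum (L : I -> plf xm) u v th : 0 < th ->
  2 * \sum_i L i (u i * v i) <= th * \sum_i L i (u i ^+ 2) + th^-1 * \sum_i L i (v i ^+ 2).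
Proof.
by move=> th0; rewrite !mulr_sumr -big_split; apply: ler_sum => i _; exact: plf_young.
Qed.

Lemma Sg_young u v th : 0 < th -> 2 * penalty_form u v <= th * penalty_form u u + th^-1 * penalty_form v v.
Proof.
move=> th0; rewrite /penalty_form !mulr_sumr -big_split; apply: ler_sum => i _ /=.
rewrite !mulr_sumr -big_split; apply: ler_sum => j _ /=.
have H := plf_young (face_form i j) (u i - u j) (v i - v j) th0; rewrite -!expr2.
have := ler_wpM2l (sigma_ge0 i j) H; lra.
Qed.

(** The upwind terms pair a jump of [w] with a value of [v]. Hence the test side is measured by
    traces in [trace_energy], and no derivative of [w] in [y] appears. *)
Lemma rem_bound w v K : degp w -> degp v -> 0 < K ->
  dG_rest w v <= K * (dx_energy w + penalty_form w w + upwind_energy w) + K^-1 * (dx_energy v + penalty_form v v + trace_energy v).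
Proof.
move=> dw dv K0; have Ki : 0 < K^-1 by rewrite invr_gt0.
have h1 : 2 * \sum_i cell_form i (dx (w i) * dx (v i)) <= K * dx_energy w + K^-1 * dx_energy v :=
  J_young_sum (fun i => cell_form i) (fun i => dx (w i)) (fun i => dx (v i)) K0.
have dNw : degp (fun i => - w i) by move=> i; exact: deg2N.
have dNv : degp (fun i => - v i) by move=> i; exact: deg2N.
have N1N a b : consistency_form (fun i => - a i) b = - consistency_form a b.
  rewrite /consistency_form -sumrN; apply: eq_bigr => i _; rewrite -sumrN; apply: eq_bigr => j _.
  rewrite -(lin2_N _ (nI_lin Omega i j)); congr (nI _ _ _ _); rewrite !dxN; ring.
have DxN a : dx_energy (fun i => - a i) = dx_energy a.
  by apply: eq_bigr => i _; rewrite dxN sqrrN.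
have h2 := N1_young v dNw Ki; rewrite N1N DxN invrK in h2.
have h3 := N1_young w dNv K0; rewrite N1N DxN in h3.
have h4 := Sg_young w v K0.
have h5 : 2 * \sum_i \sum_j upwind_form i j ((w i - w j) * v i) <=
    K * \sum_i \sum_j upwind_form i j ((w i - w j) ^+ 2) + K^-1 * \sum_i \sum_j upwind_form i j (v i ^+ 2).
  rewrite !mulr_sumr -big_split; apply: ler_sum => i _ /=.
  by rewrite !mulr_sumr -big_split; apply: ler_sum => j _ /=; exact: plf_young.
have h6 := J_young_sum inflow_form w v K0.
have Z0 : 0 <= \sum_i outflow_form i (w i ^+ 2) by apply: sumr_ge0 => i _; exact: plf_sqr_ge0.
have Y0 : 0 <= \sum_i inflow_form i (w i ^+ 2) by apply: sumr_ge0 => i _; exact: plf_sqr_ge0.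
have Y1 : 0 <= \sum_i inflow_form i (v i ^+ 2) by apply: sumr_ge0 => i _; exact: plf_sqr_ge0.
have X0 : 0 <= \sum_i \sum_j upwind_form i j ((w i - w j) ^+ 2).
  by apply: sumr_ge0 => i _; apply: sumr_ge0 => j _; exact: plf_sqr_ge0.
have X1 : 0 <= \sum_i \sum_j upwind_form i j (v i ^+ 2).
  by apply: sumr_ge0 => i _; apply: sumr_ge0 => j _; exact: plf_sqr_ge0.
have m1 := mulr_ge0 (ltW K0) Z0; have m2 := mulr_ge0 (ltW K0) Y0.
have m3 := mulr_ge0 (ltW Ki) Y1; have m4 := mulr_ge0 (ltW K0) X0; have m5 := mulr_ge0 (ltW Ki) X1.
have m6 := mulr_ge0 (ltW K0) (Dx_ge0 w); have m7 := mulr_ge0 (ltW Ki) (Dx_ge0 v).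
have m8 := mulr_ge0 (ltW K0) (Sg_ge0 w); have m9 := mulr_ge0 (ltW Ki) (Sg_ge0 v).
rewrite /dG_rest /upwind_energy /trace_energy [in leRHS]big_split; rewrite !mulrDr -![128^-1 * _ * _]mulrA in h1 h2 h3 h4 h5 h6 *.
move: h1 h2 h3 h4 h5 h6 m1 m2 m3 m4 m5 m6 m7 m8 m9.
move: (K * dx_energy w) (K^-1 * dx_energy v) (K * penalty_form w w) (K^-1 * penalty_form v v).
by move=> *; lra.
Qed.

Lemma sigma_T_ge i j : shares_face i j -> sg i j <= sigma_T Omega Cd p i.
Proof. by move=> sf; rewrite /sigma_T; apply: le_bigmax_cond; exact/asboolP. Qed.

Lemma sigma_T_ge0 i : 0 <= sigma_T Omega Cd p i. Proof. exact: bigmax_ge_id. Qed.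

Lemma Sg_le v : degp v ->
  penalty_form v v <= \sum_i 2 * sigma_T Omega Cd p i * (Cd ^+ 2 * inv_scale i * cell_form i (v i ^+ 2)).
Proof.
move=> dv; apply: (@le_trans _ _ (\sum_(i < size M) \sum_(j < size M | (j < i)%N)
   (2 * sg i j) * (face_form i j (v i ^+ 2) + face_form i j (v j ^+ 2)))).
  apply: ler_sum => i _; apply: ler_sum => j _.
  have H := plf_sqrD (face_form i j) (v i) (- v j); rewrite sqrrN in H.
  by have := ler_wpM2l (sigma_ge0 i j) H; rewrite -expr2; lra.
apply: (@le_trans _ _ (\sum_i (2 * sigma_T Omega Cd p i) * bd_form i (v i ^+ 2))).
  apply: face_sum_le.
  - by move=> i; rewrite mulr_ge0// sigma_T_ge0.
  - move=> i j ij; have [sf|nsf] := pselect (shares_face i j).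
      by rewrite ler_wpM2r ?plf_sqr_ge0// ler_wpM2l// sigma_T_ge.
    have -> : face_form i j (v i ^+ 2) = 0 by exact: fF_null.
    by rewrite !mulr0.
  - by move=> i j; rewrite sigma_sym.
apply: ler_sum => i _; rewrite ler_wpM2l ?mulr_ge0 ?sigma_T_ge0//.
exact: trace_inverse.
Qed.

Lemma fW_le (i : I) (S : set pt) (mS : measurable_on_lines S) Q :
  wP good hxm i mS (Q ^+ 2) <= xm * bd_form i (Q ^+ 2).
Proof. by apply: (wI_le good hxm) => // z; exact: sqr_ge0_ev2. Qed.

Lemma sum_FX_le i Q : \sum_j upwind_form i j (Q ^+ 2) <= xm * bd_form i (Q ^+ 2).
Proof.
rewrite -(wI_bmGi good hxm hup i (Q ^+ 2)); apply: (wI_le good hxm) => [|z].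
  by apply: measurable_on_linesI; [exact: measurable_bd_minus|exact: measurable_Gamma_int].
exact: sqr_ge0_ev2.
Qed.

Lemma Uv_le v : degp v -> trace_energy v <= \sum_i 2 * xm * (Cd ^+ 2 * inv_scale i * cell_form i (v i ^+ 2)).
Proof.
move=> dv; rewrite /trace_energy -big_split; apply: ler_sum => i _ /=.
have h1 := sum_FX_le i (v i); have h2 : inflow_form i (v i ^+ 2) <= xm * bd_form i (v i ^+ 2) := fW_le _ _ _.
have := ler_wpM2l (xm_ge0 good hxm i) (trace_inverse i (dv i)); lra.
Qed.

(** The constant is 6 = 2 + 2 + 1 + 1: the cell's own traces in the jumps, those seen by its
    downwind neighbours, and the inflow and outflow on the domain boundary. *)
Lemma Uw_le v : degp v -> upwind_energy v <= \sum_i 6 * xm * (Cd ^+ 2 * inv_scale i * cell_form i (v i ^+ 2)).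
Proof.
move=> dv; rewrite /upwind_energy.
have h1 : \sum_i \sum_j upwind_form i j ((v i - v j) ^+ 2) <=
    \sum_i 2 * (\sum_j upwind_form i j (v i ^+ 2)) + \sum_i 2 * (\sum_j upwind_form i j (v j ^+ 2)).
  rewrite -big_split; apply: ler_sum => i _ /=; rewrite !mulr_sumr -big_split.
  apply: ler_sum => j _ /=; have := plf_sqrD (upwind_form i j) (v i) (- v j).
  by rewrite sqrrN.
have h2 : \sum_i 2 * (\sum_j upwind_form i j (v j ^+ 2)) <= \sum_i 2 * (xm * bd_form i (v i ^+ 2)).
  rewrite -[leLHS]mulr_sumr -[leRHS]mulr_sumr ler_wpM2l// exchange_big /=; apply: ler_sum => j _.
  apply: (@le_trans _ _ (interior_outflow_form j (v j ^+ 2))); last exact: fW_le.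
  by apply: (inflow_le_outflow Omega good disj hxm) => z; exact: sqr_ge0_ev2.
apply: (@le_trans _ _ (\sum_i 6 * (xm * bd_form i (v i ^+ 2)))).
  apply: (@le_trans _ _ (\sum_i 2 * (\sum_j upwind_form i j (v i ^+ 2)) +
    \sum_i 2 * (xm * bd_form i (v i ^+ 2)) + \sum_i (inflow_form i (v i ^+ 2) + outflow_form i (v i ^+ 2)))).
    lra.
  rewrite -!big_split; apply: ler_sum => i _ /=.
  have := sum_FX_le i (v i).
  have : inflow_form i (v i ^+ 2) <= xm * bd_form i (v i ^+ 2) := fW_le _ _ _.
  have : outflow_form i (v i ^+ 2) <= xm * bd_form i (v i ^+ 2) := fW_le _ _ _.
  lra.
apply: ler_sum => i _; rewrite -[6 * xm * _]mulrA ler_wpM2l//.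
by rewrite ler_wpM2l ?(xm_ge0 good hxm i)//; exact: trace_inverse.
Qed.

End FixedTime.

(** * The bilinear form and the norms in terms of functionals *)

Section FormsAsFunctionals.
Context {R : realType}.
Local Notation pt := (R * R)%type.
Local Notation bp2 := {poly {poly R}}.
Variables (Omega : set pt) (M : @mesh R) (xm Cd : R) (p : nat).
Local Notation I := 'I_(size M).
Hypothesis good : forall i : I, good_cell (vert i).
Hypothesis hxm : forall (i : I) z, bd (elt i) z -> `|z.1| <= xm.
Hypothesis hxm_elt : forall (i : I) z, elt i z -> `|z.1| <= xm.
Hypothesis hup : upwind_neighbours Omega M.
Implicit Types (i j k : I) (Q : bp2) (u v w : I -> bp2).

Local Notation J := (cell_form good hxm_elt).
Local Notation FF := (face_form Omega good hxm).
Local Notation FX := (upwind_form Omega good hxm).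
Local Notation FY := (inflow_form Omega good hxm).
Local Notation sg := (sigma Omega Cd p).
Local Notation Gi := (Gamma_int Omega M).

Definition brk w : broken M := fun i => ev2 (w i).

Lemma int_J i (f : pt -> R) Q : (forall z, f z = ev2 Q z) -> \int[leb2]_(z in elt i) f z = J i Q.
Proof. by move=> h; apply: eq_Rintegral => z _. Qed.

Lemma Gamma_int_FF (f : I -> I -> pt -> pt -> R) (c : I -> I -> R) (Q : I -> I -> bp2) :
  (forall i j n z, f i j n z = c i j * ev2 (Q i j) z) ->
  Gamma_int_integral Omega f = \sum_(i < size M) \sum_(j < size M | (j < i)%N) c i j * FF i j (Q i j).
Proof.
move=> hf; apply: eq_bigr => i _; apply: eq_bigr => j _; rewrite -plfZ.
by apply: bd_int_eq_ae => e _; apply: ae01T => s _; rewrite hf !ev2E.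
Qed.

Lemma Gamma_int_nI (f : I -> I -> pt -> pt -> R) (Q : I -> I -> bp2) :
  (forall i j n z, f i j n z = n.1 * ev2 (Q i j) z) ->
  Gamma_int_integral Omega f = \sum_(i < size M) \sum_(j < size M | (j < i)%N) nI Omega i j (Q i j).
Proof.
move=> hf; apply: eq_bigr => i _; apply: eq_bigr => j _.
by apply: bd_int_eq_ae => e _; apply: ae01T => s _; rewrite hf.
Qed.

Lemma d_x_brk w i z : d_x (brk w i) z = ev2 (dx (w i)) z. Proof. exact: d_x_ev2. Qed.
Lemma d_y_brk w i z : d_y (brk w i) z = ev2 (dy (w i)) z. Proof. exact: d_y_ev2. Qed.

Lemma upwind_int_brk i u v (g : pt -> pt -> R) :
  (forall n z j, z.1 * n.2 < 0 -> (forall k, bd_plus (vert k) z <-> k = j) ->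
     g n z = z.1 * n.2 * ev2 ((u i - u j) * v i) z) ->
  bd_int (vert i) (bd_minus (vert i) `&` Gi) g = - \sum_j FX i j ((u i - u j) * v i).
Proof.
move=> hg; rewrite -sumrN (eq_bigr (fun j => FX i j (- ((u i - u j) * v i)))); last first.
  by move=> j _; rewrite plfN.
apply: (upwind_sum good hxm hup i (F := fun j => - ((u i - u j) * v i))) => n z j h hj.
by rewrite (hg _ _ j)// ltr0_norm// ev2N mulrNN.
Qed.

Lemma a_dG_brk u v : a_dG Omega Cd p (brk u) (brk v) = dG_form Omega Cd p good hxm hxm_elt u v.
Proof.
rewrite /a_dG /dG_form /dG_rest.
rewrite (Gamma_int_nI (Q := fun i j => cst2 2^-1 * (dx (u i) + dx (u j)) * (v i - v j))); last first.
  move=> i j n z; rewrite /avg /jump /b_x !d_x_brk /brk !ev2E; ring.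
rewrite (Gamma_int_nI (Q := fun i j => cst2 2^-1 * (dx (v i) + dx (v j)) * (u i - u j))); last first.
  move=> i j n z; rewrite /avg /jump /b_x !d_x_brk /brk !ev2E; ring.
rewrite (Gamma_int_FF (c := sg) (Q := fun i j => (u i - u j) * (v i - v j))); last first.
  move=> i j n z; rewrite /jump /brk !ev2E; ring.
rewrite -/(consistency_form Omega u v) -/(consistency_form Omega v u) -/(penalty_form Omega Cd p good hxm u v).
have E1 : \sum_(i < size M) (\int[leb2]_(z in elt i) (d_x (brk u i) z * d_x (brk v i) z) +
    \int[leb2]_(z in elt i) (z.1 * d_y (brk u i) z * brk v i z)) =
    \sum_i J i (dx (u i) * dx (v i)) + \sum_i J i (Xx * dy (u i) * v i).
  rewrite -big_split; apply: eq_bigr => i _; congr (_ + _); apply: int_J => z.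
    by rewrite !d_x_brk ev2M.
  by rewrite d_y_brk !ev2E.
have E2 : \sum_(i < size M) (bd_int (vert i) (bd_minus (vert i) `&` Gi)
         (fun n z => z.1 * n.2 * upwind_jump (brk u) i z * brk v i z) +
       bd_int (vert i) (bd_minus (vert i) `&` Gamma_minus Omega)
           (fun n z => z.1 * n.2 * brk u i z * brk v i z)) =
   - (\sum_i \sum_j FX i j ((u i - u j) * v i) + \sum_i FY i (u i * v i)).
  rewrite -big_split -sumrN; apply: eq_bigr => i _; rewrite opprD; congr (_ + _).
    apply: (upwind_int_brk (u := u) (v := v)) => n z j h hj.
    by rewrite /upwind_jump (upwind_traceE _ hj) /brk !ev2E; ring.
  rewrite -plfN; apply: (Gamma_minus_int good hxm hup) => n z h.
  by rewrite ltr0_norm// /brk !ev2E; ring.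
rewrite E1 E2; ring.
Qed.

Lemma norm_uw_brk w : norm_uw_sq Omega (brk w) = upwind_energy Omega good hxm w.
Proof.
rewrite /norm_uw_sq /upwind_energy -big_split; apply: eq_bigr => i _; rewrite addrC; congr (_ + _).
  apply: (upwind_sum good hxm hup i (F := fun j => (w i - w j) ^+ 2)) => n z j h hj.
  by rewrite /upwind_jump (upwind_traceE _ hj) !ev2E.
rewrite -(outflow_int good hxm hup).
by apply: bd_int_eq_ae => e _; apply: ae01T => s _; rewrite /brk ev2X.
Qed.

Lemma ip_brk u v : ip (brk u) (brk v) = \sum_i J i (u i * v i).
Proof. by apply: eq_bigr => i _; apply: int_J => z; rewrite ev2M. Qed.

Definition bd_plus_form i : plf xm := wP good hxm i (measurable_bd_plus (vert i)).

(** The square of the gradient weighted by a symmetric matrix with entries [a], [b], [b], [c], as a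
    single polynomial, so that positive functionals can be applied to it. *)
Definition quad (a b c : R) Q : bp2 :=
  cst2 a * dx Q ^+ 2 + cst2 (2 * b) * (dx Q * dy Q) + cst2 c * dy Q ^+ 2.

Section SlabNorm.
Variables (Crho Cn : R) (q : nat) (t : nat -> R) (n : nat).
Local Notation al := (alpha Omega Crho Cd Cn p q t n).
Local Notation be := (beta Omega Crho Cd Cn p q t n).
Local Notation ga := (gamma Omega Crho Cd Cn p q t n).
Local Notation ta := (tau Omega Cd Cn p q t n).
Local Notation Aq i := (quad (al i) (be i) (ga i)).

Lemma A_sq_brk i Q z : A_sq Omega Crho Cd Cn p q t n i (ev2 (dx Q) z, ev2 (dy Q) z) = ev2 (Aq i Q) z.
Proof. by rewrite /A_sq /A_mul /dot /quad !ev2E /=; ring. Qed.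

Lemma norm_Ah_brk w :
  norm_Ah_sq Omega Crho Cd Cn p q t n (brk w) = \sum_i (J i (w i ^+ 2) + J i (Aq i (w i))).
Proof.
apply: eq_bigr => i _; congr (_ + _); apply: int_J => z; first by rewrite ev2X.
by rewrite /grad d_x_brk d_y_brk A_sq_brk.
Qed.

Definition slab_norm_sq w (w' : I -> bp2) : R :=
  \sum_i (J i (Aq i (dx (w i))) + 2^-1 * (al i ^+ 2 * J i (dy (w i) ^+ 2))
     + 2^-1 * J i (dx (w i) ^+ 2) + 2^-1 * (ta i * J i ((w' i + Xx * dy (w i)) ^+ 2))
     + bd_plus_form i (Aq i (w i)))
  + penalty_form Omega Cd p good hxm w w + 2 * upwind_energy Omega good hxm w.

Lemma norm_sq_brk (U : st_fun M) s w w' : slice U n s = brk w -> slice_t U n s = brk w' ->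
  norm_sq Omega Crho Cd Cn p q t U n s = slab_norm_sq w w'.
Proof.
move=> e1 e2; rewrite /norm_sq e1 e2 norm_uw_brk /slab_norm_sq.
rewrite (Gamma_int_FF (c := sg) (Q := fun i j => (w i - w j) * (w i - w j))); last first.
  by move=> i j nu z; rewrite /jump /brk !ev2E expr2.
have d2 i z : d_y (d_x (brk w i)) z = ev2 (dy (dx (w i))) z.
  by rewrite -d_y_ev2; congr d_y; apply/funext => z'; rewrite d_x_brk.
have d3 i z : d_x (d_x (brk w i)) z = ev2 (dx (dx (w i))) z.
  by rewrite -d_x_ev2; congr d_x; apply/funext => z'; rewrite d_x_brk.
congr (_ + _ + _); apply: eq_bigr => i _.
rewrite div1r; congr (_ + _ * _ + _ * _ + _ * _ + _).
- by apply: int_J => z; rewrite /grad d2 d3 A_sq_brk.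
- by rewrite -plfZ; apply: int_J => z; rewrite d_y_brk !ev2E exprMn.
- by apply: int_J => z; rewrite d_x_brk ev2X.
- by rewrite -plfZ; apply: int_J => z; rewrite d_y_brk !ev2E.
apply: (outflow_term good i) => nu z h0.
by rewrite ger0_norm// /grad d_x_brk d_y_brk A_sq_brk.
Qed.

End SlabNorm.
End FormsAsFunctionals.

Ltac ge0_tac := repeat first [exact: sqr_ge0 | exact: ler0n | assumption | (apply: ltW; assumption)
  | apply: addr_ge0 | rewrite exprn_ge0 | rewrite invr_ge0 | apply: mulr_ge0].

(** * Scaling of tau, delta and the entries of A *)

Section ParameterBounds.
Context {R : realType}.
Local Notation pt := (R * R)%type.
Variables (Omega : set pt) (M : @mesh R) (xm Crho Cd Cn Hm : R) (p q : nat) (t : nat -> R) (n : nat).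
Local Notation I := 'I_(size M).
Hypothesis hpos : forall i : I, 0 < h i.
Hypothesis hmax : forall i : I, h i <= Hm.
Hypothesis Cd0 : 0 < Cd.
Hypothesis Cn0 : 0 < Cn.
Hypothesis p0 : (0 < p)%N.
Hypothesis k0 : 0 < k_ t n.
Implicit Types (i j : I).

Local Notation de := (delta Omega Crho Cd Cn p q t n).
Local Notation al := (alpha Omega Crho Cd Cn p q t n).
Local Notation be := (beta Omega Crho Cd Cn p q t n).
Local Notation ga := (gamma Omega Crho Cd Cn p q t n).
Local Notation ta := (tau Omega Cd Cn p q t n).
Local Notation sT := (sigma_T Omega Cd p).
Local Notation eta_p := (inv_scale p).

Let pp : 0 < p%:R :> R. Proof. by rewrite ltr0n. Qed.
Let eta0 i : 0 < eta_p i. Proof. by rewrite divr_gt0// exprn_gt0. Qed.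

Definition tauD i : R := 65 * Cn ^+ 2 / 6 + 3 * sT i ^+ 2 * h i ^+ 2 / (64 * p%:R ^+ 4)
   + (8 * xn2_T i * Cd) ^+ 2 * h i / (3 * p%:R ^+ 2).

Lemma tau_TE i : tau_T Omega Cd Cn p i = ((eta_p i) ^+ 2)^-1 * (tauD i)^-1.
Proof.
rewrite /tau_T -/(tauD i); congr (_ * _); rewrite /eta_p.
by field; rewrite !gt_eqF.
Qed.

Let Cn2 : 0 < Cn ^+ 2. Proof. exact: exprn_gt0. Qed.
Let Cd2 : 0 < Cd ^+ 2. Proof. exact: exprn_gt0. Qed.

Lemma tauD_ge i : 65 * Cn ^+ 2 / 6 <= tauD i /\ 3 * sT i ^+ 2 / (64 * eta_p i ^+ 2) <= tauD i.
Proof.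
have h1 : 0 <= (8 * xn2_T i * Cd) ^+ 2 * h i / (3 * p%:R ^+ 2).
  have hi := hpos i; ge0_tac.
have E : 3 * sT i ^+ 2 * h i ^+ 2 / (64 * p%:R ^+ 4) = 3 * sT i ^+ 2 / (64 * eta_p i ^+ 2).
  by rewrite /eta_p; field; rewrite !gt_eqF.
have h2 : 0 <= 3 * sT i ^+ 2 / (64 * eta_p i ^+ 2).
  by ge0_tac.
rewrite /tauD E; move: Cn2 h1 h2; split; lra.
Qed.

Lemma tauD_gt0 i : 0 < tauD i.
Proof. by have [h1 _] := tauD_ge i; apply: lt_le_trans h1; move: Cn2; lra. Qed.

Lemma tau_gt0 i : 0 < ta i.
Proof.
rewrite lt_min tau_TE mulr_gt0 ?invr_gt0 ?exprn_gt0 ?tauD_gt0//=.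
by rewrite divr_gt0// mulr_gt0// exprn_gt0// ltr0n.
Qed.

Lemma tau_le_tau_T i : ta i * (eta_p i ^+ 2 * tauD i) <= 1.
Proof.
have h0 := tauD_gt0 i; have h1 : 0 < eta_p i ^+ 2 by rewrite exprn_gt0.
have : ta i <= (eta_p i ^+ 2)^-1 * (tauD i)^-1 by rewrite -tau_TE /tau ge_min lexx.
by rewrite -invfM -[leRHS]mul1r ler_pdivlMr// mulr_gt0.
Qed.

Lemma tau_eta i : Cn ^+ 2 * (ta i * eta_p i ^+ 2) <= 6 / 65.
Proof.
have h0 := tau_gt0 i; have h1 : 0 < eta_p i ^+ 2 by rewrite exprn_gt0.
have [h2 _] := tauD_ge i; have := tau_le_tau_T i; rewrite mulrA => h3.
have := ler_wpM2l (ltW (mulr_gt0 h0 h1)) h2; lra.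
Qed.

Lemma tau_sigma i : ta i * sT i ^+ 2 <= 64 / 3.
Proof.
have h0 := tau_gt0 i; have h1 : 0 < eta_p i ^+ 2 by rewrite exprn_gt0.
have [_ h2] := tauD_ge i; have := tau_le_tau_T i; rewrite mulrA => h3.
have := ler_wpM2l (ltW (mulr_gt0 h0 h1)) h2.
have -> : ta i * eta_p i ^+ 2 * (3 * sT i ^+ 2 / (64 * eta_p i ^+ 2)) = 3 / 64 * (ta i * sT i ^+ 2).
  by field; rewrite gt_eqF.
lra.
Qed.

Lemma tau_k i : 64 * q.+1%:R ^+ 2 * ta i <= k_ t n.
Proof.
have q0 : 0 < 64 * q.+1%:R ^+ 2 :> R by rewrite mulr_gt0// exprn_gt0// ltr0n.
by rewrite -ler_pdivlMl// mulrC /tau ge_min lexx orbT.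
Qed.

(** Elements are no larger than [Hm], so [inv_scale] is bounded below and a missing power of it can
    be supplied. In this way the size of the domain enters the constants. *)
Lemma etaV i : 1 <= Hm * eta_p i.
Proof.
rewrite /eta_p mulrA ler_pdivlMr// mul1r; apply: le_trans (hmax i) _.
have H0 : 0 <= Hm by apply: le_trans (hmax i); exact: ltW.
by rewrite ler_peMr// -natrX ler1n expn_gt0 p0.
Qed.

Lemma tau_eta1 i : Cn ^+ 2 * (ta i * eta_p i) <= Hm.
Proof.
have H0 : 0 <= Hm by apply: le_trans (hmax i); exact: ltW.
have h0 := tau_gt0 i; have h1 := eta0 i.
have h2 := ler_wpM2l (ltW (mulr_gt0 Cn2 (mulr_gt0 h0 h1))) (etaV i).
have h3 := ler_wpM2l H0 (tau_eta i).
have : Cn ^+ 2 * (ta i * eta_p i) * (Hm * eta_p i) = Hm * (Cn ^+ 2 * (ta i * eta_p i ^+ 2)) by ring.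
lra.
Qed.

Lemma delta_ge1 i : 1 <= de i. Proof. by rewrite le_max lexx. Qed.

Lemma delta_ge i : eta_p i ^+ 2 * (4 * Cd ^+ 2 + Cn ^+ 2 / 8) <= de i.
Proof.
rewrite /delta le_max; apply/orP; right.
have -> : Cd ^+ 2 * p%:R ^+ 4 / h i ^+ 2 = Cd ^+ 2 * eta_p i ^+ 2.
  by rewrite /eta_p; field; rewrite gt_eqF.
apply: (@le_trans _ _ (Cd ^+ 2 * eta_p i ^+ 2 * (4 + Cn ^+ 2 / (8 * Cd ^+ 2)))).
  by rewrite le_eqVlt; apply/orP; left; apply/eqP; field; rewrite gt_eqF.
by apply: ler_wpM2l; [ge0_tac|rewrite le_max lexx].
Qed.

(** Keeping only the first summand of [calR] under the root gives [delta >= Cd^2 eta^2 sqrt (2 /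
    (eta^2 tau))] with [eta = inv_scale]; then square. *)
Lemma delta_tau i : 2 * Cd ^+ 4 * eta_p i ^+ 2 <= de i ^+ 2 * ta i.
Proof.
have t0 := tau_gt0 i; have e2 : 0 < eta_p i ^+ 2 by rewrite exprn_gt0.
have cR : 2 / eta_p i ^+ 2 / ta i <= calR Omega Crho Cd Cn p q t n i.
  have -> : 2 / eta_p i ^+ 2 / ta i = 2 * h i ^+ 2 / p%:R ^+ 4 / ta i.
    by rewrite /eta_p; field; rewrite !gt_eqF.
  rewrite /calR -!addrA lerDl.
  by have hi := hpos i; ge0_tac.
have c0 : 0 < 2 / eta_p i ^+ 2 / ta i by rewrite !divr_gt0.
have h1 : Cd ^+ 2 * eta_p i ^+ 2 * Num.sqrt (calR Omega Crho Cd Cn p q t n i) <= de i.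
  rewrite /delta le_max; apply/orP; right.
  have -> : Cd ^+ 2 * p%:R ^+ 4 / h i ^+ 2 = Cd ^+ 2 * eta_p i ^+ 2.
    by rewrite /eta_p; field; rewrite gt_eqF.
  by apply: ler_wpM2l; [ge0_tac|rewrite !le_max lexx !orbT].
have d0 : 0 <= de i by apply: le_trans (delta_ge1 i).
have h2 : (Cd ^+ 2 * eta_p i ^+ 2 * Num.sqrt (calR Omega Crho Cd Cn p q t n i)) ^+ 2 <= de i ^+ 2.
  have s0 := sqrtr_ge0 (calR Omega Crho Cd Cn p q t n i); rewrite ler_sqr ?nnegrE//; ge0_tac.
rewrite exprMn sqr_sqrtr ?(le_trans (ltW c0))// in h2.
rewrite -ler_pdivrMr//; apply: le_trans h2.
apply: (@le_trans _ _ ((Cd ^+ 2 * eta_p i ^+ 2) ^+ 2 * (2 / eta_p i ^+ 2 / ta i))).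
  by rewrite le_eqVlt; apply/orP; left; apply/eqP; field; rewrite !gt_eqF.
by rewrite ler_wpM2l ?sqr_ge0.
Qed.

Let d0 i : 0 < de i. Proof. by apply: lt_le_trans (delta_ge1 i). Qed.

Lemma alpha_gt0 i : 0 < al i. Proof. by rewrite divr_gt0// mulr_gt0. Qed.
Lemma beta_gt0 i : 0 < be i. Proof. by rewrite divr_gt0// mulr_gt0// exprn_gt0. Qed.
Lemma gamma_gt0 i : 0 < ga i. Proof. by rewrite divr_gt0// mulr_gt0// exprn_gt0. Qed.

(** Thanks to this the term [alpha w_y] of the norm is measured by [beta], the weight that the
    hypocoercive estimate recovers. *)
Lemma alpha_beta i : al i ^+ 2 = 3 / 4 * be i.
Proof. by rewrite /alpha /beta; field; rewrite gt_eqF. Qed.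
Lemma beta_alpha_gamma i : be i ^+ 2 <= al i * ga i.
Proof.
rewrite -subr_ge0 /alpha /beta /gamma.
have -> : 1 / (8 * de i) * (10 / (48 ^+ 2 * de i ^+ 3)) - (1 / (48 * de i ^+ 2)) ^+ 2 =
  (96 * 96 * de i ^+ 4)^-1 by field; rewrite gt_eqF.
by rewrite invr_ge0 mulr_ge0// exprn_ge0// ltW.
Qed.
Let dV1 i : (de i)^-1 <= 1. Proof. by rewrite invf_le1 ?delta_ge1. Qed.
Lemma gamma_le_beta i : ga i <= be i * (5 / 24 * (de i)^-1).
Proof.
rewrite le_eqVlt; apply/orP; left; apply/eqP; rewrite /gamma /beta; field; rewrite gt_eqF//.
Qed.
Lemma gamma_le_alpha i : ga i <= al i.
Proof.
have -> : ga i = al i * (5 / 144 * ((de i)^-1 * (de i)^-1)).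
  by rewrite /gamma /alpha; field; rewrite gt_eqF.
rewrite ler_piMr ?(ltW (alpha_gt0 i))//.
have v0 : 0 <= (de i)^-1 by rewrite invr_ge0 ltW.
have := mulr_ile1 v0 v0 (dV1 i) (dV1 i); lra.
Qed.

Lemma alpha_eta i : al i * (Cn ^+ 2 * eta_p i ^+ 2) <= 1.
Proof.
rewrite /alpha div1r ler_pdivrMl ?mulr_gt0// mulr1.
have := delta_ge i; have := mulr_ge0 (sqr_ge0 (eta_p i)) (ltW Cd2); lra.
Qed.

(** [delta] dominates the square of [inv_scale]; the first power follows from [2 eta <= 1 + eta^2]
    and [1 <= delta]. *)
Lemma eta_delta i : 8 * Cd ^+ 2 * (eta_p i / de i) <= 4 * Cd ^+ 2 + 1.
Proof.
rewrite mulrA ler_pdivrMr//.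
have h1 := delta_ge i; have h2 := delta_ge1 i.
have h3 := mulr_ge0 (sqr_ge0 (eta_p i)) (ltW Cn2).
have h4 := mulr_ge0 (sqr_ge0 (eta_p i - 1)) (ltW Cd2).
have h5 := mulr_ge0 (ltW Cd2) (_ : 0 <= de i - 1).
have := h5 ltac:(by rewrite subr_ge0).
lra.
Qed.

(** The key relation between A and the tau-term: an inverse estimate applied to [W] under the weight
    [beta] costs no more than a multiple of [tau W^2]. It comes from the root in [delta]. *)
Lemma beta_eta i : 96 * Cd ^+ 4 * (be i * eta_p i ^+ 2) <= ta i.
Proof.
have := delta_tau i; have dd : 0 < de i ^+ 2 by rewrite exprn_gt0.
have -> : 96 * Cd ^+ 4 * (be i * eta_p i ^+ 2) = (2 * Cd ^+ 4 * eta_p i ^+ 2) / de i ^+ 2.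
  by rewrite /beta; field; rewrite gt_eqF.
by rewrite ler_pdivrMr// [ta i * _]mulrC.
Qed.

Lemma alpha_trace i : Cd ^+ 2 * (eta_p i * al i) <= 4 * Cd ^+ 2 + 1.
Proof.
have := eta_delta i; have -> : 8 * Cd ^+ 2 * (eta_p i / de i) = 64 * (Cd ^+ 2 * (eta_p i * al i)).
  by rewrite /alpha; field; rewrite gt_eqF.
have : 0 <= Cd ^+ 2 * (eta_p i * al i) by have := alpha_gt0 i; have := eta0 i => *; ge0_tac.
lra.
Qed.

Lemma gamma_trace i : Cd ^+ 2 * (eta_p i * ga i) <= (4 * Cd ^+ 2 + 1) * be i.
Proof.
have h1 := gamma_le_beta i; have b0 := beta_gt0 i.
have c0 : 0 <= Cd ^+ 2 * eta_p i by rewrite mulr_ge0 ?sqr_ge0// ltW.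
have := ler_wpM2l c0 h1; have := ler_wpM2l (ltW b0) (eta_delta i).
have -> : be i * (8 * Cd ^+ 2 * (eta_p i / de i)) =
  192 / 5 * (Cd ^+ 2 * eta_p i * (be i * (5 / 24 * (de i)^-1))) by field; rewrite gt_eqF.
have : 0 <= Cd ^+ 2 * (eta_p i * ga i) by have := gamma_gt0 i; have := eta0 i => *; ge0_tac.
lra.
Qed.

Lemma beta_le1 i : be i <= 1.
Proof.
have d2 : 1 <= de i ^+ 2 by have := delta_ge1 i; rewrite expr2 => h; have := ler_pM ler01 ler01 h h; rewrite mulr1.
rewrite /beta div1r invf_le1; first lra.
by apply: mulr_gt0 => //; exact: exprn_gt0.
Qed.

End ParameterBounds.

(** * The norm at a fixed time against the basic energies *)

Section NormBounds.
Context {R : realType}.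
Local Notation pt := (R * R)%type.
Local Notation bp2 := {poly {poly R}}.
Variables (Omega : set pt) (M : @mesh R) (xm Crho Cd Cn Hm : R) (p q : nat) (t : nat -> R) (n : nat).
Local Notation I := 'I_(size M).
Hypothesis good : forall i : I, good_cell (vert i).
Hypothesis disj : forall i j : I, i != j -> elt i `&` elt j = set0.
Hypothesis hxm : forall (i : I) z, bd (elt i) z -> `|z.1| <= xm.
Hypothesis hxm_elt : forall (i : I) z, elt i z -> `|z.1| <= xm.
Hypothesis hup : upwind_neighbours Omega M.
Hypothesis hinv : inverse_estimates M Cd Cn.
Hypothesis hpos : forall i : I, 0 < h i.
Hypothesis hmax : forall i : I, h i <= Hm.
Hypothesis Cd0 : 0 < Cd.
Hypothesis Cn0 : 0 < Cn.
Hypothesis p0 : (0 < p)%N.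
Hypothesis k0 : 0 < k_ t n.
Implicit Types (i j k : I) (Q : bp2) (u v w : I -> bp2).

Local Notation J := (cell_form good hxm_elt).
Local Notation FT := (bd_form good hxm).
Local Notation Dx := (dx_energy good hxm_elt).
Local Notation Sg := (penalty_form Omega Cd p good hxm).
Local Notation Uw := (upwind_energy Omega good hxm).
Local Notation Uv := (trace_energy Omega good hxm).
Local Notation nrm := (l2_sqr good hxm_elt).
Local Notation fO := (bd_plus_form good hxm).
Local Notation al := (alpha Omega Crho Cd Cn p q t n).
Local Notation be := (beta Omega Crho Cd Cn p q t n).
Local Notation ga := (gamma Omega Crho Cd Cn p q t n).
Local Notation ta := (tau Omega Cd Cn p q t n).
Local Notation Aq i := (quad (al i) (be i) (ga i)).
Local Notation NF := (slab_norm_sq Omega Cd p good hxm hxm_elt Crho Cn q t n).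
Local Notation al0 := (alpha_gt0 Omega Crho Cd Cn p q t n).
Local Notation be0 := (beta_gt0 Omega Crho Cd Cn p q t n).
Local Notation ga0 := (gamma_gt0 Omega Crho Cd Cn p q t n).
Local Notation ta0 := (tau_gt0 Omega Cd q hpos Cn0 p0 k0).

Lemma quad_form (a b c x y : R) : 0 < a -> b ^+ 2 <= a * c -> 0 <= a * x ^+ 2 + 2 * b * (x * y) + c * y ^+ 2.
Proof.
move=> ha hb; rewrite -(pmulr_rge0 _ ha).
have -> : a * (a * x ^+ 2 + 2 * b * (x * y) + c * y ^+ 2) =
  (a * x + b * y) ^+ 2 + (a * c - b ^+ 2) * y ^+ 2 by ring.
by rewrite addr_ge0 ?sqr_ge0// mulr_ge0 ?sqr_ge0// subr_ge0.
Qed.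

Lemma ev2_quad_ge0 i Q z : 0 <= ev2 (Aq i Q) z.
Proof.
have -> : ev2 (Aq i Q) z = al i * ev2 (dx Q) z ^+ 2 + 2 * be i * (ev2 (dx Q) z * ev2 (dy Q) z) +
   ga i * ev2 (dy Q) z ^+ 2 by rewrite /quad !ev2E.
by apply: quad_form; [exact: al0|exact: beta_alpha_gamma].
Qed.

Lemma quad_ge0 (L : plf xm) i Q : 0 <= L (Aq i Q).
Proof. by apply: plf_ge0 => z _; exact: ev2_quad_ge0. Qed.

Lemma quad_le (L : plf xm) i Q :
  L (Aq i Q) <= 2 * al i * L (dx Q ^+ 2) + 2 * ga i * L (dy Q ^+ 2).
Proof.
rewrite -!plfZ -plfD; apply: plf_le => z _; rewrite /quad !ev2E.
have := @quad_form (al i) (- be i) (ga i) (ev2 (dx Q) z) (ev2 (dy Q) z) (al0 i).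
rewrite sqrrN => /(_ (beta_alpha_gamma _ _ _ _ _ _ _ _ _)).
move: (ev2 (dx Q) z) (ev2 (dy Q) z) (al i) (be i) (ga i) => x y a b c; lra.
Qed.

Definition transport_energy w (w' : I -> bp2) : R := \sum_i ta i * J i ((w' i + Xx * dy (w i)) ^+ 2).
Definition dy_energy w : R := \sum_i be i * J i (dy (w i) ^+ 2).
Definition norm_const : R := 5 + 2 * xm * (4 * Cd ^+ 2 + 1).

(** Second derivatives are removed by the gradient estimate with [alpha_eta], and the boundary term
    by the trace estimate with [alpha_trace] and [gamma_trace]. The latter produces the part of
    [norm_const] with [xm]. *)
Lemma cell_norm_le i w (w' : I -> bp2) : degp p w ->
  J i (Aq i (dx (w i))) + 2^-1 * (al i ^+ 2 * J i (dy (w i) ^+ 2))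
     + 2^-1 * J i (dx (w i) ^+ 2) + 2^-1 * (ta i * J i ((w' i + Xx * dy (w i)) ^+ 2))
     + fO i (Aq i (w i)) <=
  norm_const * (J i (dx (w i) ^+ 2) + be i * J i (dy (w i) ^+ 2) + ta i * J i ((w' i + Xx * dy (w i)) ^+ 2)).
Proof.
move=> dw; have x0 := xm_ge0 good hxm i.
have h1 := quad_le (J i) i (dx (w i)).
have h2 := grad_inverse good hxm_elt hinv hpos Cn0 p0 i (deg2_dx (dw i)).
have h3 := alpha_eta Omega Crho Cn p q t n hpos Cd0 i.
have h4 := gamma_le_alpha Omega Crho Cd Cn p q t n i.
have h5 : fO i (Aq i (w i)) <= xm * FT i (Aq i (w i)).
  by apply: (wI_le good hxm); [exact: measurable_bd_plus|move=> z _; exact: ev2_quad_ge0].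
have h6 := quad_le (FT i) i (w i).
have h7 := trace_inverse good hxm hxm_elt hinv hpos Cd0 p0 i (deg2_dx (dw i)).
have h8 := trace_inverse good hxm hxm_elt hinv hpos Cd0 p0 i (deg2_dy (dw i)).
have h9 := alpha_trace Omega Crho q t n hpos Cd0 Cn0 p0 i.
have h10 := gamma_trace Omega Crho q t n hpos Cd0 Cn0 p0 i.
have a0 := al0 i; have b0 := be0 i; have g0 := ga0 i; have t0 := ta0 i.
rewrite alpha_beta /norm_const.
have P1 := plf_sqr_ge0 (J i) (dx (w i)); have P2 := plf_sqr_ge0 (J i) (dy (w i)).
have P3 := plf_sqr_ge0 (J i) (w' i + Xx * dy (w i)).
have P4 := plf_sqr_ge0 (J i) (dx (dx (w i))); have P5 := plf_sqr_ge0 (J i) (dy (dx (w i))).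
move: h1 h2 h3 h4 h5 h6 h7 h8 h9 h10 a0 b0 g0 t0 P1 P2 P3 P4 P5.
move: (J i (Aq i (dx (w i)))) (fO i (Aq i (w i))) (FT i (Aq i (w i))) (FT i (dx (w i) ^+ 2)) (FT i (dy (w i) ^+ 2)) => A1 O1 F1 F2 F3.
move: (J i (dx (dx (w i)) ^+ 2)) (J i (dy (dx (w i)) ^+ 2)) (J i (dx (w i) ^+ 2)) (J i (dy (w i) ^+ 2)).
move: (J i ((w' i + Xx * dy (w i)) ^+ 2)) => j5 j1 j2 j3 j4.
move: (al i) (be i) (ga i) (ta i) (inv_scale p i) => a b g s e.
move=> h1 h2 h3 h4 h5 h6 h7 h8 h9 h10 a0 b0 g0 t0 P1 P2 P3 P4 P5.
have s1 : A1 <= 2 * j3.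
  have := ler_wpM2r P5 h4; have := ler_wpM2l (ltW a0) h2; have := ler_wpM2r P1 h3; lra.
have s2 : F1 <= 2 * (4 * Cd ^+ 2 + 1) * (j3 + b * j4).
  have := ler_wpM2l (ltW a0) h7; have := ler_wpM2l (ltW g0) h8.
  have := ler_wpM2r P1 h9; have := ler_wpM2r P2 h10.
  move: h6; move: (Cd ^+ 2) => c; lra.
have s3 : xm * F1 <= 2 * xm * (4 * Cd ^+ 2 + 1) * (j3 + b * j4).
  by have := ler_wpM2l x0 s2; move: (Cd ^+ 2) => c; lra.
have r1 := mulr_ge0 (ltW b0) P2; have r2 := mulr_ge0 (ltW t0) P3.
have r3 : 0 <= 2 * xm * (4 * Cd ^+ 2 + 1) by have := sqr_ge0 Cd; move=> ?; apply: mulr_ge0; lra.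
have r4 := mulr_ge0 r3 r2; rewrite -[3 / 4 * b * j4]mulrA.
move: s3 r4 {r3}; move: (b * j4) (s * j5) (2 * xm * (4 * Cd ^+ 2 + 1)) r1 r2 => bj sj K r1 r2 s3 r4; lra.
Qed.

Lemma NF_le w (w' : I -> bp2) : degp p w ->
  NF w w' <= norm_const * (Dx w + dy_energy w + transport_energy w w') + Sg w w + 2 * Uw w.
Proof.
move=> dw; rewrite /NF !lerD2r -!big_split mulr_sumr; apply: ler_sum => i _.
exact: cell_norm_le.
Qed.

(** The two terms kept here are those from which definiteness of the norm is deduced. *)
Lemma NF_ge w (w' : I -> bp2) : 2^-1 * \sum_i (al i ^+ 2 * J i (dy (w i) ^+ 2)) + 2^-1 * transport_energy w w' <= NF w w'.
Proof.
rewrite /NF -addrA ler_wpDr//.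
  by apply: addr_ge0; [exact: (Sg_ge0 Omega Cd p good hxm hpos)|apply: mulr_ge0 => //; exact: Uw_ge0].
rewrite /transport_energy !mulr_sumr -big_split; apply: ler_sum => i _ /=.
have := quad_ge0 (J i) i (dx (w i)); have := quad_ge0 (fO i) i (w i).
have := plf_sqr_ge0 (J i) (dx (w i)); lra.
Qed.

Lemma norm_Ah_ge w : nrm w <= norm_Ah_sq Omega Crho Cd Cn p q t n (brk w).
Proof. by rewrite (norm_Ah_brk Omega Cd p good hxm_elt); apply: ler_sum => i _; rewrite lerDl quad_ge0. Qed.

(** On discrete functions the A-part adds at most twice the plain squared norm: [quad_le] bounds it
    by diagonal terms, and [alpha] times the gradient estimate costs at most 1. *)
Lemma norm_Ah_le w : degp p w -> norm_Ah_sq Omega Crho Cd Cn p q t n (brk w) <= 3 * nrm w.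
Proof.
move=> dw; rewrite (norm_Ah_brk Omega Cd p good hxm_elt) mulr_sumr; apply: ler_sum => i _.
have h1 := quad_le (J i) i (w i).
have h2 := grad_inverse good hxm_elt hinv hpos Cn0 p0 i (dw i).
have h3 := alpha_eta Omega Crho Cn p q t n hpos Cd0 i.
have h4 := gamma_le_alpha Omega Crho Cd Cn p q t n i.
have := ler_wpM2r (plf_sqr_ge0 (J i) (dy (w i))) h4.
have := ler_wpM2l (ltW (al0 i)) h2; have := ler_wpM2r (plf_sqr_ge0 (J i) (w i)) h3.
move: h1; move: (J i (Aq i (w i))) (J i (dx (w i) ^+ 2)) (J i (dy (w i) ^+ 2)) (J i (w i ^+ 2)) => a1 a2 a3 a4.
by move: (al i) (ga i) => a g; lra.
Qed.

(** The summands bound, for [tau W], the [x]-derivative, the penalty and the traces. For the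
    penalty, [2 sigma eta <= sigma^2 + eta^2] is multiplied by [tau], and 22 exceeds the 64/3 of
    [tau_sigma]; the 8 is the 2 of [Uv_le] plus the 6 of [Uw_le]. *)
Definition test_const : R := 1 + Cd ^+ 2 * (22 + (Cn ^+ 2)^-1) + 8 * xm * Cd ^+ 2 * (Hm / Cn ^+ 2).

Lemma test_bound (W : I -> bp2) : degp p W ->
  forall v, (forall i, v i = cst2 (ta i) * W i) ->
  Dx v + Sg v v + Uv v + Uw v <= test_const * \sum_i ta i * J i (W i ^+ 2).
Proof.
move=> dW v hv; have dv : degp p v by move=> i; rewrite hv; exact: deg2Z.
have h1 := Sg_le Omega good disj hxm hxm_elt hinv hpos Cd0 p0 dv.
have h2 := Uv_le good hxm hxm_elt hup hinv hpos Cd0 p0 dv.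
have h3 := Uw_le good disj hxm hxm_elt hup hinv hpos Cd0 p0 dv.
apply: (@le_trans _ _ (Dx v + \sum_i 2 * sigma_T Omega Cd p i * (Cd ^+ 2 * inv_scale p i * J i (v i ^+ 2)) +
  \sum_i 2 * xm * (Cd ^+ 2 * inv_scale p i * J i (v i ^+ 2)) +
  \sum_i 6 * xm * (Cd ^+ 2 * inv_scale p i * J i (v i ^+ 2)))).
  by apply: lerD => //; apply: lerD => //; apply: lerD.
rewrite /Dx -!big_split mulr_sumr; apply: ler_sum => i _ /=.
have x0 := xm_ge0 good hxm i; have t0 := ta0 i.
have g1 := dx_inverse good hxm_elt hinv hpos Cn0 p0 i (dv i).
have g2 := tau_eta Omega Cd q hpos Cn0 p0 k0 i.
have g3 := tau_sigma Omega Cd q hpos Cn0 p0 k0 i.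
have g4 := tau_eta1 Omega Cd q hpos hmax Cn0 p0 k0 i.
have E : J i (v i ^+ 2) = ta i ^+ 2 * J i (W i ^+ 2) by rewrite hv; exact: plf_sqrZ.
have j0 := plf_sqr_ge0 (J i) (W i); rewrite E in g1 *; rewrite /test_const.
have cd : 0 <= Cd ^+ 2 by exact: sqr_ge0.
have cn : 0 < Cn ^+ 2 by exact: exprn_gt0.
have ci : 0 <= (Cn ^+ 2)^-1 by rewrite invr_ge0 ltW.
have g5 : ta i * inv_scale p i ^+ 2 <= (Cn ^+ 2)^-1 by rewrite -[leRHS]mul1r ler_pdivlMr// mulrC; lra.
have g6 : ta i * inv_scale p i <= Hm / Cn ^+ 2 by rewrite ler_pdivlMr// mulrC.
move: g1 g2 g3 g5 g6 t0 j0 {E}.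
move: (J i (dx (v i) ^+ 2)) (J i (W i ^+ 2)) (ta i) (inv_scale p i) (sigma_T Omega Cd p i) (Hm / Cn ^+ 2) => d j s e g H.
move=> g1 g2 g3 g5 g6 t0 j0.
have sj : 0 <= s * j by rewrite mulr_ge0// ltW.
have a1 : d <= s * j by have := ler_wpM2r sj g2; lra.
have a2 : 2 * g * (Cd ^+ 2 * e * (s ^+ 2 * j)) <= Cd ^+ 2 * (22 + (Cn ^+ 2)^-1) * (s * j).
  have y : 2 * (s * (g * e)) <= 22 + (Cn ^+ 2)^-1.
    have := mulr_ge0 (ltW t0) (sqr_ge0 (g - e)); lra.
  have := ler_wpM2l (mulr_ge0 cd sj) y; move: (Cd ^+ 2) ((Cn ^+ 2)^-1) => c c'; lra.
have a3 : 8 * xm * (Cd ^+ 2 * e * (s ^+ 2 * j)) <= 8 * xm * Cd ^+ 2 * H * (s * j).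
  have := ler_wpM2l (mulr_ge0 (mulr_ge0 x0 cd) sj) g6; move: (Cd ^+ 2) => c; lra.
lra.
Qed.

End NormBounds.

(** * Degrees and derivatives of time-dependent polynomials *)

Section TimeDependent.
Context {R : realType}.
Local Notation bp2 := {poly {poly R}}.
Implicit Types (P : {poly bp2}).

Definition deg3 (p : nat) P := forall l, deg2 p P`_l.

Lemma deg3_horner p P s : deg3 p P -> deg2 p P.[cst2 s].
Proof.
by move=> dP; rewrite horner_coef; apply: deg2_sum => l _; rewrite mulrC -cst2X; exact: deg2Z.
Qed.

Lemma cst2_natr n : cst2 n%:R = n%:R :> bp2.
Proof. by rewrite /cst2 !polyC_natr. Qed.

Lemma deg3_deriv p P : deg3 p P -> deg3 p P^`().
Proof. by move=> dP l; rewrite coef_deriv -mulr_natl -cst2_natr; exact: deg2Z. Qed.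

Lemma dx0 : dx 0 = 0 :> bp2. Proof. by rewrite -cst2_0 dx_cst cst2_0. Qed.
Lemma dy0 : dy 0 = 0 :> bp2. Proof. by rewrite -cst2_0 dy_cst. Qed.

Lemma deriv_map_add (d : bp2 -> bp2) P : d 0 = 0 -> (forall a b, d (a + b) = d a + d b) ->
  (map_poly d P)^`() = map_poly d P^`().
Proof.
move=> d0 dD; apply/polyP => l; rewrite coef_deriv !coef_map_id0// coef_deriv.
by move: (P`_l.+1) => Q; elim: (l.+1) => [|n IH]; rewrite ?mulr0n ?d0// !mulrS dD IH.
Qed.

Definition tW P : {poly bp2} := P^`() + Xx%:P * map_poly (@dy R) P.

Lemma tW_horner P s : (tW P).[cst2 s] = P^`().[cst2 s] + Xx * dy P.[cst2 s].
Proof. by rewrite hornerD hornerM hornerC dy_horner. Qed.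

Lemma deg3_tW p P : deg3 p P -> deg3 p (tW P).
Proof.
move=> dP l; rewrite coefD coefCM coef_map_id0 ?dy0//.
by apply: deg2D; [exact: (deg3_deriv dP l)|exact: (deg2_Xx_dy (dP l))].
Qed.

Lemma size_tW q P : (size P <= q)%N -> (size (tW P) <= q)%N.
Proof.
move=> sP; apply: leq_trans (size_polyD _ _) _; rewrite geq_max; apply/andP; split.
  by apply: leq_trans sP; apply: leq_trans (size_poly _ _) (leq_pred _).
rewrite mul_polyC; apply: leq_trans (size_scale_leq _ _) _.
by apply: leq_trans (size_poly _ _) sP.
Qed.

End TimeDependent.

(** * Recovery of the y-derivative *)

Section Hypocoercivity.
Context {R : realType}.
Local Notation pt := (R * R)%type.
Local Notation bp2 := {poly {poly R}}.
Variables (Omega : set pt) (M : @mesh R) (xm Crho Cd Cn : R) (p q : nat) (t : nat -> R) (n : nat).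
Local Notation I := 'I_(size M).
Hypothesis good : forall i : I, good_cell (vert i).
Hypothesis hxm : forall (i : I) z, bd (elt i) z -> `|z.1| <= xm.
Hypothesis hxm_elt : forall (i : I) z, elt i z -> `|z.1| <= xm.
Hypothesis hinv : inverse_estimates M Cd Cn.
Hypothesis hpos : forall i : I, 0 < h i.
Hypothesis Cd0 : 0 < Cd.
Hypothesis Cn0 : 0 < Cn.
Hypothesis p0 : (0 < p)%N.
Hypothesis k0 : 0 < k_ t n.
Implicit Types (i j k : I) (Q : bp2) (u v w : I -> bp2).

Local Notation J := (cell_form good hxm_elt).
Local Notation be := (beta Omega Crho Cd Cn p q t n).
Local Notation be0 := (beta_gt0 Omega Crho Cd Cn p q t n).
Local Notation ta := (tau Omega Cd Cn p q t n).
Local Notation ta0 := (tau_gt0 Omega Cd q hpos Cn0 p0 k0).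

(** The second summand pays for the gradient of [W] through [beta_eta], the third for the terms with
    [x u_x] through [beta_eta_le1]. *)
Definition hypo_const : R := 1 + Cn ^+ 2 / (48 * Cd ^+ 4) + xm ^+ 2 * Cn ^+ 2 / (48 * Cd ^+ 2).

Lemma beta_eta_le1 i : 192 * Cd ^+ 2 * (be i * inv_scale p i ^+ 2) <= 1.
Proof.
have d1 := delta_ge1 Omega Crho Cd Cn p q t n i; have dd := delta_ge Omega Crho Cn p q t n hpos Cd0 i.
have d0 := lt_le_trans ltr01 d1.
rewrite /beta; move: d1 dd d0; set d := delta _ _ _ _ _ _ _ _ _ => d1 dd d0.
have -> : 192 * Cd ^+ 2 * (1 / (48 * d ^+ 2) * inv_scale p i ^+ 2) = (4 * Cd ^+ 2 * inv_scale p i ^+ 2) / d ^+ 2.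
  by field; rewrite gt_eqF.
rewrite ler_pdivrMr ?exprn_gt0// mul1r.
have := mulr_ge0 (sqr_ge0 (inv_scale p i)) (sqr_ge0 Cn); have := mulr_ge0 (ltW d0) (_ : 0 <= d - 1).
rewrite subr_ge0 => /(_ d1); move: (Cd ^+ 2) (Cn ^+ 2) dd => c c' dd; lra.
Qed.

(* With [W = u' + x u_y] the commutator of [d_x] and [x d_y] produces the missing [u_y]:
   [u_y^2 = W_x u_y + W_y u_x - (u_x u_y)' - x (u_x u_y)_y]. *)
Lemma hypo_pt i (u u' : bp2) : deg2 p u -> deg2 p u' ->
  2^-1 * (be i * J i (dy u ^+ 2)) + be i * J i (dx u' * dy u + dx u * dy u') <=
  hypo_const * (ta i * J i ((u' + Xx * dy u) ^+ 2) + J i (dx u ^+ 2)).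
Proof.
move=> du du'; set W := u' + Xx * dy u.
have dW : deg2 p W by apply: deg2D => //; exact: deg2_Xx_dy.
(* The last two functionals together are [- x (u_x u_y)_y]. They are bounded by inverse estimates in
   [y] and not integrated by parts, so no boundary terms arise. *)
have E : J i (dx u' * dy u + dx u * dy u') = J i (dx W * dy u) + J i (dy W * dx u)
   - J i (dy u ^+ 2) + J i (- (Xx * dy (dx u)) * dy u) + J i (dy (dy u) * - (Xx * dx u)).
  by rewrite -!plfN -!plfD; congr (J i _); rewrite /W !dxyE; ring.
(* The weights are chosen so that the three products with [u_y] or [u_yy] each cost 1/8 of the [u_y]
   energy. The 3/8 in total are less than the half that may be given away. *)
have h1 := plf_young (J i) (dx W) (dy u) (_ : 0 < 4); have h2 := plf_young (J i) (dy W) (dx u) ltr01.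
have h3 := plf_young (J i) (- (Xx * dy (dx u))) (dy u) (_ : 0 < 4).
have e0 := eta_gt0 hpos p0 i; have cn0 : 0 < Cn ^+ 2 * inv_scale p i ^+ 2 by rewrite mulr_gt0 ?exprn_gt0.
have t0 : 0 < (4 * (Cn ^+ 2 * inv_scale p i ^+ 2))^-1 by rewrite invr_gt0 mulr_gt0.
have h4 := plf_young (J i) (dy (dy u)) (- (Xx * dx u)) t0.
have g1 := grad_inverse good hxm_elt hinv hpos Cn0 p0 i dW.
have g2 := dy_inverse good hxm_elt hinv hpos Cn0 p0 i (deg2_dx du).
have g3 := dy_inverse good hxm_elt hinv hpos Cn0 p0 i (deg2_dy du).
have x1 := plf_Xx_sqr (J i) (dy (dx u)); have x2 := plf_Xx_sqr (J i) (dx u).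
rewrite !sqrrN invrK invr1 in h2 h3 h4.
have b1 := beta_eta Omega Crho Cd q hpos Cn0 p0 k0 i; have b2 := beta_eta_le1 i.
have b3 := beta_le1 Omega Crho Cd Cn p q t n i; have b0 := be0 i.
have P1 := plf_sqr_ge0 (J i) (dx u); have P2 := plf_sqr_ge0 (J i) (dy u).
have P3 := plf_sqr_ge0 (J i) W; have P4 := plf_sqr_ge0 (J i) (dy (dx u)).
have P5 := plf_sqr_ge0 (J i) (dx W); have P6 := plf_sqr_ge0 (J i) (dy W).
rewrite E; move: h1 h2 h3 h4 g1 g2 g3 x1 x2 P1 P2 P3 P4 P5 P6 => /(_ (ltr0Sn _ 3)) h1 h2 /(_ (ltr0Sn _ 3)) h3.
move: h1 h2 h3.
move: (J i (dx W * dy u)) (J i (dy W * dx u)) (J i (- (Xx * dy (dx u)) * dy u)) => l1 l2 l3.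
move: (J i (dy (dy u) * - (Xx * dx u))) (J i ((Xx * dy (dx u)) ^+ 2)) (J i ((Xx * dx u) ^+ 2)) => l4 q1 q2.
move: (J i (dy (dy u) ^+ 2)) (J i (dy (dx u) ^+ 2)) (J i (dx u ^+ 2)) (J i (dy u ^+ 2)) => q3 q4 ux uy.
move: (J i (dx W ^+ 2)) (J i (dy W ^+ 2)) (J i (W ^+ 2)) => wx wy w.
move: b1 b2 b3 b0 e0 cn0 t0; move: (be i) (ta i) (inv_scale p i) => b s e b1 b2 b3 b0 e0 cn0 t0.
move=> h1 h2 h3 h4 g1 g2 g3 x1 x2 P1 P2 P3 P4 P5 P6.
set c := Cn ^+ 2 * e ^+ 2 in cn0 t0 h4 g1 g2 g3.
have k1 : (4 * c)^-1 * q3 <= 4^-1 * uy.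
  by have := ler_wpM2l (ltW t0) g3; have -> : (4 * c)^-1 * (c * uy) = 4^-1 * uy by field; rewrite gt_eqF.
have xx := sqr_ge0 xm.
have k2 : 4 * c * q2 <= 4 * (c * (xm ^+ 2 * ux)) by have := ler_wpM2l (ltW cn0) x2; lra.
have k3 : 4 * q1 <= 4 * (c * (xm ^+ 2 * ux)) by have := ler_wpM2l xx g2; lra.
have k4 : l1 + l2 + l3 + l4 <= 3 / 8 * uy + 2 * (c * w) + 2^-1 * ux + 4 * (c * (xm ^+ 2 * ux)).
  move: k1 k2 k3 g1 P5 P6 h4; move: (c * w) (c * (xm ^+ 2 * ux)) ((4 * c)^-1 * q3) (4 * c * q2) => *; lra.
have k5 := ler_wpM2l (ltW b0) k4.
have cd4 : 0 < Cd ^+ 4 by rewrite exprn_gt0. 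
have cd2 : 0 < Cd ^+ 2 by rewrite exprn_gt0. 
have cn2 : 0 < Cn ^+ 2 by rewrite exprn_gt0. 
have k6 : b * (2 * (c * w)) <= Cn ^+ 2 / (48 * Cd ^+ 4) * (s * w).
  have := ler_wpM2r (mulr_ge0 (ltW cn2) P3) b1.
  have -> : b * (2 * (c * w)) = 96 * Cd ^+ 4 * (b * e ^+ 2) * (Cn ^+ 2 * w) / (48 * Cd ^+ 4).
    by rewrite /c; field; rewrite gt_eqF.
  rewrite ler_pdivrMr ?mulr_gt0//.
  have -> : Cn ^+ 2 / (48 * Cd ^+ 4) * (s * w) * (48 * Cd ^+ 4) = s * (Cn ^+ 2 * w).
    by field; rewrite gt_eqF.
  by [].
have k7 : b * (4 * (c * (xm ^+ 2 * ux))) <= xm ^+ 2 * Cn ^+ 2 / (48 * Cd ^+ 2) * ux.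
  have := ler_wpM2r (mulr_ge0 (ltW cn2) (mulr_ge0 xx P1)) b2.
  have -> : b * (4 * (c * (xm ^+ 2 * ux))) = 192 * Cd ^+ 2 * (b * e ^+ 2) * (Cn ^+ 2 * (xm ^+ 2 * ux)) / (48 * Cd ^+ 2).
    by rewrite /c; field; rewrite gt_eqF.
  rewrite ler_pdivrMr ?mulr_gt0//.
  have -> : xm ^+ 2 * Cn ^+ 2 / (48 * Cd ^+ 2) * ux * (48 * Cd ^+ 2) = 1 * (Cn ^+ 2 * (xm ^+ 2 * ux)).
    by field; rewrite gt_eqF.
  by [].
have k8 : b * ux <= ux by rewrite ler_piMl.
have s0 : 0 <= s.
  by apply: le_trans b1; rewrite !mulr_ge0 ?sqr_ge0// ltW.
have m1 := mulr_ge0 s0 P3; have m2 := mulr_ge0 (ltW b0) P2.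
have f1 : 0 <= Cn ^+ 2 / (48 * Cd ^+ 4) by rewrite divr_ge0 ?mulr_ge0 ?ltW.
have f2 : 0 <= xm ^+ 2 * Cn ^+ 2 / (48 * Cd ^+ 2) by have cd2' := ltW cd2; have cn2' := ltW cn2; ge0_tac.
rewrite /hypo_const; move: k6 k7 f1 f2 k5 k8 m1 m2; rewrite !mulrDr !mulrN.
move: (Cn ^+ 2 / (48 * Cd ^+ 4)) (xm ^+ 2 * Cn ^+ 2 / (48 * Cd ^+ 2)) => K1 K2.
move: (b * (2 * (c * w))) (b * (4 * (c * (xm ^+ 2 * ux)))) (s * w) => y1 y2 sw.
move=> k6 k7 f1 f2 k5 k8 m1 m2.
have := mulr_ge0 f1 P1; have := mulr_ge0 f2 m1; lra.
Qed.

(** Here [beta eta^2] is bounded by [tau], and [tau] by [k_n]. The factor [k_n] is what later makes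
    these end values summable over arbitrarily many slabs. *)
Lemma hypo_end i (u : bp2) : deg2 p u -> be i * `|J i (dx u * dy u)| <= hypo_const * (k_ t n * J i (u ^+ 2)).
Proof.
move=> du; have h1 := plf_young (J i) (dx u) (dy u) ltr01.
have h2 := plf_young (J i) (dx u) (- dy u) ltr01; rewrite mulrN plfN sqrrN in h2.
have g1 := grad_inverse good hxm_elt hinv hpos Cn0 p0 i du.
have b1 := beta_eta Omega Crho Cd q hpos Cn0 p0 k0 i; have b0 := be0 i.
have tk := tau_k Omega Cd Cn p q t n i.
have P1 := plf_sqr_ge0 (J i) u.
have k1 : `|J i (dx u * dy u)| <= Cn ^+ 2 * inv_scale p i ^+ 2 * J i (u ^+ 2).
  have P2 := plf_sqr_ge0 (J i) (dx u); have P3 := plf_sqr_ge0 (J i) (dy u).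
  by rewrite ler_norml; apply/andP; split; rewrite ?mul1r ?invr1 in h1 h2; lra.
have tk' : ta i <= k_ t n.
  apply: le_trans tk; rewrite ler_peMl ?(ltW (ta0 i))//.
  have : 1 <= q.+1%:R ^+ 2 :> R by rewrite -natrX ler1n expn_gt0.
  lra.
have cd4 : 0 < Cd ^+ 4 by rewrite exprn_gt0. 
have cd2 : 0 < Cd ^+ 2 by rewrite exprn_gt0. 
have cn2 : 0 < Cn ^+ 2 by rewrite exprn_gt0. 
apply: le_trans (ler_wpM2l (ltW b0) k1) _.
have f2 : 0 <= xm ^+ 2 * Cn ^+ 2 / (48 * Cd ^+ 2) by ge0_tac.
apply: (@le_trans _ _ (Cn ^+ 2 / (48 * Cd ^+ 4) * (k_ t n * J i (u ^+ 2)))).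
  rewrite [be i * _]mulrA [X in _ <= X]mulrA; apply: (ler_wpM2r P1).
  have -> : be i * (Cn ^+ 2 * inv_scale p i ^+ 2) = Cn ^+ 2 / (48 * Cd ^+ 4) * (48 * Cd ^+ 4 * (be i * inv_scale p i ^+ 2)).
    by field; rewrite gt_eqF.
  have cc : 0 <= Cn ^+ 2 / (48 * Cd ^+ 4) by have cd4' := ltW cd4; ge0_tac.
  have : 0 <= Cd ^+ 4 * (be i * inv_scale p i ^+ 2) by have cd4' := ltW cd4; ge0_tac.
  by move=> z0; apply: (ler_wpM2l cc); move: b1 tk' z0; rewrite -![_ * Cd ^+ 4 * _]mulrA => *; lra.
rewrite ler_wpM2r ?mulr_ge0 ?(ltW k0)// /hypo_const.
have : 0 <= Cn ^+ 2 / (48 * Cd ^+ 4) by rewrite divr_ge0 ?mulr_ge0 ?ltW.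
lra.
Qed.

Local Notation a := (t n.-1).
Local Notation b := (t n).
Let ab : a < b. Proof. by rewrite -subr_gt0. Qed.

Lemma polyfun_J (L : plf xm) (F : R -> bp2) : tpath F -> polyfun (fun s => L (F s)).
Proof. by move=> hF; apply: polyfun_tpath hF; exact: plf_lin. Qed.

Lemma hypo_slab i (P : {poly bp2}) : deg3 p P ->
  2^-1 * (be i * TI a b (fun s => J i (dy P.[cst2 s] ^+ 2))) <=
  hypo_const * (ta i * TI a b (fun s => J i ((tW P).[cst2 s] ^+ 2)) + TI a b (fun s => J i (dx P.[cst2 s] ^+ 2))
      + k_ t n * (J i (P.[cst2 b] ^+ 2) + J i (P.[cst2 a] ^+ 2))).
Proof.
have arith (T1 T2 T3 l1 l2 jb ja c d k K m1 m2 : R) :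
    2^-1 * c * T1 + c * (l2 - l1) <= K * d * T2 + K * T3 -> c * m2 <= K * (k * jb) ->
    c * m1 <= K * (k * ja) -> c * l1 <= c * m1 -> c * - l2 <= c * m2 ->
    2^-1 * (c * T1) <= K * (d * T2 + T3 + k * (jb + ja)) by move=> *; lra.
move=> dP; have dp s := deg3_horner s dP.
(* The product [u_x u_y] as a polynomial in time; the integral of its derivative is the difference
   of end values, handled by [hypo_end]. *)
pose Z := map_poly (@dx R) P * map_poly (@dy R) P.
have Zs s : Z.[cst2 s] = dx P.[cst2 s] * dy P.[cst2 s] by rewrite hornerM dx_horner dy_horner.
have Z's s : Z^`().[cst2 s] = dx P^`().[cst2 s] * dy P.[cst2 s] + dx P.[cst2 s] * dy P^`().[cst2 s].
  rewrite derivM hornerD !hornerM (deriv_map_add _ dx0 (@dxD R)) (deriv_map_add _ dy0 (@dyD R)).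
  by rewrite !dx_horner !dy_horner.
have bd_form := TI_FTC ab Z (plf_lin (J i)).
have pZ : polyfun (fun s => J i Z^`().[cst2 s]) by apply: polyfun_J; exact: tpath_horner.
have py : polyfun (fun s => J i (dy P.[cst2 s] ^+ 2)).
  by apply: polyfun_J; apply: tpathX; apply: tpath_dy; exact: tpath_horner.
have px : polyfun (fun s => J i (dx P.[cst2 s] ^+ 2)).
  by apply: polyfun_J; apply: tpathX; apply: tpath_dx; exact: tpath_horner.
have pw : polyfun (fun s => J i ((tW P).[cst2 s] ^+ 2)).
  by apply: polyfun_J; apply: tpathX; exact: tpath_horner.
have H : TI a b (fun s => 2^-1 * be i * J i (dy P.[cst2 s] ^+ 2) + be i * J i Z^`().[cst2 s]) <=
   TI a b (fun s => hypo_const * ta i * J i ((tW P).[cst2 s] ^+ 2) + hypo_const * J i (dx P.[cst2 s] ^+ 2)).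
  apply: (TI_le ab); try (by apply: polyfunD; exact: polyfunZ).
  move=> s _; have := hypo_pt i (dp s) (deg3_horner s (deg3_deriv dP)).
  by rewrite Z's tW_horner [in leRHS]mulrDr !mulrA.
rewrite !(TI_D ab) ?(TI_Z ab) ?bd_form in H; try exact: polyfunZ; try by [].
rewrite !Zs in H.
have e1 := hypo_end i (dp b); have e2 := hypo_end i (dp a).
have b0 := ltW (be0 i).
have n1 := ler_wpM2l b0 (ler_norm (J i (dx P.[cst2 a] * dy P.[cst2 a]))).
have n2 := ler_wpM2l b0 (ler_norm (- J i (dx P.[cst2 b] * dy P.[cst2 b]))); rewrite normrN in n2.
exact: arith H e1 e2 n1 n2.
Qed.

End Hypocoercivity.

Ltac tpath_tac := repeat first [exact: tpath_cst | exact: tpath_horner | apply: tpathX | apply: tpathD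
  | apply: tpathN | apply: tpath_dx | apply: tpath_dy | apply: tpathM].
Lemma polyfun_plf (R : realType) (xm : R) (L : plf xm) F : tpath F -> polyfun (fun s => L (F s)).
Proof. by apply: polyfun_tpath; exact: plf_lin. Qed.
Lemma polyfun_nI (R : realType) (Omega : set (R * R)) (M : @mesh R) (i j : 'I_(size M)) F :
  tpath F -> polyfun (fun s => nI Omega i j (F s)).
Proof. by apply: polyfun_tpath; exact: nI_lin. Qed.

Ltac polyfun_tac := repeat first [exact: polyfun_cst | (apply: polyfun_plf; tpath_tac) | (apply: polyfun_nI; tpath_tac)
  | apply: polyfun_sum => ? | apply: polyfunD | apply: polyfunN | apply: polyfunZ].

(** * The lower bound for the test function at a fixed time *)

Section SlabEstimates.
Context {R : realType}.
Local Notation pt := (R * R)%type.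
Local Notation bp2 := {poly {poly R}}.
Variables (Omega : set pt) (M : @mesh R) (xm Crho Cd Cn Hm : R) (p q : nat) (t : nat -> R) (n : nat).
Local Notation I := 'I_(size M).
Hypothesis good : forall i : I, good_cell (vert i).
Hypothesis disj : forall i j : I, i != j -> elt i `&` elt j = set0.
Hypothesis hxm : forall (i : I) z, bd (elt i) z -> `|z.1| <= xm.
Hypothesis hxm_elt : forall (i : I) z, elt i z -> `|z.1| <= xm.
Hypothesis hup : upwind_neighbours Omega M.
Hypothesis hinv : inverse_estimates M Cd Cn.
Hypothesis hpos : forall i : I, 0 < h i.
Hypothesis hmax : forall i : I, h i <= Hm.
Hypothesis Cd0 : 0 < Cd.
Hypothesis Cn0 : 0 < Cn.
Hypothesis p0 : (0 < p)%N.
Hypothesis k0 : 0 < k_ t n.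
Implicit Types (i j k : I) (Q : bp2) (u v w : I -> bp2).

Local Notation J := (cell_form good hxm_elt).
Local Notation FX := (upwind_form Omega good hxm).
Local Notation FY := (inflow_form Omega good hxm).
Local Notation FF := (face_form Omega good hxm).
Local Notation Dx := (dx_energy good hxm_elt).
Local Notation Sg := (penalty_form Omega Cd p good hxm).
Local Notation Uw := (upwind_energy Omega good hxm).
Local Notation Uv := (trace_energy Omega good hxm).
Local Notation ta := (tau Omega Cd Cn p q t n).
Local Notation rest_form := (dG_rest Omega Cd p good hxm hxm_elt).
Local Notation aF := (dG_form Omega Cd p good hxm hxm_elt).
Local Notation KV := (test_const xm Cd Cn Hm).

Definition dG_energy u : R := Dx u + Sg u u + Uw u.

Lemma En_ge0 u : 0 <= dG_energy u.
Proof. apply: addr_ge0; last exact: Uw_ge0.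
by apply: addr_ge0; [exact: Dx_ge0|exact: (Sg_ge0 Omega Cd p good hxm hpos)]. Qed.

Lemma rest_formD u v v' c d :
  rest_form u (fun i => cst2 c * v i + cst2 d * v' i) = c * rest_form u v + d * rest_form u v'.
Proof.
have S1 (F : I -> bp2 -> R) (G G1 G2 : I -> bp2) : (forall i, lin2 (F i)) ->
    (forall i, G i = cst2 c * G1 i + cst2 d * G2 i) ->
    \sum_i F i (G i) = c * \sum_i F i (G1 i) + d * \sum_i F i (G2 i).
  move=> lF hG; rewrite !mulr_sumr -big_split; apply: eq_bigr => i _.
  by rewrite hG (lF i).1 !(lF i).2.
have S2 (F : I -> I -> bp2 -> R) (C : I -> pred I) (w : I -> I -> R) (G G1 G2 : I -> I -> bp2) : (forall i j, lin2 (F i j)) ->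
    (forall i j, G i j = cst2 c * G1 i j + cst2 d * G2 i j) ->
    \sum_i \sum_(j | C i j) w i j * F i j (G i j) =
    c * \sum_i \sum_(j | C i j) w i j * F i j (G1 i j) + d * \sum_i \sum_(j | C i j) w i j * F i j (G2 i j).
  move=> lF hG; rewrite !mulr_sumr -big_split; apply: eq_bigr => i _.
  rewrite /= !mulr_sumr -big_split; apply: eq_bigr => j _ /=.
  by rewrite hG (lF i j).1 !(lF i j).2; ring.
have S3 (F : I -> I -> bp2 -> R) (C : I -> pred I) (G G1 G2 : I -> I -> bp2) : (forall i j, lin2 (F i j)) ->
    (forall i j, G i j = cst2 c * G1 i j + cst2 d * G2 i j) ->
    \sum_i \sum_(j | C i j) F i j (G i j) =
    c * \sum_i \sum_(j | C i j) F i j (G1 i j) + d * \sum_i \sum_(j | C i j) F i j (G2 i j).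
  move=> lF hG; have := S2 F C (fun _ _ => 1) G G1 G2 lF hG.
  by under eq_bigr do under eq_bigr do rewrite mul1r; move=> ->; congr (c * _ + d * _);
    apply: eq_bigr => i _; apply: eq_bigr => j _; rewrite mul1r.
rewrite /dG_rest.
rewrite (S1 (fun i => J i) _ (fun i => dx (u i) * dx (v i)) (fun i => dx (u i) * dx (v' i))); last 2 first.
- by move=> i; exact: plf_lin.
- by move=> i; rewrite !dxyE; ring.
rewrite (S1 (fun i => FY i) _ (fun i => u i * v i) (fun i => u i * v' i)); last 2 first.
- by move=> i; exact: plf_lin.
- by move=> i; ring.
rewrite (S3 (fun i j => FX i j) _ _ (fun i j => (u i - u j) * v i) (fun i j => (u i - u j) * v' i)); last 2 first.
- by move=> i j; exact: plf_lin.
- by move=> i j; ring.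
rewrite /consistency_form /penalty_form.
rewrite (S3 (fun i j => nI Omega i j) _ _ (fun i j => cst2 2^-1 * (dx (u i) + dx (u j)) * (v i - v j))
  (fun i j => cst2 2^-1 * (dx (u i) + dx (u j)) * (v' i - v' j))); last 2 first.
- by move=> i j; exact: nI_lin.
- by move=> i j; ring.
rewrite (S3 (fun i j => nI Omega i j) _ (fun i j => cst2 2^-1 * (dx (cst2 c * v i + cst2 d * v' i) +
    dx (cst2 c * v j + cst2 d * v' j)) * (u i - u j)) (fun i j => cst2 2^-1 * (dx (v i) + dx (v j)) * (u i - u j))
  (fun i j => cst2 2^-1 * (dx (v' i) + dx (v' j)) * (u i - u j))); last 2 first.
- by move=> i j; exact: nI_lin.
- by move=> i j; rewrite !dxyE; ring.
rewrite (S2 (fun i j => FF i j) _ _ _ (fun i j => (u i - u j) * (v i - v j)) (fun i j => (u i - u j) * (v' i - v' j))); last 2 first.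
- by move=> i j; exact: plf_lin.
- by move=> i j; ring.
ring.
Qed.

(** The terms [u'] and [x u_y] tested with [tau W] combine to [tau W^2]. The remaining cross term is
    split with parameter [2 * KV]: by [test_bound] it uses half of [tau W^2], and otherwise [2 * KV]
    times the energy of [u]. As coercivity yields half of [c], the lower bound on [c] leaves twice
    that energy. *)
Lemma step_lower u u' (W z v : I -> bp2) c : degp p u -> degp p u' ->
  (forall i, W i = u' i + Xx * dy (u i)) -> (forall i, z i = cst2 (ta i) * W i) ->
  (forall i, v i = cst2 c * u i + z i) -> 0 < KV -> 4 * KV + 4 <= c ->
  c * \sum_i J i (u' i * u i) + 2 * dG_energy u + 2^-1 * \sum_i ta i * J i (W i ^+ 2) <=
  \sum_i J i (u' i * v i) + aF u v.
Proof.
have ar1 (K c' e : R) : 4 * K + 4 <= c' -> 0 <= e -> (2 * K + 2) * e <= 2^-1 * c' * e.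
  by move=> h1 h2; apply: ler_wpM2r => //; lra.
have ar2 (a b c' d e K : R) : a + b + c' + d <= K * e -> 0 <= d -> a + b + c' <= 2 * K * (2^-1 * e).
  by move=> *; lra.
move=> du du' hW hz hv KV0 hc.
have dW : degp p W by move=> i; rewrite hW; apply: deg2D; [exact: du'|exact: deg2_Xx_dy (du i)].
have dz : degp p z by move=> i; rewrite hz; exact: deg2Z.
have dNz : degp p (fun i => - z i) by move=> i; exact: deg2N.
have Ev : v = fun i => cst2 c * u i + cst2 1 * z i.
  by apply/funext => i; rewrite hv cst2_1 mul1r.
have E1 : \sum_i J i (u' i * v i) + \sum_i J i (Xx * dy (u i) * v i) =
    c * (\sum_i J i (u' i * u i) + \sum_i J i (Xx * dy (u i) * u i)) + \sum_i ta i * J i (W i ^+ 2).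
  rewrite -!big_split mulr_sumr -big_split; apply: eq_bigr => i _ /=.
  rewrite -!plfD -!plfZ -!plfD; congr (J i _).
  by rewrite hv hz expr2 {3}hW; rewrite hW; ring.
have cz := aF_coercive good disj hxm hxm_elt hup hinv hpos Cd0 p0 du.
have k2 : 0 < 2 * KV by rewrite mulr_gt0.
have rb := rest_formD u z z 0 (-1); rewrite mul0r add0r mulN1r in rb.
have rb2 : rest_form u (fun i => - z i) = - rest_form u z.
  by rewrite -rb; congr (dG_rest _ _ _ _ _ _ _); apply/funext => i; rewrite cst2_0 mul0r add0r cst2N cst2_1 mulN1r.
have hr := rem_bound Omega good disj hxm hxm_elt hinv hpos Cd0 p0 du dNz k2; rewrite rb2 in hr.
have tb := test_bound good disj hxm hxm_elt hup hinv hpos hmax Cd0 Cn0 p0 k0 dW hz.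
have DN : Dx (fun i => - z i) = Dx z by apply: eq_bigr => i _; rewrite dxN sqrrN.
have SN : Sg (fun i => - z i) (fun i => - z i) = Sg z z.
  apply: eq_bigr => i _; apply: eq_bigr => j _; congr (_ * FF i j _); ring.
have UN : Uv (fun i => - z i) = Uv z.
  rewrite /trace_energy; congr (_ + _); last by apply: eq_bigr => i _; rewrite sqrrN.
  by apply: eq_bigr => i _; apply: eq_bigr => j _; rewrite sqrrN.
rewrite DN SN UN in hr.
have U0 := Uw_ge0 Omega good hxm z.
have Ki : (2 * KV)^-1 * (Dx z + Sg z z + Uv z) <= 2^-1 * \sum_i ta i * J i (W i ^+ 2).
  rewrite ler_pdivrMl//; exact: ar2 tb U0.
have Erest : rest_form u v = c * rest_form u u + rest_form u z.
  by rewrite Ev rest_formD mul1r.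
have e0 := En_ge0 u; rewrite -/(dG_energy u) in hr cz.
have EaF : aF u v = \sum_i J i (Xx * dy (u i) * v i) + c * rest_form u u + rest_form u z.
  by rewrite /dG_form Erest addrA.
have EaFu : aF u u = \sum_i J i (Xx * dy (u i) * u i) + rest_form u u by [].
rewrite EaF; rewrite EaFu in cz.
have c0 : 0 <= c by lra.
have m1 := ler_wpM2l c0 cz.
have m2 : (2 * KV + 2) * dG_energy u <= 2^-1 * c * dG_energy u by exact: ar1.
move: E1 hr Ki m1 m2; clear -R.
move: (\sum_i J i (u' i * v i)) (\sum_i J i (Xx * dy (u i) * v i)) (\sum_i J i (u' i * u i))  => s1 s2 s3.
move: (\sum_i J i (Xx * dy (u i) * u i)) (\sum_i ta i * J i (W i ^+ 2)) (rest_form u u) (rest_form u z) => s4 s5 s6 s7.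
move: ((2 * KV)^-1 * (Dx z + Sg z z + Uv z)) KV (dG_energy u) => s8 s9 s10 *; lra.
Qed.

End SlabEstimates.

(** * Estimates integrated over one slab *)

Section SlabIntegrals.
Context {R : realType}.
Local Notation pt := (R * R)%type.
Local Notation bp2 := {poly {poly R}}.
Variables (Omega : set pt) (M : @mesh R) (xm Crho Cd Cn Hm : R) (p q : nat) (t : nat -> R) (n : nat) (tf : R).
Local Notation I := 'I_(size M).
Hypothesis good : forall i : I, good_cell (vert i).
Hypothesis disj : forall i j : I, i != j -> elt i `&` elt j = set0.
Hypothesis hxm : forall (i : I) z, bd (elt i) z -> `|z.1| <= xm.
Hypothesis hxm_elt : forall (i : I) z, elt i z -> `|z.1| <= xm.
Hypothesis hup : upwind_neighbours Omega M.
Hypothesis hinv : inverse_estimates M Cd Cn.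
Hypothesis hpos : forall i : I, 0 < h i.
Hypothesis hmax : forall i : I, h i <= Hm.
Hypothesis Cd0 : 0 < Cd.
Hypothesis Cn0 : 0 < Cn.
Hypothesis p0 : (0 < p)%N.
Hypothesis k0 : 0 < k_ t n.
Hypothesis ktf : k_ t n <= tf.
Hypothesis xm0 : 0 <= xm.
Implicit Types (i j k : I) (Q : bp2) (u v w : I -> bp2).

Local Notation J := (cell_form good hxm_elt).
Local Notation Dx := (dx_energy good hxm_elt).
Local Notation Sg := (penalty_form Omega Cd p good hxm).
Local Notation Uw := (upwind_energy Omega good hxm).
Local Notation nrm := (l2_sqr good hxm_elt).
Local Notation ta := (tau Omega Cd Cn p q t n).
Local Notation ta0 := (tau_gt0 Omega Cd q hpos Cn0 p0 k0).
Local Notation NF := (slab_norm_sq Omega Cd p good hxm hxm_elt Crho Cn q t n).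
Local Notation Bq := (dy_energy Omega Crho Cd Cn p q t n good hxm_elt).
Local Notation Tq := (transport_energy Omega Cd Cn p q t n good hxm_elt).
Local Notation rest_form := (dG_rest Omega Cd p good hxm hxm_elt).
Local Notation aF := (dG_form Omega Cd p good hxm hxm_elt).
Local Notation KV := (test_const xm Cd Cn Hm).
Local Notation KH := (hypo_const xm Cd Cn).
Local Notation KM := (norm_const xm Cd).

Local Notation En := (dG_energy Omega Cd p good hxm hxm_elt).
Local Notation a := (t n.-1).
Local Notation b := (t n).
Let ab : a < b. Proof. by rewrite -subr_gt0. Qed.

Definition at_time (P : I -> {poly bp2}) (s : R) : I -> bp2 := fun i => (P i).[cst2 s].
Definition dtime (P : I -> {poly bp2}) : I -> {poly bp2} := fun i => (P i)^`().
Definition weighted_transport (P : I -> {poly bp2}) s : R := \sum_i ta i * J i ((tW (P i)).[cst2 s] ^+ 2).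
Definition dG_action P : R := TI a b (fun s => En (at_time P s)).
Definition transport_action P : R := TI a b (weighted_transport P).
Definition test_poly (c : R) (P : I -> {poly bp2}) : I -> {poly bp2} :=
  fun i => (cst2 c)%:P * P i + (cst2 (ta i))%:P * tW (P i).

Variable P : I -> {poly bp2}.
Hypothesis sP : forall i, (size (P i) <= q.+1)%N.
Hypothesis dP : forall i, deg3 p (P i).

Let du s : degp p (at_time P s). Proof. by move=> i; exact: deg3_horner. Qed.
Let du' s : degp p (at_time (dtime P) s). Proof. by move=> i; apply: deg3_horner; exact: deg3_deriv. Qed.

Lemma tauW2_ge0 s : 0 <= weighted_transport P s.
Proof. by apply: sumr_ge0 => i _; rewrite mulr_ge0 ?plf_sqr_ge0// ltW// ta0. Qed.
Lemma IX_ge0 : 0 <= dG_action P.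
Proof. by apply: TI_ge0 => s _; exact: (En_ge0 Omega Cd p good hxm hxm_elt hpos). Qed.
Lemma IY_ge0 : 0 <= transport_action P. Proof. by apply: TI_ge0 => s _; exact: tauW2_ge0. Qed.

Lemma polyfun_En (Z : I -> {poly bp2}) : polyfun (fun s => En (at_time Z s)).
Proof. by rewrite /dG_energy /dx_energy /penalty_form /upwind_energy /at_time; polyfun_tac. Qed.
Lemma polyfun_tauW2 (Z : I -> {poly bp2}) : polyfun (weighted_transport Z).
Proof. by rewrite /weighted_transport; polyfun_tac. Qed.
Lemma polyfun_Bq (Z : I -> {poly bp2}) : polyfun (fun s => Bq (at_time Z s)).
Proof. by rewrite /dy_energy /at_time; polyfun_tac. Qed.
Lemma polyfun_NF (Z Z' : I -> {poly bp2}) : polyfun (fun s => NF (at_time Z s) (at_time Z' s)).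
Proof. by rewrite /slab_norm_sq /quad /penalty_form /upwind_energy /at_time; polyfun_tac. Qed.
Lemma polyfun_dG (Z Y Y' : I -> {poly bp2}) :
  polyfun (fun s => \sum_i J i (at_time Z s i * at_time Y s i) + aF (at_time Y' s) (at_time Y s)).
Proof. by rewrite /dG_form /dG_rest /consistency_form /penalty_form /at_time; polyfun_tac. Qed.

Lemma test_horner c Z s i :
  at_time (test_poly c Z) s i = cst2 c * at_time Z s i + cst2 (ta i) * (tW (Z i)).[cst2 s].
Proof. by rewrite /at_time /test_poly !(hornerD, hornerM, hornerC). Qed.

Lemma TI_energy : TI a b (fun s => \sum_i J i (at_time (dtime P) s i * at_time P s i)) =
  2^-1 * (nrm (at_time P b) - nrm (at_time P a)).
Proof.
rewrite (TI_sum ab); last by move=> i; rewrite /at_time; polyfun_tac.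
rewrite /nrm -sumrB mulr_sumr; apply: eq_bigr => i _.
have := TI_FTC ab (P i ^+ 2) (plf_lin (J i)); rewrite !horner_exp => <-.
rewrite -(TI_Z ab); last by polyfun_tac.
apply: TI_eq => s; rewrite -plfZ; congr (J i _).
rewrite expr2 derivM hornerD !hornerM /at_time /dtime; move: ((P i)^`().[cst2 s]) ((P i).[cst2 s]) => x y.
have -> : x * y + y * x = cst2 2 * (x * y) by rewrite /cst2 !polyC_natr; ring.
by rewrite mulrA -cst2M mulVf ?pnatr_eq0// cst2_1 mul1r.
Qed.

Lemma slab_lower c : 0 < KV -> 4 * KV + 4 <= c ->
  c * (2^-1 * (nrm (at_time P b) - nrm (at_time P a))) + 2 * dG_action P + 2^-1 * transport_action P <=
  TI a b (fun s => \sum_i J i (at_time (dtime P) s i * at_time (test_poly c P) s i) +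
    aF (at_time P s) (at_time (test_poly c P) s)).
Proof.
move=> KV0 hc; rewrite -TI_energy.
have pe : polyfun (fun s => \sum_i J i (at_time (dtime P) s i * at_time P s i)) by rewrite /at_time; polyfun_tac.
have pX := polyfun_En P; have pY := polyfun_tauW2 P.
rewrite -!(TI_Z ab)// -!(TI_D ab)//; try (by repeat first [assumption|apply: polyfunD|apply: polyfunZ]).
apply: (TI_le ab); try (by repeat first [assumption|apply: polyfunD|apply: polyfunZ]).
  exact: polyfun_dG.
move=> s _; apply: (step_lower good disj hxm hxm_elt hup hinv hpos hmax Cd0 Cn0 p0 k0 (du s) (du' s)
  (W := fun i => (tW (P i)).[cst2 s]) (z := fun i => cst2 (ta i) * (tW (P i)).[cst2 s])) => // i.
  exact: tW_horner.
exact: test_horner.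
Qed.

(** The bound of [tau] by [k_n / (64 (q+1)^2)] is made for this: it cancels the factor of the
    endpoint estimate and leaves 6/64. *)
Lemma tau_end c : c = a \/ c = b -> \sum_i ta i ^+ 2 * J i ((tW (P i)).[cst2 c] ^+ 2) <= 6 / 64 * transport_action P.
Proof.
move=> hc; rewrite /transport_action (TI_sum ab); last by move=> i; polyfun_tac.
rewrite mulr_sumr; apply: ler_sum => i _; rewrite (TI_Z ab); last by polyfun_tac.
have ar (T j s Q k : R) : k * j <= 6 * Q * T -> 64 * Q * s <= k -> 0 < s -> 0 <= j -> 0 < Q ->
    s ^+ 2 * j <= 6 / 64 * (s * T).
  move=> h1 h2 h3 j0 q0; rewrite -(ler_pM2l q0).
  by have := ler_wpM2l (ltW h3) h1; have := ler_wpM2l (mulr_ge0 (ltW h3) j0) h2; lra.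
have h1 := TI_endpoint ab (J i) (size_tW (sP i)) hc.
have h2 := tau_k Omega Cd Cn p q t n i; have h3 := ta0 i.
have j0 := plf_sqr_ge0 (J i) (tW (P i)).[cst2 c].
have q0 : 0 < q.+1%:R ^+ 2 :> R by rewrite exprn_gt0// ltr0n.
exact: ar h1 h2 h3 j0 q0.
Qed.

Lemma KH_gt0 : 0 < KH.
Proof.
have c4 : 0 <= Cd ^+ 4 by apply: exprn_ge0; exact: ltW.
have f1 : 0 <= Cn ^+ 2 / (48 * Cd ^+ 4) by ge0_tac.
have f2 : 0 <= xm ^+ 2 * Cn ^+ 2 / (48 * Cd ^+ 2) by ge0_tac.
by rewrite /hypo_const; lra.
Qed.

Lemma En_split u : En u = Dx u + (Sg u u + Uw u). Proof. by rewrite /dG_energy -addrA. Qed.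
Lemma Dx_le_En u : Dx u <= En u.
Proof.
rewrite En_split lerDl; apply: addr_ge0; last exact: Uw_ge0.
exact: (Sg_ge0 Omega Cd p good hxm hpos).
Qed.

Lemma Bq_slab : TI a b (fun s => Bq (at_time P s)) <=
  2 * KH * (transport_action P + dG_action P + k_ t n * (nrm (at_time P b) + nrm (at_time P a))).
Proof.
have ar (T X X' Y K k : R) : 2^-1 * T <= K * (Y + X' + k) -> K * X' <= K * X -> T <= 2 * K * (Y + X + k).
  by move=> *; lra.
have px : polyfun (fun s => Dx (at_time P s)) by rewrite /dx_energy /at_time; polyfun_tac.
have hx : TI a b (fun s => Dx (at_time P s)) <= dG_action P.
  by apply: (TI_le ab) => //; [exact: polyfun_En|move=> s _; exact: Dx_le_En].
have K0 := KH_gt0.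
have E : 2^-1 * TI a b (fun s => Bq (at_time P s)) <= KH * (transport_action P + TI a b (fun s => Dx (at_time P s))
     + k_ t n * (nrm (at_time P b) + nrm (at_time P a))).
  rewrite /transport_action !(TI_sum ab); try (by move=> i; rewrite /at_time; polyfun_tac).
  rewrite /l2_sqr -!big_split !mulr_sumr -big_split /= mulr_sumr; apply: ler_sum => i _.
  have := hypo_slab Omega Crho q good hxm_elt hinv hpos Cd0 Cn0 p0 k0 i (dP i).
  by rewrite !(TI_Z ab); try (by rewrite /at_time; polyfun_tac).
exact: ar E (ler_wpM2l (ltW K0) hx).
Qed.

Lemma KM_ge2 : 2 <= KM.
Proof.
have : 0 <= 2 * xm * (4 * Cd ^+ 2 + 1) by ge0_tac.
rewrite /norm_const; lra.
Qed.

Lemma NF_le_sum (Z : I -> {poly bp2}) s : (forall i, deg3 p (Z i)) ->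
  NF (at_time Z s) (at_time (dtime Z) s) <= KM * (En (at_time Z s) + Bq (at_time Z s) + weighted_transport Z s).
Proof.
have ar (f d sg u b' y K : R) : 0 <= sg -> 0 <= u -> 2 * sg <= K * sg -> 2 * u <= K * u ->
  f <= K * (d + b' + y) + sg + 2 * u -> f <= K * (d + sg + u + b' + y) by move=> *; lra.
move=> dZ; have du0 : degp p (at_time Z s) by move=> i; exact: deg3_horner.
have h := @NF_le _ Omega _ _ Crho _ _ _ q _ _ good hxm hxm_elt hinv hpos Cd0 Cn0 p0 k0 _ (at_time (dtime Z) s) du0.
have TE : Tq (at_time Z s) (at_time (dtime Z) s) = weighted_transport Z s.
  by apply: eq_bigr => i _; rewrite tW_horner.
rewrite TE in h; have K2 := KM_ge2; have S0 := Sg_ge0 Omega Cd p good hxm hpos (at_time Z s).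
have U0 := Uw_ge0 Omega good hxm (at_time Z s).
exact: ar S0 U0 (ler_wpM2r S0 K2) (ler_wpM2r U0 K2) h.
Qed.

Lemma NF_slab : TI a b (fun s => NF (at_time P s) (at_time (dtime P) s)) <=
  KM * (dG_action P + TI a b (fun s => Bq (at_time P s)) + transport_action P).
Proof.
have pX := polyfun_En P; have pY := polyfun_tauW2 P; have pB := polyfun_Bq P.
rewrite /dG_action /transport_action -!(TI_D ab) -?(TI_Z ab)//; try (by repeat first [assumption|apply: polyfunD|apply: polyfunZ]).
apply: (TI_le ab); try (by repeat first [assumption|apply: polyfunD|apply: polyfunZ]).
  exact: polyfun_NF.
by move=> s _; exact: NF_le_sum.
Qed.

End SlabIntegrals.

Lemma tW_comb (R : realType) (c d : R) (P Y : {poly {poly {poly R}}}) s :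
  (tW ((cst2 c)%:P * P + (cst2 d)%:P * Y)).[cst2 s] =
  cst2 c * (tW P).[cst2 s] + cst2 d * (Y^`().[cst2 s] + Xx * dy Y.[cst2 s]).
Proof.
have D (e : R) (Y0 : {poly {poly {poly R}}}) : ((cst2 e)%:P * Y0)^`() = (cst2 e)%:P * Y0^`().
  by rewrite mul_polyC derivZ -mul_polyC.
have e1 : ((cst2 c)%:P * P + (cst2 d)%:P * Y)^`().[cst2 s] = cst2 c * P^`().[cst2 s] + cst2 d * Y^`().[cst2 s].
  rewrite derivD (D c) (D d).
  by move: P^`() Y^`() => P1 Y1; rewrite hornerD !hornerM !hornerC.
have e2 : ((cst2 c)%:P * P + (cst2 d)%:P * Y).[cst2 s] = cst2 c * P.[cst2 s] + cst2 d * Y.[cst2 s].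
  by rewrite hornerD !hornerM !hornerC.
rewrite !tW_horner e1 e2 dyD !dyM !dy_cst.
by move: (P^`().[cst2 s]) (P.[cst2 s]) (Y^`().[cst2 s]) (Y.[cst2 s]) => p p' y y'; ring.
Qed.

Lemma square_chain (R : realType) (z w w' wx wxy wy C s X H : R) :
  z <= 2 * C * w + 2 * (s ^+ 2 * wx) -> wx <= 2 * w' + 2 * wxy ->
  wxy <= X * wy -> wy <= H * w -> 0 <= X ->
  z <= 2 * C * w + 4 * s ^+ 2 * w' + 4 * s ^+ 2 * X * H * w.
Proof.
move=> h1 h2 h3 h4 X0; have k1 := ler_wpM2l (sqr_ge0 s) h2; have k2 := ler_wpM2l X0 h4.
have k3 := ler_wpM2l (sqr_ge0 s) (le_trans h3 k2); move: (s ^+ 2) h1 k1 k3 => r h1 k1 k3; lra.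
Qed.

(** * The norm of the test function on one slab *)

Section TestFunction.
Context {R : realType}.
Local Notation pt := (R * R)%type.
Local Notation bp2 := {poly {poly R}}.
Variables (Omega : set pt) (M : @mesh R) (xm Crho Cd Cn Hm : R) (p q : nat) (t : nat -> R) (n : nat) (tf : R).
Local Notation I := 'I_(size M).
Hypothesis good : forall i : I, good_cell (vert i).
Hypothesis disj : forall i j : I, i != j -> elt i `&` elt j = set0.
Hypothesis hxm : forall (i : I) z, bd (elt i) z -> `|z.1| <= xm.
Hypothesis hxm_elt : forall (i : I) z, elt i z -> `|z.1| <= xm.
Hypothesis hup : upwind_neighbours Omega M.
Hypothesis hinv : inverse_estimates M Cd Cn.
Hypothesis hpos : forall i : I, 0 < h i.
Hypothesis hmax : forall i : I, h i <= Hm.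
Hypothesis Cd0 : 0 < Cd.
Hypothesis Cn0 : 0 < Cn.
Hypothesis p0 : (0 < p)%N.
Hypothesis k0 : 0 < k_ t n.
Hypothesis ktf : k_ t n <= tf.
Hypothesis xm0 : 0 <= xm.
Implicit Types (i j k : I) (Q : bp2) (u v w : I -> bp2).

Local Notation J := (cell_form good hxm_elt).
Local Notation FF := (face_form Omega good hxm).
Local Notation Dx := (dx_energy good hxm_elt).
Local Notation Sg := (penalty_form Omega Cd p good hxm).
Local Notation Uw := (upwind_energy Omega good hxm).
Local Notation be := (beta Omega Crho Cd Cn p q t n).
Local Notation be0 := (beta_gt0 Omega Crho Cd Cn p q t n).
Local Notation ta := (tau Omega Cd Cn p q t n).
Local Notation ta0 := (tau_gt0 Omega Cd q hpos Cn0 p0 k0).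
Local Notation NF := (slab_norm_sq Omega Cd p good hxm hxm_elt Crho Cn q t n).
Local Notation Bq := (dy_energy Omega Crho Cd Cn p q t n good hxm_elt).
Local Notation KV := (test_const xm Cd Cn Hm).
Local Notation KM := (norm_const xm Cd).

Local Notation En := (dG_energy Omega Cd p good hxm hxm_elt).
Local Notation a := (t n.-1).
Local Notation b := (t n).
Let ab : a < b. Proof. by rewrite -subr_gt0. Qed.

Local Notation tauW2 := (weighted_transport Omega Cd Cn p q t n good hxm_elt).
Local Notation IX := (dG_action Omega Cd p t n good hxm hxm_elt).
Local Notation IY := (transport_action Omega Cd Cn p q t n good hxm_elt).
Local Notation test_fun := (test_poly Omega Cd Cn p q t n).

Variable P : I -> {poly bp2}.
Hypothesis sP : forall i, (size (P i) <= q.+1)%N.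
Hypothesis dP : forall i, deg3 p (P i).
Variable c : R.
Local Notation Z := (test_fun c P).

Lemma deg3D p' (P1 P2 : {poly bp2}) : deg3 p' P1 -> deg3 p' P2 -> deg3 p' (P1 + P2).
Proof. by move=> h1 h2 l; rewrite coefD; exact: deg2D. Qed.
Lemma deg3Z p' (d : R) (P1 : {poly bp2}) : deg3 p' P1 -> deg3 p' ((cst2 d)%:P * P1).
Proof. by move=> h1 l; rewrite coefCM; exact: deg2Z. Qed.

Lemma deg3_test i : deg3 p (Z i).
Proof. by apply: deg3D; apply: deg3Z => //; exact: deg3_tW. Qed.

Lemma size_test i : (size (Z i) <= q.+1)%N.
Proof.
apply: leq_trans (size_polyD _ _) _; rewrite !mul_polyC geq_max.
by apply/andP; split; apply: leq_trans (size_scale_leq _ _) _; rewrite ?size_tW.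
Qed.

Lemma plf_sqrDZ (L : plf xm) (x y z : bp2) : z = cst2 c * x + y ->
  L (z ^+ 2) <= 2 * c ^+ 2 * L (x ^+ 2) + 2 * L (y ^+ 2).
Proof. by move=> ->; have := plf_sqrD L (cst2 c * x) y; rewrite plf_sqrZ mulrA. Qed.

Lemma sum_sqrDZ (L : I -> plf xm) (k : I -> R) (x y z : I -> bp2) : (forall i, 0 <= k i) ->
  (forall i, z i = cst2 c * x i + y i) ->
  \sum_i k i * L i (z i ^+ 2) <= 2 * c ^+ 2 * \sum_i k i * L i (x i ^+ 2) + 2 * \sum_i k i * L i (y i ^+ 2).
Proof.
move=> k0' hz; rewrite !mulr_sumr -big_split; apply: ler_sum => i _ /=.
have := ler_wpM2l (k0' i) (plf_sqrDZ (L i) (hz i)); lra.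
Qed.

Lemma Dx_test (x y z : I -> bp2) : (forall i, z i = cst2 c * x i + y i) ->
  Dx z <= 2 * c ^+ 2 * Dx x + 2 * Dx y.
Proof.
move=> hz; rewrite /dx_energy !mulr_sumr -big_split; apply: ler_sum => i _ /=.
by apply: plf_sqrDZ; rewrite hz !dxyE; ring.
Qed.

Lemma Sg_test (x y z : I -> bp2) : (forall i, z i = cst2 c * x i + y i) ->
  Sg z z <= 2 * c ^+ 2 * Sg x x + 2 * Sg y y.
Proof.
move=> hz; rewrite /penalty_form !mulr_sumr -big_split; apply: ler_sum => i _ /=.
rewrite !mulr_sumr -big_split; apply: ler_sum => j _ /=.
have E : z i - z j = cst2 c * (x i - x j) + (y i - y j) by rewrite !hz; ring.
have := ler_wpM2l (sigma_ge0 Omega Cd p hpos i j) (plf_sqrDZ (FF i j) E); rewrite !expr2; lra.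
Qed.

Lemma Uw_test (x y z : I -> bp2) : (forall i, z i = cst2 c * x i + y i) ->
  Uw z <= 2 * c ^+ 2 * Uw x + 2 * Uw y.
Proof.
move=> hz; have ar (a1 a2 a3 b1 b2 b3 C : R) : a1 <= C * a2 + 2 * a3 -> b1 <= C * b2 + 2 * b3 ->
  a1 + b1 <= C * (a2 + b2) + 2 * (a3 + b3) by move=> *; lra.
apply: (ar); rewrite !mulr_sumr -big_split; apply: ler_sum => i _ /=.
  rewrite !mulr_sumr -big_split; apply: ler_sum => j _ /=.
  by apply: plf_sqrDZ; rewrite !hz; ring.
by apply: (ar); exact: plf_sqrDZ.
Qed.

Lemma tau_scale_le i (x : R) : 0 <= x -> ta i ^+ 2 * x * (Cn ^+ 2 * inv_scale p i ^+ 2) <= ta i * x.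
Proof.
move=> x0; have := tau_eta Omega Cd q hpos Cn0 p0 k0 i; have := ta0 i.
move: (ta i) (inv_scale p i) => s e s0 h.
have := ler_wpM2r (mulr_ge0 (ltW s0) x0) h; have := mulr_ge0 (ltW s0) x0; lra.
Qed.

Lemma En_test s : En (at_time Z s) <= 2 * c ^+ 2 * En (at_time P s) + 2 * KV * tauW2 P s.
Proof.
pose z i := cst2 (ta i) * (tW (P i)).[cst2 s].
have hz i : at_time Z s i = cst2 c * at_time P s i + z i by exact: test_horner.
have h1 := Dx_test hz; have h2 := Sg_test hz; have h3 := Uw_test hz.
have dW : degp p (fun i => (tW (P i)).[cst2 s]) by move=> i; apply: deg3_horner; exact: deg3_tW.
have h4 := test_bound good disj hxm hxm_elt hup hinv hpos hmax Cd0 Cn0 p0 k0 dW (fun i => erefl (z i)).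
have h5 := Uv_ge0 Omega good hxm z; move: h1 h2 h3 h4 h5; rewrite /dG_energy -/(tauW2 P s).
have ar (a1 a2 a3 b1 b2 b3 c1 c2 c3 u T K C : R) : a1 <= C * a2 + 2 * a3 -> b1 <= C * b2 + 2 * b3 ->
  c1 <= C * c2 + 2 * c3 -> a3 + b3 + u + c3 <= K * T -> 0 <= u ->
  a1 + b1 + c1 <= C * (a2 + b2 + c2) + 2 * K * T by move=> *; lra.
exact: ar.
Qed.

Lemma Bq_test s : Bq (at_time Z s) <= 2 * c ^+ 2 * Bq (at_time P s) + 2 * tauW2 P s.
Proof.
have b0 i : 0 <= be i by apply: ltW; exact: be0.
pose z i := cst2 (ta i) * dy (tW (P i)).[cst2 s].
have hz i : dy (at_time Z s i) = cst2 c * dy (at_time P s i) + z i by rewrite test_horner !dxyE /z; ring.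
apply: le_trans (sum_sqrDZ (fun i => J i) b0 hz) _; rewrite lerD2l ler_wpM2l//.
apply: ler_sum => i _; rewrite plf_sqrZ.
have dW : deg2 p (tW (P i)).[cst2 s] by apply: deg3_horner; exact: deg3_tW.
have h1 := dy_inverse good hxm_elt hinv hpos Cn0 p0 i dW.
have h2 := tau_scale_le i (plf_sqr_ge0 (J i) (tW (P i)).[cst2 s]).
have h3 := beta_le1 Omega Crho Cd Cn p q t n i; have j0 := plf_sqr_ge0 (J i) (dy (tW (P i)).[cst2 s]).
apply: le_trans h2; apply: (@le_trans _ _ (1 * (ta i ^+ 2 * J i (dy (tW (P i)).[cst2 s] ^+ 2)))).
  by apply: ler_wpM2r => //; apply: mulr_ge0 => //; exact: sqr_ge0.
by rewrite mul1r -mulrA ler_wpM2l ?sqr_ge0// mulrC.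
Qed.

Definition transport_const : R := 1 + xm ^+ 2 * tf.

(** Applied to the test function, the transport operator gives [c W + tau (W_t + x W_y)]. The time
    inverse estimate and [tau_k] absorb [tau W_t]. For [tau x W_y] one factor [tau] pays for the
    inverse estimate in space and the other is at most [tf], whence [xm ^+ 2 * tf] in
    [transport_const]. *)
Lemma tauW2_test : TI a b (tauW2 Z) <= (2 * c ^+ 2 + transport_const) * IY P.
Proof.
have ar (T T1 T2 C s k Q X Y H : R) : s * T <= s * (C * T1 + 4 * s ^+ 2 * T2 + 4 * s ^+ 2 * X * H * T1) ->
    k ^+ 2 * T2 <= 4 * Q ^+ 4 * T1 -> 64 * Q ^+ 2 * s <= k -> H * (s) <= 6 / 65 -> 0 <= X -> 0 <= T1 -> 0 < s -> k <= Y ->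
    0 < Q -> 1 <= Q -> 0 <= T2 ->
    s * T <= (C + (1 + X * Y)) * (s * T1).
  move=> h1 h2 h3 h4 X0 T10 s0 hk Q0 Q1 T20; apply: le_trans h1 _.
  have k1 : 4 * s ^+ 2 * T2 <= T1.
    have sq : (64 * Q ^+ 2 * s) ^+ 2 <= k ^+ 2.
      have l0 : 0 <= 64 * Q ^+ 2 * s by have s0' := ltW s0; ge0_tac.
      by rewrite ler_sqr ?nnegrE ?(le_trans l0).
    have := ler_wpM2r T20 sq; have Q4 : 0 < Q ^+ 4 by rewrite exprn_gt0.
    rewrite (_ : (64 * Q ^+ 2 * s) ^+ 2 * T2 = 64 * 64 * (Q ^+ 4 * (s ^+ 2 * T2))); last by ring.
    move=> /le_trans/(_ h2) g; have g0 := mulr_ge0 (ltW Q4) T10.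
    have g1 : 0 <= Q ^+ 4 * (s ^+ 2 * T2) by rewrite !mulr_ge0 ?sqr_ge0// ltW.
    rewrite -(ler_pM2l Q4) -mulrA mulrCA; move: g g0 g1; rewrite -[4 * Q ^+ 4 * T1]mulrA.
    by move: (Q ^+ 4 * T1) (Q ^+ 4 * (s ^+ 2 * T2)) => x y g g0 g1; lra.
  have k2 : s <= Y.
    apply: le_trans hk; apply: le_trans h3; rewrite ler_peMl ?(ltW s0)//.
    have : 1 <= Q ^+ 2 by rewrite expr2 -[1]mulr1 ler_pM.
    lra.
  have k3 : 4 * s ^+ 2 * X * H * T1 <= X * Y * T1.
    have := ler_wpM2l (mulr_ge0 (mulr_ge0 X0 T10) (ltW s0)) h4.
    have := ler_wpM2l (mulr_ge0 X0 T10) k2; have := mulr_ge0 (mulr_ge0 X0 T10) (ltW s0).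
    lra.
  have : C * T1 + 4 * s ^+ 2 * T2 + 4 * s ^+ 2 * X * H * T1 <= (C + (1 + X * Y)) * T1 by lra.
  by move=> /(ler_wpM2l (ltW s0)); lra.
rewrite /IY !(TI_sum ab); try (by move=> i; polyfun_tac).
rewrite mulr_sumr; apply: ler_sum => i _; rewrite !(TI_Z ab); try (by polyfun_tac).
have s0 := ta0 i; have ti := TI_inverse ab (J i) (size_tW (sP i)).
have q1 : 1 <= q.+1%:R :> R by rewrite ler1n.
have T10 : 0 <= TI a b (fun s => J i ((tW (P i)).[cst2 s] ^+ 2)) by apply: TI_ge0 => s _; exact: plf_sqr_ge0.
have T20 : 0 <= TI a b (fun s => J i ((tW (P i))^`().[cst2 s] ^+ 2)) by apply: TI_ge0 => s _; exact: plf_sqr_ge0.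
have te := tau_eta Omega Cd q hpos Cn0 p0 k0 i; rewrite [ta i * _]mulrC mulrA in te.
have tk := tau_k Omega Cd Cn p q t n i.
apply: (ar _ _ _ _ _ _ _ _ _ _ _ ti tk te (sqr_ge0 xm) T10 s0 ktf _ q1 T20); last by rewrite ltr0n.
apply: (ler_wpM2l (ltW s0)); rewrite -!(TI_Z ab) -?(TI_D ab); try (by polyfun_tac).
apply: (TI_le ab); try (by polyfun_tac).
move=> s _; have dW : deg2 p (tW (P i)).[cst2 s] by apply: deg3_horner; exact: deg3_tW.
have h1 := dy_inverse good hxm_elt hinv hpos Cn0 p0 i dW.
have E : (tW (Z i)).[cst2 s] = cst2 c * (tW (P i)).[cst2 s] +
   cst2 (ta i) * ((tW (P i))^`().[cst2 s] + Xx * dy (tW (P i)).[cst2 s]).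
  exact: tW_comb.
have h2 := plf_sqrDZ (J i) E; rewrite plf_sqrZ in h2.
have h3 := plf_sqrD (J i) (tW (P i))^`().[cst2 s] (Xx * dy (tW (P i)).[cst2 s]).
have h4 := plf_Xx_sqr (J i) (dy (tW (P i)).[cst2 s]).
exact: square_chain h2 h3 h4 h1 (sqr_ge0 xm).
Qed.

Lemma NF_test : TI a b (fun s => NF (at_time Z s) (at_time (dtime Z) s)) <=
  KM * (2 * c ^+ 2 * (IX P + TI a b (fun s => Bq (at_time P s)) + IY P) + (2 * KV + 2 + transport_const) * IY P).
Proof.
have h := NF_slab Omega Crho q good hxm hxm_elt hinv hpos Cd0 Cn0 p0 k0 xm0 deg3_test.
apply: le_trans h _; apply: ler_wpM2l; first by apply: le_trans (KM_ge2 Cd xm0).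
have pX := polyfun_En Omega Cd p good hxm hxm_elt P; have pY := polyfun_tauW2 Omega Cd Cn p q t n good hxm_elt P.
have pB := polyfun_Bq Omega Crho Cd Cn p q t n good hxm_elt P.
have h1 : IX Z <= 2 * c ^+ 2 * IX P + 2 * KV * IY P.
  rewrite /dG_action /transport_action -!(TI_Z ab)// -(TI_D ab); try exact: polyfunZ.
  apply: (TI_le ab); [exact: polyfun_En|by apply: polyfunD; exact: polyfunZ|].
  by move=> s _; exact: En_test.
have h2 : TI a b (fun s => Bq (at_time Z s)) <= 2 * c ^+ 2 * TI a b (fun s => Bq (at_time P s)) + 2 * IY P.
  rewrite /transport_action -!(TI_Z ab)// -(TI_D ab); try exact: polyfunZ.
  apply: (TI_le ab); [exact: polyfun_Bq|by apply: polyfunD; exact: polyfunZ|].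
  by move=> s _; exact: Bq_test.
have h3 := tauW2_test; move: h1 h2 h3; rewrite -/(IY Z).
have ar (x b' y x' b1 y' C k ct : R) : x' <= C * x + 2 * k * y -> b1 <= C * b' + 2 * y -> y' <= (C + ct) * y ->
   x' + b1 + y' <= C * (x + b' + y) + (2 * k + 2 + ct) * y by move=> *; lra.
exact: ar.
Qed.

End TestFunction.

(** * Space-time functions represented by polynomials *)

Section SpaceTimeForms.
Context {R : realType}.
Local Notation pt := (R * R)%type.
Local Notation bp2 := {poly {poly R}}.
Variables (Omega : set pt) (M : @mesh R) (xm Crho Cd Cn : R) (p q N : nat) (t : nat -> R).
Local Notation I := 'I_(size M).
Hypothesis good : forall i : I, good_cell (vert i).
Hypothesis hxm : forall (i : I) z, bd (elt i) z -> `|z.1| <= xm.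
Hypothesis hxm_elt : forall (i : I) z, elt i z -> `|z.1| <= xm.
Hypothesis hup : upwind_neighbours Omega M.
Implicit Types (i j k : I) (P Z : nat -> I -> {poly bp2}) (U V : st_fun M).

Local Notation J := (cell_form good hxm_elt).
Local Notation aF := (dG_form Omega Cd p good hxm hxm_elt).
Local Notation NF n := (slab_norm_sq Omega Cd p good hxm hxm_elt Crho Cn q t n).
Local Notation Ah n w := (norm_Ah_sq Omega Crho Cd Cn p q t n (brk w)).

Definition represents P U := forall n i s z, (1 <= n <= N)%N -> U n i s z = ev2 (P n i).[cst2 s] z.
Definition st_of P : st_fun M := fun n i s z => ev2 (P n i).[cst2 s] z.
Definition tjump P n : I -> bp2 := fun i => (P n i).[cst2 (t n.-1)] - (P n.-1 i).[cst2 (t n.-1)].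

Lemma derive1_ev2_horner (Y : {poly bp2}) s z :
  derive1 (fun r => ev2 Y.[cst2 r] z) s = ev2 Y^`().[cst2 s] z.
Proof.
have l := lin2_ev2 z.
have -> : (fun r => ev2 Y.[cst2 r] z) = horner (tpoly (ev2^~ z) Y).
  by apply/funext => r; rewrite (lin2_horner Y r l).
by rewrite derive1_horner -(tpoly_deriv Y l) -(lin2_horner Y^`() s l).
Qed.

Lemma slice_rep P U n s : represents P U -> (1 <= n <= N)%N -> slice U n s = brk (at_time (P n) s).
Proof. by move=> h hn; apply/funext => i; apply/funext => z; exact: h. Qed.

Lemma slice_t_rep P U n s : represents P U -> (1 <= n <= N)%N ->
  slice_t U n s = brk (at_time (dtime (P n)) s).
Proof.
move=> h hn; apply/funext => i; apply/funext => z; rewrite /slice_t /brk /at_time /dtime.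
by rewrite -derive1_ev2_horner; congr (derive1 _ s); apply/funext => r; exact: h.
Qed.

Lemma time_jump_rep P U n : represents P U -> (2 <= n <= N)%N -> time_jump t U n.-1 = brk (tjump P n).
Proof.
move=> h /andP[n2 nN]; apply/funext => i; apply/funext => z.
have n0 : (0 < n)%N by exact: leq_trans n2.
rewrite /time_jump /brk /tjump ev2D ev2N prednK// !h ?n0//.
by rewrite -ltnS prednK// n2 (leq_trans (leq_pred _)).
Qed.

Definition dG_int P Z n : R := TI (t n.-1) (t n) (fun s =>
  \sum_i J i (at_time (dtime (P n)) s i * at_time (Z n) s i) + aF (at_time (P n) s) (at_time (Z n) s)).

Definition st_form P Z : R :=
  \sum_(1 <= n < N.+1) dG_int P Z n
  + \sum_(2 <= n < N.+1) \sum_i J i (tjump P n i * (Z n i).[cst2 (t n.-1)])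
  + \sum_i J i ((P 1%N i).[cst2 (t 0%N)] * (Z 1%N i).[cst2 (t 0%N)]).

Hypothesis N0 : (0 < N)%N.

Lemma B_st_rep P Z U V : represents P U -> represents Z V -> B_st Omega Cd p N t U V = st_form P Z.
Proof.
move=> hU hV; have n1 : (1 <= 1 <= N)%N by [].
rewrite /B_st /st_form; congr (_ + _ + _).
- apply: eq_big_nat => n hn0; have hn : (1 <= n <= N)%N by move: hn0; rewrite ltnS.
  apply: eq_Rintegral => s _.
  rewrite (slice_rep s hU hn) (slice_rep s hV hn) (slice_t_rep s hU hn).
  by rewrite (a_dG_brk Cd p good hxm hxm_elt hup) (ip_brk good hxm_elt).
- apply: eq_big_nat => n hn0; have hn : (2 <= n <= N)%N by move: hn0; rewrite ltnS.
  have hn1 : (1 <= n <= N)%N by case/andP: hn => h1 ->; rewrite ltnW.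
  by rewrite (time_jump_rep hU hn) (slice_rep _ hV hn1) (ip_brk good hxm_elt).
by rewrite (slice_rep _ hU n1) (slice_rep _ hV n1) (ip_brk good hxm_elt).
Qed.

Definition st_norm_sq P : R :=
  2^-1 * (Ah N (at_time (P N) (t N)) + Ah 1%N (at_time (P 1%N) (t 0%N)) + \sum_(2 <= n < N.+1) Ah n (tjump P n))
  + 4^-1 * \sum_(1 <= n < N.+1) TI (t n.-1) (t n) (fun s => NF n (at_time (P n) s) (at_time (dtime (P n)) s)).

Lemma norm_st_rep P U : represents P U -> norm_st Omega Crho Cd Cn p q N t U = Num.sqrt (st_norm_sq P).
Proof.
move=> hU.
have e1 : slice U N (t N) = brk (at_time (P N) (t N)) by rewrite (slice_rep _ hU) ?N0 ?leqnn.
have e2 : slice U 1%N (t 0%N) = brk (at_time (P 1%N) (t 0%N)) by rewrite (slice_rep _ hU) ?N0.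
have e3 : \sum_(2 <= n < N.+1) norm_Ah_sq Omega Crho Cd Cn p q t n (time_jump t U n.-1) =
    \sum_(2 <= n < N.+1) Ah n (tjump P n).
  apply: eq_big_nat => n hn0; have hn : (2 <= n <= N)%N by move: hn0; rewrite ltnS.
  by rewrite (time_jump_rep hU hn).
have e4 : \sum_(1 <= n < N.+1) \int[@lebesgue_measure R]_(s in I_ t n) norm_sq Omega Crho Cd Cn p q t U n s =
   \sum_(1 <= n < N.+1) TI (t n.-1) (t n) (fun s => NF n (at_time (P n) s) (at_time (dtime (P n)) s)).
  apply: eq_big_nat => n hn0; have hn : (1 <= n <= N)%N by move: hn0; rewrite ltnS.
  apply: eq_Rintegral => s _.
  exact: (norm_sq_brk Cd p good hxm hxm_elt hup Crho Cn q t (slice_rep s hU hn) (slice_t_rep s hU hn)).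
by rewrite /norm_st e1 e2 e3 e4 (div1r 2) (div1r 4).
Qed.

Definition st_poly P := forall n i, (size (P n i) <= q.+1)%N /\ deg3 p (P n i).

Lemma V_hk_rep U : V_hk p q N U -> exists2 P, st_poly P & represents P U.
Proof.
move=> hU.
have h (n : nat) (i : I) : exists Y : {poly bp2}, ((size Y <= q.+1)%N /\ deg3 p Y) /\
    ((1 <= n <= N)%N -> forall s z, U n i s z = ev2 Y.[cst2 s] z).
  (* Outside the slabs membership in [V_hk] gives no information on [U], and the zero polynomial is
     taken. *)
  have [hn|hn] := boolP (1 <= n <= N)%N; last first.
    by exists 0; split=> //; split; [rewrite size_poly0|move=> l; rewrite coef0; exact: deg2_0].
  have [phi hphi hs] := hU n i hn.
  have /(_ _)/cid2 ch l := (is_PpP p (phi l)).1 (hphi l).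
  pose Qf l := projT1 (ch l).
  have dQ l : deg2 p (Qf l) by rewrite /Qf; case: (ch l).
  have eQ l : phi l = ev2 (Qf l) by rewrite /Qf; case: (ch l).
  exists (\poly_(l < q.+1) Qf l); split.
    split; first exact: size_poly.
    by move=> l; rewrite coef_poly; case: ifP => _; [exact: dQ|exact: deg2_0].
  move=> _ s z; rewrite hs horner_poly ev2_sum; apply: eq_bigr => l _.
  by rewrite eQ -cst2X !ev2E mulrC.
pose P n := projT1 (choice (h n)).
have hP n i := projT2 (choice (h n)) i.
by exists P => [n i|n i s z hn]; [exact: (hP n i).1|exact: (hP n i).2].
Qed.

Lemma represents_st_of P : represents P (st_of P). Proof. by []. Qed.

Lemma V_hk_st_of P : st_poly P -> V_hk p q N (st_of P).
Proof.
move=> hP n i _; have [sz dP] := hP n i; exists (fun l => ev2 (P n i)`_l).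
  by move=> l; apply/is_PpP; exists (P n i)`_l.
move=> s z; rewrite /st_of (horner_coef_wide _ sz) ev2_sum; apply: eq_bigr => l _.
by rewrite -cst2X !ev2E mulrC.
Qed.

End SpaceTimeForms.

(** * Definiteness of the space-time norm *)

Section VanishingIntegral.
Context {R : realType}.
Variables (a b : R).
Hypothesis ab : a < b.

Lemma pint_ge0_eq0 (r : {poly R}) : (forall s, a <= s <= b -> 0 <= r.[s]) -> pint a b r = 0 -> r = 0.
Proof.
move=> r0 i0; have hc : antid r - ((antid r).[a])%:P = 0.
  apply: (poly_eq0_itv ab) => s /andP[as_ sb].
  have h1 : 0 <= pint a s r.
    by apply: pint_ge0; rewrite ?ltW// => y /andP[ay ys]; rewrite r0// ay (le_trans ys)// ltW.
  have h2 : 0 <= pint s b r.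
    by apply: pint_ge0; rewrite ?ltW// => y /andP[ay ys]; rewrite r0// ys andbT (le_trans _ ay)// ltW.
  move: i0 h1 h2; rewrite /pint hornerD hornerN hornerC; lra.
by rewrite -(deriv_antid r) -[antid r](subrK ((antid r).[a])%:P) hc add0r derivC.
Qed.

Lemma TI_ge0_eq0 (f : R -> R) : polyfun f -> (forall s, a <= s <= b -> 0 <= f s) ->
  TI a b f = 0 -> forall s, f s = 0.
Proof.
move=> [r hr] f0 h s; rewrite hr (_ : r = 0) ?horner0//.
apply: pint_ge0_eq0; first by move=> x /f0; rewrite hr.
by rewrite -(TI_pint ab hr).
Qed.

End VanishingIntegral.

Lemma const_in_time (R : realType) (P : {poly {poly {poly R}}}) :
  (forall s, P^`().[cst2 s] = 0) -> forall s s' z, ev2 P.[cst2 s] z = ev2 P.[cst2 s'] z.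
Proof.
move=> h s s' z; have l := lin2_ev2 z; set r := tpoly (ev2^~ z) P.
have hr : r^`() = 0.
  apply: (poly_eq0_itv ltr01) => x _.
  by rewrite /r -(tpoly_deriv P l) -(lin2_horner P^`() x l) h ev2_0.
rewrite (lin2_horner P s l) (lin2_horner P s' l) -/r; apply/eqP.
by rewrite -subr_eq0 -pint_deriv hr pint0.
Qed.

Lemma psum_nat_eq0 (R : realType) (m k : nat) (F : nat -> R) :
  (forall n, (m <= n < k)%N -> 0 <= F n) -> \sum_(m <= n < k) F n = 0 ->
  forall n, (m <= n < k)%N -> F n = 0.
Proof.
move=> F0; rewrite big_nat => /eqP; rewrite psumr_eq0// => /allP h n hn.
by have := h n; rewrite mem_index_iota hn /= => /(_ isT)/eqP.
Qed.

Section Definiteness.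
Context {R : realType}.
Local Notation pt := (R * R)%type.
Local Notation bp2 := {poly {poly R}}.
Variables (Omega : set pt) (M : @mesh R) (xm Crho Cd Cn : R) (p q N : nat) (t : nat -> R).
Local Notation I := 'I_(size M).
Hypothesis good : forall i : I, good_cell (vert i).
Hypothesis hxm : forall (i : I) z, bd (elt i) z -> `|z.1| <= xm.
Hypothesis hxm_elt : forall (i : I) z, elt i z -> `|z.1| <= xm.
Hypothesis hne : forall i : I, exists z, elt i z.
Hypothesis hpos : forall i : I, 0 < h i.
Hypothesis Cn0 : 0 < Cn.
Hypothesis p0 : (0 < p)%N.
Hypothesis N0 : (0 < N)%N.
Hypothesis tinc : forall n, (n < N)%N -> t n < t n.+1.
Variable P : nat -> I -> {poly bp2}.

Local Notation J := (cell_form good hxm_elt).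
Local Notation nrm := (l2_sqr good hxm_elt).
Local Notation NF n := (slab_norm_sq Omega Cd p good hxm hxm_elt Crho Cn q t n).
Local Notation Ah n w := (norm_Ah_sq Omega Crho Cd Cn p q t n (brk w)).
Local Notation norm2 := (st_norm_sq Omega Crho Cd Cn p q N t good hxm hxm_elt P).

Lemma slab_lt n : (1 <= n <= N)%N -> t n.-1 < t n.
Proof. by case: n => // n /andP[_ nN]; exact: tinc. Qed.
Lemma k_gt0 n : (1 <= n <= N)%N -> 0 < k_ t n.
Proof. by move=> /slab_lt; rewrite subr_gt0. Qed.

Lemma J_sqr_eq0 i Q : J i (Q ^+ 2) = 0 -> Q = 0.
Proof. by have [z hz] := hne i => h; apply: (cint_sqr_eq0 (good i) hz). Qed.

Lemma nrm_eq0 w : nrm w = 0 -> forall i, w i = 0.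
Proof.
move=> h i; apply: (@J_sqr_eq0 i).
have := psumr_eq0P (fun i _ => plf_sqr_ge0 (J i) (w i)) h; exact.
Qed.

Lemma sum_weight_eq0 (k : I -> R) (w : I -> bp2) : (forall i, 0 < k i) ->
  \sum_i k i * J i (w i ^+ 2) = 0 -> forall i, w i = 0.
Proof.
move=> k0 h i; apply: (@J_sqr_eq0 i).
have k1 j : 0 <= k j * J j (w j ^+ 2) by rewrite mulr_ge0 ?plf_sqr_ge0// ltW.
have /eqP := @psumr_eq0P _ _ _ _ (fun j _ => k1 j) h i isT.
by rewrite mulf_eq0 gt_eqF//= => /eqP.
Qed.

Lemma NF_ge0 n (w w' : I -> bp2) : (1 <= n <= N)%N -> 0 <= NF n w w'.
Proof.
move=> hn; apply: le_trans (NF_ge Omega Crho Cd Cn p q t n good hxm hxm_elt hpos w w').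
rewrite addr_ge0// mulr_ge0//; apply: sumr_ge0 => i _; rewrite mulr_ge0 ?plf_sqr_ge0 ?sqr_ge0//.
by apply: ltW; exact: (tau_gt0 Omega Cd q hpos Cn0 p0 (k_gt0 hn)).
Qed.

Lemma NF_eq0 n (w w' : I -> bp2) : (1 <= n <= N)%N -> NF n w w' = 0 ->
  (forall i, dy (w i) = 0) /\ (forall i, w' i + Xx * dy (w i) = 0).
Proof.
move=> hn h0; have := NF_ge Omega Crho Cd Cn p q t n good hxm hxm_elt hpos w w'; rewrite h0.
set A := \sum_i _; set B := transport_energy _ _ _ _ _ _ _ _ _ _ _.
have al2 (i : I) : 0 < alpha Omega Crho Cd Cn p q t n i ^+ 2 by rewrite exprn_gt0// alpha_gt0.
have ta0 (i : I) : 0 < tau Omega Cd Cn p q t n i by exact: (tau_gt0 Omega Cd q hpos Cn0 p0 (k_gt0 hn)).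
have A0 : 0 <= A by apply: sumr_ge0 => i _; rewrite mulr_ge0 ?plf_sqr_ge0// ltW.
have B0 : 0 <= B by apply: sumr_ge0 => i _; rewrite mulr_ge0 ?plf_sqr_ge0// ltW.
move=> hAB; have eA : A = 0 by clear -A0 B0 hAB; lra.
have eB : B = 0 by clear -A0 B0 hAB; lra.
by split; [exact: (sum_weight_eq0 al2 eA)|exact: (sum_weight_eq0 ta0 eB)].
Qed.

Lemma Ah_ge0 n (w : I -> bp2) : 0 <= Ah n w.
Proof. by apply: le_trans (norm_Ah_ge Omega Crho Cd Cn p q t n good hxm_elt w); exact: nrm_ge0. Qed.
Lemma Ah_eq0 n (w : I -> bp2) : Ah n w = 0 -> forall i, w i = 0.
Proof.
move=> h; apply: nrm_eq0; apply/eqP; rewrite eq_le nrm_ge0 andbT -h.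
exact: (norm_Ah_ge Omega Crho Cd Cn p q t n good hxm_elt w).
Qed.

Lemma TI_NF_ge0 n : (1 <= n <= N)%N ->
  0 <= TI (t n.-1) (t n) (fun s => NF n (at_time (P n) s) (at_time (dtime (P n)) s)).
Proof. by move=> hn; apply: TI_ge0 => s _; exact: NF_ge0. Qed.

Lemma norm2_ge0 : 0 <= norm2.
Proof.
rewrite /st_norm_sq; apply: addr_ge0; apply: mulr_ge0 => //.
  apply: addr_ge0; first by rewrite addr_ge0 ?Ah_ge0.
  by rewrite big_nat; apply: sumr_ge0 => n _; exact: Ah_ge0.
by rewrite big_nat; apply: sumr_ge0 => n; rewrite ltnS; exact: TI_NF_ge0.
Qed.

(** On each slab a zero norm gives [U_y = 0] and [U_t + x U_y = 0], so the function is constant in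
    time. The jumps vanish too, and the zero value at the final time propagates backwards; [d]
    counts the slabs that remain after the current one. *)
Lemma norm2_eq0 : norm2 = 0 -> forall n i s z, (1 <= n <= N)%N -> ev2 (P n i).[cst2 s] z = 0.
Proof.
have s1 : 0 <= \sum_(2 <= n < N.+1) Ah n (tjump t (P : nat -> I -> {poly bp2}) n).
  by rewrite big_nat; apply: sumr_ge0 => n _; exact: Ah_ge0.
have s2 : 0 <= \sum_(1 <= n < N.+1) TI (t n.-1) (t n) (fun s => NF n (at_time (P n) s) (at_time (dtime (P n)) s)).
  by rewrite big_nat; apply: sumr_ge0 => n; rewrite ltnS; exact: TI_NF_ge0.
have ar (a1 a2 a3 a4 : R) : 0 <= a1 -> 0 <= a2 -> 0 <= a3 -> 0 <= a4 ->
    2^-1 * (a1 + a2 + a3) + 4^-1 * a4 = 0 -> [/\ a1 = 0, a3 = 0 & a4 = 0].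
  by move=> *; split; lra.
rewrite /st_norm_sq => /(ar _ _ _ _ (Ah_ge0 _ _) (Ah_ge0 _ _) s1 s2)[e1 e2 e3].
have j0 n : (2 <= n <= N)%N -> forall i, tjump t P n i = 0.
  by move=> hn; apply: (@Ah_eq0 n); apply: (psum_nat_eq0 _ e2) => // k _; exact: Ah_ge0.
have k0 n i s s' z : (1 <= n <= N)%N -> ev2 (P n i).[cst2 s] z = ev2 (P n i).[cst2 s'] z.
  move=> hn; apply: const_in_time => r.
  have z0 : TI (t n.-1) (t n) (fun s => NF n (at_time (P n) s) (at_time (dtime (P n)) s)) = 0.
    by apply: (psum_nat_eq0 _ e3) => // k; rewrite ltnS; exact: TI_NF_ge0.
  have := TI_ge0_eq0 (slab_lt hn) (polyfun_NF Omega Crho Cd Cn p q t n good hxm hxm_elt _ _) _ z0 r.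
  case/(_ (fun s _ => NF_ge0 _ _ hn))/(NF_eq0 hn) => h1 h2.
  by have := h2 i; rewrite h1 mulr0 addr0.
suff H d n : (1 <= n <= N)%N -> (N - n <= d)%N -> forall i s z, ev2 (P n i).[cst2 s] z = 0.
  by move=> n i s z hn; exact: (H _ n hn (leqnn _)).
elim: d n => [|d IH] n hn hd i s z.
  have nN : n = N by apply/eqP; rewrite eqn_leq; case/andP: hn => _ ->; rewrite -subn_eq0 -leqn0.
  by rewrite (k0 n i s (t N) z hn) nN -/(at_time (P N) (t N) i) (Ah_eq0 e1) ev2_0.
have [nN|nN] := leqP N n.
  by apply: IH => //; rewrite (eqP (_ : N - n == 0)%N) ?subn_eq0.
have n1 : (2 <= n.+1 <= N)%N by case/andP: hn => h1 _; rewrite ltnS h1.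
have := j0 _ n1 i; rewrite /tjump /= => /eqP; rewrite subr_eq0 => /eqP e.
rewrite (k0 n i s (t n) z hn) -e; apply: IH; first by [].
by rewrite subnS -subn1 leq_subLR add1n.
Qed.

End Definiteness.

(** * Summation over the slabs *)

Section SlabSums.
Context {R : realType}.
Variables (c d k E F D X Y : nat -> R) (K tf : R).
Hypothesis K4 : 4 <= K.
Hypothesis d0 : forall n, (1 <= n)%N -> 0 <= d n.
Hypothesis E0 : forall n, 0 <= E n.
Hypothesis F0 : forall n, 0 <= F n.
Hypothesis D0 : forall n, 0 <= D n.

(** [E] and [F] stand for the energies at the end and the start of a slab, [D] for the jump at its
    start, [X] for the integrated energy of the form and [Y] for the integrated tau-term. *)
Definition slab_energy N : R := E N + \sum_(1 <= n < N) d n * E n + F 1%N + \sum_(2 <= n < N.+1) D n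
  + \sum_(1 <= n < N.+1) X n + \sum_(1 <= n < N.+1) Y n.

(** Summation by parts: slab [n] and the jump at its end contribute [c n] and [- c n.+1] times half
    of [E n], so the decrease of [c] leaves a positive multiple of [d n * E n]. The start energies
    cancel except for the first one. *)
Lemma sum_lower (G H : nat -> R) (B : R) N : (0 < N)%N ->
  (forall n, (1 <= n <= N)%N -> K <= c n) ->
  (forall n, (1 <= n < N)%N -> c n - c n.+1 = K * d n) ->
  (forall n, (1 <= n <= N)%N -> 0 <= X n /\ 0 <= Y n) ->
  (forall n, (1 <= n <= N)%N -> c n * (2^-1 * (E n - F n)) + 2 * X n + 2^-1 * Y n <= G n) ->
  (forall n, (2 <= n <= N)%N -> c n * (2^-1 * (F n + D n - E n.-1)) - 2^-1 * D n - 3 / 64 * Y n <= H n) ->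
  c 1%N * F 1%N - 2^-1 * F 1%N - 3 / 64 * Y 1%N <= B ->
  4^-1 * slab_energy N <= \sum_(1 <= n < N.+1) G n + \sum_(2 <= n < N.+1) H n + B.
Proof.
case: N => // m _ hK hc hXY hG hH hB.
(* The last end energy keeps the factor [c m.+1 / 2]: the next slab takes away [c m.+2 / 2] of it,
   and the difference [K * d / 2] is what the induction needs. *)
suff : 2^-1 * c m.+1 * E m.+1 + 4^-1 * (\sum_(1 <= n < m.+1) d n * E n + F 1%N + \sum_(2 <= n < m.+2) D n
    + \sum_(1 <= n < m.+2) X n + \sum_(1 <= n < m.+2) Y n) <=
    \sum_(1 <= n < m.+2) G n + \sum_(2 <= n < m.+2) H n + B.
  have := ler_wpM2r (E0 m.+1) (hK m.+1 _); rewrite leqnn => /(_ isT) h.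
  apply: le_trans; rewrite /slab_energy; have := ler_wpM2r (E0 m.+1) K4; move: (E0 m.+1) h.
  move: (\sum_(1 <= n < m.+1) _) (\sum_(2 <= n < m.+2) _) (\sum_(1 <= n < m.+2) _) (\sum_(1 <= n < m.+2) _) => *; lra.
elim: m hK hc hXY hG hH => [|m IH] hK hc hXY hG hH.
  rewrite !big_nat1 !big_geq//.
  have h := hG 1%N isT; have [x0 y0] := hXY 1%N isT; have := ler_wpM2r (F0 1) (hK 1%N isT).
  have := ler_wpM2r (F0 1) K4; move: h hB x0 y0 (F0 1); clear => *; lra.
have w n : (n <= m.+1)%N -> (n <= m.+2)%N by move=> h; apply: leq_trans h _.
have {}IH := IH (fun n hn => hK n (ltac:(by case/andP: hn => -> /w))) (fun n hn => hc n (ltac:(by case/andP: hn => -> /w)))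
  (fun n hn => hXY n (ltac:(by case/andP: hn => -> /w)))
  (fun n hn => hG n (ltac:(by case/andP: hn => -> /w))) (fun n hn => hH n (ltac:(by case/andP: hn => -> /w))).
rewrite (big_nat_recr m.+1)//= (big_nat_recr m.+2 2)//= !(big_nat_recr m.+2 1)//= (big_nat_recr m.+2 2)//=.
have hm : (1 <= m.+2 <= m.+2)%N by rewrite leqnn.
have h1 := hG m.+2 hm; have h2 := hH m.+2 (leqnn _); have [x0 y0] := hXY m.+2 hm.
have h3 := hc m.+1 (leqnn _); have hk := hK m.+2 hm.
have g1 := ler_wpM2r (D0 m.+2) hk; have g2 := ler_wpM2r (D0 m.+2) K4.
have g3 := mulr_ge0 (d0 (ltn0Sn m)) (E0 m.+1).
have g4 := ler_wpM2r g3 K4; have g5 : c m.+1 * E m.+1 - c m.+2 * E m.+1 = K * (d m.+1 * E m.+1).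
  by rewrite -mulrBl h3 mulrA.
rewrite /= in h2; move: IH h1 h2 x0 y0 g1 g2 g3 g4 g5 (D0 m.+2); rewrite mulrA.
by clear; move: (\sum_(1 <= n < m.+1) _) (\sum_(2 <= n < m.+2) _) (\sum_(1 <= n < m.+2) X _) (\sum_(1 <= n < m.+2) Y _)
  (\sum_(1 <= n < m.+2) G _) (\sum_(2 <= n < m.+2) _) => *; lra.
Qed.

Hypothesis tf0 : 0 < tf.

(** The end energy [E n] is counted with [k n], and once more with [2 * k n.+1] when the next start
    energy is replaced by jump and previous end. Since [k n + k n.+1 = tf * d n], both fit into
    [3 * tf * d n]. *)
Lemma sum_time_weight N : (0 < N)%N -> (forall n, (1 <= n <= N)%N -> 0 <= k n <= tf) ->
  (forall n, (1 <= n < N)%N -> tf * d n = k n + k n.+1) ->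
  (forall n, (2 <= n <= N)%N -> F n <= 2 * D n + 2 * E n.-1) ->
  (forall n, (1 <= n <= N)%N -> 0 <= X n /\ 0 <= Y n) ->
  \sum_(1 <= n < N.+1) k n * (E n + F n) <= 3 * tf * slab_energy N.
Proof.
case: N => // m _ hk hd hF hXY.
have xy0 : 0 <= \sum_(1 <= n < m.+2) X n /\ 0 <= \sum_(1 <= n < m.+2) Y n.
  by split; rewrite big_nat; apply: sumr_ge0 => n hn; have [] := hXY n hn.
suff : \sum_(1 <= n < m.+2) k n * (E n + F n) <= k m.+1 * E m.+1 +
    tf * (F 1%N + 3 * \sum_(1 <= n < m.+1) d n * E n + 2 * \sum_(2 <= n < m.+2) D n).
  move=> /le_trans; apply; rewrite /slab_energy; case: xy0 => x0 y0.
  have hkm : k m.+1 <= tf by have /andP[] := hk m.+1 (leqnn _).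
  have h1 := ler_wpM2r (E0 m.+1) hkm.
  have h2 : 0 <= tf * \sum_(2 <= n < m.+2) D n by apply: mulr_ge0; [exact: ltW|apply: sumr_ge0 => n _; exact: D0].
  have h3 := mulr_ge0 (ltW tf0) x0; have h4 := mulr_ge0 (ltW tf0) y0; have h5 := mulr_ge0 (ltW tf0) (F0 1).
  have h6 := mulr_ge0 (ltW tf0) (E0 m.+1); move: h1 h2 h3 h4 h5 h6; clear.
  by rewrite !mulrDr -!mulrA; move: (\sum_(1 <= n < m.+1) _) (\sum_(2 <= n < m.+2) _) (\sum_(1 <= n < m.+2) X _) (\sum_(1 <= n < m.+2) Y _) => *; lra.
move: xy0 => _.
elim: m hk hd hF {hXY} => [|m IH] hk hd hF.
  rewrite !big_nat1 !big_geq// mulrDr !mulr0 !addr0 lerD2l; apply: ler_wpM2r => //.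
  by have /andP[] := hk 1%N isT.
have w n : (n <= m.+1)%N -> (n <= m.+2)%N by move=> h; apply: leq_trans h _.
have {}IH := IH (fun n hn => hk n (ltac:(by case/andP: hn => -> /w))) (fun n hn => hd n (ltac:(by case/andP: hn => -> /w)))
  (fun n hn => hF n (ltac:(by case/andP: hn => -> /w))).
rewrite (big_nat_recr m.+2 1)//= (big_nat_recr m.+1 1 (fun n => d n * E n))//= (big_nat_recr m.+2 2)//=.
have hm : (1 <= m.+2 <= m.+2)%N by rewrite leqnn.
have /andP[k0 kt] := hk m.+2 hm; have /andP[k0' kt'] := hk m.+1 (leqnSn _).
have h2 := ler_wpM2l k0 (hF m.+2 (leqnn _)); have h3 := hd m.+1 (leqnn _); rewrite /= in h2.
have h4 := ler_wpM2r (D0 m.+2) kt; have h5 := mulr_ge0 k0' (E0 m.+1).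
have h6 : tf * (d m.+1 * E m.+1) = k m.+1 * E m.+1 + k m.+2 * E m.+1 by rewrite mulrA h3 mulrDl.
have h7 := mulr_ge0 k0 (E0 m.+1).
move: IH h2 h4 h5 h6 h7; rewrite !mulrDr.
by clear; move: (\sum_(1 <= n < m.+1) _) (\sum_(2 <= n < m.+2) _) (\sum_(1 <= n < m.+2) _) => *; lra.
Qed.

Lemma sum_shifted (H : nat -> R) (A : R) N : (0 < N)%N -> 0 <= A ->
  (forall n, (2 <= n <= N)%N -> H n <= A * D n + A * (d n.-1 * E n.-1) + Y n + Y n.-1) ->
  (forall n, (1 <= n <= N)%N -> 0 <= X n /\ 0 <= Y n) ->
  \sum_(2 <= n < N.+1) H n <= A * (\sum_(2 <= n < N.+1) D n + \sum_(1 <= n < N) d n * E n)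
     + 2 * \sum_(1 <= n < N.+1) Y n.
Proof.
case: N => // m _ A0 hH hXY.
(* Each [Y n] is used by the jumps at both ends of its slab. The last one has been used once only,
   and the subtracted term keeps that room for the next step. *)
suff : \sum_(2 <= n < m.+2) H n <= A * (\sum_(2 <= n < m.+2) D n + \sum_(1 <= n < m.+1) d n * E n)
     + 2 * \sum_(1 <= n < m.+2) Y n - Y m.+1.
  by move=> /le_trans; apply; rewrite gerBl; have [] := hXY m.+1 (leqnn _).
elim: m hH hXY => [|m IH] hH hXY.
  rewrite !big_nat1 !big_geq// addr0 mulr0 add0r; have [_] := hXY 1%N isT; lra.
have w n : (n <= m.+1)%N -> (n <= m.+2)%N by move=> h; apply: leq_trans h _.
have {}IH := IH (fun n hn => hH n (ltac:(by case/andP: hn => -> /w)))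
  (fun n hn => hXY n (ltac:(by case/andP: hn => -> /w))).
rewrite (big_nat_recr m.+1 1)//= !(big_nat_recr m.+2 2)//= (big_nat_recr m.+2 1)//=.
have := hH m.+2 (leqnn _); rewrite /=; move: IH; rewrite !mulrDr.
by move: (\sum_(1 <= n < m.+1) _) (\sum_(2 <= n < m.+2) D _) (\sum_(1 <= n < m.+2) _) (\sum_(2 <= n < m.+2) _) => *; lra.
Qed.

End SlabSums.

(** The product of the jump with the value after it is half of [u^2 + (u - v)^2 - v^2], as for
    upwind jumps in space; the second part of the test function is split off by Young's
    inequality. *)
Lemma plf_jump_test (R : realType) (xm : R) (L : plf xm) (u v w : {poly {poly R}}) (c s : R) :
  c * (2^-1 * (L (u ^+ 2) + L ((u - v) ^+ 2) - L (v ^+ 2))) - 2^-1 * L ((u - v) ^+ 2) - 2^-1 * (s ^+ 2 * L (w ^+ 2))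
    <= L ((u - v) * (cst2 c * u + cst2 s * w)).
Proof.
have h := plf_young L (u - v) (- (cst2 s * w)) ltr01.
rewrite invr1 !mul1r sqrrN plf_sqrZ mulrN plfN in h.
have -> : (u - v) * (cst2 c * u + cst2 s * w) =
   cst2 (c * 2^-1) * (u ^+ 2 + (u - v) ^+ 2 - v ^+ 2) + (u - v) * (cst2 s * w).
  rewrite (_ : u ^+ 2 + (u - v) ^+ 2 - v ^+ 2 = cst2 2 * ((u - v) * u)); last first.
    by rewrite /cst2 !polyC_natr; ring.
  by rewrite mulrA -cst2M divfK ?pnatr_eq0//; ring.
rewrite plfD plfZ !plfD plfN; lra.
Qed.

Lemma plf_sqr4 (R : realType) (xm : R) (L : plf xm) (x1 x2 x3 x4 : {poly {poly R}}) :
  L ((x1 + x2 + (x3 + x4)) ^+ 2) <=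
  4 * (L (x1 ^+ 2) + L (x2 ^+ 2)) + 4 * (L (x3 ^+ 2) + L (x4 ^+ 2)).
Proof.
have := plf_sqrD L (x1 + x2) (x3 + x4).
have := plf_sqrD L x1 x2; have := plf_sqrD L x3 x4; lra.
Qed.

Lemma test_arith (R : realType) (z1 z2 z3 e f s y S c w W : R) :
  z1 <= 2 * c * e + y -> z2 <= 2 * c * f + y -> z3 <= 4 * c * s + 2 * y -> e + f + s + y <= S ->
  0 <= c -> 0 <= e -> 0 <= f -> 0 <= s -> 0 <= y -> w <= W * S ->
  2^-1 * (3 * z1 + 3 * z2 + 3 * z3) + 4^-1 * w <= (3 / 2 * (8 * c + 4) + 4^-1 * W) * S.
Proof.
move=> h1 h2 h3 h4 c0 e0 f0 s0 y0 hw.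
have g1 := ler_wpM2l c0 h4; have g2 := mulr_ge0 c0 e0; have g3 := mulr_ge0 c0 f0.
have g4 := mulr_ge0 c0 s0; have g5 := mulr_ge0 c0 y0; lra.
Qed.

Lemma weight_arith (R : realType) (k d : R) : 0 <= d -> d <= 1 -> (k * d) ^+ 2 <= (3 * k) ^+ 2 * d.
Proof.
move=> d0 d1; have d2 : d ^+ 2 <= d by rewrite expr2 ler_piMr.
have := ler_wpM2l (sqr_ge0 k) d2; have := mulr_ge0 (sqr_ge0 k) d0; lra.
Qed.

Lemma jump_arith (R : realType) (z D e c d s1 s2 y y' a b : R) :
  s1 <= 6 / 64 * y -> s2 <= 6 / 64 * y' -> a * D <= c * D -> b * e <= c * (d * e) -> 0 <= y -> 0 <= y' ->
  z <= 4 * (a * D + b * e) + 4 * (s1 + s2) -> z <= 4 * c * D + 4 * c * (d * e) + y + y'.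
Proof. by move=> *; lra. Qed.

(** * Choice of the weights and the global estimates *)

Section Assembly.
Context {R : realType}.
Local Notation pt := (R * R)%type.
Local Notation bp2 := {poly {poly R}}.
Variables (Omega : set pt) (M : @mesh R) (xm Crho Cd Cn Hm tf : R) (p q N : nat) (t : nat -> R).
Local Notation I := 'I_(size M).
Hypothesis good : forall i : I, good_cell (vert i).
Hypothesis disj : forall i j : I, i != j -> elt i `&` elt j = set0.
Hypothesis hxm : forall (i : I) z, bd (elt i) z -> `|z.1| <= xm.
Hypothesis hxm_elt : forall (i : I) z, elt i z -> `|z.1| <= xm.
Hypothesis hup : upwind_neighbours Omega M.
Hypothesis hinv : inverse_estimates M Cd Cn.
Hypothesis hpos : forall i : I, 0 < h i.
Hypothesis hmax : forall i : I, h i <= Hm.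
Hypothesis Cd0 : 0 < Cd.
Hypothesis Cn0 : 0 < Cn.
Hypothesis p0 : (0 < p)%N.
Hypothesis N0 : (0 < N)%N.
Hypothesis tinc : forall n, (n < N)%N -> t n < t n.+1.
Hypothesis t0 : t 0%N = 0.
Hypothesis tN : t N = tf.
Hypothesis tf0 : 0 < tf.
Hypothesis xm0 : 0 <= xm.
Hypothesis Hm0 : 0 <= Hm.
Variable P : nat -> I -> {poly bp2}.
Hypothesis hP : st_poly p q P.

Local Notation J := (cell_form good hxm_elt).
Local Notation nrm := (l2_sqr good hxm_elt).
Local Notation NF n := (slab_norm_sq Omega Cd p good hxm hxm_elt Crho Cn q t n).
Local Notation Ah n w := (norm_Ah_sq Omega Crho Cd Cn p q t n (brk w)).
Local Notation norm2 := (st_norm_sq Omega Crho Cd Cn p q N t good hxm hxm_elt).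
Local Notation ta n := (tau Omega Cd Cn p q t n).
Local Notation KV := (test_const xm Cd Cn Hm).
Local Notation KH := (hypo_const xm Cd Cn).
Local Notation KM := (norm_const xm Cd).
Local Notation CT := (transport_const xm tf).

Lemma le_mono_time m n : (m <= n <= N)%N -> t m <= t n.
Proof.
elim: n => [|n IH] /andP[mn nN]; first by move: mn; rewrite leqn0 => /eqP ->.
move: mn; rewrite leq_eqVlt => /orP[/eqP <-|mn]; first exact: lexx.
apply: (le_trans (IH _)); first by rewrite -ltnS mn ltnW.
by apply: ltW; exact: tinc.
Qed.

Lemma time_ge0 n : (n <= N)%N -> 0 <= t n.
Proof. by move=> nN; rewrite -t0; apply: le_mono_time. Qed.
Lemma time_le n : (n <= N)%N -> t n <= tf.
Proof. by move=> nN; rewrite -tN; apply: le_mono_time; rewrite nN leqnn. Qed.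

Let kn n (hn : (1 <= n <= N)%N) : 0 < k_ t n := k_gt0 tinc hn.

Lemma k_le n : (1 <= n <= N)%N -> k_ t n <= tf.
Proof.
move=> /andP[n1 nN]; have := time_le nN; have := time_ge0 (leq_trans (leq_pred n) nN).
by rewrite /k_ => h1 h2; lra.
Qed.

Let KV0 : 0 < KV.
Proof.
have c1 : 0 <= (Cn ^+ 2)^-1 by rewrite invr_ge0 sqr_ge0.
have c2 : 0 <= Cd ^+ 2 * (22 + (Cn ^+ 2)^-1) by apply: mulr_ge0; [exact: sqr_ge0|lra].
have c3 : 0 <= 8 * xm * Cd ^+ 2 * (Hm / Cn ^+ 2) by ge0_tac.
by rewrite /test_const; lra.
Qed.
Let KH0 : 0 < KH := KH_gt0 xm Cn Cd0.
Let KM2 : 2 <= KM := KM_ge2 Cd xm0.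

(** The threshold required of the weight by [step_lower]. The bracket in [cw] lies between 1 and 3,
    so every slab meets it. *)
Definition Kw : R := 4 * KV + 4.
(* Decreasing in n, so that summation by parts leaves a positive multiple of every end-of-slab energy. *)
Definition cw n : R := Kw * (3 - (t n.-1 + t n) / tf).
(** The decrease of [cw] after slab [n] in units of [Kw]. It equals the length of two consecutive
    slabs over [tf], which is the form required by [sum_time_weight]. *)
Definition dw n : R := if (n < N)%N then (t n.+1 - t n.-1) / tf else 0.
Definition test n : I -> {poly bp2} := test_poly Omega Cd Cn p q t n (cw n) (P n).

Let E n := nrm (at_time (P n) (t n)).
Let F n := nrm (at_time (P n) (t n.-1)).
Let D n := nrm (tjump t P n).
Let X n := dG_action Omega Cd p t n good hxm hxm_elt (P n).
Let Y n := transport_action Omega Cd Cn p q t n good hxm_elt (P n).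
Definition energy : R := slab_energy dw E F D X Y N.

Lemma Kw4 : 4 <= Kw. Proof. by rewrite /Kw; move: KV0; lra. Qed.

Lemma cw_bounds n : (1 <= n <= N)%N -> Kw <= cw n <= 3 * Kw.
Proof.
move=> /andP[n1 nN]; have h1 := time_le nN; have h2 := time_ge0 nN.
have nN' := leq_trans (leq_pred n) nN; have h3 := time_le nN'; have h4 := time_ge0 nN'.
have a1 : (t n.-1 + t n) / tf <= 2 by rewrite ler_pdivrMr//; lra.
have a2 : 0 <= (t n.-1 + t n) / tf by apply: divr_ge0; [lra|exact: ltW].
have K0 : 0 <= Kw by apply: le_trans Kw4.
apply/andP; split; rewrite /cw.
  have := ler_wpM2l K0 a1; lra.
have := mulr_ge0 K0 a2; lra.
Qed.

Lemma cw_step n : (1 <= n < N)%N -> cw n - cw n.+1 = Kw * dw n.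
Proof. by move=> /andP[_ nN]; rewrite /cw /dw nN /=; field; rewrite gt_eqF. Qed.

Lemma dw_bounds n : (1 <= n)%N -> 0 <= dw n <= 1.
Proof.
move=> n1; rewrite /dw; case: ifP => nN; last by rewrite lexx ler01.
have nN' : (n.-1 <= N)%N by rewrite (leq_trans (leq_pred n))// ltnW.
have h1 : t n.-1 <= t n.+1 by apply: le_mono_time; rewrite nN andbT (leq_trans (leq_pred n)).
have h2 := time_le nN; have h3 := time_ge0 nN'.
rewrite divr_ge0 ?subr_ge0 ?(ltW tf0)//= ler_pdivrMr// mul1r; lra.
Qed.

Lemma dw_k n : (1 <= n < N)%N -> tf * dw n = k_ t n + k_ t n.+1.
Proof. by move=> /andP[_ nN]; rewrite /dw nN /k_ /=; field; rewrite gt_eqF. Qed.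

Let sP n i : (size (P n i) <= q.+1)%N. Proof. by case: (hP n i). Qed.
Let dP n i : deg3 p (P n i). Proof. by case: (hP n i). Qed.

Lemma st_poly_test : st_poly p q test.
Proof. by move=> n i; split; [exact: size_test|exact: (deg3_test Omega Cd Cn q t n (dP n) (cw n) i)]. Qed.

Lemma XY_ge0 n : (1 <= n <= N)%N -> 0 <= X n /\ 0 <= Y n.
Proof.
move=> hn; split; first exact: IX_ge0.
exact: (IY_ge0 Omega Cd q good hxm_elt hpos Cn0 p0 (kn hn)).
Qed.

Lemma slab_term n : (1 <= n <= N)%N ->
  cw n * (2^-1 * (E n - F n)) + 2 * X n + 2^-1 * Y n <= dG_int Omega Cd p t good hxm hxm_elt P test n.
Proof.
move=> hn; apply: (slab_lower q good disj hxm hxm_elt hup hinv hpos hmax Cd0 Cn0 p0 (kn hn) (dP n) KV0).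
by case/andP: (cw_bounds hn).
Qed.

Lemma tau_end_sum n s : (1 <= n <= N)%N -> s = t n.-1 \/ s = t n ->
  \sum_i ta n i ^+ 2 * J i ((tW (P n i)).[cst2 s] ^+ 2) <= 6 / 64 * Y n.
Proof. by move=> hn hs; exact: (tau_end Omega Cd good hxm_elt hpos Cn0 p0 (kn hn) (sP n) hs). Qed.

Lemma test_at n s i : (test n i).[cst2 s] = cst2 (cw n) * (P n i).[cst2 s] + cst2 (ta n i) * (tW (P n i)).[cst2 s].
Proof. exact: test_horner. Qed.

Lemma jump_term n : (2 <= n <= N)%N ->
  cw n * (2^-1 * (F n + D n - E n.-1)) - 2^-1 * D n - 3 / 64 * Y n <=
  \sum_i J i (tjump t P n i * (test n i).[cst2 (t n.-1)]).
Proof.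
move=> hn; have hn1 : (1 <= n <= N)%N by case/andP: hn => h1 ->; rewrite ltnW.
have h1 := tau_end_sum hn1 (or_introl erefl).
have : cw n * (2^-1 * (F n + D n - E n.-1)) - 2^-1 * D n
    - 2^-1 * \sum_i ta n i ^+ 2 * J i ((tW (P n i)).[cst2 (t n.-1)] ^+ 2) <=
  \sum_i J i (tjump t P n i * (test n i).[cst2 (t n.-1)]).
  rewrite /F /D /E /l2_sqr -big_split -sumrB !mulr_sumr -!sumrB; apply: ler_sum => i _.
  by rewrite test_at; exact: plf_jump_test.
by move: h1; move: (\sum_i ta n i ^+ 2 * _) (\sum_i J i _) => *; lra.
Qed.

Lemma initial_term : cw 1 * F 1%N - 2^-1 * F 1%N - 3 / 64 * Y 1%N <=
  \sum_i J i ((P 1%N i).[cst2 (t 0%N)] * (test 1%N i).[cst2 (t 0%N)]).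
Proof.
have hn1 : (1 <= 1 <= N)%N by rewrite N0.
have h1 := tau_end_sum hn1 (or_introl erefl).
have : cw 1 * F 1%N - 2^-1 * F 1%N
    - 2^-1 * \sum_i ta 1%N i ^+ 2 * J i ((tW (P 1%N i)).[cst2 (t 0%N)] ^+ 2) <=
  \sum_i J i ((P 1%N i).[cst2 (t 0%N)] * (test 1%N i).[cst2 (t 0%N)]).
  rewrite /F /l2_sqr !mulr_sumr -!sumrB; apply: ler_sum => i _; rewrite test_at.
  have := plf_jump_test (J i) (P 1%N i).[cst2 (t 0%N)] 0 (tW (P 1%N i)).[cst2 (t 0%N)] (cw 1) (ta 1%N i).
  by rewrite subr0 expr0n /= plf0 subr0 /at_time /=; move: (J i _) (J i _) (J i _) => *; lra.
by move: h1; rewrite /=; move: (\sum_i ta 1%N i ^+ 2 * _) (\sum_i J i _) => *; lra.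
Qed.

Lemma E_ge0 n : 0 <= E n. Proof. exact: nrm_ge0. Qed.
Lemma F_ge0 n : 0 <= F n. Proof. exact: nrm_ge0. Qed.
Lemma D_ge0 n : 0 <= D n. Proof. exact: nrm_ge0. Qed.
Let d_ge0 n (n1 : (1 <= n)%N) : 0 <= dw n. Proof. by case/andP: (dw_bounds n1). Qed.

Lemma Bform_lower : 4^-1 * energy <= st_form Omega Cd p N t good hxm hxm_elt P test.
Proof.
apply: (sum_lower (c := cw) Kw4 d_ge0 E_ge0 F_ge0 D_ge0 N0).
- by move=> n hn; case/andP: (cw_bounds hn).
- exact: cw_step.
- exact: XY_ge0.
- exact: slab_term.
- exact: jump_term.
- exact: initial_term.
Qed.

Lemma F_le n : (2 <= n <= N)%N -> F n <= 2 * D n + 2 * E n.-1.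
Proof.
move=> _; rewrite /F /D /E /l2_sqr !mulr_sumr -big_split; apply: ler_sum => i _ /=.
have := plf_sqrD (J i) (tjump t P n i) (at_time (P n.-1) (t n.-1) i).
by rewrite /tjump /at_time subrK.
Qed.

Lemma energy_parts : [/\ 0 <= E N, 0 <= F 1%N, 0 <= \sum_(1 <= n < N) dw n * E n, 0 <= \sum_(2 <= n < N.+1) D n &
  0 <= \sum_(1 <= n < N.+1) X n /\ 0 <= \sum_(1 <= n < N.+1) Y n].
Proof.
split; [exact: E_ge0|exact: F_ge0| | |].
- rewrite big_nat; apply: sumr_ge0 => n /andP[n1 _]; apply: mulr_ge0; [exact: d_ge0|exact: E_ge0].
- by apply: sumr_ge0 => n _; exact: D_ge0.
by split; rewrite big_nat; apply: sumr_ge0 => n; rewrite ltnS => hn; have [] := XY_ge0 hn.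
Qed.

Lemma energy_ge0 : 0 <= energy.
Proof.
have [e1 e2 e3 e4 [e5 e6]] := energy_parts; rewrite /energy /slab_energy.
apply: addr_ge0; last exact: e6; apply: addr_ge0; last exact: e5; apply: addr_ge0; last exact: e4.
by apply: addr_ge0; last exact: e2; apply: addr_ge0; [exact: e1|exact: e3].
Qed.

Let BT n := TI (t n.-1) (t n) (fun s => dy_energy Omega Crho Cd Cn p q t n good hxm_elt (at_time (P n) s)).
(** The hypocoercive bound contributes [2 * KH] times the actions and, through [sum_time_weight],
    [2 * KH * (3 * tf)] for the end values. *)
Definition CG : R := 1 + 2 * KH + 6 * KH * tf.

Lemma sum_XBY : \sum_(1 <= n < N.+1) (X n + BT n + Y n) <= CG * energy.
Proof.
have h1 n : (1 <= n <= N)%N -> X n + BT n + Y n <= (1 + 2 * KH) * (X n + Y n) + 2 * KH * (k_ t n * (E n + F n)).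
  move=> hn; have := Bq_slab Omega Crho q good hxm hxm_elt hinv hpos Cd0 Cn0 p0 (kn hn) (dP n).
  by rewrite -/(BT n) -/(X n) -/(Y n) -/(E n) -/(F n); move: (X n) (Y n) (BT n) (E n + F n) => x y b' e; rewrite mulrDl mul1r; lra.
apply: (@le_trans _ _ ((1 + 2 * KH) * (\sum_(1 <= n < N.+1) X n + \sum_(1 <= n < N.+1) Y n)
   + 2 * KH * \sum_(1 <= n < N.+1) k_ t n * (E n + F n))).
  rewrite -big_split !mulr_sumr -big_split [leLHS]big_nat [leRHS]big_nat; apply: ler_sum => n.
  by rewrite ltnS => hn; exact: h1.
have h2 : \sum_(1 <= n < N.+1) k_ t n * (E n + F n) <= 3 * tf * energy.
  apply: (sum_time_weight E_ge0 F_ge0 D_ge0 tf0 N0).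
  - by move=> n hn; rewrite k_le// ltW// kn.
  - exact: dw_k.
  - exact: F_le.
  - exact: XY_ge0.
have [e1 e2 e3 e4 [e5 e6]] := energy_parts; have K2 : 0 <= 2 * KH by move: KH0; lra.
have h3 : \sum_(1 <= n < N.+1) X n + \sum_(1 <= n < N.+1) Y n <= energy.
  by rewrite /energy /slab_energy; lra.
have K3 : 0 <= 1 + 2 * KH by lra.
have := ler_wpM2l K2 h2; have := ler_wpM2l K3 h3; rewrite /CG; lra.
Qed.

Definition CP : R := 3 / 2 + 4^-1 * (KM * CG).

Lemma norm2_arith (a1 a2 a3 s1 b1 b2 b3 s2 : R) : a1 <= b1 -> a2 <= b2 -> a3 <= b3 -> s1 <= s2 ->
  2^-1 * (a1 + a2 + a3) + 4^-1 * s1 <= 2^-1 * (b1 + b2 + b3) + 4^-1 * s2.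
Proof. by move=> *; lra. Qed.

Let du n s : degp p (at_time (P n) s). Proof. by move=> i; exact: (deg3_horner s (dP n i)). Qed.
Let djump n : degp p (tjump t P n).
Proof. by move=> i; apply: deg2D; [|apply: deg2N]; exact: deg3_horner. Qed.

Lemma norm2_le : norm2 P <= CP * energy.
Proof.
have hA n w : degp p w -> Ah n w <= 3 * nrm w.
  by move=> dw'; exact: (norm_Ah_le Omega Crho q t n good hxm_elt hinv hpos Cd0 Cn0 p0 dw').
have h1 : \sum_(2 <= n < N.+1) Ah n (tjump t P n) <= \sum_(2 <= n < N.+1) 3 * D n.
  by apply: ler_sum => n _; exact: hA.
have h2 : \sum_(1 <= n < N.+1) TI (t n.-1) (t n) (fun s => NF n (at_time (P n) s) (at_time (dtime (P n)) s)) <=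
    \sum_(1 <= n < N.+1) KM * (X n + BT n + Y n).
  rewrite [leLHS]big_nat [leRHS]big_nat; apply: ler_sum => n; rewrite ltnS => hn.
  exact: (NF_slab Omega Crho q good hxm hxm_elt hinv hpos Cd0 Cn0 p0 (kn hn) xm0 (dP n)).
apply: le_trans (norm2_arith (hA N _ (du N (t N))) (hA 1%N _ (du 1%N (t 0%N))) h1 h2) _.
rewrite -!mulr_sumr; have K0 : 0 <= KM by apply: le_trans KM2.
have := ler_wpM2l K0 sum_XBY; rewrite mulrA.
have [e1 e2 e3 e4 [e5 e6]] := energy_parts.
have hS : E N + F 1%N + \sum_(2 <= n < N.+1) D n <= energy by rewrite /energy /slab_energy; lra.
move: hS; rewrite /CP /E /F; move: (nrm _) (nrm _) (\sum_(2 <= n < N.+1) D n) energy (KM * CG) (KM * _) => *; lra.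
Qed.

Definition cb : R := (3 * Kw) ^+ 2.
Lemma cw_sqr n : (1 <= n <= N)%N -> cw n ^+ 2 <= cb.
Proof.
move=> /cw_bounds/andP[h1 h2]; have K0 : 0 <= Kw by apply: le_trans Kw4.
have c0 := le_trans K0 h1; rewrite /cb ler_sqr ?nnegrE//; exact: le_trans c0 h2.
Qed.

Lemma test_end n s : (1 <= n <= N)%N -> s = t n.-1 \/ s = t n ->
  nrm (at_time (test n) s) <= 2 * cb * nrm (at_time (P n) s) + Y n.
Proof.
move=> hn hs; have h1 := tau_end_sum hn hs; have h2 := cw_sqr hn; have [_ y0] := XY_ge0 hn.
have : nrm (at_time (test n) s) <= 2 * cw n ^+ 2 * nrm (at_time (P n) s)
    + 2 * \sum_i ta n i ^+ 2 * J i ((tW (P n i)).[cst2 s] ^+ 2).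
  rewrite /l2_sqr !mulr_sumr -big_split; apply: ler_sum => i _ /=.
  by rewrite -plf_sqrZ; apply: plf_sqrDZ; exact: test_at.
have := ler_wpM2r (nrm_ge0 good hxm_elt (at_time (P n) s)) h2; move: h1 y0.
by move: (nrm _) (nrm _) (\sum_i _) (Y n) => *; lra.
Qed.

(** The weight jumps as well, which brings in the value before the jump times [cw n - cw n.-1]. The
    square of this factor is at most [cb * dw n.-1] because [dw] lies in [[0, 1]], so the energy
    already contains the result. *)
Lemma jump_test_le n : (2 <= n <= N)%N ->
  nrm (tjump t test n) <= 4 * cb * D n + 4 * cb * (dw n.-1 * E n.-1) + Y n + Y n.-1.
Proof.
move=> hn; have hn1 : (1 <= n <= N)%N by case/andP: hn => h1 ->; rewrite ltnW.
have hn2 : (1 <= n.-1 <= N)%N by case/andP: hn => h1 h2; rewrite -ltnS prednK ?(ltnW h1)// h1 (leq_trans (leq_pred _)).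
have hn3 : (1 <= n.-1 < N)%N by case/andP: hn => h1 h2; rewrite -ltnS prednK ?(ltnW h1)// h1.
have h1 := tau_end_sum hn1 (or_introl erefl); have h2 := tau_end_sum hn2 (or_intror erefl).
have hc := cw_sqr hn1; have [_ y0] := XY_ge0 hn1; have [_ y1] := XY_ge0 hn2.
have en : n.-1.+1 = n by case/andP: hn => h0 _; rewrite prednK// ltnW.
have hs := cw_step hn3; rewrite en in hs.
have /andP[d0 d1] : 0 <= dw n.-1 <= 1 by apply: dw_bounds; case/andP: hn2.
have hd : (cw n - cw n.-1) ^+ 2 <= cb * dw n.-1.
  by rewrite -sqrrN opprB hs; exact: weight_arith.
have h3 : nrm (tjump t test n) <= 4 * (cw n ^+ 2 * D n + (cw n - cw n.-1) ^+ 2 * E n.-1)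
    + 4 * (\sum_i ta n i ^+ 2 * J i ((tW (P n i)).[cst2 (t n.-1)] ^+ 2) +
           \sum_i ta n.-1 i ^+ 2 * J i ((tW (P n.-1 i)).[cst2 (t n.-1)] ^+ 2)).
  rewrite /D /E /l2_sqr !mulr_sumr -!big_split !mulr_sumr -big_split; apply: ler_sum => i _ /=.
  have -> : tjump t test n i = cst2 (cw n) * tjump t P n i + cst2 (cw n - cw n.-1) * at_time (P n.-1) (t n.-1) i
    + (cst2 (ta n i) * (tW (P n i)).[cst2 (t n.-1)] + cst2 (- ta n.-1 i) * (tW (P n.-1 i)).[cst2 (t n.-1)]).
    by rewrite {1}/tjump !test_at /tjump /at_time cst2D !cst2N; ring.
  by apply: (le_trans (plf_sqr4 (J i) _ _ _ _)); rewrite !plf_sqrZ sqrrN.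
have g1 := ler_wpM2r (D_ge0 n) hc; have g2 := ler_wpM2r (E_ge0 n.-1) hd; rewrite -[cb * _ * _]mulrA in g2.
exact: jump_arith h1 h2 g1 g2 y0 y1 h3.
Qed.

(** The first part bounds the end values and the jumps of the test function, where 3 is the factor
    of [norm_Ah_le]; the second bounds its slab integrals through [NF_test]. *)
Definition CZ : R := 3 / 2 * (8 * cb + 4) + 4^-1 * (KM * (2 * cb * CG + (2 * KV + 2 + CT))).

Lemma norm2_test_le : norm2 test <= CZ * energy.
Proof.
have cb0 : 0 <= cb by exact: sqr_ge0.
have hA n w : degp p w -> Ah n w <= 3 * nrm w.
  by move=> dw'; exact: (norm_Ah_le Omega Crho q t n good hxm_elt hinv hpos Cd0 Cn0 p0 dw').
have dt n s : degp p (at_time (test n) s) by move=> i; exact: (deg3_horner s (st_poly_test n i).2).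
have hN : (1 <= N <= N)%N by rewrite N0 leqnn.
have h1N : (1 <= 1 <= N)%N by rewrite N0.
have CT0 : 0 <= CT by rewrite /transport_const; have := mulr_ge0 (sqr_ge0 xm) (ltW tf0); lra.
have K0 : 0 <= KM by apply: le_trans KM2.
have h1 : \sum_(2 <= n < N.+1) Ah n (tjump t test n) <= 3 * \sum_(2 <= n < N.+1) nrm (tjump t test n).
  rewrite mulr_sumr; apply: ler_sum => n _; apply: hA => i.
  by apply: deg2D; [|apply: deg2N]; apply: deg3_horner; exact: (st_poly_test _ _).2.
have h2 : \sum_(1 <= n < N.+1) TI (t n.-1) (t n) (fun s => NF n (at_time (test n) s) (at_time (dtime (test n)) s)) <=
    \sum_(1 <= n < N.+1) KM * (2 * cb * (X n + BT n + Y n) + (2 * KV + 2 + CT) * Y n).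
  rewrite [leLHS]big_nat [leRHS]big_nat; apply: ler_sum => n; rewrite ltnS => hn.
  apply: (le_trans (NF_test Crho good disj hxm hxm_elt hup hinv hpos hmax Cd0 Cn0 p0 (kn hn) (k_le hn) xm0 (sP n) (dP n) (cw n))).
  apply: ler_wpM2l => //; rewrite lerD2r; apply: ler_wpM2r.
    have [x0 y0] := XY_ge0 hn; rewrite -/(X n) -/(Y n) -/(BT n).
    have b0 : 0 <= BT n.
      apply: TI_ge0 => s _; apply: sumr_ge0 => i _; rewrite mulr_ge0 ?plf_sqr_ge0//.
      by apply: ltW; exact: beta_gt0.
    by apply: addr_ge0; [apply: addr_ge0; [exact: x0|exact: b0]|exact: y0].
  by rewrite ler_wpM2l//; exact: cw_sqr.
apply: le_trans (norm2_arith (hA N _ (dt N (t N))) (hA 1%N _ (dt 1%N (t 0%N))) h1 h2) _.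
have t1 := test_end hN (or_intror erefl); have t2 := test_end h1N (or_introl erefl).
have A0 : 0 <= 4 * cb by apply: mulr_ge0.
have t3 := sum_shifted N0 A0 jump_test_le XY_ge0.
have [e1 e2 e3 e4 [e5 e6]] := energy_parts.
have yle n : (1 <= n <= N)%N -> Y n <= \sum_(1 <= n < N.+1) Y n.
  move=> hn; rewrite (bigD1_seq n) ?mem_index_iota ?ltnS ?iota_uniq//= lerDl big_seq_cond.
  by apply: sumr_ge0 => j; rewrite mem_index_iota ltnS => /andP[hj _]; have [] := XY_ge0 hj.
have hw : \sum_(1 <= n < N.+1) KM * (2 * cb * (X n + BT n + Y n) + (2 * KV + 2 + CT) * Y n) <=
    KM * (2 * cb * CG + (2 * KV + 2 + CT)) * energy.
  have -> : \sum_(1 <= n < N.+1) KM * (2 * cb * (X n + BT n + Y n) + (2 * KV + 2 + CT) * Y n) =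
      KM * (2 * cb * \sum_(1 <= n < N.+1) (X n + BT n + Y n) + (2 * KV + 2 + CT) * \sum_(1 <= n < N.+1) Y n).
    by rewrite -mulr_sumr big_split -!mulr_sumr.
  rewrite -[KM * _ * _]mulrA; apply: (ler_wpM2l K0).
  rewrite [X in _ <= X]mulrDl -[2 * cb * CG * _]mulrA; apply: lerD; apply: ler_wpM2l.
  - by apply: mulr_ge0.
  - exact: sum_XBY.
  - by move: KV0 CT0 {t1 t2 t3 h1 h2 hA dt}; move: KV CT => a b a0 b0; lra.
  rewrite /energy /slab_energy lerDr.
  apply: addr_ge0; last exact: e5; apply: addr_ge0; last exact: e4.
  by apply: addr_ge0; last exact: e2; apply: addr_ge0; [exact: e1|exact: e3].
have hs : E N + F 1%N + (\sum_(2 <= n < N.+1) D n + \sum_(1 <= n < N) dw n * E n) + \sum_(1 <= n < N.+1) Y n <= energy.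
  apply: (@le_trans _ _ (energy - \sum_(1 <= n < N.+1) X n)); last by rewrite gerBl.
  by rewrite le_eqVlt; apply/orP; left; apply/eqP; rewrite /energy /slab_energy; ring.
have sd0 : 0 <= \sum_(2 <= n < N.+1) D n + \sum_(1 <= n < N) dw n * E n by apply: addr_ge0.
exact: (test_arith (le_trans t1 (lerD (lexx _) (yle N hN))) (le_trans t2 (lerD (lexx _) (yle 1%N h1N))) t3 hs cb0 e1 e2 sd0 e6 hw).
Qed.

End Assembly.

Lemma quotient_lower (R : realType) (a b B C e : R) : 0 < C -> 0 < a -> 0 < b ->
  a <= C * e -> b <= C * e -> 4^-1 * e <= B -> (4 * C)^-1 <= B / (Num.sqrt a * Num.sqrt b).
Proof.
move=> C0 a0 b0 ha hb hB; rewrite ler_pdivlMr ?mulr_gt0 ?sqrtr_gt0//.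
have c0 : 0 <= C * e by apply: le_trans ha; exact: ltW.
have s2 : Num.sqrt a * Num.sqrt b <= C * e.
  by rewrite -[leRHS]sqr_sqrtr ?expr2 ?ler_pM ?sqrtr_ge0 ?ler_wsqrtr.
have c4 : 0 <= (4 * C)^-1 by rewrite invr_ge0 mulr_ge0 ?ltW.
apply: le_trans (ler_wpM2l c4 s2) _; apply: le_trans hB.
by rewrite invfM -mulrA mulKf ?gt_eqF.
Qed.

(** * The inf-sup bound on one mesh *)

Section InfSupMesh.
Context {R : realType}.
Local Notation pt := (R * R)%type.
Local Notation bp2 := {poly {poly R}}.
Variables (Omega : set pt) (M : @mesh R) (xm Crho Cd Cn Hm tf : R) (p q N : nat) (t : nat -> R).
Local Notation I := 'I_(size M).
Hypothesis good : forall i : I, good_cell (vert i).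
Hypothesis disj : forall i j : I, i != j -> elt i `&` elt j = set0.
Hypothesis hxm : forall (i : I) z, bd (elt i) z -> `|z.1| <= xm.
Hypothesis hxm_elt : forall (i : I) z, elt i z -> `|z.1| <= xm.
Hypothesis hne : forall i : I, exists z, elt i z.
Hypothesis hup : upwind_neighbours Omega M.
Hypothesis hinv : inverse_estimates M Cd Cn.
Hypothesis hpos : forall i : I, 0 < h i.
Hypothesis hmax : forall i : I, h i <= Hm.
Hypothesis Cd0 : 0 < Cd.
Hypothesis Cn0 : 0 < Cn.
Hypothesis p0 : (0 < p)%N.
Hypothesis N0 : (0 < N)%N.
Hypothesis tinc : forall n, (n < N)%N -> t n < t n.+1.
Hypothesis t0 : t 0%N = 0.
Hypothesis tN : t N = tf.
Hypothesis tf0 : 0 < tf.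
Hypothesis xm0 : 0 <= xm.
Hypothesis Hm0 : 0 <= Hm.
Implicit Types (P Z : nat -> I -> {poly bp2}).

Local Notation J := (cell_form good hxm_elt).
Local Notation norm2 := (st_norm_sq Omega Crho Cd Cn p q N t good hxm hxm_elt).
Local Notation Bform := (st_form Omega Cd p N t good hxm hxm_elt).

Lemma ev2_eq0 (i : I) (Q : bp2) : (forall z, ev2 Q z = 0) -> Q = 0.
Proof.
move=> h; apply: (@J_sqr_eq0 _ _ _ good hxm_elt hne i); apply/eqP.
by rewrite eq_le plf_sqr_ge0 andbT -(plf0 (J i)); apply: plf_le => z _; rewrite ev2X h ev2_0 expr0n.
Qed.

(** It excludes a vanishing test function: the form would be zero against a positive lower bound. *)
Lemma Bform_eq0 P Z : (forall n i s z, (1 <= n <= N)%N -> ev2 (Z n i).[cst2 s] z = 0) -> Bform P Z = 0.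
Proof.
move=> hZ; have Z0 n s i : (1 <= n <= N)%N -> (Z n i).[cst2 s] = 0.
  by move=> hn; apply: (ev2_eq0 i) => z; exact: hZ.
have S0 (u v : I -> bp2) : (forall i, v i = 0) -> \sum_i J i (u i * v i) = 0.
  by move=> hv; rewrite big1// => i _; rewrite hv mulr0 plf0.
have A0 (u v : I -> bp2) : (forall i, v i = 0) -> dG_form Omega Cd p good hxm hxm_elt u v = 0.
  move=> hv; rewrite /dG_form (S0 (fun i => Xx * dy (u i)))// add0r.
  have -> : v = (fun i => cst2 0 * v i + cst2 0 * v i).
    by apply/funext => i; rewrite hv !mulr0 addr0.
  by rewrite (rest_formD Omega Cd p good hxm hxm_elt u v v 0 0) !mul0r addr0.
have n1 : (1 <= 1 <= N)%N by rewrite N0.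
have e1 : \sum_(1 <= n < N.+1) dG_int Omega Cd p t good hxm hxm_elt P Z n = 0.
  rewrite big_nat big1// => n hn0; have hn : (1 <= n <= N)%N by move: hn0; rewrite ltnS.
  rewrite /dG_int -[RHS](pint0 (t n.-1) (t n)); apply: TI_pint; first exact: (slab_lt tinc hn).
  move=> s; rewrite horner0 -[RHS]addr0; congr (_ + _).
    by apply: (S0 (at_time (dtime (P n)) s) (at_time (Z n) s)) => i; exact: Z0.
  by apply: A0 => i; exact: Z0.
have e2 : \sum_(2 <= n < N.+1) \sum_i J i (tjump t P n i * (Z n i).[cst2 (t n.-1)]) = 0.
  rewrite big_nat big1// => n hn0; have hn : (1 <= n <= N)%N by case/andP: hn0 => a b; rewrite (ltnW a).
  by apply: (S0 (tjump t P n) (fun i => (Z n i).[cst2 (t n.-1)])) => i; exact: Z0.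
have e3 : \sum_i J i ((P 1%N i).[cst2 (t 0%N)] * (Z 1%N i).[cst2 (t 0%N)]) = 0.
  by apply: (S0 (fun i => (P 1%N i).[cst2 (t 0%N)]) (fun i => (Z 1%N i).[cst2 (t 0%N)])) => i; exact: Z0.
by rewrite /st_form e1 e2 e3 !addr0.
Qed.

Lemma inf_sup_mesh (CC : R) : 0 < CC -> CP xm Cd Cn tf <= CC -> CZ xm Cd Cn Hm tf <= CC ->
  (((4 * CC)^-1)%:E <= inf_sup Omega M Crho Cd Cn p q N t)%E.
Proof.
move=> CC0 hCP hCZ; apply: le_ereal_inf_tmp => _ [U [hU nzU] <-].
have [P hP rU] := V_hk_rep hU.
pose Z := test Omega xm Cd Cn Hm tf p q t P; pose V := st_of Z.
have hZ : st_poly p q Z := st_poly_test Omega xm Cd Cn Hm tf t hP.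
have rV : represents N Z V := represents_st_of Z.
have lowB := Bform_lower good disj hxm hxm_elt hup hinv hpos hmax Cd0 Cn0 p0 N0 tinc t0 tN tf0 xm0 Hm0 hP.
have upP := norm2_le Omega Crho good hxm hxm_elt hinv hpos Cd0 Cn0 p0 N0 tinc t0 tN tf0 xm0 hP.
have upZ := norm2_test_le Crho good disj hxm hxm_elt hup hinv hpos hmax Cd0 Cn0 p0 N0 tinc t0 tN tf0 xm0 Hm0 hP.
have e0 := energy_ge0 Omega Cd q good hxm hxm_elt hpos Cn0 p0 tinc t0 tN tf0 P.
have nP0 := norm2_ge0 Omega Crho Cd q good hxm hxm_elt hpos Cn0 p0 tinc P.
have nZ0 := norm2_ge0 Omega Crho Cd q good hxm hxm_elt hpos Cn0 p0 tinc Z.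
move: lowB upP upZ e0; rewrite -/Z; set e := energy _ _ _ _ _ _ _ _ _ _ _ _ => lowB upP upZ e0.
have uP : norm2 P <= CC * e by apply: le_trans upP _; exact: ler_wpM2r.
have uZ : norm2 Z <= CC * e by apply: le_trans upZ _; exact: ler_wpM2r.
(* The trial function is nonzero, and definiteness makes its norm positive. With a zero norm the
   quotient would be 0 by convention and the bound would fail. *)
have nP : 0 < norm2 P.
  rewrite lt_neqAle nP0 andbT eq_sym; apply/eqP => n0; apply: nzU => n i s z hn.
  by rewrite rU//; exact: (norm2_eq0 hne hpos Cn0 p0 tinc n0).
have ep : 0 < e by have := lt_le_trans nP uP; rewrite pmulr_rgt0.
have nzV : ~ st_zero N V.
  move=> z0; have : Bform P Z = 0 by apply: Bform_eq0 => n i s z hn; exact: z0.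
  by move=> b0; move: lowB; rewrite b0 pmulr_rle0 ?invr_gt0// leNgt ep.
have nZ : 0 < norm2 Z.
  rewrite lt_neqAle nZ0 andbT eq_sym; apply/eqP => n0; apply: nzV => n i s z hn.
  exact: (norm2_eq0 hne hpos Cn0 p0 tinc n0).
apply: ereal_sup_ge; exists (B_st Omega Cd p N t U V / (norm_st Omega Crho Cd Cn p q N t U *
   norm_st Omega Crho Cd Cn p q N t V))%:E.
  by exists V => //; split=> //; exact: V_hk_st_of.
rewrite (B_st_rep Cd p t good hxm hxm_elt hup N0 rU rV).
rewrite (norm_st_rep Crho Cd Cn p q t good hxm hxm_elt hup N0 rU) (norm_st_rep Crho Cd Cn p q t good hxm hxm_elt hup N0 rV).
by rewrite lee_fin; exact: quotient_lower CC0 nP nZ uP uZ lowB.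
Qed.

End InfSupMesh.

(** * Admissible meshes and the uniform constant *)

Section AdmissibleMesh.
Context {R : realType}.
Local Notation pt := (R * R)%type.
Implicit Types (z w : pt).

Lemma fst_le_enorm z : `|z.1| <= enorm z.
Proof.
rewrite -sqrtr_sqr /enorm ler_wsqrtr// /dot -!expr2 lerDl; exact: sqr_ge0.
Qed.

(** The parallelogram identity bounds the squared distance by [2 |z|^2 + 2 |w|^2], which is at most
    [(2 r)^2]. *)
Lemma eball_dist (r : R) z w : eball 0 r z -> eball 0 r w -> enorm (z - w) <= 2 * r.
Proof.
rewrite /eball /= !subr0 => hz hw.
have r0 : 0 <= r by apply: le_trans (ltW hz); exact: sqrtr_ge0.
have d0 (x : pt) : 0 <= dot x x by rewrite /dot -!expr2 addr_ge0 ?sqr_ge0.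
have sq (x : pt) : enorm x < r -> dot x x <= r ^+ 2.
  by move=> hx; rewrite -(sqr_sqrtr (d0 x)) ler_sqr ?nnegrE ?sqrtr_ge0// ltW.
have h1 := sq _ hz; have h2 := sq _ hw.
have -> : 2 * r = Num.sqrt ((2 * r) ^+ 2) by rewrite sqrtr_sqr ger0_norm// mulr_ge0.
rewrite /enorm ler_wsqrtr//; move: h1 h2; rewrite /dot /=.
have := sqr_ge0 (z.1 + w.1); have := sqr_ge0 (z.2 + w.2); lra.
Qed.

Variables (Omega : set pt) (M : @mesh R) (Csr Crho Cd Cn r : R).
Local Notation I := 'I_(size M).
Hypothesis adm : admissible_mesh Omega M Csr Crho Cd Cn.
Hypothesis Or : Omega `<=` eball 0 r.

Let sub : subdivision Omega M. Proof. by case: adm. Qed.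
Let reg : shape_regular M Csr. Proof. by case: adm. Qed.

Lemma mesh_good (i : I) : good_cell (vert i).
Proof. by have [h _ _ _] := sub; case: (h i); [exact: good_triangle|exact: good_box]. Qed.

Lemma mesh_disj (i j : I) : i != j -> elt i `&` elt j = set0.
Proof. by have [_ h _ _] := sub; exact: h. Qed.

Lemma mesh_ball (i : I) z : elt i z -> eball 0 r z.
Proof. by have [_ _ h _] := sub; move=> /h; exact: Or. Qed.

Lemma mesh_fst_le (i : I) z : elt i z -> `|z.1| <= r.
Proof.
move=> /mesh_ball; rewrite /eball /= subr0 => /ltW; apply: le_trans; exact: fst_le_enorm.
Qed.

Lemma mesh_bd_fst_le (i : I) z : bd (elt i) z -> `|z.1| <= r.
Proof.
move=> [hz _]; have : closure [set w : pt | `|w.1| <= r] z.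
  by apply: closure_subset hz => w; exact: mesh_fst_le.
rewrite -(closure_id _).1//; apply: (@preimage_closed _ _ (fun w : pt => `|w.1|) [set x | x <= r]).
  by move=> w _; apply: (continuous_comp (@continuous_fst_pt R w)); exact: norm_continuous.
exact: closed_le.
Qed.

Lemma mesh_nonempty (i : I) : exists z, elt i z.
Proof.
have [z [s [s0 hb _]]] := reg i; exists z; apply: hb.
by rewrite /eball /= subrr /enorm /dot !mul0r addr0 sqrtr0.
Qed.

Lemma ediam_elt_le (i : I) : (ediam (elt i) <= (2 * r)%:E)%E.
Proof.
have [z hz] := mesh_nonempty i.
have r0 : 0 <= r by apply: le_trans (mesh_fst_le hz).
apply: ge_ereal_sup => _ [->|[x hx [y hy ->]]]; first by rewrite lee_fin mulr_ge0.
by rewrite lee_fin; apply: eball_dist; [exact: mesh_ball hx|exact: mesh_ball hy].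
Qed.

Lemma ediam_elt_gt0 (i : I) : (0 < ediam (elt i))%E.
Proof.
have [z [s [s0 hb _]]] := reg i.
have e0 : enorm ((s / 2, 0) : pt) = s / 2.
  by rewrite /enorm /dot /= mulr0 addr0 -expr2 sqrtr_sqr ger0_norm// divr_ge0 ?ltW.
have h1 : elt i z by apply: hb; rewrite /eball /= subrr /enorm /dot !mul0r addr0 sqrtr0.
have h2 : elt i (z + (s / 2, 0)).
  by apply: hb; rewrite /eball /= addrAC subrr add0r e0; lra.
apply: (@lt_le_trans _ _ (s / 2)%:E); first by rewrite lte_fin divr_gt0.
apply: ereal_sup_ubound; right; exists (z + (s / 2, 0)) => //; exists z => //.
by rewrite addrAC subrr add0r e0.
Qed.

Lemma mesh_h_bounds (i : I) : 0 < h i <= 2 * r.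
Proof.
rewrite /h /hdiam -/(elt i); have := ediam_elt_le i; have := ediam_elt_gt0 i.
by case: (ediam (elt i)) => [x| |]; rewrite ?lte_fin ?lee_fin//= => -> ->.
Qed.

End AdmissibleMesh.

Theorem theorem5p6 (R : realType) (Omega : set (R * R)) (tf : R)
    (Th : set (@mesh R)) (Csr Crho Cd Cn : R)
    (hOmega : polygonal_lipschitz_domain Omega)
    (hGamma : (0 < hausdorff1 (Gamma_minus Omega))%E)
    (htf : 0 < tf) (hCrho : 0 < Crho) (hCd : 0 < Cd) (hCn : 0 < Cn)
    (hTh : forall M, Th M -> admissible_mesh Omega M Csr Crho Cd Cn) :
  exists Lambda : R, 0 < Lambda /\
    forall (M : @mesh R) (p q N : nat) (t : nat -> R),
      Th M -> (1 <= p)%N -> time_partition N t tf ->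
      (Lambda%:E <= inf_sup Omega M Crho Cd Cn p q N t)%E.
Proof.
have [r Or] : exists r, Omega `<=` eball 0 r by case: hOmega.
(* The radius that bounds the domain comes with no sign, and the estimates need a nonnegative bound
   on [|x|] even for a mesh without elements. *)
pose r' := Num.max 0 r; have r0 : 0 <= r' by rewrite le_max lexx.
have Or' : Omega `<=` eball 0 r'.
  by move=> z /Or; rewrite /eball /= => /lt_le_trans; apply; rewrite le_max lexx orbT.
(* Built from the domain radius, the two inverse constants and the final time only, before any mesh,
   degree or time partition is chosen: this is the uniformity claimed. *)
pose CC := Num.max 1 (Num.max (CP r' Cd Cn tf) (CZ r' Cd Cn (2 * r') tf)).
have CC0 : 0 < CC by rewrite lt_max ltr01.
exists (4 * CC)^-1; split; first by rewrite invr_gt0 mulr_gt0.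
move=> M p q N t /hTh adm p0 [N0 t0 tN tinc].
have [_ _ _ hup hinv] := adm.
apply: (inf_sup_mesh Crho q (mesh_good adm) (mesh_disj adm) (mesh_bd_fst_le adm Or') (mesh_fst_le adm Or')
  (mesh_nonempty adm) hup hinv _ _ hCd hCn p0 N0 tinc t0 tN htf r0 (_ : 0 <= 2 * r') CC0).
- by move=> i; case/andP: (mesh_h_bounds adm Or' i).
- by move=> i; case/andP: (mesh_h_bounds adm Or' i).
- by rewrite mulr_ge0.
- by rewrite !le_max lexx orbT.
- by rewrite !le_max lexx !orbT.
Qed.
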